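(* Let $A_1,A_2$ be annotated types with $\llcorner A_2\lrcorner=(\llcorner A_1\lrcorner)^\perp$, and suppose that $P\Vdash\Gamma_1,[\![\Psi_1]\!]x{:}A_1$ and $Q\Vdash\Gamma_2,[\![\Psi_2]\!]y{:}A_2$ are derivable in the (cut-free) forwarder system, the two contexts having disjoint names. Then for every context $\Gamma$ such that $$\{\Gamma_1\rhd[\![\Psi_1]\!]x{:}A_1,\ \Gamma_2\rhd[\![\Psi_2]\!]y{:}A_2\}\longrightarrow^*_{\mathsf{distr}}\longrightarrow^*_{\mathsf{subst}}\Gamma$$ there exists a process $R$ such that $R\Vdash\Gamma$ is derivable in the (cut-free) forwarder system. More precisely, there is a sequence of reductions $(\nu xy)(P\mid Q)\longrightarrow_\beta^* R$ that preserves typing, i.e. every process in the sequence is typable by $\Gamma$ in the forwarder system extended with the Cut rule.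
   Context: We write $\wp$ for the ''par'' connective of linear logic. **Types.** $A::=a\mid a^\perp\mid 1\mid\bot\mid A\otimes A\mid A\wp A$, with the usual involutive duality: $(a^\perp)^\perp=a$, $1^\perp=\bot$, $(A\otimes B)^\perp=A^\perp\wp B^\perp$. **Annotated types:** $B::=a\mid a^\perp\mid 1^{u_1,\dots,u_n}\mid\bot^u\mid A\otimes^uB\mid A\wp^uB$, where $u,u_i$ are names (endpoints), $n\ge1$, the $u_i$ are distinct, and the left component $A$ of $\otimes^u,\wp^u$ is an unannotated type. $\llcorner B\lrcorner$ is $B$ with all annotations erased; for unannotated $A$ and a name $x$, $A(x)$ is the annotated type obtained by annotating every annotatable operator of $A$ with $x$. **Processes.** $P,Q::=x\leftrightarrow y\mid(\nu xy)(P\mid Q)\mid x().P\mid x[]\mid x(y).P\mid x[y\triangleright P].Q$ (link, parallel composition connecting endpoints $x,y$, wait, close, input binding $y$ in $P$, output binding $y$ in the spawned process $P$ and continuing as $Q$). Processes are taken up to renaming of bound names, and links are symmetric. **Queues and contexts.** A queue is $[\![\Psi]\!]::=\varnothing\mid[^u*][\![\Psi]\!]\mid[^u\,y{:}A][\![\Psi]\!]$ with $A$ unannotated; queues are identified up to swapping adjacent boxes with different labels $u\neq v$. A context is $\Gamma::=\varnothing\mid\Gamma,[\![\Psi]\!]x{:}B\mid\Gamma,[\![\Psi]\!]x{:}\cdot$ with $B$ annotated; $x{:}\cdot$ (with a non-empty queue) is a terminated endpoint. The empty queue is omitted in writing. **Forwarder rules** ($C$ below is an annotated type or $\cdot$):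 - Ax: $x\leftrightarrow y\Vdash x{:}a^\perp,y{:}a$. - $1$: $x[]\Vdash\{[^x*]u_i{:}\cdot\}_{1\le i\le n},\,x{:}1^{u_1,\dots,u_n}$. - $\bot$: from $P\Vdash\Gamma,[\![\Psi]\!][^u*]x{:}\cdot$ infer $x().P\Vdash\Gamma,[\![\Psi]\!]x{:}\bot^u$. - $\wp$: from $P\Vdash\Gamma,[\![\Psi]\!][^u\,y{:}A]x{:}B$ infer $x(y).P\Vdash\Gamma,[\![\Psi]\!]x{:}A\wp^uB$. - $\otimes$: from $P\Vdash z{:}(A(y))^\perp,\,y{:}A(z)$ and $Q\Vdash\Gamma,[\![\Psi_u]\!]u{:}C,[\![\Psi_x]\!]x{:}B$ infer $x[y\triangleright P].Q\Vdash\Gamma,[^x\,z{:}A^\perp][\![\Psi_u]\!]u{:}C,[\![\Psi_x]\!]x{:}A\otimes^uB$. **Pairs.** A configuration $\{\Gamma_1\rhd[\![\Psi_1]\!]x{:}A_1,\ \Gamma_2\rhd[\![\Psi_2]\!]y{:}A_2\}$ singles out the two cut formulas, where $\llcorner A_2\lrcorner=(\llcorner A_1\lrcorner)^\perp$ but annotations may differ. Notation: $D\{\otimes^x\}$ points to the leftmost occurrence of $\otimes^x$ in the annotated type $D$, and $D\{\otimes^c\}$ is then $D$ with the annotation of that single occurrence replaced by $c$; similarly for $\wp,\bot,1$. All rewritings below are also available with the roles of the two lines exchanged. **Distribution.** Initially a marker $\bullet$ is put in front of every queue in $\Gamma_1$ and $\Gamma_2$. One step moves the top element of the queue of $x$ to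 some endpoint $c$ (chosen freely) of the other side: $$\{\Gamma_1,[\![\Psi_{2d}]\!]\bullet[\![\Psi_d]\!]d{:}D\{\otimes^x\}\rhd[^d\,b{:}B][\![\Psi_1]\!]x{:}A_1,\ \ \Gamma_2,[\![\Psi_{1c}]\!]\bullet[\![\Psi_c]\!]c{:}C\rhd[\![\Psi_2]\!]y{:}A_2\}$$ $$\to_{\mathsf{distr}}\{\Gamma_1,[\![\Psi_{2d}]\!]\bullet[\![\Psi_d]\!]d{:}D\{\otimes^c\}\rhd[\![\Psi_1]\!]x{:}A_1,\ \ \Gamma_2,[\![\Psi_{1c}]\!][^d\,b{:}B]\bullet[\![\Psi_c]\!]c{:}C\rhd[\![\Psi_2]\!]y{:}A_2\}$$ ($C$ an annotated type or $\cdot$). When both queues of $x$ and $y$ are empty, the markers are erased and substitution starts. **Substitution.** 1. ($\otimes/\wp$, message already in queue) $\{\Gamma_1,[^x\,a{:}A^\perp][\![\Psi_b]\!]b{:}B\rhd x{:}A\otimes^bD,\ \Gamma_2,[\![\Psi_c]\!]c{:}C\{\otimes^y\}\rhd y{:}A^\perp\wp^cD'\}\to_{\mathsf{subst}}\{\Gamma_1,[^c\,a{:}A^\perp][\![\Psi_b]\!]b{:}B\rhd x{:}D,\ \Gamma_2,[\![\Psi_c]\!]c{:}C\{\otimes^b\}\rhd y{:}D'\}$ ($B$ an annotated type or $\cdot$). 2. ($\otimes/\wp$, message not yet received; applied when the queue of $b$ contains no box labelled $x$) $\{\Gamma_1,[\![\Psi_b]\!]b{:}B\{\wp^x\}\rhd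 x{:}A\otimes^bD,\ \Gamma_2,[\![\Psi_c]\!]c{:}C\{\otimes^y\}\rhd y{:}A^\perp\wp^cD'\}\to_{\mathsf{subst}}\{\Gamma_1,[\![\Psi_b]\!]b{:}B\{\wp^c\}\rhd x{:}D,\ \Gamma_2,[\![\Psi_c]\!]c{:}C\{\otimes^b\}\rhd y{:}D'\}$. 3. (atoms) $\{\Gamma_1\rhd x{:}a,\ \Gamma_2\rhd y{:}a^\perp\}\to_{\mathsf{subst}}\Gamma_1,\Gamma_2$. 4. (units) $\{\Gamma_1,\{[\![\Psi_{a_i}]\!][^x*]a_i{:}\cdot\}_i,\{[\![\Psi_{b_j}]\!]b_j{:}B_j\{\bot^x\}\}_j\rhd x{:}1^{\tilde a\tilde b},\ \Gamma_2,[\![\Psi_c]\!]c{:}C\{1^{y\tilde u}\}\rhd y{:}\bot^c\}\to_{\mathsf{subst}}\Gamma_1,\{[\![\Psi_{a_i}]\!][^c*]a_i{:}\cdot\}_i,\{[\![\Psi_{b_j}]\!]b_j{:}B_j\{\bot^c\}\}_j,\Gamma_2,[\![\Psi_c]\!]c{:}C\{1^{\tilde a\tilde b\tilde u}\}$. **Cut rule.** From $P\Vdash\Gamma_1,[\![\Psi_1]\!]x{:}A_1$, $Q\Vdash\Gamma_2,[\![\Psi_2]\!]y{:}A_2$ and $\{\Gamma_1\rhd[\![\Psi_1]\!]x{:}A_1,\Gamma_2\rhd[\![\Psi_2]\!]y{:}A_2\}\to^*_{\mathsf{distr}}\to^*_{\mathsf{subst}}\Gamma$ infer $(\nu xy)(P\mid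 Q)\Vdash\Gamma$. **Reductions** $\longrightarrow_\beta$ (closed under process contexts, and also with the two parallel components exchanged): - $(\nu xy)(z\leftrightarrow x\mid Q)\to_\beta Q[z/y]$; - $(\nu xy)(x[]\mid y().Q)\to_\beta Q$ (with $Q$ retyped: the queue of the terminated endpoint $y$ is redistributed over the terminated endpoints $\tilde u$ annotating $x{:}1^{\tilde u}$, as prescribed by the distribution of the cut); - $(\nu xy)(P\mid z().Q)\to_\beta z().(\nu xy)(P\mid Q)$ for $z\ne y$; - $(\nu xy)(P\mid u(v).Q)\to_\beta u(v).(\nu xy)(P\mid Q)$ for $u\neq y$; - $(\nu xy)(P\mid z[v\triangleright Q].R)\to_\beta z[v\triangleright Q].(\nu xy)(P\mid R)$ for $z\neq y$; - $(\nu xy)(x[a\triangleright P].Q\mid y(c).R)\to_\beta(\nu xy)(Q\mid(\nu a\rhd c)(P\mid R))$, where $(\nu a\rhd c)(P\mid R)$ denotes the process obtained from $R$ by replacing the output subterm $u[v\triangleright S].T$ such that $c$ is free in $S$ by $u[a\triangleright P].T$.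
   Formalization: In substitution rule 1 the relabelled box [^c a:A^⊥] is kept behind any boxes already labelled c in the queue of b instead of being put on top; with the displayed rule two messages can be reversed, giving an underivable Γ. The rules agree if no c-labelled box is present. *)

(* Defs.v *)
From Stdlib Require Import Arith List Permutation Relations.
Import ListNotations.

Definition atom := nat.
Definition name := nat.

(** * Types *)

Inductive ty :=
| Atom (a : atom)
| NAtom (a : atom)
| One
| Bot
| Tensor (A B : ty)
| Par (A B : ty).

Fixpoint dual (A : ty) : ty :=
  match A with
  | Atom a => NAtom a
  | NAtom a => Atom a
  | One => Bot
  | Bot => One
  | Tensor A B => Par (dual A) (dual B)
  | Par A B => Tensor (dual A) (dual B)
  end.

(* [ATensor A u B] is A (x)^u B and [APar A u B] is A par^u B: the left
   component carries no annotation, so an annotated type is a right spine and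
   its "leftmost" annotated operator is the outermost one. *)
Inductive aty :=
| AAtom (a : atom)
| ANAtom (a : atom)
| AOne (us : list name)
| ABot (u : name)
| ATensor (A : ty) (u : name) (B : aty)
| APar (A : ty) (u : name) (B : aty).

Fixpoint wf_aty (B : aty) : Prop :=
  match B with
  | AOne us => us <> [] /\ NoDup us
  | ATensor _ _ B | APar _ _ B => wf_aty B
  | _ => True
  end.

Fixpoint erase (B : aty) : ty :=
  match B with
  | AAtom a => Atom a
  | ANAtom a => NAtom a
  | AOne _ => One
  | ABot _ => Bot
  | ATensor A _ B => Tensor A (erase B)
  | APar A _ B => Par A (erase B)
  end.

(* [annot A x] is A(x); its dual (A(x))^\perp is [annot (dual A) x]. *)
Fixpoint annot (A : ty) (x : name) : aty :=
  match A with
  | Atom a => AAtom a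
  | NAtom a => ANAtom a
  | One => AOne [x]
  | Bot => ABot x
  | Tensor A B => ATensor A x (annot B x)
  | Par A B => APar A x (annot B x)
  end.

Fixpoint aty_names (B : aty) : list name :=
  match B with
  | AAtom _ | ANAtom _ => []
  | AOne us => us
  | ABot u => [u]
  | ATensor _ u B | APar _ u B => u :: aty_names B
  end.

(* The annotation of a unit 1 is a finite set of names, listed in any order. *)
Inductive aty_eq : aty -> aty -> Prop :=
| aty_eq_atom a : aty_eq (AAtom a) (AAtom a)
| aty_eq_natom a : aty_eq (ANAtom a) (ANAtom a)
| aty_eq_one us vs : Permutation us vs -> aty_eq (AOne us) (AOne vs)
| aty_eq_bot u : aty_eq (ABot u) (ABot u)
| aty_eq_tensor A u B B' : aty_eq B B' -> aty_eq (ATensor A u B) (ATensor A u B')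
| aty_eq_par A u B B' : aty_eq B B' -> aty_eq (APar A u B) (APar A u B').

(* [retensor x c D] turns D{(x)^x} into D{(x)^c}, and is [None] when (x)^x does
   not occur in D; similarly for [repar], [rebot] and [reone], the last one
   replacing the single element y of the annotation of 1 by the names [us]. *)
Fixpoint retensor (x c : name) (D : aty) : option aty :=
  match D with
  | ATensor A u B =>
      if Nat.eq_dec u x then Some (ATensor A c B)
      else option_map (ATensor A u) (retensor x c B)
  | APar A u B => option_map (APar A u) (retensor x c B)
  | _ => None
  end.

Fixpoint repar (x c : name) (D : aty) : option aty :=
  match D with
  | APar A u B =>
      if Nat.eq_dec u x then Some (APar A c B)
      else option_map (APar A u) (repar x c B)
  | ATensor A u B => option_map (ATensor A u) (repar x c B)
  | _ => None
  end.

Fixpoint rebot (x c : name) (D : aty) : option aty :=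
  match D with
  | ABot u => if Nat.eq_dec u x then Some (ABot c) else None
  | ATensor A u B => option_map (ATensor A u) (rebot x c B)
  | APar A u B => option_map (APar A u) (rebot x c B)
  | _ => None
  end.

Fixpoint reone (y : name) (us : list name) (D : aty) : option aty :=
  match D with
  | AOne vs =>
      if in_dec Nat.eq_dec y vs
      then Some (AOne (us ++ remove Nat.eq_dec y vs)) else None
  | ATensor A u B => option_map (ATensor A u) (reone y us B)
  | APar A u B => option_map (APar A u) (reone y us B)
  | _ => None
  end.

(** * Processes *)

Inductive proc :=
| Link (x y : name)
| Cut (x y : name) (P Q : proc)   (* binds x in P and y in Q *)
| Wait (x : name) (P : proc)
| Close (x : name)
| Recv (x y : name) (P : proc)    (* binds y in P *)
| Send (x y : name) (P Q : proc). (* binds y in P only *)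

Fixpoint fn (P : proc) : list name :=
  match P with
  | Link x y => [x; y]
  | Cut x y P Q => remove Nat.eq_dec x (fn P) ++ remove Nat.eq_dec y (fn Q)
  | Wait x P => x :: fn P
  | Close x => [x]
  | Recv x y P => x :: remove Nat.eq_dec y (fn P)
  | Send x y P Q => x :: remove Nat.eq_dec y (fn P) ++ fn Q
  end.

Fixpoint bn (P : proc) : list name :=
  match P with
  | Link _ _ | Close _ => []
  | Cut x y P Q => x :: y :: bn P ++ bn Q
  | Wait _ P => bn P
  | Recv _ y P => y :: bn P
  | Send _ y P Q => y :: bn P ++ bn Q
  end.

Definition transp (a b n : name) : name :=
  if Nat.eq_dec n a then b else if Nat.eq_dec n b then a else n.

Fixpoint swap (a b : name) (P : proc) : proc :=
  match P with
  | Link x y => Link (transp a b x) (transp a b y)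
  | Cut x y P Q => Cut (transp a b x) (transp a b y) (swap a b P) (swap a b Q)
  | Wait x P => Wait (transp a b x) (swap a b P)
  | Close x => Close (transp a b x)
  | Recv x y P => Recv (transp a b x) (transp a b y) (swap a b P)
  | Send x y P Q => Send (transp a b x) (transp a b y) (swap a b P) (swap a b Q)
  end.

(* Equality of processes: renaming of bound names and symmetry of links. *)
Inductive proc_eq : proc -> proc -> Prop :=
| pe_refl P : proc_eq P P
| pe_sym P Q : proc_eq P Q -> proc_eq Q P
| pe_trans P Q R : proc_eq P Q -> proc_eq Q R -> proc_eq P R
| pe_link x y : proc_eq (Link x y) (Link y x)
| pe_cut_l x x' y P Q : ~ In x' (fn P) ->
    proc_eq (Cut x y P Q) (Cut x' y (swap x x' P) Q)
| pe_cut_r x y y' P Q : ~ In y' (fn Q) ->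
    proc_eq (Cut x y P Q) (Cut x y' P (swap y y' Q))
| pe_recv x y y' P : ~ In y' (fn P) ->
    proc_eq (Recv x y P) (Recv x y' (swap y y' P))
| pe_send x y y' P Q : ~ In y' (fn P) ->
    proc_eq (Send x y P Q) (Send x y' (swap y y' P) Q)
| pe_ctx_cut x y P P' Q Q' : proc_eq P P' -> proc_eq Q Q' ->
    proc_eq (Cut x y P Q) (Cut x y P' Q')
| pe_ctx_wait x P P' : proc_eq P P' -> proc_eq (Wait x P) (Wait x P')
| pe_ctx_recv x y P P' : proc_eq P P' -> proc_eq (Recv x y P) (Recv x y P')
| pe_ctx_send x y P P' Q Q' : proc_eq P P' -> proc_eq Q Q' ->
    proc_eq (Send x y P Q) (Send x y P' Q').

(* [subst_name z y P] replaces the free occurrences of y in P by z; it is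
   capture-avoiding when z is not a bound name of P. *)
Fixpoint subst_name (z y : name) (P : proc) : proc :=
  let r n := if Nat.eq_dec n y then z else n in
  let under b Q := if Nat.eq_dec b y then Q else subst_name z y Q in
  match P with
  | Link u v => Link (r u) (r v)
  | Cut u v P Q => Cut u v (under u P) (under v Q)
  | Wait u P => Wait (r u) (subst_name z y P)
  | Close u => Close (r u)
  | Recv u v P => Recv (r u) v (under v P)
  | Send u v P Q => Send (r u) v (under v P) (subst_name z y Q)
  end.

(* [graft a P c R R'] holds when R' is (nu a |> c)(P | R).  The side conditions
   only say that c is not shadowed on the way to the replaced output and that
   no free name of the inserted [a]P is captured. *)
Definition no_clash (a : name) (P : proc) (c b : name) : Prop :=
  b <> c /\ ~ In b (remove Nat.eq_dec a (fn P)).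

Inductive graft (a : name) (P : proc) (c : name) : proc -> proc -> Prop :=
| graft_here u v S T : v <> c -> In c (fn S) ->
    graft a P c (Send u v S T) (Send u a P T)
| graft_wait u R R' : graft a P c R R' -> graft a P c (Wait u R) (Wait u R')
| graft_recv u v R R' : no_clash a P c v -> graft a P c R R' ->
    graft a P c (Recv u v R) (Recv u v R')
| graft_send u v S T T' : graft a P c T T' ->
    graft a P c (Send u v S T) (Send u v S T')
| graft_cut_l u v S S' T : no_clash a P c u -> graft a P c S S' ->
    graft a P c (Cut u v S T) (Cut u v S' T)
| graft_cut_r u v S T T' : no_clash a P c v -> graft a P c T T' ->
    graft a P c (Cut u v S T) (Cut u v S T').

(* (nu xy)(P | Q), or its mirror image (nu yx)(Q | P). *)
Definition par_comp (mirror : bool) (x y : name) (P Q : proc) : proc :=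
  if mirror then Cut y x Q P else Cut x y P Q.

(* The conditions on bound names are the usual freshness conventions: every
   process can be renamed to satisfy those that depend on the choice of bound
   names, and the others hold for all typable processes. *)
Inductive redex (m : bool) : proc -> proc -> Prop :=
| r_link x y z Q : z <> x -> ~ In z (bn Q) ->
    redex m (par_comp m x y (Link z x) Q) (subst_name z y Q)
| r_unit x y Q : ~ In y (fn Q) ->
    redex m (par_comp m x y (Close x) (Wait y Q)) Q
| r_wait x y z P Q : z <> y ->
    redex m (par_comp m x y P (Wait z Q)) (Wait z (par_comp m x y P Q))
| r_recv x y u v P Q : u <> y -> v <> y -> ~ In v (fn P) ->
    redex m (par_comp m x y P (Recv u v Q)) (Recv u v (par_comp m x y P Q))
| r_send x y z v P Q R : z <> y -> ~ In y (remove Nat.eq_dec v (fn Q)) ->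
    redex m (par_comp m x y P (Send z v Q R)) (Send z v Q (par_comp m x y P R))
| r_comm x y a c P Q R R' :
    c <> y ->
    ~ In x (remove Nat.eq_dec a (fn P)) -> ~ In y (remove Nat.eq_dec a (fn P)) ->
    graft a P c R R' -> ~ In c (fn R') ->
    redex m (par_comp m x y (Send x a P Q) (Recv y c R)) (par_comp m x y Q R').

Inductive beta : proc -> proc -> Prop :=
| b_redex m P Q : redex m P Q -> beta P Q
| b_eq P P' Q Q' : proc_eq P P' -> beta P' Q' -> proc_eq Q' Q -> beta P Q
| b_cut_l x y P P' Q : beta P P' -> beta (Cut x y P Q) (Cut x y P' Q)
| b_cut_r x y P Q Q' : beta Q Q' -> beta (Cut x y P Q) (Cut x y P Q')
| b_wait x P P' : beta P P' -> beta (Wait x P) (Wait x P')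
| b_recv x y P P' : beta P P' -> beta (Recv x y P) (Recv x y P')
| b_send_l x y P P' Q : beta P P' -> beta (Send x y P Q) (Send x y P' Q)
| b_send_r x y P Q Q' : beta Q Q' -> beta (Send x y P Q) (Send x y P Q').

(** * Queues and contexts *)

Inductive box :=
| Star (u : name)
| Msg (u y : name) (A : ty).

Definition label (b : box) : name :=
  match b with Star u | Msg u _ _ => u end.

(* The head of the list is the top of the queue, i.e. the oldest box. *)
Definition queue := list box.

Inductive queue_eq : queue -> queue -> Prop :=
| qe_refl Ψ : queue_eq Ψ Ψ
| qe_swap Ψ b b' Ψ' : label b <> label b' ->
    queue_eq (Ψ ++ b :: b' :: Ψ') (Ψ ++ b' :: b :: Ψ')
| qe_trans Ψ Ψ' Ψ'' : queue_eq Ψ Ψ' -> queue_eq Ψ' Ψ'' -> queue_eq Ψ Ψ''.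

(* [Ep Ψ x (Some B)] is [[Ψ]]x:B, and [Ep Ψ x None] the terminated [[Ψ]]x:. *)
Record endpoint := Ep {
  ep_queue : queue;
  ep_name : name;
  ep_type : option aty
}.

Definition ctx := list endpoint.

Definition ep_eq (e e' : endpoint) : Prop :=
  queue_eq (ep_queue e) (ep_queue e') /\ ep_name e = ep_name e' /\
  match ep_type e, ep_type e' with
  | Some B, Some B' => aty_eq B B'
  | None, None => True
  | _, _ => False
  end.

(* Equality of multisets whose elements are taken modulo [R]. *)
Definition mset_eq {E : Type} (R : E -> E -> Prop) (l l' : list E) : Prop :=
  exists l0, Permutation l l0 /\ Forall2 R l0 l'.

Definition ctx_eq : ctx -> ctx -> Prop := mset_eq ep_eq.

Definition msg_names (Ψ : queue) : list name :=
  flat_map (fun b => match b with Star _ => [] | Msg _ y _ => [y] end) Ψ.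

Definition declared (Γ : ctx) : list name :=
  flat_map (fun e => ep_name e :: msg_names (ep_queue e)) Γ.

Definition wf_ep (e : endpoint) : Prop :=
  match ep_type e with
  | Some B => wf_aty B
  | None => ep_queue e <> []
  end.

Definition wf_ctx (Γ : ctx) : Prop := NoDup (declared Γ) /\ Forall wf_ep Γ.

Definition ep_names (e : endpoint) : list name :=
  ep_name e :: map label (ep_queue e) ++ msg_names (ep_queue e) ++
  match ep_type e with Some B => aty_names B | None => [] end.

Definition ctx_disjoint (Γ Δ : ctx) : Prop :=
  forall n, In n (flat_map ep_names Γ) -> ~ In n (flat_map ep_names Δ).

(** * Configurations *)

(* One line  Γ |> [[Ψ]]x:A  of a configuration; [E] is the type of the entries
   of Γ, which carry a marker during distribution. *)
Record side (E : Type) := Side {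
  s_ctx : list E;
  s_queue : queue;
  s_name : name;
  s_type : aty
}.
Arguments Side {E}.
Arguments s_ctx {E}.
Arguments s_queue {E}.
Arguments s_name {E}.
Arguments s_type {E}.

Definition config (E : Type) : Type := side E * side E.

(* [(Ψ', Ep Ψ x C)] is [[Ψ']] . [[Ψ]]x:C, where the dot is the marker. *)
Definition marked := (queue * endpoint)%type.

Definition marked_eq (e e' : marked) : Prop :=
  queue_eq (fst e) (fst e') /\ ep_eq (snd e) (snd e').

Definition mark (e : endpoint) : marked := ([], e).

Definition unmark (e : marked) : endpoint :=
  Ep (fst e ++ ep_queue (snd e)) (ep_name (snd e)) (ep_type (snd e)).

Definition map_side {E F : Type} (f : E -> F) (s : side E) : side F :=
  Side (map f (s_ctx s)) (s_queue s) (s_name s) (s_type s).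

Definition side_eq {E : Type} (R : E -> E -> Prop) (s t : side E) : Prop :=
  mset_eq R (s_ctx s) (s_ctx t) /\ queue_eq (s_queue s) (s_queue t) /\
  s_name s = s_name t /\ aty_eq (s_type s) (s_type t).

(* The two lines may be exchanged, so each rewriting rule below is available
   with either assignment of roles. *)
Definition config_eq {E : Type} (R : E -> E -> Prop) (K L : config E) : Prop :=
  (side_eq R (fst K) (fst L) /\ side_eq R (snd K) (snd L)) \/
  (side_eq R (fst K) (snd L) /\ side_eq R (snd K) (fst L)).

Inductive distr_rule : config marked -> config marked -> Prop :=
| distr_move Γ1 Γ2 Ψ2d Ψd d D D' b B Ψ1 x A1 Ψ1c Ψc c C Ψ2 y A2 :
    retensor x c D = Some D' ->
    distr_rule
      (Side ((Ψ2d, Ep Ψd d (Some D)) :: Γ1) (Msg d b B :: Ψ1) x A1,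
       Side ((Ψ1c, Ep Ψc c C) :: Γ2) Ψ2 y A2)
      (Side ((Ψ2d, Ep Ψd d (Some D')) :: Γ1) Ψ1 x A1,
       Side ((Ψ1c ++ [Msg d b B], Ep Ψc c C) :: Γ2) Ψ2 y A2).

Definition distr (K K' : config marked) : Prop :=
  exists K0 K0', config_eq marked_eq K K0 /\ distr_rule K0 K0' /\
                 config_eq marked_eq K0' K'.

(* In [subst_queued] the message a is the first box labelled x in the queue of
   b.  Once relabelled it must stay behind the boxes Ψ' that are already
   labelled c: they come from the distribution or from earlier messages of x,
   and boxes with equal labels are delivered in order.  When there is no such
   box, Ψ' is empty and a is on top of the queue before and after the step. *)
Inductive subst_rule : config endpoint -> config endpoint -> Prop :=
| subst_queued Γ1 Γ2 x y a b c A D D' Ψ' Ψb B Ψc C C' :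
    Forall (fun e => label e = c) Ψ' -> Forall (fun e => label e <> c) Ψb ->
    retensor y b C = Some C' ->
    subst_rule
      (Side (Ep (Ψ' ++ Msg x a (dual A) :: Ψb) b B :: Γ1) [] x (ATensor A b D),
       Side (Ep Ψc c (Some C) :: Γ2) [] y (APar (dual A) c D'))
      (Side (Ep (Ψ' ++ Msg c a (dual A) :: Ψb) b B :: Γ1) [] x D,
       Side (Ep Ψc c (Some C') :: Γ2) [] y D')
| subst_unreceived Γ1 Γ2 x y b c A D D' Ψb B B' Ψc C C' :
    Forall (fun e => label e <> x) Ψb ->
    repar x c B = Some B' ->
    retensor y b C = Some C' ->
    subst_rule
      (Side (Ep Ψb b (Some B) :: Γ1) [] x (ATensor A b D),
       Side (Ep Ψc c (Some C) :: Γ2) [] y (APar (dual A) c D'))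
      (Side (Ep Ψb b (Some B') :: Γ1) [] x D,
       Side (Ep Ψc c (Some C') :: Γ2) [] y D').

Definition subst (K K' : config endpoint) : Prop :=
  exists K0 K0', config_eq ep_eq K K0 /\ subst_rule K0 K0' /\
                 config_eq ep_eq K0' K'.

Definition rebot_ep (x c : name) (e e' : endpoint) : Prop :=
  exists Ψ b B B', rebot x c B = Some B' /\
    e = Ep Ψ b (Some B) /\ e' = Ep Ψ b (Some B').

Definition term_ep (x : name) (p : queue * name) : endpoint :=
  Ep (fst p ++ [Star x]) (snd p) None.

Inductive subst_last_rule : config endpoint -> ctx -> Prop :=
| subst_atom Γ1 Γ2 x y a :
    subst_last_rule (Side Γ1 [] x (AAtom a), Side Γ2 [] y (ANAtom a))
                    (Γ1 ++ Γ2)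
| subst_unit Γ1 Γ2 x y c (ps : list (queue * name)) Δ Δ' Ψc C C' :
    let us := map snd ps ++ map ep_name Δ in
    Forall2 (rebot_ep x c) Δ Δ' ->
    reone y us C = Some C' ->
    subst_last_rule
      (Side (Γ1 ++ map (term_ep x) ps ++ Δ) [] x (AOne us),
       Side (Γ2 ++ [Ep Ψc c (Some C)]) [] y (ABot c))
      (Γ1 ++ map (term_ep c) ps ++ Δ' ++ Γ2 ++ [Ep Ψc c (Some C')]).

Definition subst_last (K : config endpoint) (Γ : ctx) : Prop :=
  exists K0 Γ0, config_eq ep_eq K K0 /\ subst_last_rule K0 Γ0 /\ ctx_eq Γ0 Γ.

(* K ->*_distr ->*_subst Γ. *)
Definition composes (K : config endpoint) (Γ : ctx) : Prop :=
  exists s1 s2 L,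
    clos_refl_trans _ distr (map_side mark (fst K), map_side mark (snd K)) (s1, s2) /\
    s_queue s1 = [] /\ s_queue s2 = [] /\
    clos_refl_trans _ subst (map_side unmark s1, map_side unmark s2) L /\
    subst_last L Γ.

(** * Typing *)

(* [typed false] is the forwarder system, [typed true] its extension with the
   Cut rule.  Contexts are well formed by convention; the rules that do not
   require it preserve it. *)
Inductive typed (cut : bool) : proc -> ctx -> Prop :=
| t_ax x y a :
    x <> y ->
    typed cut (Link x y) [Ep [] x (Some (ANAtom a)); Ep [] y (Some (AAtom a))]
| t_one x us :
    wf_ctx (map (fun u => Ep [Star x] u None) us ++ [Ep [] x (Some (AOne us))]) ->
    typed cut (Close x)
      (map (fun u => Ep [Star x] u None) us ++ [Ep [] x (Some (AOne us))])
| t_bot P Γ Ψ u x :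
    typed cut P (Ep (Ψ ++ [Star u]) x None :: Γ) ->
    typed cut (Wait x P) (Ep Ψ x (Some (ABot u)) :: Γ)
| t_par P Γ Ψ u x y A B :
    typed cut P (Ep (Ψ ++ [Msg u y A]) x (Some B) :: Γ) ->
    typed cut (Recv x y P) (Ep Ψ x (Some (APar A u B)) :: Γ)
| t_tensor P Q Γ Ψu Ψx x y z u A B C :
    typed cut P [Ep [] z (Some (annot (dual A) y)); Ep [] y (Some (annot A z))] ->
    typed cut Q (Ep Ψu u C :: Ep Ψx x (Some B) :: Γ) ->
    wf_ctx (Ep (Msg x z (dual A) :: Ψu) u C ::
            Ep Ψx x (Some (ATensor A u B)) :: Γ) ->
    typed cut (Send x y P Q)
      (Ep (Msg x z (dual A) :: Ψu) u C :: Ep Ψx x (Some (ATensor A u B)) :: Γ)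
| t_cut P Q Γ1 Γ2 Ψ1 Ψ2 x y A1 A2 Γ :
    cut = true ->
    erase A2 = dual (erase A1) ->
    typed cut P (Ep Ψ1 x (Some A1) :: Γ1) ->
    typed cut Q (Ep Ψ2 y (Some A2) :: Γ2) ->
    ctx_disjoint (Ep Ψ1 x (Some A1) :: Γ1) (Ep Ψ2 y (Some A2) :: Γ2) ->
    composes (Side Γ1 Ψ1 x A1, Side Γ2 Ψ2 y A2) Γ ->
    wf_ctx Γ ->
    typed cut (Cut x y P Q) Γ
| t_proc_eq P P' Γ : typed cut P Γ -> proc_eq P P' -> typed cut P' Γ
| t_ctx_eq P Γ Γ' : typed cut P Γ -> ctx_eq Γ Γ' -> typed cut P Γ'.

(* Main.v *)
(* Give every message and every unit a wire, and annotate types by wires instead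
   of names.  A forwarder then only depends on the multiset of its pending
   messages and on its wired types, while the names in a context are read back
   from the senders and receivers of the wires; the only constraint left on the
   queues is FIFO: no endpoint receives two wires in one order while another
   sends them in the opposite order.

   In a cut, the two wirings can be chosen so that the dual formulas carry the
   same wires.  Composing two contexts then amounts to spreading the two queues
   as prefixes over the queues of the other side and reading back the names from
   the union of the wirings; conversely every such spreading is obtained by a
   run of distribution and substitution.  So a cut is typed by Γ as soon as its
   premises have such wirings, and this is invariant under each reduction: a
   principal tensor/par step moves one message from the queue of its receiver to
   the spread prefix of the same queue, which leaves the composite unchanged.
   Induction on the number of actions of P and Q concludes. *)

From Stdlib Require Import Arith List Permutation Relations Lia.
Require Import Defs.
Import ListNotations.

(** The obstacle is that the annotations of a configuration change at every step, while each rule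
    speaks of the current ones and leaves some choices open. The remedy is to describe every
    configuration as a masking of the labels [f] and [g] of the final context: on its own side, [x]
    poses as the sender of the wires that its formula sends, and as the receiver of those in its
    queue or received by its formula. A distribution step records the chosen endpoint in [g] and
    unmasks one queued wire; a substitution step unmasks the first wire of the cut formula; the last
    step unmasks the unit, if there is one. Both directions are needed: the given run must yield
    wirings, and after each reduction the new wirings must again admit a run to the same context.
    The free choices of the distribution are kept as data, the shares in [L1] and [L2]; a reduction
    changes them by at most one message. A message wire has one receiver while a unit wire may have
    several, so units are treated apart throughout. *)

(** * Order of occurrence and duplicate-freeness in lists *)

Definition memb (n : nat) (l : list nat) : bool :=
  if in_dec Nat.eq_dec n l then true else false.

Lemma memb_in n l : memb n l = true <-> In n l.
Proof. unfold memb; destruct in_dec; split; congruence || auto. Qed.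

Lemma memb_notin n l : memb n l = false <-> ~ In n l.
Proof. unfold memb; destruct in_dec; split; congruence || tauto. Qed.

(** Some occurrence of [a] precedes some occurrence of [b]. This is a strict order only on
    duplicate-free lists, such as the wires of one endpoint in a valid wiring. *)
Fixpoint before (l : list nat) (a b : nat) : Prop :=
  match l with
  | [] => False
  | c :: l => (a = c /\ In b l) \/ before l a b
  end.

Lemma before_app l l' a b :
  before (l ++ l') a b <-> before l a b \/ before l' a b \/ (In a l /\ In b l').
Proof.
  induction l as [|c l IH]; simpl; [tauto|].
  rewrite in_app_iff, IH. intuition (subst; auto).
Qed.

Lemma before_in l a b : before l a b -> In a l /\ In b l.
Proof.
  induction l as [|c l IH]; simpl; [tauto|]. intuition (subst; auto).
Qed.

Lemma before_asym l a b : NoDup l -> before l a b -> before l b a -> False.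
Proof.
  induction 1 as [|c l Hc Hl IH]; simpl; [tauto|].
  intros [[-> H]|H] [[-> H']|H']; eauto.
  - apply before_in in H'; tauto.
  - apply before_in in H; tauto.
Qed.

Lemma before_irrefl l a : NoDup l -> before l a a -> False.
Proof. eauto using before_asym. Qed.

Lemma before_total l a b :
  In a l -> In b l -> a <> b -> before l a b \/ before l b a.
Proof.
  induction l as [|c l IH]; simpl; [tauto|].
  intros [->|Ha] [->|Hb] N; try (exfalso; congruence); auto. destruct (IH Ha Hb N); tauto.
Qed.

Lemma in_map_fst {A B : Type} (l : list (A * B)) a b : In (a, b) l -> In a (map fst l).
Proof. intro H. change a with (fst (a, b)). now apply in_map. Qed.

Lemma NoDup_app_iff {A : Type} (l l' : list A) :
  NoDup (l ++ l') <-> NoDup l /\ NoDup l' /\ (forall a, In a l -> In a l' -> False).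
Proof.
  induction l as [|c l IH]; simpl.
  - split; [intros; repeat split; auto using NoDup_nil|tauto].
  - rewrite !NoDup_cons_iff, in_app_iff, IH. firstorder (subst; eauto).
Qed.

Lemma NoDup_flat_in {A B : Type} (F : A -> list B) W e :
  NoDup (flat_map F W) -> In e W -> NoDup (F e).
Proof.
  induction W as [|a W IH]; simpl; [tauto|].
  rewrite NoDup_app_iff. intros H [->|He]; tauto.
Qed.

(** Disjointness of the lists [F e] lets an element determine the entry that holds it: a wire its
    sender, a name the endpoint that declares it. *)
Lemma NoDup_flat_inj {A B : Type} (F : A -> list B) W e e' b :
  NoDup (flat_map F W) -> In e W -> In e' W -> In b (F e) -> In b (F e') -> e = e'.
Proof.
  induction W as [|a W IH]; simpl; [tauto|].
  rewrite NoDup_app_iff. intros (H1 & H2 & H3) [->|He] [->|He'] Hb Hb'; auto;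
    exfalso; eapply H3; eauto; apply in_flat_map; eauto.
Qed.

Lemma flat_map_perm {A B : Type} (F : A -> list B) W W' :
  Permutation W W' -> Permutation (flat_map F W) (flat_map F W').
Proof. apply Permutation_flat_map. Qed.

Lemma in_perm_cons {A : Type} (a : A) l : In a l -> exists l', Permutation l (a :: l').
Proof.
  intro H. apply in_split in H as (l1 & l2 & ->). exists (l1 ++ l2).
  symmetry. apply Permutation_middle.
Qed.

Lemma in_split_map {A B : Type} (F : A -> B) b (l : list A) :
  In b (map F l) -> exists l1 a l2, l = l1 ++ a :: l2 /\ F a = b.
Proof.
  intro H. apply in_map_iff in H as (a & E & H). apply in_split in H as (l1 & l2 & ->).
  exists l1, a, l2. auto.
Qed.

Lemma map_eq_app_cons {A B : Type} (F : A -> B) l b1 b b2 :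
  map F l = b1 ++ b :: b2 ->
  exists l1 a l2, l = l1 ++ a :: l2 /\ map F l1 = b1 /\ F a = b /\ map F l2 = b2.
Proof.
  intro H. apply map_eq_app in H as (l1 & l2 & -> & E1 & E2).
  destruct l2 as [|a l2]; simpl in E2; [discriminate|].
  injection E2 as E2 E3. exists l1, a, l2. auto.
Qed.

(** * Queues up to swaps *)

Definition lab (l : name) (q : queue) : queue := filter (fun b => label b =? l) q.

Lemma lab_app l q q' : lab l (q ++ q') = lab l q ++ lab l q'.
Proof. apply filter_app. Qed.

Lemma lab_cons l b q : lab l (b :: q) = if label b =? l then b :: lab l q else lab l q.
Proof. reflexivity. Qed.

Lemma lab_nil l q : Forall (fun b => label b <> l) q -> lab l q = [].
Proof.
  induction 1 as [|b q Hb Hq IH]; simpl; auto.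
  apply Nat.eqb_neq in Hb. rewrite Hb. auto.
Qed.

Lemma lab_id l q : Forall (fun b => label b = l) q -> lab l q = q.
Proof.
  induction 1 as [|b q Hb Hq IH]; simpl; auto.
  apply Nat.eqb_eq in Hb. rewrite Hb. f_equal; auto.
Qed.

Lemma queue_eq_sym q q' : queue_eq q q' -> queue_eq q' q.
Proof.
  induction 1; eauto using queue_eq, not_eq_sym.
Qed.

Lemma queue_eq_app q1 q1' q2 q2' :
  queue_eq q1 q1' -> queue_eq q2 q2' -> queue_eq (q1 ++ q2) (q1' ++ q2').
Proof.
  intros H1 H2. apply qe_trans with (q1' ++ q2).
  - induction H1 as [|Ψ b b' Ψ' N|]; eauto using queue_eq.
    rewrite <- !app_assoc. now apply qe_swap.
  - induction H2 as [|Ψ b b' Ψ' N|]; eauto using queue_eq.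
    rewrite !app_assoc. now apply qe_swap.
Qed.

(** Boxes commute exactly when their labels differ, so a queue up to equality is a family of lists,
    one for each label. From right to left, the top box of [q] is the first one of its label in [q']
    and can be swapped to the front. *)
Lemma queue_eq_lab q q' : queue_eq q q' <-> forall l, lab l q = lab l q'.
Proof.
  split.
  - induction 1 as [|Ψ b b' Ψ' N|]; intro l; auto; [|congruence].
    rewrite !lab_app, !lab_cons.
    destruct (Nat.eqb_spec (label b) l), (Nat.eqb_spec (label b') l); congruence.
  - revert q'. induction q as [|b q IH]; intros q' H.
    + destruct q' as [|b q']; [constructor|].
      specialize (H (label b)). simpl in H. rewrite Nat.eqb_refl in H. discriminate.
    + assert (exists p s, q' = p ++ b :: s /\ Forall (fun c => label c <> label b) p)
        as (p & s & -> & Hp).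
      { specialize (H (label b)). rewrite lab_cons, Nat.eqb_refl in H. clear IH.
        induction q' as [|c q' IH]; [discriminate|].
        rewrite (lab_cons _ c) in H. destruct (Nat.eqb_spec (label c) (label b)) as [E|N].
        - injection H as -> _. exists [], q'. auto.
        - destruct (IH H) as (p & s & -> & Hp). exists (c :: p), s. auto. }
      assert (queue_eq (b :: p ++ s) (p ++ b :: s)) as Hf.
      { clear -Hp. induction Hp as [|c p Hc Hp IH]; [constructor|].
        apply qe_trans with (c :: b :: p ++ s).
        - apply (qe_swap [] b c (p ++ s)). congruence.
        - apply (queue_eq_app [c] [c]); [constructor|auto]. }
      eapply qe_trans; [|exact Hf].
      apply (queue_eq_app [b] [b]); [constructor|]. apply IH. intro l.
      specialize (H l). rewrite lab_app, !lab_cons in H. rewrite lab_app.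
      destruct (Nat.eqb_spec (label b) l) as [E|N]; auto. subst l.
      rewrite (lab_nil _ p) in H by auto. rewrite (lab_nil _ p) by auto.
      exact (f_equal (@tl _) H).
Qed.

Lemma queue_eq_perm q q' : queue_eq q q' -> Permutation q q'.
Proof.
  induction 1; eauto using Permutation. apply Permutation_app_head. constructor.
Qed.

(** An equality of queues has to be carried to the items behind the boxes. The swaps are replayed on
    the preimage, and only items whose boxes have different labels can change order; [k] extracts
    the wire of an item. *)
Lemma queue_eq_lift {A : Type} (F : A -> box) (k : A -> nat) q Ψ :
  queue_eq (map F q) Ψ ->
  exists q', Ψ = map F q' /\ Permutation q q' /\
    forall a b, before (map k q') a b ->
      before (map k q) a b \/
      exists i j, In i q /\ In j q /\ k i = a /\ k j = b /\ label (F i) <> label (F j).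
Proof.
  intro H. remember (map F q) as Φ eqn:E. revert q E.
  induction H as [|Ψ b b' Ψ' N|Ψ1 Ψ2 Ψ3 H1 IH1 H2 IH2]; intros q E.
  - exists q. auto.
  - symmetry in E. apply map_eq_app_cons in E as (q1 & i & q2 & -> & <- & <- & E).
    destruct q2 as [|j q2]; simpl in E; [discriminate|]. injection E as <- <-.
    exists (q1 ++ j :: i :: q2). rewrite map_app. split; [reflexivity|]. split.
    + apply Permutation_app_head. constructor.
    + intros a b. rewrite !map_app, !before_app. simpl.
      intros [?|[[[-> [<-|?]]|[[-> ?]|?]]|?]]; intuition auto.
      right. exists j, i. rewrite !in_app_iff; simpl. intuition auto.
  - destruct (IH1 q E) as (q' & -> & P1 & B1). destruct (IH2 q' eq_refl) as (q'' & -> & P2 & B2).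
    exists q''. split; [reflexivity|]. split; [now transitivity q'|].
    intros a b Hb. apply B2 in Hb as [Hb|(i & j & Hi & Hj & E1 & E2 & N)]; auto.
    right. exists i, j. repeat split; auto;
      eapply Permutation_in; try (symmetry; exact P1); auto.
Qed.

(** * Annotated types, endpoints and contexts up to equality *)

Lemma aty_eq_refl A : aty_eq A A.
Proof. induction A; constructor; auto. Qed.

Lemma aty_eq_sym A B : aty_eq A B -> aty_eq B A.
Proof. induction 1; constructor; auto. now symmetry. Qed.

Lemma aty_eq_trans A B C : aty_eq A B -> aty_eq B C -> aty_eq A C.
Proof.
  intro H. revert C. induction H; intros C HC; inversion HC; subst; constructor; auto.
  etransitivity; eauto.
Qed.

Definition oaty_eq (t t' : option aty) : Prop :=
  match t, t' with
  | Some B, Some B' => aty_eq B B'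
  | None, None => True
  | _, _ => False
  end.

Lemma ep_eq_refl e : ep_eq e e.
Proof.
  repeat split; [constructor|]. destruct (ep_type e); auto using aty_eq_refl.
Qed.

Lemma ep_eq_sym e e' : ep_eq e e' -> ep_eq e' e.
Proof.
  intros (H1 & H2 & H3). repeat split; auto using queue_eq_sym.
  destruct (ep_type e), (ep_type e'); auto using aty_eq_sym.
Qed.

Lemma ep_eq_trans e e' e'' : ep_eq e e' -> ep_eq e' e'' -> ep_eq e e''.
Proof.
  intros (H1 & H2 & H3) (H4 & H5 & H6). repeat split; [eauto using queue_eq|congruence|].
  destruct (ep_type e), (ep_type e'), (ep_type e''); auto; try tauto.
  eauto using aty_eq_trans.
Qed.

Lemma marked_eq_refl e : marked_eq e e.
Proof. split; [constructor|apply ep_eq_refl]. Qed.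

Lemma marked_eq_sym e e' : marked_eq e e' -> marked_eq e' e.
Proof. intros [H1 H2]; split; auto using queue_eq_sym, ep_eq_sym. Qed.

Lemma marked_eq_trans e e' e'' : marked_eq e e' -> marked_eq e' e'' -> marked_eq e e''.
Proof. intros [H1 H2] [H3 H4]; split; eauto using queue_eq, ep_eq_trans. Qed.

(** Bundled so that the facts about multisets modulo a relation serve both for endpoints and for
    marked endpoints. *)
Record equivalence_rel {E : Type} (R : E -> E -> Prop) : Prop := {
  er_refl e : R e e;
  er_sym e e' : R e e' -> R e' e;
  er_trans e e' e'' : R e e' -> R e' e'' -> R e e'' }.

Lemma ep_equiv : equivalence_rel ep_eq.
Proof. split; eauto using ep_eq_refl, ep_eq_sym, ep_eq_trans. Qed.

Lemma marked_equiv : equivalence_rel marked_eq.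
Proof. split; eauto using marked_eq_refl, marked_eq_sym, marked_eq_trans. Qed.

Lemma perm_Forall2 {A B : Type} (R : A -> B -> Prop) l l' k :
  Permutation l l' -> Forall2 R l k -> exists k', Permutation k k' /\ Forall2 R l' k'.
Proof.
  intro H. revert k. induction H as [|a l l' H IH|a b l|l1 l2 l3 H1 IH1 H2 IH2]; intros k F.
  - inversion F; subst. exists []; auto.
  - inversion F as [|? b ? k0 Hab Hl]; subst. destruct (IH _ Hl) as (k' & P & F').
    exists (b :: k'); auto.
  - inversion F as [|? b' ? k0 Hab Hl]; subst. inversion Hl as [|? a' ? k1 Hab' Hl']; subst.
    exists (a' :: b' :: k1). split; [constructor|auto].
  - destruct (IH1 _ F) as (k1 & P1 & F1). destruct (IH2 _ F1) as (k2 & P2 & F2).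
    exists k2. split; [now transitivity k1|auto].
Qed.

Lemma perm_Forall2_r {A B : Type} (R : A -> B -> Prop) l k k' :
  Permutation k k' -> Forall2 R l k -> exists l', Permutation l l' /\ Forall2 R l' k'.
Proof.
  intros P F. apply Forall2_flip in F.
  destruct (perm_Forall2 _ _ _ _ P F) as (l' & P' & F'). exists l'. split; auto.
  now apply Forall2_flip in F'.
Qed.

Lemma Forall2_trans {A B C : Type} (R : A -> B -> Prop) (S : B -> C -> Prop) (U : A -> C -> Prop) :
  (forall a b c, R a b -> S b c -> U a c) ->
  forall l k m, Forall2 R l k -> Forall2 S k m -> Forall2 U l m.
Proof.
  intros H l k m F. revert m. induction F; intros m G; inversion G; subst; constructor; eauto.
Qed.

Section Mset.
Context {E : Type} (R : E -> E -> Prop) (HR : equivalence_rel R).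

Lemma mset_refl l : mset_eq R l l.
Proof.
  exists l. split; auto. induction l; constructor; auto. apply (er_refl _ HR).
Qed.

Lemma mset_sym l l' : mset_eq R l l' -> mset_eq R l' l.
Proof.
  intros (l0 & P & F). symmetry in P.
  destruct (perm_Forall2 _ _ _ _ P F) as (k & P' & F'). exists k. split; auto.
  apply Forall2_flip. revert F'. apply Forall2_impl. apply (er_sym _ HR).
Qed.

Lemma mset_trans l l' l'' : mset_eq R l l' -> mset_eq R l' l'' -> mset_eq R l l''.
Proof.
  intros (l0 & P & F) (l1 & P1 & F1).
  destruct (perm_Forall2_r _ _ _ _ P1 F) as (k & Pk & Fk). exists k. split.
  - now transitivity l0.
  - eapply Forall2_trans; eauto. apply (er_trans _ HR).
Qed.

Lemma mset_perm l l' : Permutation l l' -> mset_eq R l l'.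
Proof.
  intro P. exists l'. split; auto. clear -HR.
  induction l'; constructor; auto. apply (er_refl _ HR).
Qed.

Lemma mset_perm_l l l1 l' : Permutation l l1 -> mset_eq R l1 l' -> mset_eq R l l'.
Proof. intros P (l0 & P0 & F). exists l0. split; auto. now transitivity l1. Qed.

Lemma mset_Forall2 l l' : Forall2 R l l' -> mset_eq R l l'.
Proof. intro F. exists l. auto. Qed.

Lemma mset_app l l' k k' : mset_eq R l l' -> mset_eq R k k' -> mset_eq R (l ++ k) (l' ++ k').
Proof.
  intros (l0 & P & F) (k0 & P' & F'). exists (l0 ++ k0). split.
  - now apply Permutation_app.
  - now apply Forall2_app.
Qed.

Lemma mset_cons e e' l l' : R e e' -> mset_eq R l l' -> mset_eq R (e :: l) (e' :: l').
Proof. intros He H. apply (mset_app [e] [e']); auto. apply mset_Forall2. auto. Qed.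

(** Aligns the distinguished entry of a rule with an entry of a wiring whose read-back context
    equals the one in the rule. *)
Lemma mset_map_inv {A : Type} (F : A -> E) e l L :
  mset_eq R (e :: l) (map F L) ->
  exists a L', Permutation L (a :: L') /\ R e (F a) /\ mset_eq R l (map F L').
Proof.
  intros (l0 & P & H).
  destruct (perm_Forall2 _ _ (e :: l) _ (Permutation_sym P) H) as (k & Pk & Hk).
  inversion Hk as [|? b ? k' Hb Hk']; subst.
  symmetry in Pk. apply Permutation_map_inv in Pk as (L0 & E0 & PL).
  destruct L0 as [|a L']; simpl in E0; [discriminate|]. injection E0 as -> ->.
  exists a, L'. split; [now symmetry|]. split; auto. now apply mset_Forall2.
Qed.

Lemma side_refl s : side_eq R s s.
Proof. repeat split; auto using mset_refl, aty_eq_refl. constructor. Qed.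

Lemma side_sym s t : side_eq R s t -> side_eq R t s.
Proof.
  intros (H1 & H2 & H3 & H4). repeat split; auto using mset_sym, queue_eq_sym, aty_eq_sym.
Qed.

Lemma side_trans s t u : side_eq R s t -> side_eq R t u -> side_eq R s u.
Proof.
  intros (H1 & H2 & H3 & H4) (H5 & H6 & H7 & H8).
  repeat split; eauto using mset_trans, qe_trans, aty_eq_trans. congruence.
Qed.

Lemma config_refl K : config_eq R K K.
Proof. left; auto using side_refl. Qed.

Lemma config_sym K L : config_eq R K L -> config_eq R L K.
Proof. intros [[]|[]]; [left|right]; auto using side_sym. Qed.

Lemma config_trans K L M : config_eq R K L -> config_eq R L M -> config_eq R K M.
Proof.
  intros [[H1 H2]|[H1 H2]] [[H3 H4]|[H3 H4]];
    [left|right|right|left]; eauto using side_trans.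
Qed.

Lemma config_swap s t : config_eq R (s, t) (t, s).
Proof. right; simpl; auto using side_refl. Qed.

End Mset.

Lemma ctx_eq_refl Γ : ctx_eq Γ Γ.
Proof. apply mset_refl, ep_equiv. Qed.

Lemma ctx_eq_sym Γ Δ : ctx_eq Γ Δ -> ctx_eq Δ Γ.
Proof. apply mset_sym, ep_equiv. Qed.

Lemma ctx_eq_trans Γ Δ Θ : ctx_eq Γ Δ -> ctx_eq Δ Θ -> ctx_eq Γ Θ.
Proof. apply mset_trans, ep_equiv. Qed.

Lemma ctx_eq_perm Γ Δ : Permutation Γ Δ -> ctx_eq Γ Δ.
Proof. apply mset_perm, ep_equiv. Qed.

Lemma msg_names_app q q' : msg_names (q ++ q') = msg_names q ++ msg_names q'.
Proof. apply flat_map_app. Qed.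

Lemma declared_eq Γ Δ : ctx_eq Γ Δ -> Permutation (declared Γ) (declared Δ).
Proof.
  intros (Γ0 & P & F). transitivity (declared Γ0); [now apply flat_map_perm|].
  clear P. induction F as [|e e' l l' He F IH]; [constructor|]. simpl.
  destruct He as (H1 & H2 & _). rewrite H2. constructor. apply Permutation_app; auto.
  apply flat_map_perm. now apply queue_eq_perm.
Qed.

Lemma wf_aty_eq A B : aty_eq A B -> wf_aty A -> wf_aty B.
Proof.
  induction 1 as [| |us vs H| | |]; simpl; auto. intros [N D]. split.
  - intros ->. symmetry in H. apply Permutation_nil in H. auto.
  - eapply Permutation_NoDup; eauto.
Qed.

Lemma wf_ep_eq e e' : ep_eq e e' -> wf_ep e -> wf_ep e'.
Proof.
  intros (H1 & _ & H3). unfold wf_ep.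
  destruct (ep_type e), (ep_type e'); try tauto; [now apply wf_aty_eq|].
  intros N E. apply N. apply queue_eq_perm in H1. rewrite E in H1.
  symmetry in H1. now apply Permutation_nil in H1.
Qed.

Lemma wf_ctx_eq Γ Δ : ctx_eq Γ Δ -> wf_ctx Γ -> wf_ctx Δ.
Proof.
  intros H [H1 H2]. split.
  - apply (Permutation_NoDup (declared_eq _ _ H) H1).
  - destruct H as (Γ0 & P & F). assert (Forall wf_ep Γ0) as H0 by (apply (Permutation_Forall P H2)).
    clear -F H0. induction F; inversion H0; subst; constructor; eauto using wf_ep_eq.
Qed.

(** * Wired contexts *)

(* A wire stands for one message, or for one unit 1 together with the matching
   bottoms, whatever names label it; [typ w] below is the type of the message,
   and [None] for a unit. *)
Definition wire := nat.

Inductive wty :=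
| WAtom (a : atom)
| WNAtom (a : atom)
| WOne (w : wire)
| WBot (w : wire)
| WTensor (A : ty) (w : wire) (B : wty)
| WPar (A : ty) (w : wire) (B : wty).

Fixpoint ins (T : wty) : list wire :=
  match T with
  | WBot w => [w]
  | WTensor _ _ B => ins B
  | WPar _ w B => w :: ins B
  | _ => []
  end.

Fixpoint outs (T : wty) : list wire :=
  match T with
  | WOne w => [w]
  | WTensor _ w B => w :: outs B
  | WPar _ _ B => outs B
  | _ => []
  end.

Fixpoint wdual (T : wty) : wty :=
  match T with
  | WAtom a => WNAtom a
  | WNAtom a => WAtom a
  | WOne w => WBot w
  | WBot w => WOne w
  | WTensor A w B => WPar (dual A) w (wdual B)
  | WPar A w B => WTensor (dual A) w (wdual B)
  end.

Lemma dual_dual A : dual (dual A) = A.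
Proof. induction A; simpl; congruence. Qed.

Lemma wdual_wdual T : wdual (wdual T) = T.
Proof. induction T; simpl; rewrite ?dual_dual; congruence. Qed.

Lemma ins_wdual T : ins (wdual T) = outs T.
Proof. induction T; simpl; congruence. Qed.

Lemma outs_wdual T : outs (wdual T) = ins T.
Proof. induction T; simpl; congruence. Qed.

(* A received message z:A on a wire, or a received star ([None]). *)
Notation item := (wire * option (name * ty))%type.

Record wep := WEp { wp : list item; wn : name; wt : option wty }.

Definition iw (e : wep) : list wire :=
  map fst (wp e) ++ match wt e with Some T => ins T | None => [] end.

Definition ow (e : wep) : list wire :=
  match wt e with Some T => outs T | None => [] end.

(* [f w] is the endpoint that sends on the wire w, hence the label of its boxes,
   and [g w] lists the endpoints that have received or will receive from it. *)
Fixpoint rbT (f : wire -> name) (g : wire -> list name) (T : wty) : aty :=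
  match T with
  | WAtom a => AAtom a
  | WNAtom a => ANAtom a
  | WOne w => AOne (g w)
  | WBot w => ABot (f w)
  | WTensor A w B => ATensor A (hd 0 (g w)) (rbT f g B)
  | WPar A w B => APar A (f w) (rbT f g B)
  end.

Definition rbI (f : wire -> name) (i : item) : box :=
  match i with
  | (w, None) => Star (f w)
  | (w, Some (z, A)) => Msg (f w) z A
  end.

Definition rb (f : wire -> name) (g : wire -> list name) (e : wep) : endpoint :=
  Ep (map (rbI f) (wp e)) (wn e) (option_map (rbT f g) (wt e)).

Definition imsgs (q : list item) : list name :=
  flat_map (fun i => match snd i with Some (z, _) => [z] | None => [] end) q.

Definition decl (W : list wep) : list name :=
  flat_map (fun e => wn e :: imsgs (wp e)) W.

Definition types (W : list wep) : list (name * wty) :=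
  flat_map (fun e => match wt e with Some T => [(wn e, T)] | None => [] end) W.

Fixpoint tyok (typ : wire -> option ty) (T : wty) : Prop :=
  match T with
  | WAtom _ | WNAtom _ => True
  | WOne w | WBot w => typ w = None
  | WTensor A w B => typ w = Some (dual A) /\ tyok typ B
  | WPar A w B => typ w = Some A /\ tyok typ B
  end.

Definition itemok (typ : wire -> option ty) (i : item) : Prop :=
  typ (fst i) = option_map snd (snd i).

Definition isstar (i : item) : bool := match snd i with None => true | _ => false end.

(* A typable endpoint has received its star, exactly once, iff it is terminated. *)
Definition tok (typ : wire -> option ty) (e : wep) : Prop :=
  Forall (itemok typ) (wp e) /\
  match wt e with
  | Some T => tyok typ T /\ filter isstar (wp e) = []
  | None => exists w, filter isstar (wp e) = [(w, None)]
  end.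

(* [v_fifo] is the order-theoretic content of the queues: it is what makes the
   leftmost occurrence pointed to by a rewriting step the expected one. *)
Record Valid (typ : wire -> option ty) (W : list wep) : Prop := {
  v_decl : NoDup (decl W);
  v_iw : forall e, In e W -> NoDup (iw e);
  v_ow : NoDup (flat_map ow W);
  v_irr : forall e w, In e W -> In w (iw e) -> In w (ow e) -> False;
  v_msg : forall e e' w, In e W -> In e' W -> In w (iw e) -> In w (iw e') ->
    typ w <> None -> wn e = wn e';
  v_io : forall e w, In e W -> In w (iw e) -> exists e', In e' W /\ In w (ow e');
  v_oi : forall e w, In e W -> In w (ow e) -> exists e', In e' W /\ In w (iw e');
  v_fifo : forall e e' a b, In e W -> In e' W ->
    before (iw e) a b -> before (ow e') b a -> False;
  v_tok : forall e, In e W -> tok typ e }.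
Arguments v_decl {typ W}.
Arguments v_iw {typ W}.
Arguments v_ow {typ W}.
Arguments v_irr {typ W}.
Arguments v_msg {typ W}.
Arguments v_io {typ W}.
Arguments v_oi {typ W}.
Arguments v_fifo {typ W}.
Arguments v_tok {typ W}.

(** Only wires that are sent in [W] are constrained, and [g w] is fixed only up to order. A valid
    wiring therefore determines its context up to [ctx_eq] and no further. *)
Record Labelling (f : wire -> name) (g : wire -> list name) (W : list wep) : Prop := {
  l_f : forall e w, In e W -> In w (ow e) -> f w = wn e;
  l_nd : forall e w, In e W -> In w (ow e) -> NoDup (g w);
  l_g : forall e w n, In e W -> In w (ow e) ->
    (In n (g w) <-> exists e', In e' W /\ wn e' = n /\ In w (iw e')) }.
Arguments l_f {f g W}.
Arguments l_nd {f g W}.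
Arguments l_g {f g W}.

Lemma imsgs_app q q' : imsgs (q ++ q') = imsgs q ++ imsgs q'.
Proof. apply flat_map_app. Qed.

Lemma msg_names_rb f q : msg_names (map (rbI f) q) = imsgs q.
Proof.
  induction q as [|[w [[z A]|]] q IH]; simpl; auto. f_equal; auto.
Qed.

Lemma declared_rb f g W : declared (map (rb f g) W) = decl W.
Proof.
  induction W as [|e W IH]; simpl; auto. rewrite msg_names_rb. f_equal. f_equal. auto.
Qed.

Lemma label_rbI f i : label (rbI f i) = f (fst i).
Proof. destruct i as [w [[z A]|]]; reflexivity. Qed.

Lemma decl_perm W W' : Permutation W W' -> Permutation (decl W) (decl W').
Proof. apply flat_map_perm. Qed.

Lemma decl_wn e W : In e W -> In (wn e) (decl W).
Proof. intro H. apply in_flat_map. exists e. simpl; auto. Qed.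

Lemma NoDup_wn W : NoDup (decl W) -> NoDup (map wn W).
Proof.
  induction W as [|e W IH]; simpl; [constructor|]. intro D.
  inversion D as [|? ? N D']; subst. constructor.
  - intro H. apply in_map_iff in H as (e' & E & He). apply N. rewrite <- E.
    apply in_app_iff. right. now apply (decl_wn e' W).
  - apply IH. apply NoDup_app_iff in D'. tauto.
Qed.

Lemma wn_inj W e e' : NoDup (decl W) -> In e W -> In e' W -> wn e = wn e' -> e = e'.
Proof.
  intros D H H' E. eapply NoDup_flat_inj with (b := wn e); eauto; simpl; auto.
Qed.

Lemma Valid_perm typ W W' : Permutation W W' -> Valid typ W -> Valid typ W'.
Proof.
  intros P V. assert (forall e, In e W' -> In e W) as I
    by (intro e; apply Permutation_in; now symmetry).
  assert (forall e, In e W -> In e W') as J by (intro e; now apply Permutation_in).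
  destruct V. split; eauto.
  - eapply Permutation_NoDup; [apply decl_perm|]; eauto.
  - eapply Permutation_NoDup; [apply flat_map_perm|]; eauto.
  - intros e w He Hw. destruct (v_io0 e w) as (e' & ? & ?); eauto.
  - intros e w He Hw. destruct (v_oi0 e w) as (e' & ? & ?); eauto.
Qed.
Arguments Valid_perm {typ W W'}.

Lemma Labelling_perm f g W W' : Permutation W W' -> Labelling f g W -> Labelling f g W'.
Proof.
  intros P L. assert (forall e, In e W' -> In e W) as I
    by (intro e; apply Permutation_in; now symmetry).
  assert (forall e, In e W -> In e W') as J by (intro e; now apply Permutation_in).
  destruct L. split; eauto. intros e w n He Hw. rewrite l_g0 by eauto.
  split; intros (e' & ? & ? & ?); eauto.
Qed.
Arguments Labelling_perm {f g W W'}.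

Lemma ow_uniq typ W e e' w :
  Valid typ W -> In e W -> In e' W -> In w (ow e) -> In w (ow e') -> e = e'.
Proof. intros V. eapply NoDup_flat_inj, (v_ow V). Qed.

Lemma f_ow typ W f g e w :
  Valid typ W -> Labelling f g W -> In e W -> In w (iw e) ->
  exists e', In e' W /\ In w (ow e') /\ f w = wn e'.
Proof.
  intros V L He Hw. destruct (v_io V e w) as (e' & H' & Hw'); auto.
  exists e'. repeat split; auto. eapply l_f; eauto.
Qed.

Lemma f_wn_ow typ W f g e e' w :
  Valid typ W -> Labelling f g W -> In e W -> In w (iw e) -> In e' W -> f w = wn e' -> In w (ow e').
Proof.
  intros V L He Hw He' E. destruct (f_ow _ _ _ _ _ _ V L He Hw) as (e2 & H2 & Hw2 & E2).
  replace e' with e2; auto. eapply wn_inj; eauto using v_decl. congruence.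
Qed.

Lemma nodup_single (l : list nat) a :
  NoDup l -> (forall n, In n l <-> n = a) -> l = [a].
Proof.
  intros D H. destruct l as [|b l].
  - exfalso. apply (H a). reflexivity.
  - assert (b = a) as -> by (apply H; simpl; auto). destruct l as [|c l]; auto.
    assert (c = a) as -> by (apply H; simpl; auto).
    inversion D; subst. simpl in *; tauto.
Qed.

(** By [v_msg] a message wire has a single receiver, so the head taken by [rbT] is its true
    annotation and not an arbitrary choice. *)
Lemma g_msg typ W f g e e' w :
  Valid typ W -> Labelling f g W -> In e W -> In w (iw e) -> In e' W -> In w (ow e') ->
  typ w <> None -> g w = [wn e].
Proof.
  intros V L He Hw He' Hw' N. apply nodup_single; [eapply l_nd; eauto|].
  intro n. rewrite (l_g L) by eauto. split.
  - intros (e2 & H2 & <- & Hw2). symmetry. eapply (v_msg V); eauto.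
  - intros ->. eauto.
Qed.

Lemma rbT_ext f g f' g' T :
  (forall w, In w (ins T) -> f w = f' w) -> (forall w, In w (outs T) -> g w = g' w) ->
  rbT f g T = rbT f' g' T.
Proof.
  induction T; simpl; intros Hf Hg; f_equal; auto; try (f_equal; auto).
Qed.

Lemma rbI_ext f f' q :
  (forall w, In w (map fst q) -> f w = f' w) -> map (rbI f) q = map (rbI f') q.
Proof.
  intro H. apply map_ext_in. intros [w [[z A]|]] Hi; simpl;
    rewrite H; auto; eapply in_map_fst; eauto.
Qed.

Lemma rb_ext f g f' g' e :
  (forall w, In w (iw e) -> f w = f' w) -> (forall w, In w (ow e) -> g w = g' w) ->
  rb f g e = rb f' g' e.
Proof.
  destruct e as [q n t]; unfold rb, iw, ow; simpl. intros Hf Hg. f_equal.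
  - apply rbI_ext. intros; apply Hf, in_app_iff; auto.
  - destruct t as [T|]; simpl; f_equal. apply rbT_ext; auto.
    intros; apply Hf, in_app_iff; auto.
Qed.

(* For message wires only the single supplier matters, hence [hd]. *)
Lemma rbT_eq typ f g f' g' T :
  tyok typ T ->
  (forall w, In w (ins T) -> f w = f' w) ->
  (forall w, In w (outs T) -> Permutation (g w) (g' w) /\ (typ w <> None -> g w = g' w)) ->
  aty_eq (rbT f g T) (rbT f' g' T).
Proof.
  induction T; simpl; intros K Hf Hg; try constructor.
  - apply Hg; auto.
  - rewrite Hf by auto. constructor.
  - destruct K as [K1 K2]. destruct (Hg w) as [_ E]; auto. rewrite E by congruence.
    constructor; auto.
  - destruct K as [K1 K2]. rewrite Hf by auto. constructor; auto.
Qed.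

(** Two labellings agree on senders and on the receiver of each message. For a unit they may list
    the receivers in different orders, which [aty_eq] absorbs. *)
Lemma rb_Labelling typ W f g f' g' e :
  Valid typ W -> Labelling f g W -> Labelling f' g' W -> In e W -> ep_eq (rb f g e) (rb f' g' e).
Proof.
  intros V L L' He.
  assert (forall w, In w (iw e) -> f w = f' w) as Hf.
  { intros w Hw. destruct (v_io V e w) as (e' & H' & Hw'); auto.
    rewrite (l_f L e'), (l_f L' e'); auto. }
  assert (forall w, In w (ow e) -> Permutation (g w) (g' w) /\ (typ w <> None -> g w = g' w)) as Hg.
  { intros w Hw. split.
    - apply NoDup_Permutation; eauto using l_nd. intro n.
      rewrite (l_g L), (l_g L') by eauto. reflexivity.
    - intro N. destruct (v_oi V e w) as (e' & H' & Hw'); auto.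
      rewrite (g_msg typ W f g e' e), (g_msg typ W f' g' e' e); auto. }
  destruct (v_tok V e He) as [_ K].
  destruct e as [q n t]; unfold rb, iw, ow in *; simpl in *. split; [|split]; simpl; auto.
  - rewrite (rbI_ext f f'); [constructor|]. intros; apply Hf, in_app_iff; auto.
  - destruct t as [T|]; simpl; auto. apply (rbT_eq typ); try tauto.
    intros; apply Hf, in_app_iff; auto.
Qed.

Lemma rb_LSpec_ctx typ W f g f' g' L :
  Valid typ W -> Labelling f g W -> Labelling f' g' W -> incl L W ->
  Forall2 ep_eq (map (rb f g) L) (map (rb f' g') L).
Proof.
  intros V HL HL' I. induction L as [|e L IH]; simpl; constructor.
  - eapply rb_Labelling; eauto. apply I; simpl; auto.
  - apply IH. intros a Ha; apply I; simpl; auto.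
Qed.

(** * Preservation of validity *)

(** Passing from [e] to [e'] may drop the wires outside [keep] and may reorder received wires,
    provided their labels under [f], that is their senders, differ. *)
Record Sim (f : wire -> name) (keep : wire -> Prop) (e e' : wep) : Prop := {
  sim_n : wn e = wn e';
  sim_iw : forall a, In a (iw e') <-> In a (iw e) /\ keep a;
  sim_ow : forall a, In a (ow e') <-> In a (ow e) /\ keep a;
  sim_biw : forall a b, before (iw e') a b -> before (iw e) a b \/ f a <> f b;
  sim_bow : forall a b, before (ow e') a b -> before (ow e) a b;
  sim_nd : NoDup (iw e') }.

Lemma Forall2_in_l {A B : Type} (R : A -> B -> Prop) l k a :
  Forall2 R l k -> In a l -> exists b, In b k /\ R a b.
Proof.
  induction 1 as [|x y l k H F IH]; simpl; [tauto|]. intros [->|Ha]; eauto.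
  destruct (IH Ha) as (b & ? & ?); eauto.
Qed.

Lemma Forall2_in_r {A B : Type} (R : A -> B -> Prop) l k b :
  Forall2 R l k -> In b k -> exists a, In a l /\ R a b.
Proof.
  induction 1 as [|x y l k H F IH]; simpl; [tauto|]. intros [->|Ha]; eauto.
  destruct (IH Ha) as (c & ? & ?); eauto.
Qed.

(** FIFO compares two wires sent by one endpoint, hence with one label, so a reordering allowed by
    [sim_biw] cannot violate it. Using the same [keep] for inputs and outputs leaves no wire with
    only one end. *)
Lemma Valid_sim typ f g keep W W' :
  Valid typ W -> Labelling f g W -> Forall2 (Sim f keep) W W' ->
  NoDup (decl W') -> NoDup (flat_map ow W') -> (forall e, In e W' -> tok typ e) ->
  Valid typ W' /\ Labelling f g W'.
Proof.
  intros V L S D O K.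
  assert (forall e, In e W' -> exists e0, In e0 W /\ Sim f keep e0 e) as B
    by (intros; eapply Forall2_in_r; eauto).
  assert (forall e, In e W -> exists e0, In e0 W' /\ Sim f keep e e0) as C
    by (intros; eapply Forall2_in_l; eauto).
  split; split; auto.
  - intros e He. destruct (B e He) as (e0 & _ & []). auto.
  - intros e w He. destruct (B e He) as (e0 & H0 & []).
    rewrite sim_iw0, sim_ow0. intros [] []. eapply (v_irr V e0 w); auto.
  - intros e e' w He He'. destruct (B e He) as (e0 & H0 & []).
    destruct (B e' He') as (e1 & H1 & []).
    rewrite sim_iw0, sim_iw1, <- sim_n0, <- sim_n1. intros [] [].
    eapply (v_msg V); eauto.
  - intros e w He. destruct (B e He) as (e0 & H0 & []). rewrite sim_iw0. intros [Hw Hk].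
    destruct (v_io V e0 w H0 Hw) as (e1 & H1 & Hw1).
    destruct (C e1 H1) as (e2 & H2 & []). exists e2. rewrite sim_ow1. auto.
  - intros e w He. destruct (B e He) as (e0 & H0 & []). rewrite sim_ow0. intros [Hw Hk].
    destruct (v_oi V e0 w H0 Hw) as (e1 & H1 & Hw1).
    destruct (C e1 H1) as (e2 & H2 & []). exists e2. rewrite sim_iw1. auto.
  - intros e e' a b He He' HI HO. destruct (B e He) as (e0 & H0 & []).
    destruct (B e' He') as (e1 & H1 & []). apply sim_bow1 in HO.
    apply sim_biw0 in HI as [HI|N]; [eapply (v_fifo V e0 e1); eauto|].
    apply before_in in HO as []. apply N.
    rewrite !(l_f L e1); auto.
  - intros e w He. destruct (B e He) as (e0 & H0 & []). rewrite sim_ow0. intros [Hw Hk].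
    rewrite <- sim_n0. eapply l_f; eauto.
  - intros e w He. destruct (B e He) as (e0 & H0 & []). rewrite sim_ow0. intros [Hw Hk].
    eapply l_nd; eauto.
  - intros e w n He. destruct (B e He) as (e0 & H0 & []). rewrite sim_ow0. intros [Hw Hk].
    rewrite (l_g L e0) by auto. split.
    + intros (e1 & H1 & En & Hw1). destruct (C e1 H1) as (e2 & H2 & []).
      exists e2. rewrite sim_iw1. repeat split; auto; congruence.
    + intros (e1 & H1 & En & Hw1). destruct (B e1 H1) as (e2 & H2 & []).
      apply sim_iw1 in Hw1. exists e2. repeat split; try congruence; tauto.
Qed.

Lemma Sim_refl f (keep : wire -> Prop) e :
  NoDup (iw e) -> (forall a, In a (iw e) \/ In a (ow e) -> keep a) -> Sim f keep e e.
Proof. intros D K. split; auto; intro a; specialize (K a); tauto. Qed.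

Lemma Sim_refl_all f (keep : wire -> Prop) W :
  (forall e, In e W -> NoDup (iw e)) ->
  (forall e a, In e W -> In a (iw e) \/ In a (ow e) -> keep a) -> Forall2 (Sim f keep) W W.
Proof.
  intros D K. induction W; constructor.
  - apply Sim_refl; firstorder.
  - apply IHW; firstorder.
Qed.

(** Made for receptions: a received wire passes from the front of the type to the end of the queue,
    and [iw], which lists the queue and then the type, does not notice. *)
Lemma Valid_same typ f g e e' W :
  Valid typ (e :: W) -> Labelling f g (e :: W) ->
  wn e = wn e' -> iw e = iw e' -> ow e = ow e' -> NoDup (decl (e' :: W)) -> tok typ e' ->
  Valid typ (e' :: W) /\ Labelling f g (e' :: W).
Proof.
  intros V L En Ei Eo D K. apply (Valid_sim typ f g (fun _ => True) (e :: W)); auto.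
  - constructor.
    + pose proof (v_iw V e (or_introl eq_refl)) as N. rewrite Ei in N.
      split; auto; rewrite ?Ei, ?Eo; tauto.
    + apply Sim_refl_all; auto. intros; eapply v_iw; simpl; eauto. now right.
  - pose proof (v_ow V) as O. simpl in *. now rewrite <- Eo.
  - intros a [<-|Ha]; auto. eapply (v_tok V). now right.
Qed.

Lemma wf_aty_rbT f g T :
  (forall w, In w (outs T) -> g w <> [] /\ NoDup (g w)) -> wf_aty (rbT f g T).
Proof. induction T; simpl; auto. Qed.

Lemma g_nonempty typ W f g e w :
  Valid typ W -> Labelling f g W -> In e W -> In w (ow e) -> g w <> [].
Proof.
  intros V L He Hw E. destruct (v_oi V e w) as (e' & H' & Hw'); auto.
  assert (In (wn e') (g w)) as H by (apply (l_g L e); eauto).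
  rewrite E in H. destruct H.
Qed.

Lemma wf_rb typ W f g : Valid typ W -> Labelling f g W -> wf_ctx (map (rb f g) W).
Proof.
  intros V L. split; [rewrite declared_rb; apply (v_decl V)|].
  apply Forall_forall. intros e' H. apply in_map_iff in H as (e & <- & He).
  destruct (v_tok V e He) as [_ K]. unfold wf_ep. simpl.
  destruct e as [q n [T|]]; simpl in *.
  - apply wf_aty_rbT. intros w Hw.
    split; [eapply g_nonempty; eauto|eapply (l_nd L); eauto].
  (* A terminated endpoint holds its star, so its queue is not empty. *)
  - destruct K as [w K]. intro E. destruct q; discriminate.
Qed.

Lemma before_app_split (l1 l2 : list nat) a b c :
  before (l1 ++ l2) a b -> before (l1 ++ c :: l2) a b.
Proof. rewrite !before_app. simpl. tauto. Qed.

Lemma NoDup_mid {A : Type} (l1 l2 : list A) (c : A) :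
  NoDup (l1 ++ c :: l2) <-> NoDup (l1 ++ l2) /\ ~ In c (l1 ++ l2).
Proof.
  split.
  - apply NoDup_remove.
  - intros [H1 H2]. eapply Permutation_NoDup; [apply Permutation_middle|]. now constructor.
Qed.

Lemma filter_isstar_mid q1 i q2 :
  isstar i = false -> filter isstar (q1 ++ i :: q2) = filter isstar (q1 ++ q2).
Proof. intro H. rewrite !filter_app. simpl. now rewrite H. Qed.

Lemma Sim_remove f w q1 m q2 u C :
  NoDup (iw (WEp (q1 ++ (w, m) :: q2) u C)) ->
  ~ In w (ow (WEp (q1 ++ (w, m) :: q2) u C)) ->
  Sim f (fun a => a <> w) (WEp (q1 ++ (w, m) :: q2) u C) (WEp (q1 ++ q2) u C).
Proof.
  unfold iw, ow; simpl. rewrite !map_app. simpl. rewrite <- !app_assoc. simpl.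
  intros D N. apply NoDup_mid in D as [D M]. split; simpl; auto; unfold iw, ow; simpl;
    rewrite ?map_app; simpl; rewrite <- ?app_assoc; simpl; auto.
  - intro a. rewrite !in_app_iff in *; simpl. rewrite in_app_iff.
    intuition (subst; try tauto).
  - intro a. intuition (subst; tauto).
  - intros a b H. left. now apply before_app_split.
Qed.

Lemma Sim_send f w q x A B :
  NoDup (outs (WTensor A w B)) -> NoDup (iw (WEp q x (Some B))) ->
  ~ In w (iw (WEp q x (Some B))) ->
  Sim f (fun a => a <> w) (WEp q x (Some (WTensor A w B))) (WEp q x (Some B)).
Proof.
  unfold iw, ow; simpl. intros D N M. inversion D; subst.
  split; simpl; auto; unfold iw, ow; simpl; auto; intro a;
    intuition (subst; auto); congruence.
Qed.

Lemma Valid_send typ f g q1 w z q2 u C q x A B W :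
  let eu := WEp (q1 ++ (w, Some (z, dual A)) :: q2) u C in
  let ex := WEp q x (Some (WTensor A w B)) in
  Valid typ (eu :: ex :: W) -> Labelling f g (eu :: ex :: W) ->
  Valid typ (WEp (q1 ++ q2) u C :: WEp q x (Some B) :: W) /\
  Labelling f g (WEp (q1 ++ q2) u C :: WEp q x (Some B) :: W).
Proof.
  intros eu ex V L.
  assert (In w (iw eu)) as Iu by (unfold iw; simpl; rewrite map_app, !in_app_iff; simpl; auto).
  assert (In w (ow ex)) as Ox by (simpl; auto).
  assert (typ w = Some (dual A)) as Tw.
  { destruct (v_tok V ex) as [_ [[K _] _]]; simpl; auto. }
  assert (eu <> ex) as N.
  { intros E. apply (v_irr V ex w); simpl; auto. now rewrite <- E. }
  pose proof (v_decl V) as D. pose proof (v_ow V) as O.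
  assert (forall e, In e (ex :: W) -> ~ In w (iw e)) as NI.
  { intros e He Hw. assert (wn eu = wn e) as E.
    { apply (v_msg V eu e w); auto; [now left|now right|congruence]. }
    simpl in D. inversion D as [|? ? D1 _]; subst. apply D1. simpl in E. rewrite E.
    apply in_app_iff. right. exact (decl_wn e (ex :: W) He). }
  assert (forall e, In e (eu :: W) -> ~ In w (ow e)) as NO.
  { intros e He Hw. assert (e = ex) as ->.
    { apply (ow_uniq typ (eu :: ex :: W) e ex w); auto; simpl in *; tauto. }
    simpl in He. destruct He as [He|He]; [auto|].
    simpl in O. rewrite NoDup_app_iff in O. destruct O as (_ & O & _).
    change (NoDup (w :: (outs B ++ flat_map ow W))) in O.
    inversion O as [|? ? O1 _]; subst. apply O1, in_app_iff. right.
    apply in_flat_map. exists ex. auto. }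
  apply (Valid_sim typ f g (fun a => a <> w) (eu :: ex :: W)); auto.
  - constructor; [|constructor].
    + apply Sim_remove; [apply (v_iw V); simpl; auto|apply NO; simpl; auto].
    + apply Sim_send.
      * apply (NoDup_flat_in ow (eu :: ex :: W) ex O). simpl; auto.
      * apply (v_iw V ex). simpl; auto.
      * apply (NI ex). simpl; auto.
    + apply Sim_refl_all.
      * intros; apply (v_iw V); simpl; auto.
      * intros e a He [Ha|Ha] ->; [eapply NI|eapply NO]; eauto; simpl; auto.
  - unfold decl in *. simpl in *. rewrite imsgs_app in *. simpl in D.
    rewrite <- app_assoc in *. change (NoDup ((u :: imsgs q1) ++ z :: (imsgs q2 ++ x :: imsgs q ++ decl W))) in D.
    apply NoDup_mid in D as [D _]. exact D.
  - simpl in *. apply NoDup_mid in O as [O _]. exact O.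
  - intros e [<-|[<-|He]].
    + destruct (v_tok V eu) as [K1 K2]; simpl; auto. split; simpl in *.
      * rewrite Forall_app in *. destruct K1 as [K1 K3]. inversion K3; auto.
      * rewrite filter_isstar_mid in K2; auto.
    + destruct (v_tok V ex) as [K1 [[K2 K3] K4]]; simpl; auto. split; simpl in *; auto.
    + apply (v_tok V); simpl; auto.
Qed.

(** * Typing rules on read-back contexts *)

Lemma typed_mono P Γ : typed false P Γ -> forall c, typed c P Γ.
Proof.
  induction 1; intro c; try discriminate; eauto using typed.
Qed.

Lemma rb_wait typ f g q x w W P c :
  let e := WEp q x (Some (WBot w)) in let e' := WEp (q ++ [(w, None)]) x None in
  Valid typ (e :: W) -> Labelling f g (e :: W) ->
  Valid typ (e' :: W) /\ Labelling f g (e' :: W) /\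
  (typed c P (map (rb f g) (e' :: W)) -> typed c (Wait x P) (map (rb f g) (e :: W))).
Proof.
  intros e e' V L. destruct (v_tok V e) as [K1 [K2 K3]]; [simpl; auto|].
  assert (Valid typ (e' :: W) /\ Labelling f g (e' :: W)) as [V' L'].
  { apply (Valid_same typ f g e); auto.
    - unfold iw; simpl. rewrite map_app, app_nil_r. reflexivity.
    - pose proof (v_decl V) as D. unfold decl in *; simpl in *. rewrite imsgs_app.
      simpl. now rewrite app_nil_r.
    - split; simpl in *.
      + rewrite Forall_app. split; auto.
      + exists w. rewrite filter_app, K3. reflexivity. }
  split; [auto|split; [auto|]]. intro H. simpl. apply t_bot.
  simpl in H. unfold rb at 1 in H. simpl in H. rewrite map_app in H. exact H.
Qed.

Lemma rb_recv typ f g q x z A w B W P c :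
  let e := WEp q x (Some (WPar A w B)) in
  let e' := WEp (q ++ [(w, Some (z, A))]) x (Some B) in
  ~ In z (decl (e :: W)) ->
  Valid typ (e :: W) -> Labelling f g (e :: W) ->
  Valid typ (e' :: W) /\ Labelling f g (e' :: W) /\
  (typed c P (map (rb f g) (e' :: W)) -> typed c (Recv x z P) (map (rb f g) (e :: W))).
Proof.
  intros e e' Z V L. destruct (v_tok V e) as [K1 [[K2 K2'] K3]]; [simpl; auto|].
  assert (Valid typ (e' :: W) /\ Labelling f g (e' :: W)) as [V' L'].
  { apply (Valid_same typ f g e); auto.
    - unfold iw; simpl. rewrite map_app, <- app_assoc. reflexivity.
    - pose proof (v_decl V) as D. unfold decl in *; simpl in *. rewrite imsgs_app.
      simpl. rewrite <- app_assoc. simpl.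
      change (NoDup ((x :: imsgs q) ++ z :: decl W)). apply NoDup_mid. split; auto.
    - split; simpl in *.
      + rewrite Forall_app. split; auto.
      + split; auto. rewrite filter_app, K3. reflexivity. }
  split; [auto|split; [auto|]]. intro H. simpl. apply t_par.
  simpl in H. unfold rb at 1 in H. simpl in H. rewrite map_app in H. exact H.
Qed.

(** [w] is the first wire sent by [x], so by FIFO nothing that [eu] receives before [w] comes from
    [x]. The box of [w] can thus be swapped to the top of its queue, where the tensor rule expects
    it. *)
Lemma first_label typ f g W eu ex w O a :
  Valid typ W -> Labelling f g W -> In eu W -> In ex W -> ow ex = w :: O ->
  before (iw eu) a w -> f a <> wn ex.
Proof.
  intros V L Hu Hx Eo B E. destruct (before_in _ _ _ B) as [Ha Hw].
  assert (In a (ow ex)) as Oa by (apply (f_wn_ow typ W f g eu ex a); auto).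
  rewrite Eo in Oa. destruct Oa as [->|Oa].
  - eapply before_irrefl; eauto. eapply v_iw; eauto.
  - apply (v_fifo V eu ex a w); auto. rewrite Eo. simpl; auto.
Qed.

Lemma Forall2_ep_refl Γ : Forall2 ep_eq Γ Γ.
Proof. induction Γ; constructor; auto using ep_eq_refl. Qed.

Lemma queue_eq_front b q1 q2 :
  Forall (fun c => label c <> label b) q1 -> queue_eq (q1 ++ b :: q2) (b :: q1 ++ q2).
Proof.
  intro H. apply queue_eq_lab. intro l. rewrite lab_cons, !lab_app, lab_cons.
  destruct (Nat.eqb_spec (label b) l) as [E|N]; auto. subst l. now rewrite lab_nil.
Qed.

Lemma rb_send typ f g q1 w z q2 u C q x v A B W P S c :
  let eu := WEp (q1 ++ (w, Some (z, dual A)) :: q2) u C in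
  let ex := WEp q x (Some (WTensor A w B)) in
  Valid typ (eu :: ex :: W) -> Labelling f g (eu :: ex :: W) ->
  typed false S [Ep [] z (Some (annot (dual A) v)); Ep [] v (Some (annot A z))] ->
  typed c P (map (rb f g) (WEp (q1 ++ q2) u C :: WEp q x (Some B) :: W)) ->
  typed c (Send x v S P) (map (rb f g) (eu :: ex :: W)).
Proof.
  intros eu ex V L HS HP.
  assert (In w (iw eu)) as Iu by (unfold iw; simpl; rewrite map_app, !in_app_iff; simpl; auto).
  assert (f w = x) as Fw by (apply (l_f L ex); simpl; auto).
  assert (typ w = Some (dual A)) as Tw.
  { destruct (v_tok V ex) as [_ [[K _] _]]; simpl; auto. }
  assert (g w = [u]) as Gw.
  { apply (g_msg typ (eu :: ex :: W) f g eu ex); simpl; auto. congruence. }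
  assert (Forall (fun c => label c <> x) (map (rbI f) q1)) as N.
  { apply Forall_map, Forall_forall. intros i Hi. rewrite label_rbI.
    apply (first_label typ f g (eu :: ex :: W) eu ex w (outs B)); simpl; auto.
    unfold iw; simpl. rewrite map_app, <- app_assoc. apply before_app. right; right.
    split; [now apply in_map|]. simpl; auto. }
  assert (ctx_eq (Ep (Msg x z (dual A) :: map (rbI f) (q1 ++ q2)) u (option_map (rbT f g) C) ::
      Ep (map (rbI f) q) x (Some (ATensor A u (rbT f g B))) :: map (rb f g) W)
      (map (rb f g) (eu :: ex :: W))) as Q.
  { apply mset_Forall2. constructor; [|constructor].
    - split; [|split]; simpl; auto.
      + rewrite !map_app. simpl. rewrite Fw. apply queue_eq_sym.
        apply (queue_eq_front (Msg x z (dual A))). exact N.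
      + destruct C; simpl; auto. apply aty_eq_refl.
    - simpl. unfold rb. simpl. rewrite Gw. apply ep_eq_refl.
    - apply Forall2_ep_refl. }
  eapply t_ctx_eq; [|exact Q].
  apply t_tensor; auto using typed_mono.
  eapply wf_ctx_eq; [apply ctx_eq_sym; exact Q|]. eapply wf_rb; eauto.
Qed.

(** * Renaming and free names *)

Lemma transp_l a b : transp a b a = b.
Proof. unfold transp. destruct Nat.eq_dec; congruence. Qed.

Lemma transp_r a b : transp a b b = a.
Proof. unfold transp. repeat destruct Nat.eq_dec; congruence. Qed.

Lemma transp_other a b n : n <> a -> n <> b -> transp a b n = n.
Proof. intros. unfold transp. repeat destruct Nat.eq_dec; congruence. Qed.

Lemma transp_inv a b n : transp a b (transp a b n) = n.
Proof. unfold transp. repeat destruct Nat.eq_dec; congruence. Qed.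

Lemma transp_inj a b n m : transp a b n = transp a b m -> n = m.
Proof. intro H. rewrite <- (transp_inv a b n), H. apply transp_inv. Qed.

Lemma transp_conj a b c d n :
  transp a b (transp c d n) = transp (transp a b c) (transp a b d) (transp a b n).
Proof.
  destruct (Nat.eq_dec n c) as [->|N1]; [now rewrite !transp_l|].
  destruct (Nat.eq_dec n d) as [->|N2]; [now rewrite !transp_r|].
  rewrite (transp_other c d n), (transp_other (transp a b c)); auto;
    intro E; apply transp_inj in E; auto.
Qed.

Lemma swap_conj a b c d P :
  swap a b (swap c d P) = swap (transp a b c) (transp a b d) (swap a b P).
Proof. induction P; simpl; rewrite ?IHP, ?IHP1, ?IHP2, <- ?transp_conj; reflexivity. Qed.

Lemma in_remove_iff n m l : In n (remove Nat.eq_dec m l) <-> In n l /\ n <> m.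
Proof.
  split; [apply in_remove|]. intros []. now apply in_in_remove.
Qed.

Lemma fn_swap a b P n : In n (fn (swap a b P)) <-> In (transp a b n) (fn P).
Proof.
  assert (forall x, transp a b x = n <-> x = transp a b n) as E.
  { intro x. split; [intros <-; now rewrite transp_inv|intros ->; apply transp_inv]. }
  assert (forall x, n <> transp a b x <-> transp a b n <> x) as E'.
  { intro x. split; intros N K; apply N; symmetry; apply E; symmetry; exact K. }
  induction P; simpl; rewrite ?in_app_iff, ?in_remove_iff, ?IHP, ?IHP1, ?IHP2, ?E, ?E'; tauto.
Qed.

Lemma proc_eq_swap a b P Q : proc_eq P Q -> proc_eq (swap a b P) (swap a b Q).
Proof.
  induction 1; simpl; eauto using proc_eq; rewrite swap_conj;
    constructor; rewrite fn_swap, transp_inv; auto.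
Qed.

Lemma proc_eq_fn P Q : proc_eq P Q -> forall n, In n (fn P) <-> In n (fn Q).
Proof.
  assert (forall x x' P, ~ In x' (fn P) -> forall n,
    In n (fn P) /\ n <> x <-> In n (fn (swap x x' P)) /\ n <> x') as K.
  { intros x x' R H n. rewrite fn_swap.
    destruct (Nat.eq_dec n x) as [->|N].
    - rewrite transp_l. tauto.
    - destruct (Nat.eq_dec n x') as [->|N']; [tauto|]. rewrite transp_other; tauto. }
  induction 1; intro n; simpl; rewrite ?in_app_iff, ?in_remove_iff; try tauto.
  - symmetry. auto.
  - etransitivity; eauto.
  - rewrite (K x x') by auto. tauto.
  - rewrite (K y y') by auto. tauto.
  - rewrite (K y y') by auto. tauto.
  - rewrite (K y y') by auto. tauto.
  - rewrite IHproc_eq1, IHproc_eq2. tauto.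
  - rewrite IHproc_eq. tauto.
  - rewrite IHproc_eq. tauto.
  - rewrite IHproc_eq1, IHproc_eq2. tauto.
Qed.

Fixpoint sw_aty (t : name -> name) (B : aty) : aty :=
  match B with
  | AAtom a => AAtom a
  | ANAtom a => ANAtom a
  | AOne us => AOne (map t us)
  | ABot u => ABot (t u)
  | ATensor A u B => ATensor A (t u) (sw_aty t B)
  | APar A u B => APar A (t u) (sw_aty t B)
  end.

Definition sw_box (t : name -> name) (b : box) : box :=
  match b with Star u => Star (t u) | Msg u z A => Msg (t u) (t z) A end.

Definition sw_ep (t : name -> name) (e : endpoint) : endpoint :=
  Ep (map (sw_box t) (ep_queue e)) (t (ep_name e)) (option_map (sw_aty t) (ep_type e)).

Section Swap.
Context (t : name -> name) (Ht : forall n m, t n = t m -> n = m).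

Lemma sw_annot A x : sw_aty t (annot A x) = annot A (t x).
Proof. induction A; simpl; congruence. Qed.

Lemma sw_aty_eq B B' : aty_eq B B' -> aty_eq (sw_aty t B) (sw_aty t B').
Proof. induction 1; simpl; constructor; auto. now apply Permutation_map. Qed.

Lemma sw_queue_eq q q' : queue_eq q q' -> queue_eq (map (sw_box t) q) (map (sw_box t) q').
Proof.
  induction 1; eauto using queue_eq. rewrite !map_app. simpl. apply qe_swap.
  destruct b, b'; simpl in *; auto.
Qed.

Lemma sw_ep_eq e e' : ep_eq e e' -> ep_eq (sw_ep t e) (sw_ep t e').
Proof.
  intros (H1 & H2 & H3). split; [|split]; simpl; auto using sw_queue_eq.
  destruct (ep_type e), (ep_type e'); simpl; auto using sw_aty_eq.
Qed.

Lemma sw_ctx_eq Γ Δ : ctx_eq Γ Δ -> ctx_eq (map (sw_ep t) Γ) (map (sw_ep t) Δ).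
Proof.
  intros (Γ0 & P & F). exists (map (sw_ep t) Γ0). split; [now apply Permutation_map|].
  clear P. induction F; simpl; constructor; auto using sw_ep_eq.
Qed.

Lemma sw_declared Γ : declared (map (sw_ep t) Γ) = map t (declared Γ).
Proof.
  induction Γ as [|e Γ IH]; simpl; auto. rewrite map_app. f_equal. f_equal; auto.
  destruct e as [q n C]; simpl. induction q as [|[u|u z A] q IHq]; simpl; auto.
  f_equal; auto.
Qed.

Lemma sw_wf Γ : wf_ctx Γ -> wf_ctx (map (sw_ep t) Γ).
Proof.
  intros [D K]. split.
  - rewrite sw_declared. apply FinFun.Injective_map_NoDup; auto.
  - apply Forall_map. revert K. apply Forall_impl. intros [q n [B|]]; unfold wf_ep; simpl.
    + induction B; simpl; auto. intros [H1 H2]. split.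
      * destruct us; simpl; congruence.
      * apply FinFun.Injective_map_NoDup; auto.
    + destruct q; simpl; congruence.
Qed.
End Swap.

(** Equivariance, needed to rename the bound name of an input. The cut-free system suffices, because
    the spawned processes occurring in [fwd] are cut-free. *)
Lemma typed_swap a b P Γ :
  typed false P Γ -> typed false (swap a b P) (map (sw_ep (transp a b)) Γ).
Proof.
  pose proof (transp_inj a b) as I.
  induction 1; simpl in *; try discriminate; unfold sw_ep in *; simpl in *;
    rewrite ?map_app in *; simpl in *.
  - constructor. intro E. apply I in E. auto.
  - match goal with H : wf_ctx _ |- _ => apply (sw_wf _ I) in H; rewrite map_app, map_map in H end.
    rewrite map_map. simpl.
    rewrite <- (map_map (transp a b) (fun u => Ep [Star (transp a b x)] u None)) in *.
    apply t_one. exact H.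
  - apply t_bot. auto.
  - apply t_par. auto.
  - rewrite !sw_annot in *. apply t_tensor; auto.
    match goal with H : wf_ctx _ |- _ => apply (sw_wf _ I) in H; exact H end.
  - eauto using t_proc_eq, proc_eq_swap.
  - eapply t_ctx_eq; eauto. now apply (sw_ctx_eq _ I).
Qed.

Lemma fresh_name (F : list name) : exists z, ~ In z F.
Proof.
  exists (S (list_max F)). intro H.
  assert (Forall (fun k => k <= list_max F) F) as M by now apply list_max_le.
  rewrite Forall_forall in M. apply M in H. lia.
Qed.

(** * Wired typing *)

(* Where a message waits is irrelevant to the process: only the set [M] of all
   the received items and the types [E] of the non-terminated endpoints matter. *)
Inductive fwd : nat -> proc -> list item -> list (name * wty) -> Prop :=
| f_link n x y a : x <> y -> fwd n (Link x y) [] [(x, WNAtom a); (y, WAtom a)]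
| f_close n x w M : Forall (eq (w, None)) M -> fwd n (Close x) M [(x, WOne w)]
| f_wait n x w P M E :
    fwd n P ((w, None) :: M) E -> fwd (S n) (Wait x P) M ((x, WBot w) :: E)
| f_recv n x z w A B P M E :
    fwd n P ((w, Some (z, A)) :: M) ((x, B) :: E) ->
    ~ In z (imsgs M ++ x :: map fst E) ->
    fwd (S n) (Recv x z P) M ((x, WPar A w B) :: E)
| f_send n x v z w A B S0 P M E :
    typed false S0 [Ep [] z (Some (annot (dual A) v)); Ep [] v (Some (annot A z))] ->
    fwd n P M ((x, B) :: E) ->
    fwd (S n) (Send x v S0 P) ((w, Some (z, dual A)) :: M) ((x, WTensor A w B) :: E)
| f_eq n P P' M M' E E' :
    proc_eq P P' -> Permutation M M' -> Permutation E E' -> fwd n P M E -> fwd n P' M' E'.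

Definition swI (t : name -> name) (i : item) : item :=
  (fst i, option_map (fun p => (t (fst p), snd p)) (snd i)).

Definition swE (t : name -> name) (p : name * wty) : name * wty := (t (fst p), snd p).

Lemma imsgs_sw t M : imsgs (map (swI t) M) = map t (imsgs M).
Proof. induction M as [|[w [[z A]|]] M IH]; simpl; congruence. Qed.

Lemma fst_swE t E : map fst (map (swE t) E) = map t (map fst E).
Proof. induction E; simpl; congruence. Qed.

Lemma fwd_swap a b n P M E :
  fwd n P M E -> fwd n (swap a b P) (map (swI (transp a b)) M) (map (swE (transp a b)) E).
Proof.
  pose proof (transp_inj a b) as I.
  induction 1; simpl in *.
  - apply f_link. intro E. apply I in E. auto.
  - apply f_close. apply Forall_map. revert H. apply Forall_impl. intros ? <-. reflexivity.
  - apply f_wait. auto.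
  - apply f_recv; auto. rewrite imsgs_sw, fst_swE.
    assert (~ In (transp a b z) (map (transp a b) (imsgs M ++ x :: map fst E))) as K.
    { intro K. apply in_map_iff in K as (z' & E' & K). apply I in E'. congruence. }
    rewrite map_app in K. exact K.
  - apply f_send; auto. apply (typed_swap a b) in H. unfold sw_ep in H. simpl in H.
    now rewrite !sw_annot in H.
  - eapply f_eq; [apply proc_eq_swap|apply Permutation_map|apply Permutation_map|]; eauto.
Qed.

Lemma map_id_in {A : Type} (F : A -> A) l : (forall a, In a l -> F a = a) -> map F l = l.
Proof. intro H. rewrite <- (map_id l) at 2. now apply map_ext_in. Qed.

Lemma swI_fresh a b M : ~ In a (imsgs M) -> ~ In b (imsgs M) -> map (swI (transp a b)) M = M.
Proof.
  intros Ha Hb. apply map_id_in. intros [w [[z A]|]] H; unfold swI; simpl; auto.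
  assert (In z (imsgs M)) as Hz by (apply in_flat_map; exists (w, Some (z, A)); simpl; auto).
  rewrite transp_other; auto; congruence.
Qed.

Lemma swE_fresh a b E : ~ In a (map fst E) -> ~ In b (map fst E) -> map (swE (transp a b)) E = E.
Proof.
  intros Ha Hb. apply map_id_in. intros [z T] H. unfold swE; simpl.
  apply in_map_fst in H. rewrite transp_other; auto; congruence.
Qed.

Lemma typed_wf P Γ : typed false P Γ -> wf_ctx Γ.
Proof.
  induction 1 as [x y a N|x us H|P Γ Ψ u x H IH|P Γ Ψ u x y A B H IH| | | |]; auto; try discriminate.
  - split; [|repeat constructor]. simpl. repeat constructor; simpl; intuition.
  - destruct IH as [D K]. split.
    + simpl in *. rewrite msg_names_app in D. simpl in D. now rewrite app_nil_r in D.
    + inversion K; subst. constructor; simpl; auto. exact I.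
  - destruct IH as [D K]. split.
    + simpl in *. rewrite msg_names_app, <- app_assoc in D. simpl in D.
      change (NoDup ((x :: msg_names Ψ) ++ y :: declared Γ)) in D. now apply NoDup_mid in D.
    + inversion K as [|? ? K1 K2]; subst. constructor; auto.
  - eauto using wf_ctx_eq.
Qed.

(** Gives two bounds on the free names, the lower one for active endpoints only. They meet for a
    spawned process, whose context has two active endpoints and no queue. *)
Lemma typed_fn P Γ :
  typed false P Γ ->
  incl (fn P) (declared Γ) /\
  (forall e, In e Γ -> ep_type e <> None -> In (ep_name e) (fn P)).
Proof.
  induction 1 as [x y a N|x us W|P Γ Ψ u x H IH|P Γ Ψ u x y A B H IH|
    P Q Γ Ψu Ψx x y z u A B C HP IHP HQ IHQ W| |P P' Γ H IH E|P Γ Γ' H IH E]; try discriminate.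
  - split.
    + intro n. simpl. tauto.
    + simpl. intros e [<-|[<-|[]]] _; simpl; auto.
  - split.
    + intros n [<-|[]]. unfold declared. rewrite flat_map_app, in_app_iff. simpl. auto.
    + intros e He T. apply in_app_iff in He as [He|[<-|[]]]; [|simpl; auto].
      apply in_map_iff in He as (v & <- & _). simpl in T. congruence.
  - destruct IH as [I1 I2]. split.
    + intros n [<-|Hn]; [simpl; auto|]. apply I1 in Hn. simpl in *.
      rewrite msg_names_app in Hn. simpl in Hn. rewrite !in_app_iff in *. simpl in Hn. tauto.
    + intros e [<-|He] T; simpl; auto. right. apply I2; simpl; auto.
  - destruct IH as [I1 I2]. apply typed_wf in H as [D _]. split.
    + intros n [<-|Hn]; [simpl; auto|]. apply in_remove_iff in Hn as [Hn N].
      apply I1 in Hn. simpl in *. rewrite msg_names_app in Hn. simpl in Hn.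
      rewrite !in_app_iff in *. simpl in Hn. intuition congruence.
    + intros e [<-|He] T; simpl; auto. right. apply in_remove_iff. split.
      * apply I2; simpl; auto.
      * simpl in D. rewrite msg_names_app, <- app_assoc in D. simpl in D.
        change (NoDup ((x :: msg_names Ψ) ++ y :: declared Γ)) in D.
        apply NoDup_mid in D as [_ D]. intros E. apply D, in_app_iff. right.
        apply in_flat_map. exists e. simpl; auto.
  - destruct IHP as [I1 I2], IHQ as [I3 I4]. split.
    + intros n [<-|Hn]; [simpl; rewrite !in_app_iff; simpl; auto|].
      apply in_app_iff in Hn as [Hn|Hn].
      * apply in_remove_iff in Hn as [Hn N]. apply I1 in Hn. simpl in *.
        rewrite ?in_app_iff. intuition congruence.
      * apply I3 in Hn. simpl in *. rewrite !in_app_iff in *. simpl in *. tauto.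
    + intros e He T. simpl. rewrite in_app_iff. destruct He as [<-|[<-|He]]; simpl; auto.
      * right; right. apply (I4 (Ep Ψu u C)); simpl; auto.
      * right; right. apply I4; simpl; auto.
  - pose proof (proc_eq_fn _ _ E) as F. destruct IH as [I1 I2]. split.
    + intros n Hn. apply I1, F, Hn.
    + intros. apply F; auto.
  - destruct IH as [I1 I2]. split.
    + intros n Hn. eapply Permutation_in; [apply declared_eq; eauto|]. auto.
    + intros e He T. destruct E as (Γ0 & Pm & F).
      destruct (Forall2_in_r _ _ _ _ F He) as (e0 & He0 & (_ & En & Et)).
      rewrite <- En. apply I2; [symmetry in Pm; eapply Permutation_in; eauto|].
      destruct (ep_type e0); [congruence|]. destruct (ep_type e); tauto.
Qed.

(** A spawned process mentions exactly its bound name and the forwarded message. This settles the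
    side conditions of the reductions on outputs and identifies the output that a graft replaces. *)
Lemma spawn_fn S0 z v A :
  typed false S0 [Ep [] z (Some (annot (dual A) v)); Ep [] v (Some (annot A z))] ->
  z <> v /\ (forall n, In n (fn S0) <-> n = z \/ n = v).
Proof.
  intro H. pose proof (typed_wf _ _ H) as [D _]. apply typed_fn in H as [I1 I2]. split.
  - simpl in D. inversion D; subst. simpl in *. intuition.
  - intro n. split.
    + intro Hn. apply I1 in Hn. simpl in Hn. intuition.
    + intros [->| ->].
      * apply (I2 (Ep [] z (Some (annot (dual A) v)))); simpl; auto. congruence.
      * apply (I2 (Ep [] v (Some (annot A z)))); simpl; auto. congruence.
Qed.

Lemma imsgs_perm M M' : Permutation M M' -> Permutation (imsgs M) (imsgs M').
Proof. apply flat_map_perm. Qed.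

Lemma fwd_fn n P M E : fwd n P M E -> incl (fn P) (imsgs M ++ map fst E).
Proof.
  induction 1 as [| |n x w P M E H IH|n x z w A B P M E H IH F|n x v z w A B S0 P M E HS H IH|
    n P P' M M' E E' Pe PM PE H IH]; intros m Hm; simpl in *.
  - tauto.
  - rewrite in_app_iff. simpl. tauto.
  - rewrite in_app_iff in *. simpl. destruct Hm as [<-|Hm]; auto. apply IH in Hm.
    rewrite in_app_iff in Hm. tauto.
  - rewrite in_app_iff in *. simpl. destruct Hm as [<-|Hm]; auto.
    apply in_remove_iff in Hm as [Hm N]. apply IH in Hm. simpl in Hm.
    rewrite in_app_iff in Hm. simpl in Hm. intuition congruence.
  - apply spawn_fn in HS as [N F]. rewrite in_app_iff. simpl. destruct Hm as [<-|Hm]; auto.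
    apply in_app_iff in Hm as [Hm|Hm].
    + apply in_remove_iff in Hm as [Hm N']. apply F in Hm. intuition.
    + apply IH in Hm. rewrite in_app_iff in Hm. simpl in Hm. tauto.
  - apply (proc_eq_fn _ _ Pe), IH in Hm. apply in_app_iff in Hm. apply in_app_iff.
    destruct Hm as [Hm|Hm]; [left|right].
    + eapply Permutation_in; [apply imsgs_perm|]; eauto.
    + eapply Permutation_in; [apply Permutation_map|]; eauto.
Qed.

(** Inversion of [fwd] through process equality and permutations. The bound name of an input can be
    taken outside any finite [F], since swapping names in the continuation preserves [fwd] with the
    same number. *)
Inductive fwd_head (F : list name) : nat -> proc -> list item -> list (name * wty) -> Prop :=
| h_link n x y a P E :
    proc_eq P (Link x y) -> x <> y -> Permutation E [(x, WNAtom a); (y, WAtom a)] ->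
    fwd_head F n P [] E
| h_close n x w P M :
    proc_eq P (Close x) -> Forall (eq (w, None)) M -> fwd_head F n P M [(x, WOne w)]
| h_wait n x w P P' M E E' :
    proc_eq P (Wait x P') -> fwd n P' ((w, None) :: M) E' ->
    Permutation E ((x, WBot w) :: E') -> fwd_head F (S n) P M E
| h_recv n x z w A B P P' M E E' :
    proc_eq P (Recv x z P') -> ~ In z F -> ~ In z (imsgs M ++ x :: map fst E') ->
    fwd n P' ((w, Some (z, A)) :: M) ((x, B) :: E') ->
    Permutation E ((x, WPar A w B) :: E') -> fwd_head F (S n) P M E
| h_send n x v z w A B S0 P P' M M' E E' :
    proc_eq P (Send x v S0 P') ->
    typed false S0 [Ep [] z (Some (annot (dual A) v)); Ep [] v (Some (annot A z))] ->
    fwd n P' M' ((x, B) :: E') ->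
    Permutation M ((w, Some (z, dual A)) :: M') ->
    Permutation E ((x, WTensor A w B) :: E') -> fwd_head F (S n) P M E.

Lemma fwd_inv F n P M E : fwd n P M E -> fwd_head F n P M E.
Proof.
  induction 1 as [| |n x w P M E H IH|n x z w A B P M E H IH N|n x v z w A B S0 P M E HS H IH|
    n P P' M M' E E' Pe PM PE H IH].
  - apply (h_link F n x y a); [apply pe_refl|assumption|reflexivity].
  - eapply h_close; [apply pe_refl|assumption].
  - eapply h_wait; [apply pe_refl|eassumption|reflexivity].
  (* Besides [F], the new name avoids [fn P] for the renaming to be legal, and the messages and
     endpoints for the side condition of [f_recv]. *)
  - destruct (fresh_name (F ++ fn P ++ imsgs M ++ x :: map fst E)) as [z' Z'].
    rewrite !in_app_iff in *. apply (h_recv F n x z' w A B _ (swap z z' P) M _ E); auto.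
    + apply pe_recv. tauto.
    + rewrite in_app_iff. tauto.
    + apply (fwd_swap z z') in H. simpl in *. unfold swI at 1, swE at 1 in H. simpl in H.
      rewrite transp_l, swI_fresh, swE_fresh, transp_other in H; intuition.
  - eapply h_send; [apply pe_refl|eassumption|eassumption|reflexivity|reflexivity].
  - inversion IH; subst.
    + apply Permutation_nil in PM as ->. eapply h_link; eauto using proc_eq.
      etransitivity; [symmetry|]; eauto.
    + apply Permutation_length_1_inv in PE as ->. eapply h_close; eauto using proc_eq.
      eapply Permutation_Forall; eauto.
    + eapply h_wait; eauto using proc_eq.
      * eapply f_eq; [constructor|constructor; exact PM|reflexivity|eauto].
      * etransitivity; [symmetry|]; eauto.
    + apply (h_recv F n0 x z w A B P' P'0 M' E' E'0); eauto using proc_eq.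
      * intro Hz. apply H2. rewrite in_app_iff in *. destruct Hz as [Hz|]; auto. left.
        eapply Permutation_in; [apply imsgs_perm; symmetry|]; eauto.
      * eapply f_eq; [constructor|constructor; exact PM|reflexivity|eauto].
      * etransitivity; [symmetry|]; eauto.
    + eapply h_send; [eauto using proc_eq|eassumption|eassumption| |];
        (etransitivity; [symmetry; eassumption|eassumption]).
Qed.

(** A unit wire may have several receivers, so its star may occur several times among the items;
    copies are harmless because [f_close] accepts any number of them. A cut on units replaces one
    star by many. *)
Lemma fwd_star w n P M E : fwd n P M E -> In (w, None) M -> fwd n P ((w, None) :: M) E.
Proof.
  induction 1 as [|n x w' M H|n x w' P M E H IH|n x z w' A B P M E H IH N|
    n x v z w' A B S0 P M E HS H IH|n P P' M M' E E' Pe PM PE H IH]; intro Hw.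
  - destruct Hw.
  - rewrite Forall_forall in H. apply f_close. constructor; auto.
    now apply Forall_forall.
  - apply f_wait. eapply f_eq; [constructor|apply perm_swap|reflexivity|]. apply IH; simpl; auto.
  - apply f_recv; auto. eapply f_eq; [constructor|apply perm_swap|reflexivity|].
    apply IH; simpl; auto.
  - eapply f_eq; [constructor|apply perm_swap|reflexivity|]. apply f_send; auto. apply IH.
    destruct Hw as [E0|]; [discriminate|auto].
  - eapply f_eq; [exact Pe|constructor; exact PM|exact PE|]. apply IH.
    eapply Permutation_in; [symmetry|]; eauto.
Qed.

Lemma types_perm W W' : Permutation W W' -> Permutation (types W) (types W').
Proof. apply flat_map_perm. Qed.

Lemma items_perm W W' : Permutation W W' -> Permutation (flat_map wp W) (flat_map wp W').
Proof. apply flat_map_perm. Qed.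

Lemma find_type W x T E :
  Permutation ((x, T) :: E) (types W) ->
  exists q W', Permutation W (WEp q x (Some T) :: W') /\ Permutation E (types W').
Proof.
  intro P. assert (In (x, T) (types W)) as H by (eapply Permutation_in; [exact P|simpl; auto]).
  apply in_flat_map in H as ([q n [T0|]] & He & H); simpl in H; [|tauto].
  destruct H as [H|[]]. injection H as -> ->.
  apply in_perm_cons in He as (W' & PW). exists q, W'. split; auto.
  apply types_perm in PW. apply (Permutation_trans P) in PW. simpl in PW.
  now apply Permutation_cons_inv in PW.
Qed.

Lemma find_item W i M :
  Permutation (i :: M) (flat_map wp W) ->
  exists q1 q2 u C W', Permutation W (WEp (q1 ++ i :: q2) u C :: W') /\
    Permutation M ((q1 ++ q2) ++ flat_map wp W').
Proof.
  intro P. assert (In i (flat_map wp W)) as H by (eapply Permutation_in; [exact P|simpl; auto]).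
  apply in_flat_map in H as ([q n C] & He & H). simpl in H.
  apply in_split in H as (q1 & q2 & ->).
  apply in_perm_cons in He as (W' & PW). exists q1, q2, n, C, W'. split; auto.
  apply items_perm in PW. apply (Permutation_trans P) in PW. simpl in PW.
  rewrite <- app_assoc in PW. simpl in PW. apply Permutation_cons_app_inv in PW.
  now rewrite <- app_assoc.
Qed.

(** The entry holding the message receives the wire and [x] sends it, so by [v_irr] they are two
    different entries and both can be put in front. *)
Lemma find_send typ W x T E i M :
  Valid typ W -> Permutation (i :: M) (flat_map wp W) ->
  Permutation ((x, T) :: E) (types W) -> In (fst i) (outs T) ->
  exists q1 q2 u C q W0,
    Permutation W (WEp (q1 ++ i :: q2) u C :: WEp q x (Some T) :: W0) /\
    Permutation M ((q1 ++ q2) ++ q ++ flat_map wp W0) /\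
    Permutation E (types (WEp (q1 ++ q2) u C :: W0)).
Proof.
  intros V PM PE Hi. destruct (find_item _ _ _ PM) as (q1 & q2 & u & C & W' & PW & PM').
  pose proof (Permutation_trans PE (types_perm _ _ PW)) as PE'.
  assert (In (WEp (q1 ++ i :: q2) u C) W) as Hu
    by (eapply Permutation_in; [symmetry; exact PW|simpl; auto]).
  destruct (find_type _ _ _ _ PE) as (q & W2 & PW2 & _).
  assert (In (WEp q x (Some T)) W) as Hx
    by (eapply Permutation_in; [symmetry; exact PW2|simpl; auto]).
  assert (In (fst i) (iw (WEp (q1 ++ i :: q2) u C))) as Iu
    by (unfold iw; simpl; rewrite map_app, !in_app_iff; simpl; auto).
  pose proof (Permutation_in _ PW Hx) as [Hx'|Hx'].
  - exfalso. eapply (v_irr V); [exact Hu|exact Iu|]. rewrite Hx'. exact Hi.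
  - apply in_perm_cons in Hx' as (W0 & PW0). exists q1, q2, u, C, q, W0. split; [|split].
    + now rewrite <- PW0.
    + rewrite PM'. apply Permutation_app_head. now apply items_perm in PW0.
    + apply (Permutation_cons_inv (a := (x, T))). rewrite PE'.
      simpl. apply types_perm in PW0. simpl in PW0. rewrite PW0.
      destruct C; simpl; [apply perm_swap|reflexivity].
Qed.

Lemma types_nil W : types W = [] -> forall e, In e W -> wt e = None.
Proof.
  intros H e He. destruct (wt e) as [T|] eqn:E; auto. exfalso.
  assert (In (wn e, T) (types W)) as K by (apply in_flat_map; exists e; rewrite E; simpl; auto).
  rewrite H in K. destruct K.
Qed.

Lemma ctx_rb_perm f g W W' : Permutation W W' -> ctx_eq (map (rb f g) W) (map (rb f g) W').
Proof. intro P. apply ctx_eq_perm. now apply Permutation_map. Qed.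

Lemma typed_rb_perm c P f g W W' :
  Permutation W W' -> typed c P (map (rb f g) W) -> typed c P (map (rb f g) W').
Proof. intros. eapply t_ctx_eq; eauto. now apply ctx_rb_perm. Qed.

(** Every valid placement of the items and types gives a context for [P]. The induction is on the
    number of actions, not on the derivation, because inversion may return a renamed
    continuation. *)
Lemma fwd_typed typ f g n P M E W :
  fwd n P M E -> Valid typ W -> Labelling f g W ->
  Permutation M (flat_map wp W) -> Permutation E (types W) ->
  typed false P (map (rb f g) W).
Proof.
  revert P M E W. induction n as [n IH] using lt_wf_ind.
  intros P M E W H V L PM PE.
  destruct (fwd_inv (decl W) _ _ _ _ H) as
    [n x y a P E Pe N PE'|n x w P M Pe FM|n x w P P' M E E' Pe HP PE'|
     n x z w A B P P' M E E' Pe NF N HP PE'|n x v z w A B S0 P P' M M' E E' Pe HS HP PM' PE'].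
  - eapply t_proc_eq; [|apply pe_sym; exact Pe]. rewrite PE' in PE.
    apply Permutation_nil in PM.
    destruct (find_type _ _ _ _ PE) as (q & W1 & P1 & PE1).
    destruct (find_type _ _ _ _ PE1) as (q' & W2 & P2 & PE2).
    rewrite P2 in P1. apply Permutation_nil in PE2.
    pose proof (items_perm _ _ P1) as Q. rewrite PM in Q. apply Permutation_nil in Q.
    simpl in Q. apply app_eq_nil in Q as [-> Q]. apply app_eq_nil in Q as [-> Q].
    (* A further entry would be terminated, hence hold a star, but no item is left. *)
    assert (W2 = []) as ->.
    { destruct W2 as [|e W2]; auto. exfalso.
      assert (In e W) as He by (eapply Permutation_in; [symmetry; exact P1|simpl; auto]).
      destruct (v_tok V e He) as [_ K]. rewrite (types_nil _ PE2) in K by (simpl; auto).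
      simpl in Q. apply app_eq_nil in Q as [Q _]. rewrite Q in K. destruct K; discriminate. }
    eapply typed_rb_perm; [symmetry; exact P1|]. apply t_ax. auto.
  - eapply t_proc_eq; [|apply pe_sym; exact Pe].
    destruct (find_type _ _ _ _ PE) as (q & W1 & P1 & PE1). apply Permutation_nil in PE1.
    pose proof (Permutation_trans PM (items_perm _ _ P1)) as Q. simpl in Q.
    assert (forall i, In i (q ++ flat_map wp W1) -> i = (w, None)) as Q'.
    { intros i Hi. symmetry. rewrite Forall_forall in FM. apply FM.
      eapply Permutation_in; [symmetry; exact Q|auto]. }
    pose proof (Valid_perm P1 V) as V1. pose proof (Labelling_perm P1 L) as L1.
    assert (q = []) as ->.
    { destruct (v_tok V1 (WEp q x (Some (WOne w)))) as [_ [_ K]]; [simpl; auto|].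
      simpl in K. destruct q as [|i q]; auto. exfalso. rewrite (Q' i) in K by (simpl; auto).
      discriminate. }
    (* All these entries are terminated, so each holds a star. Every item is the star on [w], and an
       entry receives [w] at most once, so its queue is exactly that star. *)
    assert (W1 = map (fun u => WEp [(w, None)] u None) (map wn W1)) as EW.
    { rewrite map_map. symmetry. apply map_id_in. intros e He.
      pose proof (types_nil _ PE1 e He) as T.
      destruct (v_tok V1 e) as [_ K]; [simpl; auto|]. rewrite T in K. destruct K as [w' K].
      pose proof (v_iw V1 e (or_intror He)) as D.
      destruct e as [p m t]; simpl in *. subst t. unfold iw in D. simpl in D.
      rewrite app_nil_r in D. f_equal.
      assert (forall i, In i p -> i = (w, None)) as Q2
        by (intros; apply Q', in_flat_map; exists (WEp p m None); auto).
      destruct p as [|i p]; [discriminate|]. rewrite (Q2 i) in * by (simpl; auto).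
      destruct p as [|j p]; auto. exfalso. rewrite (Q2 j) in D by (simpl; auto).
      simpl in D. inversion D; subst. simpl in *. tauto. }
    set (us := map wn W1) in *.
    assert (f w = x) as Fw by (apply (l_f L1 (WEp [] x (Some (WOne w)))); simpl; auto).
    assert (Permutation us (g w)) as Pu.
    { apply NoDup_Permutation.
      - pose proof (NoDup_wn _ (v_decl V1)) as D. now inversion D.
      - apply (l_nd L1 (WEp [] x (Some (WOne w)))); simpl; auto.
      - intro m. rewrite (l_g L1 (WEp [] x (Some (WOne w)))) by (simpl; auto).
        unfold us. rewrite in_map_iff. split.
        + intros (e & <- & He). exists e. repeat split; simpl; auto.
          rewrite EW in He. apply in_map_iff in He as (u & <- & _). simpl; auto.
        + intros (e & [<-|He] & Hm & Hw); [simpl in Hw; tauto|eauto]. }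
    eapply typed_rb_perm; [symmetry; exact P1|].
    assert (ctx_eq (map (fun u => Ep [Star x] u None) us ++ [Ep [] x (Some (AOne us))])
              (map (rb f g) (WEp [] x (Some (WOne w)) :: W1))) as Q2.
    { eapply ctx_eq_trans; [apply ctx_eq_perm; symmetry; apply Permutation_cons_append|].
      apply mset_Forall2. simpl. constructor.
      - split; [|split]; simpl; auto; constructor. auto.
      - rewrite EW, !map_map. unfold rb. simpl. rewrite Fw. apply Forall2_ep_refl. }
    eapply t_ctx_eq; [|exact Q2]. apply t_one.
    eapply wf_ctx_eq; [apply ctx_eq_sym; exact Q2|]. eapply wf_rb; eauto.
  - eapply t_proc_eq; [|apply pe_sym; exact Pe]. rewrite PE' in PE.
    destruct (find_type _ _ _ _ PE) as (q & W1 & P1 & PE1).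
    eapply typed_rb_perm; [symmetry; exact P1|].
    pose proof (Valid_perm P1 V) as V1. pose proof (Labelling_perm P1 L) as L1.
    destruct (rb_wait typ f g q x w W1 P' false V1 L1) as (V2 & L2 & K). apply K.
    eapply IH; eauto. simpl. rewrite <- app_assoc. simpl.
    apply items_perm in P1. simpl in P1. rewrite PM, P1. apply Permutation_middle.
  - eapply t_proc_eq; [|apply pe_sym; exact Pe]. rewrite PE' in PE.
    destruct (find_type _ _ _ _ PE) as (q & W1 & P1 & PE1).
    eapply typed_rb_perm; [symmetry; exact P1|].
    pose proof (Valid_perm P1 V) as V1. pose proof (Labelling_perm P1 L) as L1.
    destruct (rb_recv typ f g q x z A w B W1 P' false) as (V2 & L2 & K); auto.
    { intro Hz. apply NF. eapply Permutation_in; [apply decl_perm; symmetry; exact P1|exact Hz]. }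
    apply K. eapply IH; eauto.
    + simpl. rewrite <- app_assoc. simpl.
      apply items_perm in P1. simpl in P1. rewrite PM, P1. apply Permutation_middle.
    + simpl. now constructor.
  - eapply t_proc_eq; [|apply pe_sym; exact Pe]. rewrite PE' in PE. rewrite PM' in PM.
    destruct (find_send _ _ _ _ _ _ _ V PM PE) as (q1 & q2 & u & C & q & W0 & P1 & PM1 & PE1);
      [simpl; auto|].
    eapply typed_rb_perm; [symmetry; exact P1|].
    pose proof (Valid_perm P1 V) as V1. pose proof (Labelling_perm P1 L) as L1.
    apply (rb_send typ); auto.
    destruct (Valid_send typ f g q1 w z q2 u C q x A B W0 V1 L1) as [V2 L2].
    eapply IH; eauto. simpl in *. rewrite PE1. destruct C; simpl; [apply perm_swap|reflexivity].
Qed.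

(** * Wiring a typable context *)

(** Queues agree literally, so that the shape of a queue in a typing rule can be inverted on the
    wired side; types agree only up to the order of unit annotations. *)
Definition rep1 f g (e : endpoint) (e' : wep) : Prop :=
  ep_queue e = map (rbI f) (wp e') /\ ep_name e = wn e' /\
  oaty_eq (ep_type e) (option_map (rbT f g) (wt e')).

Definition rep f g (Γ : ctx) (W : list wep) : Prop := Forall2 (rep1 f g) Γ W.

Lemma rep_declared f g Γ W : rep f g Γ W -> declared Γ = decl W.
Proof.
  induction 1 as [|e e' Γ W (H1 & H2 & _) H IH]; simpl; auto.
  rewrite H1, H2, msg_names_rb, IH. reflexivity.
Qed.

Lemma rep_ep_eq f g Γ W : rep f g Γ W -> Forall2 ep_eq Γ (map (rb f g) W).
Proof.
  induction 1 as [|e e' Γ W (H1 & H2 & H3) H IH]; simpl; constructor; auto.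
  split; [|split]; simpl; auto. rewrite H1. constructor.
Qed.

Definition upd {A : Type} (F : wire -> A) (w : wire) (a : A) (w' : wire) : A :=
  if Nat.eq_dec w' w then a else F w'.

Lemma upd_same {A : Type} (F : wire -> A) w a : upd F w a w = a.
Proof. unfold upd. destruct Nat.eq_dec; congruence. Qed.

Lemma upd_other {A : Type} (F : wire -> A) w a w' : w' <> w -> upd F w a w' = F w'.
Proof. unfold upd. destruct Nat.eq_dec; congruence. Qed.

Lemma tyok_ext typ typ' T :
  (forall w, In w (ins T ++ outs T) -> typ w = typ' w) -> tyok typ T -> tyok typ' T.
Proof.
  induction T; simpl; auto; intros H.
  - intros <-. symmetry; auto.
  - intros <-. symmetry; auto.
  - intros [<- K]. split; [symmetry; apply H; rewrite in_app_iff; simpl; auto|].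
    apply IHT; auto. intros w' Hw. apply H. rewrite in_app_iff in *. simpl. tauto.
  - intros [<- K]. split; [symmetry; apply H; rewrite in_app_iff; simpl; auto|].
    apply IHT; auto.
Qed.

Lemma tok_ext typ typ' e :
  (forall w, In w (iw e) \/ In w (ow e) -> typ w = typ' w) -> tok typ e -> tok typ' e.
Proof.
  destruct e as [q n t]; unfold iw, ow; simpl. intros H [K1 K2]. split; simpl in *.
  - rewrite Forall_forall in *. intros [w m] Hi. specialize (K1 _ Hi). unfold itemok in *.
    simpl in *. rewrite <- K1. symmetry. apply H. left. apply in_app_iff. left.
    eapply in_map_fst; eauto.
  - destruct t as [T|]; auto. destruct K2. split; auto. eapply tyok_ext; [|eauto].
    intros w Hw. apply H. rewrite in_app_iff in *. tauto.
Qed.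

(** The converse of [Valid_send]. The fresh wire is the first one received by [u] and the first one
    sent by [x], so it cannot take part in a FIFO violation. *)
Lemma Valid_add typ f g w z q1 u C q x A B W :
  let e1 := WEp q1 u C in let e2 := WEp q x (Some B) in
  let e1' := WEp ((w, Some (z, dual A)) :: q1) u C in
  let e2' := WEp q x (Some (WTensor A w B)) in
  Valid typ (e1 :: e2 :: W) -> Labelling f g (e1 :: e2 :: W) ->
  (forall e, In e (e1 :: e2 :: W) -> ~ In w (iw e) /\ ~ In w (ow e)) ->
  ~ In z (decl (e1 :: e2 :: W)) ->
  Valid (upd typ w (Some (dual A))) (e1' :: e2' :: W) /\
  Labelling (upd f w x) (upd g w [u]) (e1' :: e2' :: W).
Proof.
  intros e1 e2 e1' e2' V L NW Z.
  pose proof (v_decl V) as D. pose proof (v_ow V) as O.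
  assert (forall e, In e (e1' :: e2' :: W) -> exists e0, In e0 (e1 :: e2 :: W) /\
    wn e = wn e0 /\
    (iw e = iw e0 \/ (e = e1' /\ e0 = e1)) /\ (ow e = ow e0 \/ (e = e2' /\ e0 = e2))) as B1.
  { intros e [<-|[<-|He]].
    - exists e1. simpl; auto 10.
    - exists e2. simpl; auto 10.
    - exists e. simpl; auto 10. }
  assert (forall e, In e (e1 :: e2 :: W) -> exists e', In e' (e1' :: e2' :: W) /\
    wn e' = wn e /\ incl (iw e) (iw e') /\ incl (ow e) (ow e')) as B2.
  { intros e [<-|[<-|He]].
    - exists e1'. repeat split; simpl; auto; intro a; unfold iw; simpl; auto.
    - exists e2'. repeat split; simpl; auto; intro a; unfold ow; simpl; auto.
    - exists e. repeat split; simpl; auto; apply incl_refl. }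
  assert (iw e1' = w :: iw e1) as I1 by reflexivity.
  assert (ow e2' = w :: ow e2) as O2 by reflexivity.
  assert (forall e e0 a, iw e = iw e0 \/ (e = e1' /\ e0 = e1) -> In a (iw e) -> a <> w ->
    In a (iw e0)) as I3.
  { intros e e0 a [<-|[-> ->]] Ha N; auto. rewrite I1 in Ha. destruct Ha; auto. congruence. }
  assert (forall e e0 a, ow e = ow e0 \/ (e = e2' /\ e0 = e2) -> In a (ow e) -> a <> w ->
    In a (ow e0)) as O3.
  { intros e e0 a [<-|[-> ->]] Ha N; auto. rewrite O2 in Ha. destruct Ha; auto. congruence. }
  assert (u <> x) as Nux.
  { intros ->. unfold decl in D. simpl in D. inversion D as [|? ? N _]; subst. apply N.
    rewrite in_app_iff. simpl; auto. }
  assert (forall e, In e (e1' :: e2' :: W) -> wn e = u -> e = e1') as U1.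
  { intros e [<-|[<-|He]]; auto; simpl; intro E; [congruence|]. exfalso.
    unfold decl in D. simpl in D. apply NoDup_cons_iff in D as [N _]. apply N.
    rewrite in_app_iff. right. simpl. right. rewrite in_app_iff. right. rewrite <- E.
    now apply (decl_wn e W). }
  assert (NoDup (decl (e1' :: e2' :: W))) as D'.
  { unfold decl in *. simpl in *. change (NoDup ([u] ++ z :: (imsgs q1 ++ x :: imsgs q ++ decl W))).
    apply NoDup_mid. split; auto. }
  split; split; auto.
  - intros e [<-|[<-|He]].
    + rewrite I1. constructor; [apply NW|apply (v_iw V)]; simpl; auto.
    + apply (v_iw V e2). simpl; auto.
    + apply (v_iw V). simpl; auto.
  - simpl. change (NoDup (ow e1 ++ w :: (outs B ++ flat_map ow W))). apply NoDup_mid. split.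
    + exact O.
    + intro Hw. change (In w (flat_map ow (e1 :: e2 :: W))) in Hw.
      apply in_flat_map in Hw as (e & He & Hw). destruct (NW e He); auto.
  - intros e a He HI HO. destruct (B1 e He) as (e0 & H0 & En & [EI|[-> ->]] & [EO|[E2 E3]]).
    + rewrite EI in HI. rewrite EO in HO. eapply (v_irr V); eauto.
    + subst e e0. destruct HO as [<-|HO].
      * rewrite EI in HI. destruct (NW e2 H0); auto.
      * rewrite EI in HI. apply (v_irr V e2 a); auto.
    + rewrite EO in HO. destruct HI as [<-|HI]; [destruct (NW e1 H0); auto|].
      apply (v_irr V e1 a); auto.
    + apply Nux. unfold e1', e2' in E2. congruence.
  - intros e e' a He He' Ha Ha' N.
    destruct (B1 e He) as (e0 & H0 & En & EI & _), (B1 e' He') as (e0' & H0' & En' & EI' & _).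
    destruct (Nat.eq_dec a w) as [->|Na].
    + destruct EI as [EI|[-> _]]; [rewrite EI in Ha; destruct (NW e0 H0); tauto|].
      destruct EI' as [EI'|[-> _]]; [rewrite EI' in Ha'; destruct (NW e0' H0'); tauto|]. auto.
    + rewrite upd_other in N by auto. rewrite En, En'. apply (v_msg V e0 e0' a); eauto.
  - intros e a He Ha. destruct (B1 e He) as (e0 & H0 & En & EI & _).
    destruct (Nat.eq_dec a w) as [->|Na]; [exists e2'; simpl; auto|].
    destruct (v_io V e0 a) as (e' & He' & Ha'); eauto.
    destruct (B2 e' He') as (e'' & ? & ? & ? & ?). eauto.
  - intros e a He Ha. destruct (B1 e He) as (e0 & H0 & En & _ & EO).
    destruct (Nat.eq_dec a w) as [->|Na]; [exists e1'; simpl; auto|].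
    destruct (v_oi V e0 a) as (e' & He' & Ha'); eauto.
    destruct (B2 e' He') as (e'' & ? & ? & ? & ?). eauto.
  - intros e e' a b He He' HI HO.
    destruct (B1 e He) as (e0 & H0 & _ & EI & _), (B1 e' He') as (e0' & H0' & _ & _ & EO).
    assert (before (iw e0) a b \/ (a = w /\ In b (iw e0))) as HI'.
    { destruct EI as [<-|[-> ->]]; auto. rewrite I1 in HI. simpl in HI. tauto. }
    assert (before (ow e0') b a \/ (b = w /\ In a (ow e0'))) as HO'.
    { destruct EO as [<-|[-> ->]]; auto. rewrite O2 in HO. simpl in HO. tauto. }
    destruct (NW e0 H0) as [N1 N2], (NW e0' H0') as [N1' N2'].
    destruct HI' as [HI'|[-> HI']], HO' as [HO'|[-> HO']].
    + apply (v_fifo V e0 e0' a b); auto.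
    + apply before_in in HI'. tauto.
    + apply before_in in HO'. tauto.
    + tauto.
  - intros e [<-|[<-|He]].
    + destruct (v_tok V e1) as [K1 K2]; [simpl; auto|].
      assert (tok (upd typ w (Some (dual A))) e1) as [K1' K2'].
      { eapply tok_ext; [|split; eauto]. intros a Ha. rewrite upd_other; auto.
        intros ->. destruct (NW e1); simpl; tauto. }
      split; simpl in *; auto. constructor; auto. unfold itemok. simpl. apply upd_same.
    + assert (tok (upd typ w (Some (dual A))) e2) as [K1' [K2' K3']].
      { eapply tok_ext; [|apply (v_tok V); simpl; auto]. intros a Ha. rewrite upd_other; auto.
        intros ->. destruct (NW e2); simpl; tauto. }
      split; simpl in *; auto. rewrite upd_same. auto.
    + eapply tok_ext; [|apply (v_tok V); simpl; auto]. intros a Ha. rewrite upd_other; auto.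
      intros ->. destruct (NW e); simpl; tauto.
  - intros e a He Ha. destruct (B1 e He) as (e0 & H0 & En & _ & EO).
    destruct (Nat.eq_dec a w) as [->|Na].
    + rewrite upd_same. destruct EO as [EO|[-> _]]; auto. rewrite EO in Ha.
      destruct (NW e0 H0); tauto.
    + rewrite upd_other, En by auto. apply (l_f L); eauto.
  - intros e a He Ha. destruct (B1 e He) as (e0 & H0 & En & _ & EO).
    destruct (Nat.eq_dec a w) as [->|Na].
    + rewrite upd_same. repeat constructor. auto.
    + rewrite upd_other by auto. apply (l_nd L e0); eauto.
  - intros e a m He Ha. destruct (B1 e He) as (e0 & H0 & En & _ & EO).
    destruct (Nat.eq_dec a w) as [->|Na].
    + rewrite upd_same. split.
      * intros [<-|[]]. exists e1'. simpl; auto.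
      * intros (e' & He' & <- & Hw). left.
        destruct (B1 e' He') as (e0' & H0' & En' & [EI|[-> _]] & _); auto.
        rewrite EI in Hw. destruct (NW e0' H0'); tauto.
    + rewrite upd_other by auto. rewrite (l_g L e0); eauto. split.
      * intros (e' & He' & <- & Hw). destruct (B2 e' He') as (e'' & ? & ? & ? & ?). eauto.
      * intros (e' & He' & <- & Hw). destruct (B1 e' He') as (e0' & H0' & En' & EI & _).
        exists e0'. eauto.
Qed.

(** The effect of a context equality on a wiring: queues are permuted, but wires with one sender
    keep their order. *)
Definition reord (f : wire -> name) (e e' : wep) : Prop :=
  wn e = wn e' /\ wt e = wt e' /\ Permutation (wp e) (wp e') /\
  (forall a b, before (map fst (wp e')) a b -> before (map fst (wp e)) a b \/ f a <> f b).

Lemma reord_decl f W W' : Forall2 (reord f) W W' -> Permutation (decl W) (decl W').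
Proof.
  induction 1 as [|e e' W W' (H1 & H2 & H3 & H4) H IH]; [constructor|]. simpl.
  rewrite H1. constructor. apply Permutation_app; auto. now apply imsgs_perm.
Qed.

Lemma reord_ow f W W' : Forall2 (reord f) W W' -> flat_map ow W = flat_map ow W'.
Proof.
  induction 1 as [|e e' W W' (H1 & H2 & H3 & H4) H IH]; simpl; auto.
  unfold ow at 1 3. rewrite H2, IH. reflexivity.
Qed.

Lemma reord_types f W W' : Forall2 (reord f) W W' -> types W = types W'.
Proof.
  induction 1 as [|e e' W W' (H1 & H2 & H3 & H4) H IH]; simpl; auto.
  rewrite H1, H2, IH. reflexivity.
Qed.

Lemma reord_items f W W' :
  Forall2 (reord f) W W' -> Permutation (flat_map wp W) (flat_map wp W').
Proof.
  induction 1 as [|e e' W W' (H1 & H2 & H3 & H4) H IH]; simpl; auto.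
  now apply Permutation_app.
Qed.

Lemma filter_perm {A : Type} (p : A -> bool) l l' :
  Permutation l l' -> Permutation (filter p l) (filter p l').
Proof.
  induction 1; simpl; eauto using Permutation.
  - destruct (p x); auto.
  - destruct (p x), (p y); try reflexivity. apply perm_swap.
Qed.

Lemma reord_Sim f e e' :
  reord f e e' -> NoDup (iw e) -> Sim f (fun _ => True) e e' /\ (forall typ, tok typ e -> tok typ e').
Proof.
  intros (H1 & H2 & H3 & H4) D. assert (Permutation (iw e) (iw e')) as P.
  { unfold iw. rewrite H2. apply Permutation_app_tail. now apply Permutation_map. }
  split; [split|]; auto.
  - intro a. split; [split; auto|intros [Ha _]];
      (eapply Permutation_in; [|eauto]); auto. now symmetry.
  - intro a. unfold ow. rewrite H2. tauto.
  - intros a b. unfold iw. rewrite !before_app, H2.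
    intros [Hb|[Hb|[Ha Hb]]]; [apply H4 in Hb; tauto|tauto|].
    left. right; right. split; auto. eapply Permutation_in; [|exact Ha].
    apply Permutation_map. now symmetry.
  - intros a b. unfold ow. rewrite H2. auto.
  - eapply Permutation_NoDup; eauto.
  - intros typ [K1 K2]. split.
    + eapply Permutation_Forall; eauto.
    + rewrite <- H2. apply (filter_perm isstar) in H3. destruct (wt e) as [T|].
      * destruct K2 as [K2 K3]. split; auto. rewrite K3 in H3. now apply Permutation_nil.
      * destruct K2 as [w K2]. exists w. rewrite K2 in H3. now apply Permutation_length_1_inv.
Qed.

Lemma Valid_reord typ f g W W' :
  Valid typ W -> Labelling f g W -> Forall2 (reord f) W W' -> Valid typ W' /\ Labelling f g W'.
Proof.
  intros V L F. apply (Valid_sim typ f g (fun _ => True) W); auto.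
  - pose proof (v_iw V) as D. clear V L. induction F; constructor.
    + apply reord_Sim; auto. apply D; simpl; auto.
    + apply IHF. intros; apply D; simpl; auto.
  - eapply Permutation_NoDup; [apply (reord_decl f W); auto|apply (v_decl V)].
  - rewrite <- (reord_ow f W); auto. apply (v_ow V).
  - intros e' He'. destruct (Forall2_in_r _ _ _ _ F He') as (e & He & R).
    apply (reord_Sim f e); auto; [apply (v_iw V)|apply (v_tok V)]; auto.
Qed.

Lemma rep_reord f g Γ Γ' W :
  rep f g Γ W -> Forall2 ep_eq Γ Γ' -> exists W', Forall2 (reord f) W W' /\ rep f g Γ' W'.
Proof.
  intro H. revert Γ'. induction H as [|e e' Γ W (H1 & H2 & H3) H IH]; intros Γ' F;
    inversion F as [|? e2 ? Γ2 (H4 & H5 & H6) F']; subst.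
  - exists []. split; constructor.
  - destruct (IH _ F') as (W' & F1 & R1).
    rewrite H1 in H4. apply (queue_eq_lift (rbI f) fst) in H4 as (q & Eq & P & B).
    exists (WEp q (wn e') (wt e') :: W'). split; constructor; auto.
    + split; [|split; [|split]]; simpl; auto.
      intros a b Hb. apply B in Hb as [?|(i & j & _ & _ & <- & <- & N)]; auto.
      rewrite !label_rbI in N. auto.
    + split; [|split]; simpl; auto; [congruence|].
      destruct (ep_type e), (ep_type e2), (wt e'); simpl in *; try tauto.
      eauto using aty_eq_trans, aty_eq_sym.
Qed.

Lemma fresh_wire (W : list wep) :
  exists w, forall e, In e W -> ~ In w (iw e) /\ ~ In w (ow e).
Proof.
  destruct (fresh_name (flat_map (fun e => iw e ++ ow e) W)) as [w H]. exists w.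
  intros e He. split; intro Hw; apply H, in_flat_map; exists e; rewrite in_app_iff; auto.
Qed.

Lemma rep1_ext f g f' g' e e' :
  (forall w, In w (iw e') -> f w = f' w) -> (forall w, In w (ow e') -> g w = g' w) ->
  rep1 f g e e' -> rep1 f' g' e e'.
Proof.
  intros Hf Hg (H1 & H2 & H3). pose proof (rb_ext f g f' g' e' Hf Hg) as E.
  unfold rb in E. injection E as E1 E2. split; [|split]; congruence.
Qed.

(** The wiring is built along the derivation. Receptions move a wire from a queue back to the type,
    the tensor rule adds a fresh wire, and a context equality reorders the queues; the label maps
    change only at a fresh wire. *)
Lemma typed_fwd P Γ :
  typed false P Γ ->
  exists n typ f g W, Valid typ W /\ Labelling f g W /\ rep f g Γ W /\
    fwd n P (flat_map wp W) (types W).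
Proof.
  induction 1 as [x y a N|x us H|P Γ Ψ u x H IH|P Γ Ψ u x y A B H IH|
    P Q Γ Ψu Ψx x y z u A B C HP IHP HQ IHQ W'| |P P' Γ H IH E|P Γ Γ' H IH E]; try discriminate.
  - exists 0, (fun _ => None), (fun _ => 0), (fun _ => []),
      [WEp [] x (Some (WNAtom a)); WEp [] y (Some (WAtom a))]. split; [|split; [|split]].
    + split; simpl; try (intros; repeat match goal with
        H : _ \/ _ |- _ => destruct H | H : False |- _ => destruct H end; subst; simpl in *; tauto).
      * repeat constructor; simpl; intuition.
      * intros e [<-|[<-|[]]]; constructor.
      * constructor.
      * intros e [<-|[<-|[]]]; split; simpl; auto.
    + split; simpl; try (intros; repeat match goal with
        H : _ \/ _ |- _ => destruct H | H : False |- _ => destruct H end; subst; simpl in *; tauto).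
    + repeat constructor.
    + simpl. now apply f_link.
  (* One wire, numbered 0, links the unit to all of its stars. *)
  - set (W := map (fun u => WEp [(0, None)] u None) us ++ [WEp [] x (Some (WOne 0))]).
    assert (rep (fun _ => x) (fun _ => us)
      (map (fun u => Ep [Star x] u None) us ++ [Ep [] x (Some (AOne us))]) W) as R.
    { apply Forall2_app.
      - clear. generalize us at 1 as vs. induction us; simpl; constructor; auto.
        split; [|split]; simpl; auto.
      - constructor; constructor; [|split]; simpl; auto using aty_eq_refl. }
    assert (forall e, In e W ->
      (exists u, In u us /\ e = WEp [(0, None)] u None) \/ e = WEp [] x (Some (WOne 0))) as I.
    { intros e He. apply in_app_iff in He as [He|[<-|[]]]; auto.
      apply in_map_iff in He as (u & <- & Hu). eauto. }
    assert (forall u, In u us -> In (WEp [(0, None)] u None) W) as I1.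
    { intros u Hu. apply in_app_iff. left. now apply in_map_iff; exists u. }
    assert (In (WEp [] x (Some (WOne 0))) W) as I2 by (apply in_app_iff; simpl; auto).
    destruct H as [D K]. rewrite Forall_app in K. destruct K as [_ K].
    apply Forall_inv in K. destruct K as [K1 K2].
    exists 0, (fun _ => None), (fun _ => x), (fun _ => us), W. split; [|split; [|split]]; auto.
    + split.
      * now rewrite <- (rep_declared _ _ _ _ R).
      * intros e He. destruct (I e He) as [(u & Hu & ->)| ->]; repeat constructor. simpl; tauto.
      * unfold W. rewrite flat_map_app. simpl. replace (flat_map ow _) with (@nil wire).
        -- repeat constructor. simpl; tauto.
        -- clear. induction us; auto.
      * intros e w He. destruct (I e He) as [(u & Hu & ->)| ->]; unfold iw, ow; simpl; tauto.
      * congruence.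
      * intros e w He. destruct (I e He) as [(u & Hu & ->)| ->]; unfold iw, ow; simpl; [|tauto].
        intros [<-|[]]. eexists; split; [exact I2|]. simpl; auto.
      * intros e w He. destruct (I e He) as [(u & Hu & ->)| ->]; unfold iw, ow; simpl; [tauto|].
        intros [<-|[]]. destruct us as [|u us']; [congruence|].
        eexists; split; [apply I1; simpl; auto|]. simpl; auto.
      * intros e e' a b He He'. destruct (I e He) as [(u & Hu & ->)| ->]; unfold iw; simpl; tauto.
      * intros e He. destruct (I e He) as [(u & Hu & ->)| ->]; split; simpl; eauto.
        repeat constructor.
    + split.
      * intros e w He. destruct (I e He) as [(u & Hu & ->)| ->]; simpl; tauto.
      * auto.
      * intros e w n He Hw. split.
        -- intro Hn. exists (WEp [(0, None)] n None). split; [auto|]. split; auto.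
           destruct (I e He) as [(u & Hu & ->)| ->]; simpl in *; tauto.
        -- intros (e' & He' & <- & Hw'). destruct (I e' He') as [(u & Hu & ->)| ->]; simpl in *; tauto.
    + unfold W. rewrite flat_map_app. unfold types. rewrite flat_map_app. simpl.
      replace (flat_map _ (map _ us)) with (@nil (name * wty)).
      * apply f_close. rewrite app_nil_r. clear. induction us; simpl; constructor; auto.
      * clear. induction us; auto.
  - destruct IH as (n & typ & f & g & W & V & L & R & F).
    inversion R as [|? e ? W0 (R1 & R2 & R3) R0]; subst. destruct e as [q m t]; simpl in *.
    subst m. destruct t; simpl in R3; [tauto|].
    symmetry in R1. apply map_eq_app_cons in R1 as (q1 & [w [[z A]|]] & q2 & -> & <- & Ew & E2);
      simpl in Ew; [discriminate|]. injection Ew as Ew.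
    destruct q2; [|discriminate].
    destruct (v_tok V (WEp (q1 ++ [(w, None)]) x None)) as [K1 [w' K2]]; [simpl; auto|].
    simpl in *. rewrite Forall_app in K1. destruct K1 as [K1 K3].
    inversion K3 as [|? ? K4 _]; subst. unfold itemok in K4. simpl in K4.
    assert (filter isstar q1 = []) as K5.
    { rewrite filter_app in K2. simpl in K2. destruct (filter isstar q1) as [|i l]; auto.
      destruct l; discriminate. }
    destruct (Valid_same typ f g (WEp (q1 ++ [(w, None)]) x None)
      (WEp q1 x (Some (WBot w))) W0) as [V' L']; auto.
    { unfold iw; simpl. now rewrite map_app, app_nil_r. }
    { pose proof (v_decl V) as D. unfold decl in *. simpl in *.
      rewrite imsgs_app in D. simpl in D. now rewrite app_nil_r in D. }
    { split; simpl; auto. }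
    exists (S n), typ, f, g, (WEp q1 x (Some (WBot w)) :: W0). split; [|split; [|split]]; auto.
    + constructor; auto. split; [|split]; simpl; auto. constructor.
    + simpl. apply f_wait. eapply f_eq; [constructor| |reflexivity|exact F].
      rewrite <- app_assoc. simpl. symmetry. apply Permutation_middle.
  - destruct IH as (n & typ & f & g & W & V & L & R & F).
    inversion R as [|? e ? W0 (R1 & R2 & R3) R0]; subst. destruct e as [q m t]; simpl in *.
    subst m. destruct t as [T|]; simpl in R3; [|tauto].
    symmetry in R1. apply map_eq_app_cons in R1 as (q1 & [w [[z A']|]] & q2 & -> & <- & Ew & E2);
      simpl in Ew; [|discriminate]. injection Ew as Ew -> ->.
    destruct q2; [|discriminate].
    destruct (v_tok V (WEp (q1 ++ [(w, Some (y, A))]) x (Some T))) as [K1 [K2 K2']]; [simpl; auto|].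
    simpl in *. rewrite Forall_app in K1. destruct K1 as [K1 K3].
    inversion K3 as [|? ? K4 _]; subst. unfold itemok in K4. simpl in K4.
    rewrite filter_app in K2'. apply app_eq_nil in K2' as [K5 _].
    pose proof (v_decl V) as D. unfold decl in D. simpl in D.
    rewrite imsgs_app, <- app_assoc in D. simpl in D.
    change (NoDup ((x :: imsgs q1) ++ y :: decl W0)) in D. apply NoDup_mid in D as [D Dy].
    destruct (Valid_same typ f g (WEp (q1 ++ [(w, Some (y, A))]) x (Some T))
      (WEp q1 x (Some (WPar A w T))) W0) as [V' L']; auto.
    { unfold iw; simpl. now rewrite map_app, <- app_assoc. }
    { split; simpl; auto. }
    exists (S n), typ, f, g, (WEp q1 x (Some (WPar A w T)) :: W0). split; [|split; [|split]]; auto.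
    + constructor; auto. split; [|split]; simpl; auto. constructor. auto.
    + simpl. apply f_recv.
      * eapply f_eq; [constructor| |reflexivity|exact F].
        rewrite <- app_assoc. simpl. symmetry. apply Permutation_middle.
      * intro Hy. apply Dy. clear -Hy. simpl. rewrite in_app_iff in *.
        assert (forall l, In y (imsgs (flat_map wp l)) \/ In y (map fst (types l)) -> In y (decl l)) as G.
        { induction l as [|e l IH]; simpl; [tauto|]. rewrite imsgs_app, map_app, !in_app_iff.
          destruct (wt e); simpl; tauto. }
        rewrite imsgs_app, in_app_iff in Hy. simpl in Hy. specialize (G W0). tauto.
  - destruct IHQ as (n & typ & f & g & W & V & L & R & F).
    inversion R as [|? e1 ? W1 (R1 & R2 & R3) R0]; subst.
    inversion R0 as [|? e2 ? W2 (R4 & R5 & R6) R7]; subst.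
    destruct e1 as [q1 m1 t1], e2 as [q2 m2 t2]; simpl in *. subst m1 m2.
    destruct t2 as [T|]; simpl in R6; [|tauto].
    destruct (fresh_wire (WEp q1 u t1 :: WEp q2 x (Some T) :: W2)) as [w Hw].
    destruct (Valid_add typ f g w z q1 u t1 q2 x A T W2) as [V' L']; auto.
    { destruct W' as [D _]. unfold decl. simpl in *.
      rewrite (rep_declared _ _ _ _ R7) in D. rewrite R1, R4, !msg_names_rb in D.
      change (NoDup ([u] ++ z :: (imsgs q1 ++ x :: imsgs q2 ++ decl W2))) in D.
      apply NoDup_mid in D as [_ D]. exact D. }
    assert (forall a, a <> w -> f a = upd f w x a) as Ef by (intros; now rewrite upd_other).
    assert (forall a, a <> w -> g a = upd g w [u] a) as Eg by (intros; now rewrite upd_other).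
    assert (forall e e', In e' (WEp q1 u t1 :: WEp q2 x (Some T) :: W2) ->
      rep1 f g e e' -> rep1 (upd f w x) (upd g w [u]) e e') as Er.
    { intros e e' He'. destruct (Hw e' He'). apply rep1_ext; intros a Ha;
        [apply Ef|apply Eg]; intros ->; tauto. }
    destruct (Er (Ep Ψu u C) (WEp q1 u t1)) as (S1 & S2 & S3); [simpl; auto|split; auto|].
    destruct (Er (Ep Ψx x (Some B)) (WEp q2 x (Some T))) as (S4 & S5 & S6); [simpl; auto|split; auto|].
    exists (S n), (upd typ w (Some (dual A))), (upd f w x), (upd g w [u]),
      (WEp ((w, Some (z, dual A)) :: q1) u t1 :: WEp q2 x (Some (WTensor A w T)) :: W2).
    split; [|split; [|split]]; auto.
    + constructor; [|constructor].
      * split; [|split]; simpl in *; auto. rewrite upd_same. congruence.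
      * split; [|split]; simpl in *; auto. rewrite upd_same. constructor. auto.
      * unfold rep in R7. clear -R7 Er.
        assert (forall e, In e W2 -> In e (WEp q1 u t1 :: WEp q2 x (Some T) :: W2)) as I
          by (simpl; auto).
        induction R7; constructor; auto.
        -- apply Er; auto. simpl; auto.
        -- apply IHR7; [|simpl; auto]. intros. apply Er; auto. simpl in *; tauto.
    + eapply f_eq; [constructor|reflexivity| |
        apply (f_send n x y z w A T P Q (q1 ++ q2 ++ flat_map wp W2)
          (types (WEp q1 u t1 :: W2))); [exact HP|]].
      * simpl. destruct t1; simpl; [apply perm_swap|reflexivity].
      * eapply f_eq; [constructor|reflexivity| |exact F].
        simpl. destruct t1; simpl; [apply perm_swap|reflexivity].
  - destruct IH as (n & typ & f & g & W & V & L & R & F).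
    exists n, typ, f, g, W. split; [|split; [|split]]; auto.
    eapply f_eq; eauto.
  - destruct IH as (n & typ & f & g & W & V & L & R & F). destruct E as (Γ0 & Pm & FE).
    destruct (perm_Forall2 _ _ _ _ Pm R) as (W0 & PW & R0).
    destruct (rep_reord _ _ _ _ _ R0 FE) as (W1 & F1 & R1).
    destruct (Valid_reord typ f g W0 W1) as [V1 L1];
      eauto using Valid_perm, Labelling_perm.
    exists n, typ, f, g, W1. split; [|split; [|split]]; auto.
    eapply f_eq; [constructor| | |exact F].
    + etransitivity; [apply items_perm; exact PW|]. eapply reord_items; eauto.
    + etransitivity; [apply types_perm; exact PW|]. erewrite reord_types; eauto.
Qed.

(** * Composition of two wired contexts *)

Definition inw (W : list wep) (w : wire) : Prop :=
  exists e, In e W /\ (In w (iw e) \/ In w (ow e)).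

(* The two wirings are chosen so that the dual cut types carry the same wires,
   and so that no other wire is shared. *)
Record CutWiring (typ : wire -> option ty) (x : name) (q : list item) (T : wty) (L1 : list wep)
    (y : name) (q' : list item) (L2 : list wep) : Prop := {
  s_v1 : Valid typ (WEp q x (Some T) :: L1);
  s_v2 : Valid typ (WEp q' y (Some (wdual T)) :: L2);
  s_sh : forall w, inw (WEp q x (Some T) :: L1) w ->
    inw (WEp q' y (Some (wdual T)) :: L2) w -> In w (ins T) \/ In w (outs T);
  s_nm : forall n, In n (decl (WEp q x (Some T) :: L1)) ->
    In n (decl (WEp q' y (Some (wdual T)) :: L2)) -> False }.
Arguments s_v1 {typ x q T L1 y q' L2}.
Arguments s_v2 {typ x q T L1 y q' L2}.
Arguments s_sh {typ x q T L1 y q' L2}.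
Arguments s_nm {typ x q T L1 y q' L2}.

(* An entry [(p, e)] is an endpoint with the items [p] it got by distribution,
   which stand before those of its own queue. *)
Definition unm (pe : list item * wep) : wep :=
  WEp (fst pe ++ wp (snd pe)) (wn (snd pe)) (wt (snd pe)).

(** Boxes leave from the top of a queue and are appended in front of a marker, so each share is a
    subsequence of [m] and the shares together exhaust it. *)
Record Distr (m : list item) (L : list (list item * wep)) : Prop := {
  d_ord : forall pe a b, In pe L -> before (map fst (fst pe)) a b -> before (map fst m) a b;
  d_perm : Permutation (flat_map fst L) m }.
Arguments d_ord {m L}.
Arguments d_perm {m L}.

Definition comp (L1 L2 : list (list item * wep)) : list wep := map unm L1 ++ map unm L2.

Lemma iw_unm pe : iw (unm pe) = map fst (fst pe) ++ iw (snd pe).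
Proof. unfold iw; simpl. now rewrite map_app, app_assoc. Qed.

Lemma ow_unm pe : ow (unm pe) = ow (snd pe).
Proof. reflexivity. Qed.

Lemma CutWiring_sym typ x q T L1 y q' L2 :
  CutWiring typ x q T L1 y q' L2 -> CutWiring typ y q' (wdual T) L2 x q L1.
Proof.
  intros []. split; rewrite ?wdual_wdual; auto.
  - intros w H H'. rewrite ins_wdual, outs_wdual. apply or_comm. auto.
  - intros n H H'. eauto.
Qed.
Arguments CutWiring_sym {typ x q T L1 y q' L2}.

Lemma head_ow typ X L e w :
  Valid typ (X :: L) -> In e L -> In w (ow X) -> In w (ow e) -> False.
Proof.
  intros V He H H'. pose proof (v_ow V) as O. simpl in O.
  apply NoDup_app_iff in O as (_ & _ & O). apply (O w); auto. apply in_flat_map. eauto.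
Qed.

Lemma head_wn typ X L e : Valid typ (X :: L) -> In e L -> wn X <> wn e.
Proof.
  intros V He E. pose proof (NoDup_wn _ (v_decl V)) as D. simpl in D.
  inversion D as [|? ? N _]; subst. apply N. rewrite E. now apply in_map.
Qed.

Lemma head_iw typ X L e w :
  Valid typ (X :: L) -> In e L -> In w (iw X) -> In w (iw e) -> typ w <> None -> False.
Proof.
  intros V He H H' N. apply (head_wn typ X L e V He).
  apply (v_msg V X e w); simpl; auto.
Qed.

Lemma inw_intro_i W e w : In e W -> In w (iw e) -> inw W w.
Proof. exists e; auto. Qed.

Lemma inw_intro_o W e w : In e W -> In w (ow e) -> inw W w.
Proof. exists e; auto. Qed.

Lemma in_map_snd {A B : Type} (l : list (A * B)) pe : In pe l -> In (snd pe) (map snd l).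
Proof. apply in_map. Qed.

Definition msg_only (q : list item) : Prop := filter isstar q = [].

Lemma msg_only_in q i : msg_only q -> In i q -> snd i <> None.
Proof.
  unfold msg_only. intros H Hi E. assert (In i (filter isstar q)) as K.
  { apply filter_In. split; auto. unfold isstar. now rewrite E. }
  rewrite H in K. destruct K.
Qed.

Lemma in_msg_only q : (forall i, In i q -> snd i <> None) -> msg_only q.
Proof.
  induction q as [|i q IH]; intro H; [reflexivity|]. unfold msg_only. simpl.
  unfold isstar at 1. specialize (H i (or_introl eq_refl)) as Hi.
  destruct (snd i); [|congruence]. apply IH. intros; apply H; simpl; auto.
Qed.

Section Composition.
Context (typ : wire -> option ty) (x : name) (q : list item) (T : wty)
  (L1 : list (list item * wep)) (y : name) (q' : list item) (L2 : list (list item * wep)).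
Context (S : CutWiring typ x q T (map snd L1) y q' (map snd L2)).

Let X := WEp q x (Some T).
Let Y := WEp q' y (Some (wdual T)).

(** A wire common to both sides lies in [T]. A wire queued at [y] does not: it is neither sent by
    [y] nor received by [y] a second time through its type. *)
Lemma pool_fresh w : inw (X :: map snd L1) w -> In w (map fst q') -> False.
Proof.
  intros H H'. assert (In w (iw Y)) as HY by (apply in_app_iff; auto).
  destruct (s_sh S w H) as [K|K].
  - apply (inw_intro_i _ Y); simpl; auto.
  - apply (v_irr (s_v2 S) Y w); simpl; auto.
    unfold ow; simpl. now rewrite outs_wdual.
  - pose proof (v_iw (s_v2 S) Y (or_introl eq_refl)) as D.
    apply NoDup_app_iff in D as (_ & _ & D). apply (D w); auto. simpl. now rewrite ins_wdual.
Qed.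

Lemma pool_msg i : In i q' -> snd i <> None /\ typ (fst i) <> None.
Proof.
  intro H. destruct (v_tok (s_v2 S) Y) as [K1 [_ K2]]; [simpl; auto|].
  simpl in *. rewrite Forall_forall in K1. specialize (K1 _ H). unfold itemok in K1.
  pose proof (msg_only_in _ _ K2 H) as N. split; auto. rewrite K1.
  destruct (snd i); simpl; congruence.
Qed.

Lemma ow_cross e e' w :
  In e (map snd L1) -> In e' (map snd L2) -> In w (ow e) -> In w (ow e') -> False.
Proof.
  intros He He' H H'. destruct (s_sh S w) as [K|K].
  - apply (inw_intro_o _ e); simpl; auto.
  - apply (inw_intro_o _ e'); simpl; auto.
  - apply (head_ow _ _ _ e' w (s_v2 S)); auto.
    unfold ow; simpl. now rewrite outs_wdual.
  - apply (head_ow _ _ _ e w (s_v1 S)); auto.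
Qed.

Lemma iw_cross e e' w :
  In e (map snd L1) -> In e' (map snd L2) -> In w (iw e) -> In w (iw e') -> typ w <> None -> False.
Proof.
  intros He He' H H' N. destruct (s_sh S w) as [K|K].
  - apply (inw_intro_i _ e); simpl; auto.
  - apply (inw_intro_i _ e'); simpl; auto.
  - apply (head_iw _ _ _ e w (s_v1 S)); auto. apply in_app_iff; auto.
  - apply (head_iw _ _ _ e' w (s_v2 S)); auto. apply in_app_iff. simpl.
    rewrite ins_wdual; auto.
Qed.

Lemma cross_io e e' w :
  In e (map snd L1) -> In e' (map snd L2) -> In w (iw e) -> In w (ow e') -> In w (outs T).
Proof.
  intros He He' H H'. destruct (s_sh S w) as [K|K]; auto.
  - apply (inw_intro_i _ e); simpl; auto.
  - apply (inw_intro_o _ e'); simpl; auto.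
  - exfalso. apply (head_ow _ _ _ e' w (s_v2 S)); auto.
    unfold ow; simpl. now rewrite outs_wdual.
Qed.

(** On the first side [x] poses as the sender of [w]. The true sender is the endpoint of the second
    side from which [y] receives it. *)
Lemma outs_cons w : In w (outs T) -> exists e, In e (map snd L2) /\ In w (ow e).
Proof.
  intro H. assert (In w (iw Y)) as HY by (apply in_app_iff; simpl; rewrite ins_wdual; auto).
  destruct (v_io (s_v2 S) Y w) as (e & [<-|He] & Hw); simpl; eauto.
  exfalso. apply (v_irr (s_v2 S) Y w); simpl; auto.
Qed.

Lemma outs_supp w : In w (outs T) -> exists e, In e (map snd L1) /\ In w (iw e).
Proof.
  intro H. assert (In w (ow X)) as HX by auto.
  destruct (v_oi (s_v1 S) X w) as (e & [<-|He] & Hw); simpl; eauto.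
  exfalso. apply (v_irr (s_v1 S) X w); simpl; auto.
Qed.

Lemma pool_cons w : In w (map fst q) -> exists e, In e (map snd L1) /\ In w (ow e).
Proof.
  intro H. assert (In w (iw X)) as HX by (apply in_app_iff; auto).
  destruct (v_io (s_v1 S) X w) as (e & [<-|He] & Hw); simpl; eauto.
  exfalso. apply (v_irr (s_v1 S) X w); simpl; auto.
Qed.

Context (D1 : Distr q' L1) (D2 : Distr q L2).

Lemma pref_in pe i : In pe L1 -> In i (fst pe) -> In i q'.
Proof.
  intros H Hi. eapply Permutation_in; [apply (d_perm D1)|]. apply in_flat_map; eauto.
Qed.

Lemma pref_in_w pe w : In pe L1 -> In w (map fst (fst pe)) -> In w (map fst q').
Proof.
  intros H Hw. apply in_map_iff in Hw as (i & <- & Hi). apply in_map. eapply pref_in; eauto.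
Qed.

Lemma pref_nodup : NoDup (flat_map (fun pe => map fst (fst pe)) L1).
Proof.
  apply (Permutation_NoDup (l := map fst q')).
  - rewrite <- (Permutation_map fst (d_perm D1)). rewrite flat_map_concat_map, concat_map, map_map,
      <- flat_map_concat_map. reflexivity.
  - pose proof (v_iw (s_v2 S) Y (or_introl eq_refl)) as D.
    apply NoDup_app_iff in D. tauto.
Qed.

Lemma pref_own pe pe' w : In pe L1 -> In pe' L1 ->
  In w (map fst (fst pe)) -> In w (iw (snd pe')) \/ In w (ow (snd pe')) -> False.
Proof.
  intros H H' Hw K. apply (pool_fresh w).
  - exists (snd pe'). split; auto. right. now apply in_map_snd.
  - eapply pref_in_w; [|eauto]; auto.
Qed.

Lemma pref_own_cross pe pe' w : In pe L1 -> In pe' L2 ->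
  In w (map fst (fst pe)) -> In w (iw (snd pe')) -> False.
Proof.
  intros H H' Hw K. apply pref_in_w in Hw; auto.
  assert (typ w <> None) as N.
  { apply in_map_iff in Hw as (i & <- & Hi). now apply pool_msg. }
  apply (head_iw _ _ _ (snd pe') w (s_v2 S)); auto.
  - now apply in_map_snd.
  - apply in_app_iff; auto.
Qed.

Lemma comp_iw pe : In pe L1 -> NoDup (iw (unm pe)).
Proof.
  intro H. rewrite iw_unm. apply NoDup_app_iff. split; [|split].
  - exact (NoDup_flat_in _ _ _ pref_nodup H).
  - apply (v_iw (s_v1 S)). right. now apply in_map_snd.
  - intros w Hw Hw'. eapply (pref_own pe pe w); eauto.
Qed.

Lemma comp_irr pe w : In pe L1 -> In w (iw (unm pe)) -> In w (ow (unm pe)) -> False.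
Proof.
  intros H. rewrite iw_unm, ow_unm, in_app_iff. intros [Hw|Hw] Hw'.
  - eapply (pref_own pe pe w); eauto.
  - eapply (v_irr (s_v1 S) (snd pe)); eauto. right. now apply in_map_snd.
Qed.

Lemma comp_msg_same pe pe' w : In pe L1 -> In pe' L1 -> In w (iw (unm pe)) -> In w (iw (unm pe')) ->
  typ w <> None -> wn (unm pe) = wn (unm pe').
Proof.
  intros H H'. rewrite !iw_unm, !in_app_iff. intros [Hw|Hw] [Hw'|Hw'] N.
  - f_equal. f_equal. exact (NoDup_flat_inj _ _ _ _ _ pref_nodup H H' Hw Hw').
  - destruct (pref_own pe pe' w); auto.
  - destruct (pref_own pe' pe w); auto.
  - simpl. apply (v_msg (s_v1 S) _ _ w); auto; right; now apply in_map_snd.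
Qed.

Lemma comp_oi pe w : In pe L1 -> In w (ow (unm pe)) -> exists e, In e (comp L1 L2) /\ In w (iw e).
Proof.
  intros H Hw. rewrite ow_unm in Hw.
  destruct (v_oi (s_v1 S) (snd pe) w) as (e & [<-|He] & Hw'); auto.
  - right. now apply in_map_snd.
  - apply in_app_iff in Hw' as [Hw'|Hw']; simpl in Hw'.
    + apply in_map_iff in Hw' as (i & <- & Hi).
      apply (Permutation_in _ (Permutation_sym (d_perm D2))) in Hi.
      apply in_flat_map in Hi as (pe' & Hpe & Hi). exists (unm pe'). split.
      * apply in_app_iff. right. now apply in_map.
      * rewrite iw_unm. apply in_app_iff. left. now apply in_map.
    + assert (In w (ow Y)) as HY by (unfold ow; simpl; now rewrite outs_wdual).
      destruct (v_oi (s_v2 S) Y w) as (e & [<-|He] & Hw2); simpl; auto.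
      * destruct (v_irr (s_v2 S) Y w); simpl; auto.
      * apply in_map_iff in He as (pe' & <- & Hpe). exists (unm pe'). split.
        -- apply in_app_iff. right. now apply in_map.
        -- rewrite iw_unm. apply in_app_iff. auto.
  - apply in_map_iff in He as (pe' & <- & Hpe). exists (unm pe'). split.
    + apply in_app_iff. left. now apply in_map.
    + rewrite iw_unm. apply in_app_iff. auto.
Qed.

Lemma comp_fifo_same pe pe' a b : In pe L1 -> In pe' L1 ->
  before (iw (unm pe)) a b -> before (ow (unm pe')) b a -> False.
Proof.
  intros H H' HI HO. rewrite iw_unm, before_app in HI. rewrite ow_unm in HO.
  destruct (before_in _ _ _ HO) as [Hb Ha]. destruct HI as [HI|[HI|[HI _]]].
  - apply before_in in HI as [HI _]. eapply (pref_own pe pe' a); auto.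
  - eapply (v_fifo (s_v1 S) (snd pe) (snd pe')); eauto; right; now apply in_map_snd.
  - eapply (pref_own pe pe' a); auto.
Qed.

(** FIFO is transported through the cut formula. The inputs of [y] are its queue followed by the
    outputs of [T]; the share of [pe] respects the order of that queue, and FIFO between [pe] and
    [x] fixes the order inside [T]. So [a] precedes [b] at [y], and FIFO between [y] and [pe']
    applies. *)
Lemma comp_fifo_cross pe pe' a b : In pe L1 -> In pe' L2 ->
  before (iw (unm pe)) a b -> before (ow (unm pe')) b a -> False.
Proof.
  intros H H' HI HO. rewrite iw_unm, before_app in HI. rewrite ow_unm in HO.
  assert (In (snd pe) (map snd L1)) as H1 by now apply in_map_snd.
  assert (In (snd pe') (map snd L2)) as H2 by now apply in_map_snd.
  destruct (before_in _ _ _ HO) as [Hb Ha].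
  assert (before (iw Y) a b -> False) as K.
  { intro HY. apply (v_fifo (s_v2 S) Y (snd pe') a b); simpl; auto. }
  apply K. unfold iw. simpl. rewrite ins_wdual, before_app. destruct HI as [HI|[HI|[HI HI']]].
  - left. eapply (d_ord D1); eauto.
  - right; left. destruct (before_in _ _ _ HI) as [Ia Ib].
    assert (In a (outs T)) as Oa by (apply (cross_io (snd pe) (snd pe')); auto).
    assert (In b (outs T)) as Ob by (apply (cross_io (snd pe) (snd pe')); auto).
    destruct (before_total (outs T) a b) as [?|B]; auto.
    + intros ->. eapply before_irrefl; [|exact HI]. apply (v_iw (s_v1 S)). now right.
    + exfalso. apply (v_fifo (s_v1 S) (snd pe) X a b); simpl; auto.
  - right; right. split; [eapply pref_in_w; eauto|].
    apply (cross_io (snd pe) (snd pe')); auto.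
Qed.

(** The queue of [y] holds no star, as [y] is active, so adding a share does not disturb the count
    of stars required by [tok]. *)
Lemma comp_tok pe : In pe L1 -> tok typ (unm pe).
Proof.
  intro H. destruct (v_tok (s_v1 S) (snd pe)) as [K1 K2];
    [right; now apply in_map_snd|].
  assert (msg_only (fst pe)) as M.
  { apply in_msg_only. intros i Hi. apply pool_msg. eapply pref_in; eauto. }
  split; simpl.
  - apply Forall_app. split; auto. apply Forall_forall. intros i Hi.
    destruct (v_tok (s_v2 S) Y) as [K3 _]; [simpl; auto|].
    rewrite Forall_forall in K3. apply K3. eapply pref_in; eauto.
  - rewrite filter_app. rewrite M. exact K2.
Qed.
End Composition.

Lemma decl_unm L m : Permutation (flat_map fst L) m ->
  Permutation (decl (map unm L)) (imsgs m ++ decl (map snd L)).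
Proof.
  intro P. rewrite <- (imsgs_perm _ _ P). clear P.
  induction L as [|[p e] L IH]; simpl; [constructor|].
  rewrite !imsgs_app, <- !app_assoc, IH.
  rewrite (app_assoc (imsgs p) _ (wn e :: _)). apply Permutation_cons_app.
  rewrite <- app_assoc. apply Permutation_app_head. rewrite !app_assoc.
  apply Permutation_app_tail. apply Permutation_app_comm.
Qed.

Lemma in_comp_l L1 L2 pe : In pe L1 -> In (unm pe) (comp L1 L2).
Proof. intro H. apply in_app_iff. left. now apply in_map. Qed.

Lemma in_comp_r L1 L2 pe : In pe L2 -> In (unm pe) (comp L1 L2).
Proof. intro H. apply in_app_iff. right. now apply in_map. Qed.

Lemma in_comp L1 L2 e : In e (comp L1 L2) -> exists pe, e = unm pe /\ (In pe L1 \/ In pe L2).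
Proof.
  intro H. apply in_app_iff in H as [H|H]; apply in_map_iff in H as (pe & <- & H); eauto.
Qed.

Lemma comp_perm L1 L2 : Permutation (comp L1 L2) (comp L2 L1).
Proof. apply Permutation_app_comm. Qed.

Lemma comp_io typ x q T L1 y q' L2 pe w :
  CutWiring typ x q T (map snd L1) y q' (map snd L2) -> Distr q' L1 -> In pe L1 ->
  In w (iw (unm pe)) -> exists e, In e (comp L1 L2) /\ In w (ow e).
Proof.
  intros S D H Hw. rewrite iw_unm in Hw. apply in_app_iff in Hw as [Hw|Hw].
  - apply (pref_in_w _ _ D) in Hw; auto.
    destruct (pool_cons _ _ _ _ _ _ _ _ (CutWiring_sym S) w Hw) as (e & He & Hw').
    apply in_map_iff in He as (pe' & <- & He). exists (unm pe'). split; auto. now apply in_comp_r.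
  - destruct (v_io (s_v1 S) (snd pe) w) as (e & [<-|He] & Hw'); auto.
    + right. now apply in_map_snd.
    + destruct (outs_cons _ _ _ _ _ _ _ _ S w Hw') as (e & He & Hw2).
      apply in_map_iff in He as (pe' & <- & He). exists (unm pe'). split; auto. now apply in_comp_r.
    + apply in_map_iff in He as (pe' & <- & He). exists (unm pe'). split; auto. now apply in_comp_l.
Qed.

Lemma flat_ow_unm L : flat_map ow (map unm L) = flat_map ow (map snd L).
Proof. induction L; simpl; f_equal; auto. Qed.

Lemma Valid_comp typ x q T L1 y q' L2 :
  CutWiring typ x q T (map snd L1) y q' (map snd L2) -> Distr q' L1 -> Distr q L2 ->
  Valid typ (comp L1 L2).
Proof.
  intros S D1 D2. pose proof (CutWiring_sym S) as S'.
  destruct (s_v1 S) as [A1 _ A3 _ _ _ _ _ _].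
  destruct (s_v2 S) as [B1 _ B3 _ _ _ _ _ _].
  pose proof (s_nm S) as N. split.
  - unfold comp, decl. rewrite flat_map_app.
    apply (Permutation_NoDup (l := (imsgs q ++ decl (map snd L1)) ++ imsgs q' ++ decl (map snd L2))).
    + symmetry. rewrite (decl_unm L1 _ (d_perm D1)), (decl_unm L2 _ (d_perm D2)).
      rewrite <- !app_assoc.
      rewrite (Permutation_app_swap_app (decl (map snd L1)) (imsgs q)).
      rewrite (Permutation_app_swap_app (imsgs q') (imsgs q)).
      apply Permutation_app_head. apply Permutation_app_swap_app.
    + simpl in A1, B1. inversion A1; inversion B1; subst. apply NoDup_app_iff. split; [|split]; auto.
      intros n H H'. apply (N n); simpl; auto.
  - intros e He. apply in_comp in He as (pe & -> & [He|He]).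
    + eapply (comp_iw _ _ _ _ _ _ _ _ S); auto.
    + eapply (comp_iw _ _ _ _ _ _ _ _ S'); auto.
  - unfold comp. rewrite flat_map_app, !flat_ow_unm. simpl in A3, B3.
    apply NoDup_app_iff in A3, B3. apply NoDup_app_iff. split; [|split]; try tauto.
    intros w H H'. apply in_flat_map in H as (e & He & H). apply in_flat_map in H' as (e' & He' & H').
    eapply (ow_cross _ _ _ _ _ _ _ _ S e e' w); auto.
  - intros e w He. apply in_comp in He as (pe & -> & [He|He]).
    + eapply (comp_irr _ _ _ _ _ _ _ _ S); auto.
    + eapply (comp_irr _ _ _ _ _ _ _ _ S'); auto.
  - assert (forall pe pe' w, In pe L1 -> In pe' L2 -> In w (iw (unm pe)) -> In w (iw (unm pe')) ->
      typ w <> None -> False) as K.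
    { intros pe pe' w H H' Hw Hw' T0. rewrite iw_unm, in_app_iff in *.
      destruct Hw as [Hw|Hw], Hw' as [Hw'|Hw'].
      - apply (pref_in_w _ _ D1) in Hw; auto. apply (pref_in_w _ _ D2) in Hw'; auto.
        eapply (pool_fresh _ _ _ _ _ _ _ _ S w); auto.
        eexists. split; [left; reflexivity|]. left. apply in_app_iff. auto.
      - eapply (pref_own_cross _ _ _ _ _ _ _ _ S D1 pe pe' w); auto.
      - eapply (pref_own_cross _ _ _ _ _ _ _ _ S' D2 pe' pe w); auto.
      - eapply (iw_cross _ _ _ _ _ _ _ _ S (snd pe) (snd pe') w); auto using in_map_snd. }
    intros e e' w He He' Hw Hw' T0. apply in_comp in He as (pe & -> & He).
    apply in_comp in He' as (pe' & -> & He'). destruct He as [He|He], He' as [He'|He'].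
    + eapply (comp_msg_same _ _ _ _ _ _ _ _ S D1); eauto.
    + destruct (K pe pe' w); auto.
    + destruct (K pe' pe w); auto.
    + eapply (comp_msg_same _ _ _ _ _ _ _ _ S' D2); eauto.
  - intros e w He Hw. apply in_comp in He as (pe & -> & [He|He]).
    + eapply (comp_io _ _ _ _ _ _ _ _ _ _ S); eauto.
    + destruct (comp_io _ _ _ _ _ _ _ _ _ _ S' D2 He Hw) as (e & He' & Hw'). exists e. split; auto.
      eapply Permutation_in; [apply comp_perm|auto].
  - intros e w He Hw. apply in_comp in He as (pe & -> & [He|He]).
    + eapply (comp_oi _ _ _ _ _ _ _ _ S); eauto.
    + destruct (comp_oi _ _ _ _ _ _ _ _ S' D1 pe w He Hw) as (e & He' & Hw').
      exists e. split; auto. eapply Permutation_in; [apply comp_perm|auto].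
  - intros e e' a b He He' Ha Hb. apply in_comp in He as (pe & -> & He).
    apply in_comp in He' as (pe' & -> & He'). destruct He as [He|He], He' as [He'|He'].
    + eapply (comp_fifo_same _ _ _ _ _ _ _ _ S D1 pe pe' a b); auto.
    + eapply (comp_fifo_cross _ _ _ _ _ _ _ _ S D1 pe pe' a b); auto.
    + eapply (comp_fifo_cross _ _ _ _ _ _ _ _ S' D2 pe pe' a b); auto.
    + eapply (comp_fifo_same _ _ _ _ _ _ _ _ S' D2 pe pe' a b); auto.
  - intros e He. apply in_comp in He as (pe & -> & [He|He]).
    + eapply (comp_tok _ _ _ _ _ _ _ _ S D1); auto.
    + eapply (comp_tok _ _ _ _ _ _ _ _ S' D2); auto.
Qed.

(** * Annotations of one side of a configuration *)

(* Before the cut is reduced, its formulas hide the other side: x is the sender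
   of the wires leaving side 1 and the receiver of those entering it. *)
Definition lin (x : name) (T : wty) (f : wire -> name) (w : wire) : name :=
  if memb w (outs T) then x else f w.

(** [N] lists the endpoints of the same side, the only receivers visible there; [x] replaces those
    of the other side. It is put first because [hd] reads the annotation of a tensor. *)
Definition lout (x : name) (q : list item) (T : wty) (N : list name) (g : wire -> list name)
    (w : wire) : list name :=
  if memb w (map fst q ++ ins T) then x :: filter (fun n => memb n N) (g w)
  else if memb w (outs T) then filter (fun n => memb n N) (g w) else g w.

Definition names (L : list (list item * wep)) : list name := map (fun pe => wn (snd pe)) L.

Lemma lin_in x T f w : In w (outs T) -> lin x T f w = x.
Proof. unfold lin. intro H. apply memb_in in H. now rewrite H. Qed.

Lemma lin_out x T f w : ~ In w (outs T) -> lin x T f w = f w.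
Proof. unfold lin. intro H. apply memb_notin in H. now rewrite H. Qed.

Lemma lout_in x q T N g w : In w (map fst q) \/ In w (ins T) ->
  lout x q T N g w = x :: filter (fun n => memb n N) (g w).
Proof. unfold lout. intro H. apply in_app_iff, memb_in in H. now rewrite H. Qed.

Lemma lout_out x q T N g w : ~ In w (map fst q) -> ~ In w (ins T) -> ~ In w (outs T) ->
  lout x q T N g w = g w.
Proof.
  unfold lout. intros H1 H2 H3. apply memb_notin in H3. rewrite H3.
  destruct (memb w (map fst q ++ ins T)) eqn:E; auto. apply memb_in, in_app_iff in E. tauto.
Qed.

Lemma lout_outs x q T N g w : ~ In w (map fst q) -> ~ In w (ins T) -> In w (outs T) ->
  lout x q T N g w = filter (fun n => memb n N) (g w).
Proof.
  unfold lout. intros H1 H2 H3. apply memb_in in H3. rewrite H3.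
  destruct (memb w (map fst q ++ ins T)) eqn:E; auto. apply memb_in, in_app_iff in E. tauto.
Qed.

Lemma names_disj typ x q T L1 y q' L2 n :
  CutWiring typ x q T (map snd L1) y q' (map snd L2) -> In n (names L1) -> In n (names L2) -> False.
Proof.
  intros S H H'. apply in_map_iff in H as (pe & <- & H). apply in_map_iff in H' as (pe' & E & H').
  apply (s_nm S (wn (snd pe))).
  - apply decl_wn. right. now apply in_map_snd.
  - rewrite <- E. apply decl_wn. right. now apply in_map_snd.
Qed.

(** The masked labels are labels of one side alone: there [x] does send the outputs of [T] and does
    receive the wires of its queue and of the inputs of [T]. Only an inclusion of the shares in the
    queues is asked, so the state before any distribution, with empty shares, is covered too. *)
Lemma Labelling_side typ x q T L1 y q' L2 f g :
  CutWiring typ x q T (map snd L1) y q' (map snd L2) ->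
  (forall pe, In pe L1 -> incl (map fst (fst pe)) (map fst q')) ->
  (forall pe, In pe L2 -> incl (map fst (fst pe)) (map fst q)) ->
  Labelling f g (comp L1 L2) ->
  Labelling (lin x T f) (lout x q T (names L1) g) (WEp q x (Some T) :: map snd L1).
Proof.
  intros S D1 D2 L. pose proof (CutWiring_sym S) as S'.
  set (X := WEp q x (Some T)). pose proof (s_v1 S) as V. fold X in V.
  assert (forall pe w, In pe L1 -> In w (ow (snd pe)) -> ~ In w (outs T)) as NO.
  { intros pe w H Hw Hw'. apply (head_ow _ X _ (snd pe) w V); auto. now apply in_map_snd. }
  assert (forall w, In w (outs T) -> ~ In w (map fst q) /\ ~ In w (ins T)) as NI.
  { intros w Hw. split; intro H; apply (v_irr V X w); simpl; auto; apply in_app_iff; auto. }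
  assert (forall pe n w, In n (names L1) -> In pe L1 \/ In pe L2 -> wn (unm pe) = n ->
    inw (X :: map snd L1) w -> In w (iw (unm pe)) -> In pe L1 /\ In w (iw (snd pe))) as K.
  { intros pe n w Hn H E Hi Hw. destruct H as [H|H].
    - split; auto. rewrite iw_unm in Hw. apply in_app_iff in Hw as [Hw|Hw]; auto. exfalso.
      apply (pool_fresh _ _ _ _ _ _ _ _ S w Hi). apply (D1 pe); auto.
    - exfalso. apply (names_disj _ _ _ _ _ _ _ _ n S Hn). rewrite <- E.
      exact (in_map (fun pe => wn (snd pe)) _ _ H). }
  assert (forall pe w, In pe L1 -> In w (iw (snd pe)) -> exists e', In e' (comp L1 L2) /\
    wn e' = wn (snd pe) /\ In w (iw e')) as K'.
  { intros pe w H Hw. exists (unm pe). split; [now apply in_comp_l|]. split; auto.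
    rewrite iw_unm. apply in_app_iff; auto. }
  assert (forall w n, In w (outs T) ->
    (In n (g w) <-> exists e', In e' (comp L1 L2) /\ wn e' = n /\ In w (iw e'))) as G.
  { intros w n Hw. destruct (outs_cons _ _ _ _ _ _ _ _ S w Hw) as (e & He & Hw').
    apply in_map_iff in He as (pe & <- & He). apply (l_g L (unm pe)); auto.
    now apply in_comp_r. }
  assert (forall w, In w (outs T) -> NoDup (g w)) as GN.
  { intros w Hw. destruct (outs_cons _ _ _ _ _ _ _ _ S w Hw) as (e & He & Hw').
    apply in_map_iff in He as (pe & <- & He). apply (l_nd L (unm pe)); auto.
    now apply in_comp_r. }
  split.
  - intros e w [<-|He] Hw; [now apply lin_in|]. apply in_map_iff in He as (pe & <- & He).
    rewrite lin_out by eauto. apply (l_f L (unm pe)); auto. now apply in_comp_l.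
  - intros e w [<-|He] Hw.
    + destruct (NI w Hw). rewrite lout_outs by auto. apply NoDup_filter. auto.
    + apply in_map_iff in He as (pe & <- & He).
      assert (NoDup (g w)) as Gw by (apply (l_nd L (unm pe)); auto; now apply in_comp_l).
      destruct (in_dec Nat.eq_dec w (map fst q ++ ins T)) as [I|I].
      * apply in_app_iff in I. rewrite lout_in by auto. constructor; [|now apply NoDup_filter].
        intro H. apply filter_In in H as [_ H]. apply memb_in in H.
        apply in_map_iff in H as (pe' & E & H).
        apply (head_wn _ X _ (snd pe') V); [now apply in_map_snd|auto].
      * rewrite in_app_iff in I. rewrite lout_out; eauto.
  - intros e w n [<-|He] Hw.
    + destruct (NI w Hw). rewrite lout_outs by auto. rewrite filter_In, memb_in, G by auto. split.
      * intros [(e' & He' & En & Hw') Hn]. apply in_comp in He' as (pe & -> & He').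
        destruct (K pe n w) as [H1 H2]; auto.
        { eapply inw_intro_o; [left; reflexivity|auto]. }
        exists (snd pe). repeat split; auto. right. now apply in_map_snd.
      * intros (e' & [<-|He'] & En & Hw').
        -- apply in_app_iff in Hw'. tauto.
        -- apply in_map_iff in He' as (pe & <- & He'). split.
           ++ rewrite <- En. auto.
           ++ rewrite <- En. exact (in_map (fun pe => wn (snd pe)) _ _ He').
    + apply in_map_iff in He as (pe & <- & He).
      assert (inw (X :: map snd L1) w) as Iw.
      { apply (inw_intro_o _ (snd pe)); auto. right. now apply in_map_snd. }
      assert (In n (g w) <-> exists e', In e' (comp L1 L2) /\ wn e' = n /\ In w (iw e')) as Gw
        by (apply (l_g L (unm pe)); auto; now apply in_comp_l).
      destruct (in_dec Nat.eq_dec w (map fst q ++ ins T)) as [I|I].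
      * pose proof I as I'. apply in_app_iff in I'. rewrite lout_in by auto.
        simpl. rewrite filter_In, memb_in, Gw. split.
        -- intros [<-|[(e' & He' & En & Hw') Hn]].
           ++ exists X. simpl; auto.
           ++ apply in_comp in He' as (pe' & -> & He'). destruct (K pe' n w) as [H1 H2]; auto.
              exists (snd pe'). repeat split; auto. right. now apply in_map_snd.
        -- intros (e' & [<-|He'] & En & Hw'); auto. right.
           apply in_map_iff in He' as (pe' & <- & He'). split.
           ++ rewrite <- En. auto.
           ++ rewrite <- En. exact (in_map (fun pe => wn (snd pe)) _ _ He').
      * rewrite in_app_iff in I. rewrite lout_out by eauto. rewrite Gw. split.
        -- intros (e' & He' & En & Hw'). apply in_comp in He' as (pe' & -> & He').
           destruct He' as [He'|He'].
           ++ destruct (K pe' n w) as [H1 H2]; auto.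
              { rewrite <- En. exact (in_map (fun pe => wn (snd pe)) _ _ He'). }
              exists (snd pe'). repeat split; auto. right. now apply in_map_snd.
           ++ exfalso. rewrite iw_unm in Hw'. apply in_app_iff in Hw' as [Hw'|Hw'].
              ** apply (D2 pe') in Hw'; auto.
              ** destruct (s_sh S w Iw); auto.
                 { apply (inw_intro_i _ (snd pe')); auto. right. now apply in_map_snd. }
                 eapply NO; eauto.
        -- intros (e' & [<-|He'] & En & Hw'); [exfalso; apply in_app_iff in Hw'; auto|].
           apply in_map_iff in He' as (pe' & <- & He'). rewrite <- En. auto.
Qed.

(** * Reannotation *)

Lemma retensor_cong x c D E D' :
  aty_eq D E -> retensor x c D = Some D' -> exists E', retensor x c E = Some E' /\ aty_eq D' E'.
Proof.
  intro H. revert D'. induction H as [| | | |A u B B' H IH|A u B B' H IH]; simpl; intros D' E;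
    try discriminate.
  - destruct (Nat.eq_dec u x).
    + injection E as <-. eexists; split; eauto using aty_eq.
    + destruct (retensor x c B); [|discriminate]. injection E as <-.
      destruct (IH _ eq_refl) as (E' & -> & ?). eexists; split; [reflexivity|]. now constructor.
  - destruct (retensor x c B); [|discriminate]. injection E as <-.
    destruct (IH _ eq_refl) as (E' & -> & ?). eexists; split; [reflexivity|]. now constructor.
Qed.

Lemma repar_cong x c D E D' :
  aty_eq D E -> repar x c D = Some D' -> exists E', repar x c E = Some E' /\ aty_eq D' E'.
Proof.
  intro H. revert D'. induction H as [| | | |A u B B' H IH|A u B B' H IH]; simpl; intros D' E;
    try discriminate.
  - destruct (repar x c B); [|discriminate]. injection E as <-.
    destruct (IH _ eq_refl) as (E' & -> & ?). eexists; split; [reflexivity|]. now constructor.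
  - destruct (Nat.eq_dec u x).
    + injection E as <-. eexists; split; eauto using aty_eq.
    + destruct (repar x c B); [|discriminate]. injection E as <-.
      destruct (IH _ eq_refl) as (E' & -> & ?). eexists; split; [reflexivity|]. now constructor.
Qed.

Lemma rebot_cong x c D E D' :
  aty_eq D E -> rebot x c D = Some D' -> exists E', rebot x c E = Some E' /\ aty_eq D' E'.
Proof.
  intro H. revert D'. induction H as [| | |u|A u B B' H IH|A u B B' H IH]; simpl; intros D' E;
    try discriminate.
  - destruct (Nat.eq_dec u x); [|discriminate]. injection E as <-. eexists; split; eauto using aty_eq.
  - destruct (rebot x c B); [|discriminate]. injection E as <-.
    destruct (IH _ eq_refl) as (E' & -> & ?). eexists; split; [reflexivity|]. now constructor.
  - destruct (rebot x c B); [|discriminate]. injection E as <-.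
    destruct (IH _ eq_refl) as (E' & -> & ?). eexists; split; [reflexivity|]. now constructor.
Qed.

Lemma remove_perm a l l' :
  Permutation l l' -> Permutation (remove Nat.eq_dec a l) (remove Nat.eq_dec a l').
Proof.
  induction 1; simpl; eauto using Permutation.
  - destruct (Nat.eq_dec a x); auto.
  - destruct (Nat.eq_dec a x), (Nat.eq_dec a y); try reflexivity. apply perm_swap.
Qed.

Lemma reone_cong y us D E D' :
  aty_eq D E -> reone y us D = Some D' -> exists E', reone y us E = Some E' /\ aty_eq D' E'.
Proof.
  intro H. revert D'. induction H as [| |vs vs' P| |A u B B' H IH|A u B B' H IH]; simpl; intros D' E;
    try discriminate.
  - destruct (in_dec Nat.eq_dec y vs) as [I|]; [|discriminate]. injection E as <-.
    destruct (in_dec Nat.eq_dec y vs') as [|N].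
    + eexists; split; [reflexivity|]. constructor. apply Permutation_app_head. now apply remove_perm.
    + destruct N. eapply Permutation_in; eauto.
  - destruct (reone y us B); [|discriminate]. injection E as <-.
    destruct (IH _ eq_refl) as (E' & -> & ?). eexists; split; [reflexivity|]. now constructor.
  - destruct (reone y us B); [|discriminate]. injection E as <-.
    destruct (IH _ eq_refl) as (E' & -> & ?). eexists; split; [reflexivity|]. now constructor.
Qed.

(** Leftmost occurrences meet wires here: if no output of [T] before [w] is annotated with [x], then
    the occurrence rewritten by [retensor] is that of [w]. *)
Lemma retensor_rb typ x c f g g' T w :
  tyok typ T -> typ w <> None -> NoDup (outs T) -> In w (outs T) ->
  hd 0 (g w) = x -> hd 0 (g' w) = c ->
  (forall a, before (outs T) a w -> hd 0 (g a) <> x) ->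
  (forall a, In a (outs T) -> a <> w -> g' a = g a) ->
  retensor x c (rbT f g T) = Some (rbT f g' T).
Proof.
  intros K N D Hw Gx Gc B G. induction T as [| |u|u|A u T IH|A u T IH]; simpl in *; try tauto.
  - destruct Hw as [->|[]]. congruence.
  - destruct K as [K1 K2]. inversion D as [|? ? Nu D']; subst. destruct Hw as [->|Hw].
    + destruct Nat.eq_dec as [_|]; [|congruence]. f_equal. f_equal; auto.
      apply rbT_ext; auto. intros a Ha. symmetry. apply G; auto. intros ->. auto.
    + destruct (Nat.eq_dec (hd 0 (g u)) (hd 0 (g w))) as [E|_]; [destruct (B u); auto|].
      rewrite IH; simpl; auto.
      f_equal. f_equal. rewrite G; auto. intros ->. auto.
  - destruct K as [K1 K2]. rewrite IH; auto.
Qed.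

Lemma repar_rb typ x c f f' g T w :
  tyok typ T -> typ w <> None -> NoDup (ins T) -> In w (ins T) ->
  f w = x -> f' w = c ->
  (forall a, before (ins T) a w -> f a <> x) ->
  (forall a, In a (ins T) -> a <> w -> f' a = f a) ->
  repar x c (rbT f g T) = Some (rbT f' g T).
Proof.
  intros K N D Hw Gx Gc B G. induction T as [| |u|u|A u T IH|A u T IH]; simpl in *; try tauto.
  - destruct Hw as [->|[]]. congruence.
  - destruct K as [K1 K2]. rewrite IH; auto.
  - destruct K as [K1 K2]. inversion D as [|? ? Nu D']; subst. destruct Hw as [->|Hw].
    + destruct Nat.eq_dec as [_|]; [|congruence]. f_equal. f_equal; auto.
      apply rbT_ext; auto. intros a Ha. symmetry. apply G; auto. intros ->. auto.
    + destruct (Nat.eq_dec (f u) (f w)) as [E|_]; [destruct (B u); auto|].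
      rewrite IH; simpl; auto.
      f_equal. f_equal. rewrite G; auto. intros ->. auto.
Qed.

(** A type ends in at most one unit, so the occurrence is unique and no hypothesis on the order of
    wires is made; the same holds for [reone_rb]. *)
Lemma rebot_rb typ x c f f' g T w :
  tyok typ T -> typ w = None -> NoDup (ins T) -> In w (ins T) ->
  f w = x -> f' w = c ->
  (forall a, In a (ins T) -> a <> w -> f' a = f a) ->
  rebot x c (rbT f g T) = Some (rbT f' g T).
Proof.
  intros K N D Hw Gx Gc G. induction T as [| |u|u|A u T IH|A u T IH]; simpl in *; try tauto.
  - destruct Hw as [->|[]]. destruct Nat.eq_dec; congruence.
  - destruct K as [K1 K2]. rewrite IH; auto.
  - destruct K as [K1 K2]. inversion D as [|? ? Nu D']; subst.
    destruct Hw as [->|Hw]; [congruence|]. rewrite IH; auto. simpl. rewrite (G u); auto.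
    intros ->. auto.
Qed.

Lemma reone_rb typ y us f g g' T w :
  tyok typ T -> typ w = None -> NoDup (outs T) -> In w (outs T) -> In y (g w) ->
  g' w = us ++ remove Nat.eq_dec y (g w) ->
  (forall a, In a (outs T) -> a <> w -> g' a = g a) ->
  reone y us (rbT f g T) = Some (rbT f g' T).
Proof.
  intros K N D Hw Gy Gw G. induction T as [| |u|u|A u T IH|A u T IH]; simpl in *; try tauto.
  - destruct Hw as [->|[]]. destruct in_dec; [now rewrite Gw|tauto].
  - destruct K as [K1 K2]. inversion D as [|? ? Nu D']; subst.
    destruct Hw as [->|Hw]; [congruence|]. rewrite IH; auto. simpl. rewrite (G u); auto.
    intros ->. auto.
  - destruct K as [K1 K2]. rewrite IH; auto.
Qed.

Lemma lab_in l b q : In b (lab l q) <-> In b q /\ label b = l.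
Proof. unfold lab. rewrite filter_In, Nat.eqb_eq. reflexivity. Qed.

(** Queues are compared label by label. In the component of [x] the first box disappears on both
    sides; in that of [c] the new box comes last on both sides, since neither [Ψb] nor [q2] contains
    a box labelled [c]. All other components are unchanged. *)
Lemma queue_relabel x c a A Ψ' Ψb q1 q2 b0 :
  x <> c -> Forall (fun b => label b = c) Ψ' -> Forall (fun b => label b <> c) Ψb ->
  Forall (fun b => label b <> x) q1 -> Forall (fun b => label b <> c) q2 -> label b0 = x ->
  queue_eq (Ψ' ++ Msg x a A :: Ψb) (q1 ++ b0 :: q2) ->
  b0 = Msg x a A /\ queue_eq (Ψ' ++ Msg c a A :: Ψb) (q1 ++ Msg c a A :: q2).
Proof.
  intros N H1 H2 H3 H4 E H. pose proof (proj1 (queue_eq_lab _ _) H) as Q.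
  assert (lab x Ψ' = []) as Hx.
  { apply lab_nil. revert H1. apply Forall_impl. congruence. }
  assert (b0 = Msg x a A) as ->.
  { specialize (Q x). rewrite !lab_app, !lab_cons, Hx, (lab_nil x q1), E in Q by auto.
    simpl in Q. rewrite Nat.eqb_refl in Q. congruence. }
  split; auto. apply queue_eq_lab. intro l. specialize (Q l).
  rewrite !lab_app, !lab_cons in *. simpl in *.
  destruct (Nat.eqb_spec c l) as [El|Nl].
  - subst l. destruct (Nat.eqb_spec x c); [congruence|].
    rewrite (lab_id c Ψ'), (lab_nil c Ψb), (lab_nil c q2) in * by auto.
    rewrite !app_nil_r in Q. congruence.
  - rewrite (lab_nil l Ψ') in * by (revert H1; apply Forall_impl; congruence).
    destruct (Nat.eqb_spec x l) as [El|Nl'].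
    + subst l. rewrite (lab_nil x q1) in * by auto. simpl in *. congruence.
    + auto.
Qed.

Lemma queue_relabel_star x c Ψ q1 q2 :
  x <> c -> Forall (fun b => label b <> x) q1 -> Forall (fun b => label b <> x) q2 ->
  Forall (fun b => label b <> c) q2 ->
  queue_eq (Ψ ++ [Star x]) (q1 ++ Star x :: q2) ->
  queue_eq (Ψ ++ [Star c]) (q1 ++ Star c :: q2).
Proof.
  intros N H1 H2 H3 H. pose proof (proj1 (queue_eq_lab _ _) H) as Q.
  apply queue_eq_lab. intro l. specialize (Q l).
  rewrite !lab_app, !lab_cons in *. simpl in *.
  destruct (Nat.eqb_spec c l) as [El|Nl].
  - subst l. destruct (Nat.eqb_spec x c); [congruence|].
    rewrite (lab_nil c q2) in * by auto. rewrite !app_nil_r in Q. congruence.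
  - destruct (Nat.eqb_spec x l) as [El|Nl'].
    + subst l. rewrite (lab_nil x q1), (lab_nil x q2) in * by auto. simpl in *.
      rewrite app_nil_r. apply (app_inv_tail [Star x]). exact Q.
    + auto.
Qed.

(** * The states of a configuration *)

(** The outcome of a composition with its labels [f] and [g]. The shares in [L1] and [L2] record the
    choices made by the distribution. *)
Record Composite typ x q T L1 y q' L2 (f : wire -> name) (g : wire -> list name) : Prop := {
  c_s : CutWiring typ x q T (map snd L1) y q' (map snd L2);
  c_d1 : Distr q' L1;
  c_d2 : Distr q L2;
  c_l : Labelling f g (comp L1 L2) }.
Arguments c_s {typ x q T L1 y q' L2 f g}.
Arguments c_d1 {typ x q T L1 y q' L2 f g}.
Arguments c_d2 {typ x q T L1 y q' L2 f g}.
Arguments c_l {typ x q T L1 y q' L2 f g}.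

Lemma Composite_sym typ x q T L1 y q' L2 f g :
  Composite typ x q T L1 y q' L2 f g -> Composite typ y q' (wdual T) L2 x q L1 f g.
Proof.
  intros []. split; auto using CutWiring_sym. eapply Labelling_perm; [apply comp_perm|auto].
Qed.
Arguments Composite_sym {typ x q T L1 y q' L2 f g}.

Lemma Composite_Valid typ x q T L1 y q' L2 f g :
  Composite typ x q T L1 y q' L2 f g -> Valid typ (comp L1 L2).
Proof. intros []. eapply Valid_comp; eauto. Qed.
Arguments Composite_Valid {typ x q T L1 y q' L2 f g}.

(* T is what is left of the cut formula U after some substitution steps. *)
Record Suf (typ : wire -> option ty) (T U : wty) : Prop := {
  sf_o : exists o, outs U = o ++ outs T;
  sf_i : exists i, ins U = i ++ ins T;
  sf_t : tyok typ T }.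
Arguments sf_o {typ T U}.
Arguments sf_i {typ T U}.
Arguments sf_t {typ T U}.

Lemma tyok_wdual typ T : tyok typ T -> tyok typ (wdual T).
Proof. induction T; simpl; rewrite ?dual_dual; intuition. Qed.

Lemma Suf_sym typ T U : Suf typ T U -> Suf typ (wdual T) (wdual U).
Proof.
  intros []. split; rewrite ?ins_wdual, ?outs_wdual; auto using tyok_wdual.
Qed.

Lemma Suf_refl typ T : tyok typ T -> Suf typ T T.
Proof. intro K. split; auto; exists []; auto. Qed.

Lemma Suf_tensor typ A w T U : Suf typ (WTensor A w T) U -> Suf typ T U.
Proof.
  intros [(o & Eo) (i & Ei) [_ K]]. split; auto.
  - exists (o ++ [w]). rewrite <- app_assoc. auto.
  - exists i. auto.
Qed.

Lemma Suf_par typ A w T U : Suf typ (WPar A w T) U -> Suf typ T U.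
Proof.
  intros [(o & Eo) (i & Ei) [_ K]]. split; auto.
  - exists o. auto.
  - exists (i ++ [w]). rewrite <- app_assoc. auto.
Qed.

(** One line during substitution: its queue is empty and its cut formula is reduced to [T], so
    exactly the wires of [T] are still masked. *)
Definition uside f g x (T : wty) (N : list name) (C : list wep) : side endpoint :=
  Side (map (rb (lin x T f) (lout x [] T N g)) C) [] x (rbT (lin x T f) (lout x [] T N g) T).

(** * Order of the wires during substitution *)

Section Subst.
Context typ x q U L1 y q' L2 f g (C : Composite typ x q U L1 y q' L2 f g).
Let S := c_s C.
Let S' := CutWiring_sym S.
Let V1 := s_v1 S.
Let V2 := s_v2 S.
Let D1 := c_d1 C.
Let D2 := c_d2 C.
Let L := c_l C.
Let VC := Composite_Valid C.
Let X := WEp q x (Some U).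
Let Y := WEp q' y (Some (wdual U)).
Let C1 := map unm L1.
Let C2 := map unm L2.

Lemma C1_in e : In e C1 -> exists pe, e = unm pe /\ In pe L1 /\ In (snd pe) (map snd L1) /\
  In (snd pe) (X :: map snd L1) /\ In e (comp L1 L2).
Proof.
  intro H. apply in_map_iff in H as (pe & <- & H). exists pe.
  assert (In (snd pe) (map snd L1)) by now apply in_map_snd.
  repeat split; simpl; auto. now apply in_comp_l.
Qed.

Lemma C2_in e : In e C2 -> exists pe, e = unm pe /\ In pe L2 /\ In (snd pe) (map snd L2) /\
  In (snd pe) (Y :: map snd L2) /\ In e (comp L1 L2).
Proof.
  intro H. apply in_map_iff in H as (pe & <- & H). exists pe.
  assert (In (snd pe) (map snd L2)) by now apply in_map_snd.
  repeat split; simpl; auto. now apply in_comp_r.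
Qed.

Lemma x_fresh e : In e (comp L1 L2) -> wn e <> x.
Proof.
  intros H E. apply in_comp in H as (pe & -> & [H|H]); simpl in E.
  - apply (head_wn _ X _ (snd pe) V1); [now apply in_map_snd|auto].
  - apply (s_nm S x).
    + simpl; auto.
    + rewrite <- E. apply decl_wn. right. now apply in_map_snd.
Qed.

Lemma y_fresh e : In e (comp L1 L2) -> wn e <> y.
Proof.
  intros H E. apply in_comp in H as (pe & -> & [H|H]); simpl in E.
  - apply (s_nm S y).
    + rewrite <- E. apply decl_wn. right. now apply in_map_snd.
    + simpl; auto.
  - apply (head_wn _ Y _ (snd pe) V2); [now apply in_map_snd|auto].
Qed.

Lemma own_iw pe a : In pe L1 -> In a (iw (unm pe)) -> In a (outs U) -> In a (iw (snd pe)).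
Proof.
  intros H Ha Ho. rewrite iw_unm in Ha. apply in_app_iff in Ha as [Ha|Ha]; auto. exfalso.
  apply (pool_fresh _ _ _ _ _ _ _ _ S a).
  - exists X. split; [simpl; auto|]. right. exact Ho.
  - eapply pref_in_w; eauto.
Qed.

Lemma own_before pe a b : In pe L1 -> In a (iw (snd pe)) -> In b (iw (snd pe)) ->
  before (iw (unm pe)) a b -> before (iw (snd pe)) a b.
Proof.
  intros H Ha Hb B. rewrite iw_unm, before_app in B.
  assert (In a (map fst (fst pe)) -> False) as K by (intro; eapply (pref_own _ _ _ _ _ _ _ _ S D1 pe pe a); auto).
  destruct B as [B|[B|[B _]]]; auto; try tauto. apply before_in in B. tauto.
Qed.

Context (T : wty) (HT : Suf typ T U).

Lemma outs_suf a : In a (outs T) -> In a (outs U).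
Proof. destruct (sf_o HT) as [o ->]. rewrite in_app_iff. auto. Qed.

Lemma ins_suf a : In a (ins T) -> In a (ins U).
Proof. destruct (sf_i HT) as [i ->]. rewrite in_app_iff. auto. Qed.

Lemma outs_nd : NoDup (outs T).
Proof.
  destruct (sf_o HT) as [o E]. pose proof (NoDup_flat_in ow _ X (v_ow V1) (or_introl eq_refl)) as D.
  unfold ow in D. simpl in D. rewrite E in D. apply NoDup_app_iff in D. tauto.
Qed.

Lemma ins_outs a : In a (ins T) -> In a (outs T) -> False.
Proof.
  intros H H'. apply (v_irr V1 X a); simpl; auto.
  - apply in_app_iff. right. now apply ins_suf.
  - now apply outs_suf.
Qed.

Lemma ow1_outs e a : In e C1 -> In a (ow e) -> In a (outs T) -> False.
Proof.
  intros He Ha Ho. apply C1_in in He as (pe & -> & _ & H & _).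
  apply (head_ow _ X _ (snd pe) a V1); auto. now apply outs_suf.
Qed.

Lemma lbl_x e a : In e C1 -> In a (iw e) -> lin x T f a = x -> In a (outs T).
Proof.
  intros He Ha E. destruct (in_dec Nat.eq_dec a (outs T)) as [|N]; auto. exfalso.
  rewrite lin_out in E by auto. apply C1_in in He as (pe & -> & _ & _ & _ & H).
  destruct (f_ow _ _ _ _ _ _ VC L H Ha) as (e' & He' & _ & Ef).
  apply (x_fresh e'); congruence.
Qed.

Context (w : wire) (O : list wire) (EO : outs T = w :: O).

Let Ow : In w (outs T).
Proof. rewrite EO. simpl; auto. Qed.

(** [w] heads the remaining outputs of the cut formula, so by FIFO between [e] and [x] none of them
    is received before [w]. In the queue of [e], no box in front of [w] is therefore labelled [x].
    Distributed items do not interfere, as they carry no wire of the cut formula. *)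
Lemma first_x e a : In e C1 -> before (iw e) a w -> In a (outs T) -> False.
Proof.
  intros He B Ha. destruct (before_in _ _ _ B) as [Ia Iw].
  apply C1_in in He as (pe & -> & Hpe & _ & He & Hc).
  assert (a <> w) as N by (intros ->; eapply before_irrefl; [apply (v_iw VC _ Hc)|exact B]).
  apply own_before in B; auto; try (apply own_iw; auto using outs_suf).
  apply (v_fifo V1 (snd pe) X a w); simpl; auto.
  unfold ow; simpl. destruct (sf_o HT) as [o ->]. apply before_app. right; left.
  rewrite EO in *. destruct Ha as [->|Ha]; [congruence|]. simpl; auto.
Qed.

(** A box behind [w] with the same true sender [c] is on an output of [U]. It cannot be on an output
    that is already consumed, since FIFO puts those in front of [w]; so it is still masked as [x].
    Hence the relabelled message comes after every box visibly labelled [c]. *)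
Lemma after_c e a c : In e C1 -> In c C2 -> before (iw e) w a -> f a = wn c -> In a (outs T).
Proof.
  intros He Hc B E. destruct (before_in _ _ _ B) as [Iw Ia].
  apply C1_in in He as (pe & -> & Hpe & Hs & He & Hcm).
  apply C2_in in Hc as (pc & -> & Hpc & Hsc & _ & Hcc).
  assert (In a (ow (unm pc))) as Oa by (apply (f_wn_ow typ (comp L1 L2) f g (unm pe)); auto).
  rewrite ow_unm in Oa.
  assert (In w (iw (snd pe))) as Iw' by (apply own_iw; auto using outs_suf).
  assert (In a (iw (snd pe))) as Ia'.
  { rewrite iw_unm in Ia. apply in_app_iff in Ia as [Ia|Ia]; auto. exfalso.
    rewrite iw_unm, before_app in B. destruct B as [B|[B|[B _]]].
    - apply before_in in B as [B _]. eapply (pref_own _ _ _ _ _ _ _ _ S D1 pe pe w); auto.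
    - apply before_in in B as [_ B]. eapply (pref_own _ _ _ _ _ _ _ _ S D1 pe pe a); auto.
    - eapply (pref_own _ _ _ _ _ _ _ _ S D1 pe pe w); auto. }
  apply own_before in B; auto.
  assert (In a (outs U)) as Ha.
  { apply (cross_io _ _ _ _ _ _ _ _ S (snd pe) (snd pc)); auto. }
  destruct (sf_o HT) as [o E']. rewrite E' in Ha. apply in_app_iff in Ha as [Ha|]; auto.
  exfalso. apply (v_fifo V1 (snd pe) X w a); simpl; auto.
  unfold ow; simpl. rewrite E'. apply before_app. right; right. auto.
Qed.

(** The counterpart for sending: FIFO between [y] and [c] on the second side makes the tensor of [w]
    the first one of [c] that carries a remaining wire. *)
Lemma first_y c a : In c C2 -> before (ow c) a w -> In a (outs T) -> False.
Proof.
  intros Hc B Ha. destruct (before_in _ _ _ B) as [Ia Iw].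
  apply C2_in in Hc as (pc & -> & Hpc & Hsc & Hyc & Hcc). rewrite ow_unm in B.
  assert (a <> w) as N.
  { intros ->. eapply before_irrefl; [|exact B]. exact (NoDup_flat_in ow _ _ (v_ow V2) Hyc). }
  apply (v_fifo V2 Y (snd pc) w a); simpl; auto.
  unfold iw; simpl. rewrite ins_wdual. destruct (sf_o HT) as [o ->].
  rewrite !before_app. right; left; right; left.
  rewrite EO in *. destruct Ha as [->|Ha]; [congruence|]. simpl; auto.
Qed.

Lemma cons_c : exists c, In c C2 /\ In w (ow c) /\ f w = wn c /\
  (forall e, In e (comp L1 L2) -> In w (ow e) -> e = c).
Proof.
  destruct (outs_cons _ _ _ _ _ _ _ _ S w) as (e & He & Hw); [now apply outs_suf|].
  apply in_map_iff in He as (pe & <- & He). exists (unm pe).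
  assert (In (unm pe) (comp L1 L2)) as Hc by now apply in_comp_r.
  repeat split; auto.
  - unfold C2. now apply in_map.
  - now apply (l_f L (unm pe)).
  - intros e' H' Hw'. eapply ow_uniq; [exact VC| | | |]; eauto.
Qed.

Lemma supp_b : typ w <> None -> exists b, In b C1 /\ In w (iw b) /\ g w = [wn b] /\
  (forall e, In e (comp L1 L2) -> In w (iw e) -> e = b).
Proof.
  intro N. destruct (outs_supp _ _ _ _ _ _ _ _ S w) as (e & He & Hw); [now apply outs_suf|].
  apply in_map_iff in He as (pe & <- & He). exists (unm pe).
  assert (In (unm pe) (comp L1 L2)) as Hc by now apply in_comp_l.
  assert (In w (iw (unm pe))) as Hw' by (rewrite iw_unm; apply in_app_iff; auto).
  repeat split; auto.
  - unfold C1. now apply in_map.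
  - destruct cons_c as (c & Hc2 & Hwc & _ & _). apply (g_msg typ (comp L1 L2) f g (unm pe) c); auto.
    apply C2_in in Hc2 as (pc & -> & _ & _ & _ & H). auto.
  - intros e' H' Hw2. eapply wn_inj; [apply (v_decl VC)| | |]; auto.
    apply (v_msg VC e' (unm pe) w); auto.
Qed.
End Subst.

Arguments first_x {typ x q U L1 y q' L2 f g} C {T} HT {w O} EO.
Arguments after_c {typ x q U L1 y q' L2 f g} C {T} HT {w O} EO.
Arguments first_y {typ x q U L1 y q' L2 f g} C {T} HT {w O} EO.
Arguments cons_c {typ x q U L1 y q' L2 f g} C {T} HT {w O} EO.
Arguments supp_b {typ x q U L1 y q' L2 f g} C {T} HT {w O} EO.
Arguments lbl_x {typ x q U L1 y q' L2 f g} C {T}.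
Arguments x_fresh {typ x q U L1 y q' L2 f g} C.
Arguments y_fresh {typ x q U L1 y q' L2 f g} C.
Arguments ow1_outs {typ x q U L1 y q' L2 f g} C {T} HT.
Arguments outs_nd {typ x q U L1 y q' L2 f g} C {T} HT.
Arguments ins_outs {typ x q U L1 y q' L2 f g} C {T} HT.

Lemma memb_cons_other a w l : a <> w -> memb a (w :: l) = memb a l.
Proof.
  intro N. destruct (memb a l) eqn:E.
  - apply memb_in in E. apply memb_in. simpl; auto.
  - apply memb_notin in E. apply memb_notin. simpl. intuition.
Qed.

Lemma lin_tensor x A w D f a : a <> w -> lin x (WTensor A w D) f a = lin x D f a.
Proof. intro N. unfold lin. simpl. now rewrite memb_cons_other. Qed.

Lemma lout_tensor x A w D N g a : a <> w -> lout x [] (WTensor A w D) N g a = lout x [] D N g a.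
Proof. intro H. unfold lout. simpl. now rewrite memb_cons_other. Qed.

Lemma lout_par x A w D N g a : a <> w -> lout x [] (WPar A w D) N g a = lout x [] D N g a.
Proof. intro H. unfold lout. simpl. now rewrite memb_cons_other. Qed.

Lemma names_unm L : map wn (map unm L) = names L.
Proof. unfold names. rewrite map_map. reflexivity. Qed.

Lemma in_names L e : In e (map unm L) -> In (wn e) (names L).
Proof. intro H. rewrite <- names_unm. now apply in_map. Qed.

(** No endpoint of the composite is named [y], so an annotation [y] on a tensor of the second side
    can only come from the mask. *)
Lemma hd_y {typ x q U L1 y q' L2 f g} (C : Composite typ x q U L1 y q' L2 f g) {T} (HT : Suf typ T U) c a :
  In c (map unm L2) -> In a (ow c) -> typ a <> None ->
  hd 0 (lout y [] (wdual T) (names L2) g a) = y -> In a (outs T).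
Proof.
  intros Hc Ha N E. destruct (in_dec Nat.eq_dec a (outs T)) as [|Na]; auto. exfalso.
  pose proof (Composite_Valid C) as VC.
  assert (In c (comp L1 L2)) as Hcc by (apply in_app_iff; auto).
  rewrite lout_out in E; rewrite ?ins_wdual, ?outs_wdual; simpl; auto.
  - destruct (v_oi VC c a Hcc Ha) as (b & Hb & Hab).
    rewrite (g_msg typ (comp L1 L2) f g b c a) in E; eauto using c_l. simpl in E.
    exact (y_fresh C b Hb E).
  - intro Hi. pose proof (Composite_sym C) as C'.
    apply (ow1_outs C' (Suf_sym _ _ _ HT) c a); auto. now rewrite outs_wdual.
Qed.

Lemma ep_align f g e q n t :
  ep_eq (Ep q n t) (rb f g e) ->
  queue_eq q (map (rbI f) (wp e)) /\ n = wn e /\ oaty_eq t (option_map (rbT f g) (wt e)).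
Proof. exact (fun H => H). Qed.

Lemma before_outs_msg typ T a b : tyok typ T -> before (outs T) a b -> typ a <> None.
Proof.
  induction T as [| |u|u|A u T IH|A u T IH]; simpl; try tauto.
  intros [K1 K2] [[-> _]|B]; [congruence|auto].
Qed.

Lemma comp_nd_outs {typ x q U L1 y q' L2 f g} (C : Composite typ x q U L1 y q' L2 f g) e T :
  In e (comp L1 L2) -> wt e = Some T -> NoDup (outs T) /\ NoDup (ins T) /\ tyok typ T.
Proof.
  intros He E. pose proof (Composite_Valid C) as VC. split; [|split].
  - pose proof (NoDup_flat_in ow _ e (v_ow VC) He) as ND. unfold ow in ND. now rewrite E in ND.
  - pose proof (v_iw VC e He) as ND. unfold iw in ND. rewrite E in ND.
    apply NoDup_app_iff in ND. tauto.
  - destruct (v_tok VC e He) as [_ K]. rewrite E in K. tauto.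
Qed.

Lemma retensor_step {typ x q U L1 y q' L2 f g} (C : Composite typ x q U L1 y q' L2 f g) {A w D}
  (HT : Suf typ (WTensor A w D) U) c Tc b :
  In c (map unm L2) -> wt c = Some Tc -> In w (outs Tc) -> g w = [b] ->
  retensor y b (rbT (lin y (wdual (WTensor A w D)) f)
      (lout y [] (wdual (WTensor A w D)) (names L2) g) Tc) =
  Some (rbT (lin y (wdual D) f) (lout y [] (wdual D) (names L2) g) Tc).
Proof.
  intros Hc Ec Hw Gw. assert (In c (comp L1 L2)) as Hcc by (apply in_app_iff; auto).
  destruct (comp_nd_outs C c Tc Hcc Ec) as (N1 & _ & K).
  assert (typ w <> None) as Nw by (destruct (sf_t HT) as [E _]; congruence).
  assert (NoDup (w :: outs D)) as DO by exact (outs_nd C HT).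
  erewrite (retensor_rb typ y b _ _ (lout y [] (wdual D) (names L2) g) Tc w); auto.
  - rewrite lout_in; auto. right. simpl; auto.
  - rewrite lout_out, Gw; simpl; auto.
    + rewrite ins_wdual. now inversion DO.
    + rewrite outs_wdual. intro H. apply (ins_outs C HT w); simpl; auto.
  - intros a B Hy. destruct (before_in _ _ _ B) as [Ia _].
    apply (first_y C HT (eq_refl : outs (WTensor A w D) = w :: outs D) c a); auto.
    + unfold ow. now rewrite Ec.
    + apply (hd_y C HT c); auto; [unfold ow; now rewrite Ec|]. eapply before_outs_msg; eauto.
  - intros a _ Na. symmetry. now apply lout_par.
Qed.

Lemma repar_step {typ x q U L1 y q' L2 f g} (C : Composite typ x q U L1 y q' L2 f g) {A w D}
  (HT : Suf typ (WTensor A w D) U) b Tb G :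
  In b (map unm L1) -> wt b = Some Tb -> In w (ins Tb) ->
  repar x (f w) (rbT (lin x (WTensor A w D) f) G Tb) = Some (rbT (lin x D f) G Tb).
Proof.
  intros Hb Eb Hw. assert (In b (comp L1 L2)) as Hbc by (apply in_app_iff; auto).
  destruct (comp_nd_outs C b Tb Hbc Eb) as (_ & N1 & K).
  assert (typ w <> None) as Nw by (destruct (sf_t HT) as [E _]; congruence).
  assert (NoDup (w :: outs D)) as DO by exact (outs_nd C HT).
  apply (repar_rb typ) with (w := w); auto.
  - apply lin_in. simpl; auto.
  - apply lin_out. now inversion DO.
  - intros v B0 El. assert (before (iw b) v w) as B1.
    { unfold iw. rewrite Eb. apply before_app. auto. }
    apply (first_x C HT (eq_refl : outs (WTensor A w D) = w :: outs D) b v); auto.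
    apply (lbl_x C b); auto. apply before_in in B1. tauto.
  - intros v _ Nv. symmetry. now apply lin_tensor.
Qed.

(** The endpoints [b] and [c] of the rule are annotations of the two cut formulas, so they are
    forced: they are the receiver [eb] and the true sender [ec] of the first wire. What the rule
    does to their queues and types is precisely to unmask that wire. *)
Lemma subst_sound {typ x q U L1 y q' L2 f g} (C : Composite typ x q U L1 y q' L2 f g) {T}
  (HT : Suf typ T U) K K' :
  subst_rule K K' ->
  side_eq ep_eq (fst K) (uside f g x T (names L1) (map unm L1)) ->
  side_eq ep_eq (snd K) (uside f g y (wdual T) (names L2) (map unm L2)) ->
  exists A w D, T = WTensor A w D /\
    side_eq ep_eq (fst K') (uside f g x D (names L1) (map unm L1)) /\
    side_eq ep_eq (snd K') (uside f g y (wdual D) (names L2) (map unm L2)).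
Proof.
  intros R H1 H2. pose proof (Composite_Valid C) as VC.
  assert (exists A w D, T = WTensor A w D) as (A & w & D & ->).
  { destruct H1 as (_ & _ & _ & H1). destruct R; simpl in H1; destruct T; simpl in H1;
      inversion H1; subst; eauto. }
  exists A, w, D. split; auto.
  assert (typ w <> None) as Nw by (destruct (sf_t HT) as [E _]; congruence).
  set (O := outs D). assert (outs (WTensor A w D) = w :: O) as EO by reflexivity.
  destruct (supp_b C HT EO Nw) as (eb & Hb & Wb & Gb & Ub).
  destruct (cons_c C HT EO) as (ec & Hc & Wc & Fc & Uc).
  assert (NoDup (w :: O)) as DO by (rewrite <- EO; apply (outs_nd C HT)).
  assert (~ In w O) as NwO by now inversion DO.
  assert (~ In w (ins D)) as NwI.
  { intro H. apply (ins_outs C HT w); simpl; auto. }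
  set (N1 := names L1) in *. set (N2 := names L2) in *.
  set (C1 := map unm L1) in *. set (C2 := map unm L2) in *.
  assert (incl C1 (comp L1 L2)) as I1 by (intros e He; apply in_app_iff; auto).
  assert (incl C2 (comp L1 L2)) as I2 by (intros e He; apply in_app_iff; auto).
  assert (wn ec <> x) as Ncx by (apply (x_fresh C); auto).
  set (T := WTensor A w D) in *.
  assert (lin x T f w = x) as F1w by (apply lin_in; simpl; auto).
  assert (lin x D f w = wn ec) as F1w' by (rewrite lin_out; auto).
  assert (lin y (wdual T) f w = wn ec) as F2w.
  { rewrite lin_out; auto. rewrite outs_wdual. exact NwI. }
  assert (lout x [] T N1 g w = [wn eb]) as G1w.
  { rewrite lout_outs, Gb; simpl; auto. replace (memb (wn eb) N1) with true; auto.
    symmetry. apply memb_in. now apply in_names. }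
  assert (hd 0 (lout y [] (wdual T) N2 g w) = y) as G2w.
  { rewrite lout_in; auto. right. rewrite ins_wdual. simpl; auto. }
  assert (hd 0 (lout y [] (wdual D) N2 g w) = wn eb) as G2w'.
  { rewrite lout_out, Gb; simpl; auto.
    - now rewrite ins_wdual.
    - now rewrite outs_wdual. }
  (* Only [eb] receives [w], and no endpoint of the first side sends it, so unmasking [w] leaves the
     other entries as they are. *)
  assert (forall e, In e C1 -> e <> eb -> rb (lin x T f) (lout x [] T N1 g) e = rb (lin x D f) (lout x [] D N1 g) e) as R1.
  { intros e He Ne. apply rb_ext; intros a Ha.
    - apply lin_tensor. intros ->. apply Ne. auto.
    - apply lout_tensor. intros ->. apply (ow1_outs C HT e w); simpl; auto. }
  assert (forall e, In e C2 -> e <> ec ->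
    rb (lin y (wdual T) f) (lout y [] (wdual T) N2 g) e = rb (lin y (wdual D) f) (lout y [] (wdual D) N2 g) e) as R2.
  { intros e He Ne. apply rb_ext; intros a Ha; [reflexivity|].
    apply lout_par. intros ->. apply Ne. auto. }
  assert (forall e C0 Γ, Permutation C1 (e :: C0) -> e = eb ->
    mset_eq ep_eq Γ (map (rb (lin x T f) (lout x [] T N1 g)) C0) ->
    mset_eq ep_eq Γ (map (rb (lin x D f) (lout x [] D N1 g)) C0)) as M1.
  { intros e C0 Γ P -> M. erewrite map_ext_in; [exact M|]. intros a Ha. symmetry. apply R1.
    - eapply Permutation_in; [symmetry; exact P|simpl; auto].
    - intros ->. assert (NoDup (map wn C1)) as ND.
      { pose proof (NoDup_wn _ (v_decl VC)) as ND. unfold comp in ND. rewrite map_app in ND.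
        apply NoDup_app_iff in ND. tauto. }
      rewrite P in ND. simpl in ND. inversion ND as [|? ? Nn _]. apply Nn. now apply in_map. }
  assert (forall e C0 Γ, Permutation C2 (e :: C0) -> e = ec ->
    mset_eq ep_eq Γ (map (rb (lin y (wdual T) f) (lout y [] (wdual T) N2 g)) C0) ->
    mset_eq ep_eq Γ (map (rb (lin y (wdual D) f) (lout y [] (wdual D) N2 g)) C0)) as M2.
  { intros e C0 Γ P -> M. erewrite map_ext_in; [exact M|]. intros a Ha. symmetry. apply R2.
    - eapply Permutation_in; [symmetry; exact P|simpl; auto].
    - intros ->. assert (NoDup (map wn C2)) as ND.
      { pose proof (NoDup_wn _ (v_decl VC)) as ND. unfold comp in ND. rewrite map_app in ND.
        apply NoDup_app_iff in ND. tauto. }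
      rewrite P in ND. simpl in ND. inversion ND as [|? ? Nn _]. apply Nn. now apply in_map. }
  assert (forall Γ2 Ψc c E E' D',
    side_eq ep_eq (Side (Ep Ψc c (Some E) :: Γ2) [] y (APar (dual A) c D'))
      (uside f g y (wdual T) N2 C2) ->
    retensor y (wn eb) E = Some E' ->
    c = wn ec /\
    side_eq ep_eq (Side (Ep Ψc c (Some E') :: Γ2) [] y D') (uside f g y (wdual D) N2 C2)) as KC.
  { clear H1 H2 R. intros Γ2 Ψc c E E' D' (Ha & _ & _ & Hd) HE.
    simpl in Ha. change (aty_eq (APar (dual A) c D') (APar (dual A) (lin y (wdual T) f w)
      (rbT (lin y (wdual T) f) (lout y [] (wdual T) N2 g) (wdual D)))) in Hd. rewrite F2w in Hd.
    apply mset_map_inv in Ha as (e & C0 & P & He & Hm).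
    apply ep_align in He as (Qe & Ne & Te).
    assert (c = wn ec) as -> by (inversion Hd; auto).
    assert (aty_eq D' (rbT (lin y (wdual T) f) (lout y [] (wdual T) N2 g) (wdual D))) as Hd'
      by (inversion Hd; auto).
    assert (In e C2) as He by (eapply Permutation_in; [symmetry; exact P|simpl; auto]).
    assert (e = ec) as -> by (apply (wn_inj (comp L1 L2)); auto; apply (v_decl VC)).
    split; auto. split; [|split; [constructor|split; [reflexivity|]]].
    - simpl. apply mset_sym; [apply ep_equiv|].
      apply (mset_perm_l _ _ (map (rb (lin y (wdual D) f) (lout y [] (wdual D) N2 g)) (ec :: C0)));
        [now apply Permutation_map|].
      apply mset_sym; [apply ep_equiv|]. apply mset_cons; [|now apply (M2 ec)].
      split; [exact Qe|split; [exact Ne|]]. simpl.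
      unfold ow in Wc. destruct (wt ec) as [Tc|] eqn:Ec; [|destruct Wc]. simpl in Te |- *.
      destruct (retensor_cong _ _ _ _ _ Te HE) as (E2 & HE2 & Hq).
      pose proof (eq_trans (eq_sym HE2) (retensor_step C HT ec Tc (wn eb) Hc Ec Wc Gb)) as RS.
      injection RS as ->. exact Hq.
    - simpl. simpl in Hd'. erewrite rbT_ext; [exact Hd'|reflexivity|].
      intros a Ha. symmetry. apply lout_par. intros ->. apply NwI. now rewrite outs_wdual in Ha. }
  assert (forall D0 b, aty_eq (ATensor A b D0) (rbT (lin x T f) (lout x [] T N1 g) T) ->
    b = wn eb /\ aty_eq D0 (rbT (lin x D f) (lout x [] D N1 g) D)) as KT.
  { intros D0 b Hd. change (aty_eq (ATensor A b D0) (ATensor A (hd 0 (lout x [] T N1 g w))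
      (rbT (lin x T f) (lout x [] T N1 g) D))) in Hd.
    rewrite G1w in Hd. simpl hd in Hd. inversion Hd; subst. split; auto.
    erewrite rbT_ext; [eassumption| |]; intros a Ha; symmetry;
      [apply lin_tensor|apply lout_tensor]; intros ->; auto. }
  assert (forall i, In i (wp eb) -> label (rbI (lin x T f) i) = x -> before (iw eb) (fst i) w -> False) as KF.
  { intros i Hi El B. rewrite label_rbI in El. apply (first_x C HT EO eb (fst i)); auto.
    apply (lbl_x C eb); auto. unfold iw. apply in_app_iff. left. now apply in_map. }
  inversion R as [Γ1 Γ2 x0 y0 a b c A0 D0 D' Ψ' Ψb B Ψc c0 C' HΨ' HΨb HC E1 E2|
    Γ1 Γ2 x0 y0 b c A0 D0 D' Ψb B B' Ψc c0 C' HΨb HB HC E1 E2]; subst K K';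
    simpl in H1, H2; clear R;
    pose proof H1 as (Ha & _ & Hx & Hd); pose proof H2 as (_ & _ & Hy & _);
    simpl in Ha, Hx, Hd, Hy; subst x0 y0;
    assert (A0 = A) as -> by (inversion Hd; auto);
    apply KT in Hd as [-> Hd];
    destruct (KC _ _ _ _ _ _ H2 HC) as [-> H2'];
    (split; [|exact H2']); clear H2' HC KC;
    (split; [|split; [constructor|split; [reflexivity|exact Hd]]]);
    simpl; apply mset_map_inv in Ha as (e & C0 & P & He & Hm);
    apply ep_align in He as (Qe & Ne & Te);
    (assert (In e C1) as He by (eapply Permutation_in; [symmetry; exact P|simpl; auto]));
    (assert (e = eb) as -> by (apply (wn_inj (comp L1 L2)); auto; apply (v_decl VC)));
    (apply mset_sym; [apply ep_equiv|]);
    (apply (mset_perm_l _ _ (map (rb (lin x D f) (lout x [] D N1 g)) (eb :: C0)));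
        [now apply Permutation_map|]);
    (apply mset_sym; [apply ep_equiv|]); (apply mset_cons; [|now apply (M1 eb)]);
    pose proof (v_iw VC eb (I1 _ Hb)) as NDb.
  (* If [w] were still in the type of [eb], the box labelled [x] would be an earlier input from the
     remaining outputs, which [first_x] excludes. *)
  - assert (In w (map fst (wp eb))) as Wp.
    { unfold iw in Wb. apply in_app_iff in Wb as [|Wt]; auto. exfalso.
      apply queue_eq_perm in Qe.
      assert (In (Msg x a (dual A)) (map (rbI (lin x T f)) (wp eb))) as Hi.
      { eapply Permutation_in; [exact Qe|]. apply in_app_iff. simpl; auto. }
      apply in_map_iff in Hi as (i & Ei & Hi). apply (KF i Hi); [now rewrite Ei|].
      unfold iw. apply before_app. right; right. split; auto. now apply in_map. }
    assert (exists (p1 : list item) m (p2 : list item),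
      wp eb = p1 ++ @cons item (w, m) p2) as (p1 & m & p2 & Ep).
    { apply in_split_map in Wp as (p1 & [w' m] & p2 & Ep & Ew). simpl in Ew. subst w'. eauto. }
    assert (forall i, In i p1 \/ In i p2 -> fst i <> w) as Npw.
    { intros i Hi E. unfold iw in NDb. rewrite Ep, map_app in NDb. simpl in NDb.
      rewrite <- app_assoc in NDb. apply NoDup_mid in NDb as [_ NDb]. apply NDb.
      rewrite <- E, !in_app_iff. destruct Hi; auto using in_map. }
    rewrite Ep, map_app in Qe. simpl map in Qe.
    assert (~ In w (match wt eb with Some T0 => ins T0 | None => [] end)) as Nwt.
    { intro Hi. unfold iw in NDb. rewrite Ep, map_app in NDb. simpl in NDb.
      rewrite <- app_assoc in NDb. apply NoDup_mid in NDb as [_ NDb]. apply NDb.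
      rewrite !in_app_iff. auto. }
    apply (queue_relabel x (wn ec)) in Qe as [Eb Qe]; auto.
    + split; [|split; [reflexivity|]].
      * simpl. rewrite Ep, map_app, map_cons.
        replace (rbI (lin x D f) (w, m)) with (Msg (wn ec) a (dual A)).
        -- rewrite (rbI_ext (lin x D f) (lin x T f) p1), (rbI_ext (lin x D f) (lin x T f) p2); auto;
             intros v Hv; symmetry; apply lin_tensor; apply in_map_iff in Hv as (i & <- & Hi); auto.
        -- destruct m as [[z A']|]; simpl in Eb; [|discriminate]. injection Eb as _ -> ->.
           simpl. now rewrite F1w'.
      * simpl. destruct B as [B|], (wt eb) as [Tb|] eqn:Et; simpl in *; auto.
        erewrite rbT_ext; [exact Te| |]; intros v Hv; symmetry.
        -- apply lin_tensor. intros ->. auto.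
        -- apply lout_tensor. intros ->. apply (ow1_outs C HT eb w); simpl; auto.
           unfold ow. now rewrite Et.
    + apply Forall_map, Forall_forall. intros i Hi El. apply (KF i); auto.
      * rewrite Ep, in_app_iff. auto.
      * unfold iw. rewrite Ep, map_app. simpl. rewrite <- app_assoc. apply before_app.
        right; right. split; [now apply in_map|]. simpl; auto.
    + apply Forall_map, Forall_forall. intros i Hi El. rewrite label_rbI in El.
      assert (~ In (fst i) (outs T)) as Ni by (intro Ho; rewrite lin_in in El; auto).
      rewrite lin_out in El by auto. apply Ni. apply (after_c C HT EO eb (fst i) ec); auto.
      unfold iw. rewrite Ep, map_app. simpl. rewrite <- app_assoc. apply before_app.
      right; left. simpl. left. split; auto. apply in_app_iff. left. now apply in_map.
    + change (label (rbI (lin x T f) (w, m)) = x). now rewrite label_rbI.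
  - assert (~ In w (map fst (wp eb))) as Wp.
    { intro Wp. apply in_map_iff in Wp as (i & Ei & Hi). apply queue_eq_perm in Qe.
      assert (In (rbI (lin x T f) i) Ψb) as Hi'.
      { eapply Permutation_in; [symmetry; exact Qe|]. now apply in_map. }
      rewrite Forall_forall in HΨb. apply (HΨb _ Hi'). rewrite label_rbI, Ei. exact F1w. }
    unfold iw in Wb. apply in_app_iff in Wb as [Wb|Wb]; [tauto|].
    split; [|split; [reflexivity|]].
    + simpl. rewrite (rbI_ext (lin x D f) (lin x T f)); [exact Qe|].
      intros v Hv. symmetry. apply lin_tensor. intros ->. auto.
    + simpl. destruct (wt eb) as [Tb|] eqn:Et; [|destruct Wb]. simpl in Te |- *.
      destruct (repar_cong _ _ _ _ _ Te HB) as (E2 & HE2 & Hq).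
      rewrite <- Fc in HE2.
      pose proof (eq_trans (eq_sym HE2) (repar_step C HT eb Tb _ Hb Et Wb)) as RS.
      injection RS as ->. erewrite rbT_ext; [exact Hq|reflexivity|].
      intros v Hv. symmetry. apply lout_tensor. intros ->. apply (ow1_outs C HT eb w); simpl; auto.
      unfold ow. now rewrite Et.
Qed.

(** * Progress of substitution *)

Lemma lab_filter c l q : lab l (filter (fun b => negb (label b =? c)) q) = if c =? l then [] else lab l q.
Proof.
  induction q as [|b q IH]; simpl; [destruct (c =? l); auto|].
  destruct (Nat.eqb_spec (label b) c) as [E|N]; simpl; rewrite IH;
    destruct (Nat.eqb_spec c l) as [E'|N']; auto;
    destruct (Nat.eqb_spec (label b) l); try congruence.
Qed.

Lemma lab_lab c l q : lab l (lab c q) = if c =? l then lab c q else [].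
Proof.
  destruct (Nat.eqb_spec c l) as [->|N].
  - apply lab_id, Forall_forall. intros b Hb. now apply lab_in in Hb.
  - apply lab_nil, Forall_forall. intros b Hb. apply lab_in in Hb as [_ ->]. auto.
Qed.

(** Produces the shape demanded by [subst_queued]: the boxes already labelled [c] stay in front of
    the message, and all other boxes overtaken by it are moved behind it, none of them having its
    label. *)
Lemma queue_split x c b q1 q2 :
  x <> c -> Forall (fun b => label b <> x) q1 -> label b = x ->
  queue_eq (q1 ++ b :: q2) (lab c q1 ++ b :: filter (fun b => negb (label b =? c)) q1 ++ q2).
Proof.
  intros N H E. apply queue_eq_lab. intro l.
  rewrite !lab_app, !lab_cons, !lab_app, lab_lab, lab_filter, E.
  destruct (Nat.eqb_spec c l) as [El|Nl], (Nat.eqb_spec x l) as [El'|Nl']; simpl; auto.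
  - congruence.
  - now rewrite El.
  - rewrite <- El', (lab_nil x q1) by auto. reflexivity.
Qed.

(** The first wire of the formula has a unique receiver, which holds it either in its queue or in
    its type; this decides which of the two substitution rules applies. *)
Lemma subst_progress {typ x q U L1 y q' L2 f g} (C : Composite typ x q U L1 y q' L2 f g) {A w D}
  (HT : Suf typ (WTensor A w D) U) :
  exists K K', subst_rule K K' /\
    side_eq ep_eq (fst K) (uside f g x (WTensor A w D) (names L1) (map unm L1)) /\
    side_eq ep_eq (snd K) (uside f g y (wdual (WTensor A w D)) (names L2) (map unm L2)).
Proof.
  pose proof (Composite_Valid C) as VC.
  assert (typ w = Some (dual A)) as Tw by (destruct (sf_t HT) as [E _]; auto).
  assert (typ w <> None) as Nw by congruence.
  set (T := WTensor A w D) in *. set (O := outs D).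
  assert (outs T = w :: O) as EO by reflexivity.
  destruct (supp_b C HT EO Nw) as (eb & Hb & Wb & Gb & _).
  destruct (cons_c C HT EO) as (ec & Hc & Wc & Fc & _).
  assert (In eb (comp L1 L2)) as Hb' by (apply in_app_iff; auto).
  assert (In ec (comp L1 L2)) as Hc' by (apply in_app_iff; auto).
  assert (wn ec <> x) as Ncx by (apply (x_fresh C); auto).
  assert (NoDup (w :: O)) as DO by (rewrite <- EO; apply (outs_nd C HT)).
  assert (~ In w (ins D)) as NwI by (intro H; apply (ins_outs C HT w); simpl; auto).
  assert (lin x T f w = x) as F1w by (apply lin_in; simpl; auto).
  assert (lin y (wdual T) f w = wn ec) as F2w.
  { rewrite lin_out; auto. rewrite outs_wdual. exact NwI. }
  assert (lout x [] T (names L1) g w = [wn eb]) as G1w.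
  { rewrite lout_outs, Gb; simpl; auto. replace (memb (wn eb) (names L1)) with true; auto.
    symmetry. apply memb_in. now apply in_names. }
  destruct (in_perm_cons _ _ Hb) as (B0 & PB). destruct (in_perm_cons _ _ Hc) as (C0 & PC).
  set (f1 := lin x T f) in *. set (g1 := lout x [] T (names L1) g) in *.
  set (f2 := lin y (wdual T) f) in *. set (g2 := lout y [] (wdual T) (names L2) g) in *.
  set (Γ1 := map (rb f1 g1) B0). set (Γ2 := map (rb f2 g2) C0).
  unfold ow in Wc. destruct (wt ec) as [Tc|] eqn:Ec; [|destruct Wc].
  pose proof (retensor_step C HT ec Tc (wn eb) Hc Ec Wc Gb) as RS.
  set (D1 := rbT f1 g1 D). set (D2 := rbT f2 g2 (wdual D)).
  set (Ψc := map (rbI f2) (wp ec)).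
  assert (side_eq ep_eq (Side (Ep Ψc (wn ec) (Some (rbT f2 g2 Tc)) :: Γ2) [] y (APar (dual A) (wn ec) D2))
    (uside f g y (wdual T) (names L2) (map unm L2))) as S2.
  { split; [|split; [constructor|split; [reflexivity|]]].
    - simpl. apply mset_sym; [apply ep_equiv|].
      apply (mset_perm_l _ _ (map (rb f2 g2) (ec :: C0))); [now apply Permutation_map|].
      apply mset_Forall2. constructor; [|apply Forall2_ep_refl]. unfold rb, Ψc. rewrite Ec.
      apply ep_eq_refl.
    - change (aty_eq (APar (dual A) (wn ec) D2) (APar (dual A) (f2 w) D2)). rewrite F2w.
      apply aty_eq_refl. }
  assert (forall q0, queue_eq q0 (map (rbI f1) (wp eb)) ->
    side_eq ep_eq (Side (Ep q0 (wn eb) (option_map (rbT f1 g1) (wt eb)) :: Γ1) [] x (ATensor A (wn eb) D1))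
      (uside f g x T (names L1) (map unm L1))) as S1.
  { intros q0 Hq. split; [|split; [constructor|split; [reflexivity|]]].
    - simpl. apply mset_sym; [apply ep_equiv|].
      apply (mset_perm_l _ _ (map (rb f1 g1) (eb :: B0))); [now apply Permutation_map|].
      apply mset_Forall2. constructor; [|apply Forall2_ep_refl].
      split; [now apply queue_eq_sym|split; [reflexivity|]]. simpl.
      destruct (wt eb); simpl; auto. apply aty_eq_refl.
    - change (aty_eq (ATensor A (wn eb) D1) (ATensor A (hd 0 (g1 w)) D1)). rewrite G1w.
      apply aty_eq_refl. }
  assert (forall i, In i (wp eb) -> label (rbI f1 i) = x -> before (iw eb) (fst i) w -> False) as KF.
  { intros i Hi El B. rewrite label_rbI in El. apply (first_x C HT EO eb (fst i)); auto.
    apply (lbl_x C eb); auto. unfold iw. apply in_app_iff. left. now apply in_map. }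
  pose proof Wb as Wb'. unfold iw in Wb'. apply in_app_iff in Wb' as [Wp|Wt].
  - assert (exists (p1 : list item) m (p2 : list item),
      wp eb = p1 ++ @cons item (w, m) p2) as (p1 & m & p2 & Ep).
    { apply in_split_map in Wp as (p1 & [w' m] & p2 & Ep & Ew). simpl in Ew. subst w'. eauto. }
    assert (exists z, m = Some (z, dual A)) as [z ->].
    { destruct (v_tok VC eb Hb') as [K _]. rewrite Ep, Forall_app in K. destruct K as [_ K].
      apply Forall_inv in K. unfold itemok in K. simpl in K. rewrite Tw in K.
      destruct m as [[z A']|]; simpl in K; [|discriminate]. injection K as <-. eauto. }
    eexists (_, _), _. split; [|split; [apply S1|exact S2]].
    + eapply (subst_queued Γ1 Γ2 x y z (wn eb) (wn ec) A D1 D2 (lab (wn ec) (map (rbI f1) p1))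
        (filter (fun b => negb (label b =? wn ec)) (map (rbI f1) p1) ++ map (rbI f1) p2)).
      * apply Forall_forall. intros b Hi. now apply lab_in in Hi.
      * apply Forall_app. split.
        -- apply Forall_forall. intros b Hi. apply filter_In in Hi as [_ Hi].
           destruct (Nat.eqb_spec (label b) (wn ec)); [discriminate|auto].
        -- apply Forall_map, Forall_forall. intros i Hi El. rewrite label_rbI in El.
           assert (~ In (fst i) (outs T)) as Ni by (intro Ho; unfold f1 in El; rewrite lin_in in El; auto).
           unfold f1 in El. rewrite lin_out in El by auto. apply Ni.
           apply (after_c C HT EO eb (fst i) ec); auto.
           unfold iw. rewrite Ep, map_app. simpl. rewrite <- app_assoc. apply before_app.
           right; left. simpl. left. split; auto. apply in_app_iff. left. now apply in_map.
      * exact RS.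
    + rewrite Ep, map_app, map_cons. apply queue_eq_sym.
      change (rbI f1 (w, Some (z, dual A))) with (Msg (f1 w) z (dual A)). rewrite F1w.
      apply (queue_split x); auto. apply Forall_map, Forall_forall. intros i Hi El.
      apply (KF i); auto.
      * rewrite Ep, in_app_iff. auto.
      * unfold iw. rewrite Ep, map_app. simpl. rewrite <- app_assoc. apply before_app.
        right; right. split; [now apply in_map|]. simpl; auto.
  - destruct (wt eb) as [Tb|] eqn:Eb; [|destruct Wt].
    pose proof (repar_step C HT eb Tb g1 Hb Eb Wt) as RP. fold T in RP. rewrite Fc in RP.
    eexists (_, _), _. split; [|split; [apply S1, qe_refl|exact S2]].
    eapply subst_unreceived; [|exact RP|exact RS].
    apply Forall_map, Forall_forall. intros i Hi El. apply (KF i); auto.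
    unfold iw. rewrite Eb. apply before_app. right; right. split; auto. now apply in_map.
Qed.

(** * The last step of substitution *)

Lemma mset_map_app {E A : Type} (R : E -> E -> Prop) (F : A -> E) l1 l2 L :
  mset_eq R (l1 ++ l2) (map F L) ->
  exists La Lb, Permutation L (La ++ Lb) /\ Forall2 R l1 (map F La) /\ Forall2 R l2 (map F Lb).
Proof.
  intros (l0 & P & H).
  destruct (perm_Forall2 _ _ (l1 ++ l2) _ (Permutation_sym P) H) as (k & Pk & Hk).
  symmetry in Pk. apply Permutation_map_inv in Pk as (L0 & -> & PL).
  apply Forall2_app_inv_l in Hk as (k1 & k2 & H1 & H2 & E0).
  apply map_eq_app in E0 as (La & Lb & -> & <- & <-).
  exists La, Lb. auto.
Qed.

Lemma Forall2_map_impl {A B E : Type} (R : E -> E -> Prop) (h h' : A -> E) (k k' : B -> E) l m :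
  Forall2 R (map h l) (map k m) ->
  (forall a b, In b m -> R (h a) (k b) -> R (h' a) (k' b)) ->
  Forall2 R (map h' l) (map k' m).
Proof.
  revert l. induction m as [|b m IH]; intros [|a l] F H; inversion F; subst; constructor.
  - apply H; simpl; auto.
  - apply IH; auto. intros; apply H; simpl; auto.
Qed.

Lemma Forall2_map_step {B E : Type} (R S : E -> E -> Prop) (k k' : B -> E) l l' m :
  Forall2 R l (map k m) -> Forall2 S l l' ->
  (forall a a' b, In b m -> R a (k b) -> S a a' -> R a' (k' b)) ->
  Forall2 R l' (map k' m).
Proof.
  revert l l'. induction m as [|b m IH]; intros l l' F G H; inversion F; subst; inversion G; subst;
    constructor.
  - eapply H; simpl; eauto.
  - eapply IH; eauto. intros; eapply H; simpl; eauto.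
Qed.

Section Last.
Context {typ x q U L1 y q' L2 f g} (C : Composite typ x q U L1 y q' L2 f g) {w : wire}
  (HT : Suf typ (WOne w) U).
Let T := WOne w.
Let f1 := lin x T f.
Let g1 := lout x [] T (names L1) g.
Let f2 := lin y (wdual T) f.
Let g2 := lout y [] (wdual T) (names L2) g.
Let VC := Composite_Valid C.
Let L := c_l C.
Let EO : outs (WOne w) = w :: [] := eq_refl.
Let C1 := map unm L1.
Let C2 := map unm L2.

Lemma inc1 e : In e C1 -> In e (comp L1 L2).
Proof. intro. apply in_app_iff; auto. Qed.

Lemma inc2 e : In e C2 -> In e (comp L1 L2).
Proof. intro. apply in_app_iff; auto. Qed.

Lemma f1_other a : a <> w -> f1 a = f a.
Proof. intro. apply lin_out. simpl. intuition. Qed.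

Lemma f1_w : f1 w = x.
Proof. apply lin_in. simpl; auto. Qed.

Lemma f2_any a : f2 a = f a.
Proof. apply lin_out. simpl. auto. Qed.

Lemma g1_other a : a <> w -> g1 a = g a.
Proof. intro. apply lout_out; simpl; intuition. Qed.

Lemma g2_other a : a <> w -> g2 a = g a.
Proof. intro. apply lout_out; simpl; intuition. Qed.

Lemma w_none : typ w = None.
Proof. exact (sf_t HT). Qed.

Lemma g1_ow e a : In e C1 -> In a (ow e) -> g1 a = g a.
Proof. intros He Ha. apply g1_other. intros ->. apply (ow1_outs C HT e w); simpl; auto. Qed.

Lemma last_rb1 e : In e C1 -> ~ In w (iw e) -> rb f1 g1 e = rb f g e.
Proof.
  intros He Hw. apply rb_ext; intros a Ha.
  - apply f1_other. intros ->. auto.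
  - now apply (g1_ow e).
Qed.

Lemma last_g n : In n (g w) <-> exists e, In e (comp L1 L2) /\ wn e = n /\ In w (iw e).
Proof.
  destruct (cons_c C HT EO) as (c & Hc & Wc & _). apply (l_g L c); auto. now apply inc2.
Qed.

Lemma last_gnd : NoDup (g w).
Proof.
  destruct (cons_c C HT EO) as (c & Hc & Wc & _). apply (l_nd L c); auto. now apply inc2.
Qed.

Lemma g1_w : g1 w = filter (fun n => memb n (names L1)) (g w).
Proof. apply lout_outs; simpl; auto. Qed.

Lemma last_names e us : In e C1 -> Permutation us (g1 w) -> (In (wn e) us <-> In w (iw e)).
Proof.
  intros He P. assert (In (wn e) us <-> In (wn e) (g1 w)) as ->
    by (split; apply Permutation_in; auto; now symmetry).
  rewrite g1_w, filter_In, memb_in, last_g. split.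
  - intros [(e' & He' & En & Hw) _]. replace e with e'; auto.
    apply (wn_inj (comp L1 L2)); auto; [apply (v_decl VC)|now apply inc1].
  - intro Hw. split; [|now apply in_names]. exists e. split; auto. now apply inc1.
Qed.

(* Since w is the last output of c, no box for c follows the star w. *)
Lemma star_queue e : In e C1 -> In w (iw e) -> wt e = None ->
  exists p1 p2 : list item, wp e = p1 ++ @cons item (w, None) p2 /\
    Forall (fun b => label b <> x) (map (rbI f1) p1) /\
    Forall (fun b => label b <> x) (map (rbI f1) p2) /\
    Forall (fun b => label b <> f w) (map (rbI f1) p2) /\
    map (rbI f1) p1 = map (rbI f) p1 /\ map (rbI f1) p2 = map (rbI f) p2.
Proof.
  intros He Hw Et. pose proof (v_iw VC e (inc1 _ He)) as ND.
  destruct (cons_c C HT EO) as (c & Hc & Wc & Fc & _).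
  unfold iw in Hw, ND. rewrite Et, app_nil_r in *.
  apply in_split_map in Hw as (p1 & [w' m] & p2 & E & Ew). simpl in Ew. subst w'.
  assert (m = None) as ->.
  { destruct (v_tok VC e (inc1 _ He)) as [K _]. rewrite E, Forall_app in K. destruct K as [_ K].
    apply Forall_inv in K. unfold itemok in K. simpl in K. rewrite w_none in K.
    destruct m as [[]|]; [discriminate|auto]. }
  exists p1, p2. split; auto.
  rewrite E, map_app in ND. simpl in ND. apply NoDup_mid in ND as [_ ND].
  assert (forall i, In i p1 \/ In i p2 -> fst i <> w) as N.
  { intros i Hi Ei. apply ND. rewrite <- Ei, in_app_iff. destruct Hi; auto using in_map. }
  assert (forall i, In i p1 \/ In i p2 -> In (fst i) (iw e)) as Ii.
  { intros i Hi. unfold iw. apply in_app_iff. left. apply in_map. rewrite E, in_app_iff. simpl. tauto. }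
  assert (forall i, In i p1 \/ In i p2 -> f1 (fst i) <> x) as Nx.
  { intros i Hi El. apply (lbl_x C e (fst i)) in El; auto. simpl in El. apply (N i); intuition. }
  split; [|split; [|split; [|split]]].
  - apply Forall_map, Forall_forall. intros i Hi. rewrite label_rbI. auto.
  - apply Forall_map, Forall_forall. intros i Hi. rewrite label_rbI. auto.
  - apply Forall_map, Forall_forall. intros i Hi. rewrite label_rbI, f1_other by auto.
    intro El. apply (N i); auto. assert (In (fst i) (outs (WOne w))) as K; [|simpl in K; intuition].
    apply (after_c C HT EO e (fst i) c); auto; [|congruence].
    unfold iw. rewrite E, map_app. simpl. rewrite !before_app. left. right; left. simpl. left.
    split; auto. now apply in_map.
  - apply rbI_ext. intros a Ha. apply f1_other. apply in_map_iff in Ha as (i & <- & Hi). auto.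
  - apply rbI_ext. intros a Ha. apply f1_other. apply in_map_iff in Ha as (i & <- & Hi). auto.
Qed.

(** An active endpoint has not received a star, and [w] is a unit wire, so [w] must be in its
    type. *)
Lemma star_ins e T0 : In e C1 -> In w (iw e) -> wt e = Some T0 -> In w (ins T0) /\ ~ In w (map fst (wp e)).
Proof.
  intros He Hw Et. destruct (v_tok VC e (inc1 _ He)) as [K K2]. rewrite Et in K2.
  assert (~ In w (map fst (wp e))) as N.
  { intro H. apply in_map_iff in H as (i & Ei & Hi). rewrite Forall_forall in K. specialize (K _ Hi).
    unfold itemok in K. rewrite Ei, w_none in K. destruct K2 as [_ K2].
    apply (msg_only_in _ _ K2 Hi). destruct (snd i) as [[]|]; [discriminate|auto]. }
  split; auto. unfold iw in Hw. rewrite Et in Hw. apply in_app_iff in Hw. tauto.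
Qed.

Lemma rebot_step e T0 G : In e C1 -> In w (iw e) -> wt e = Some T0 ->
  rebot x (f w) (rbT f1 G T0) = Some (rbT f G T0).
Proof.
  intros He Hw Et. destruct (star_ins e T0 He Hw Et) as [Hi _].
  destruct (comp_nd_outs C e T0 (inc1 _ He) Et) as (_ & N & K).
  apply (rebot_rb typ) with (w := w); auto using w_none, f1_w.
  intros a _ Na. symmetry. now apply f1_other.
Qed.

Lemma star_end p e : In e C1 -> In w (iw e) ->
  ep_eq (term_ep x p) (rb f1 g1 e) -> ep_eq (term_ep (f w) p) (rb f g e).
Proof.
  intros He Hw Hp. destruct (cons_c C HT EO) as (ec & Hc & _ & Fc & _).
  apply ep_align in Hp as (Hq & Hn & Ht). split; [|split]; simpl; auto.
  - destruct (wt e) as [|] eqn:Et; [destruct Ht|].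
    destruct (star_queue e He Hw Et) as (p1 & p2 & Ep & Q1 & Q2 & Q3 & Q4 & Q5).
    rewrite Ep, map_app, map_cons in *. rewrite <- Q4, <- Q5.
    change (rbI f1 (w, None)) with (Star (f1 w)) in Hq. rewrite f1_w in Hq.
    change (rbI f (w, None)) with (Star (f w)).
    apply (queue_relabel_star x); auto. rewrite Fc. apply not_eq_sym. apply (x_fresh C).
    now apply inc2.
  - destruct (wt e); auto.
Qed.

Lemma bot_end p p' e : In e C1 -> In w (iw e) ->
  ep_eq p (rb f1 g1 e) -> rebot_ep x (f w) p p' -> ep_eq p' (rb f g e).
Proof.
  intros He Hw Hp (Ψ & b & B & B' & Hr & -> & ->). apply ep_align in Hp as (Hq & Hn & Ht).
  destruct (wt e) as [T0|] eqn:Et; [|destruct Ht]. simpl in Ht.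
  destruct (star_ins e T0 He Hw Et) as [Hi Hni].
  split; [|split]; simpl; auto.
  - rewrite (rbI_ext f f1); [exact Hq|]. intros a Ha. symmetry. apply f1_other. intros ->. auto.
  - rewrite Et. simpl. destruct (rebot_cong _ _ _ _ _ Ht Hr) as (B2 & HB & Hq2).
    rewrite (rebot_step e T0 g1 He Hw Et) in HB. injection HB as <-.
    erewrite rbT_ext; [exact Hq2|reflexivity|]. intros a Ha. symmetry.
    apply (g1_ow e); auto. unfold ow. now rewrite Et.
Qed.

(** The mask [y] stands for the receivers of [w] on the first side, and [us] lists them. Replacing
    [y] by [us] therefore restores [g w], up to the order that [aty_eq] ignores. *)
Lemma reone_step c Tc us : In c C2 -> wt c = Some Tc -> In w (outs Tc) -> Permutation us (g1 w) ->
  exists B, reone y us (rbT f2 g2 Tc) = Some B /\ aty_eq B (rbT f g Tc).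
Proof.
  intros Hc Et Hw P. destruct (comp_nd_outs C c Tc (inc2 _ Hc) Et) as (N & _ & K).
  set (g' := fun a => if Nat.eq_dec a w then us ++ remove Nat.eq_dec y (g2 w) else g2 a).
  assert (g2 w = y :: filter (fun n => memb n (names L2)) (g w)) as G2.
  { apply lout_in. simpl; auto. }
  assert (reone y us (rbT f2 g2 Tc) = Some (rbT f2 g' Tc)) as R.
  { apply (reone_rb typ) with (w := w); auto using w_none.
    - rewrite G2. simpl; auto.
    - unfold g'. destruct (Nat.eq_dec w w); [reflexivity|congruence].
    - intros a _ Na. unfold g'. destruct (Nat.eq_dec a w); [congruence|reflexivity]. }
  eexists. split; [exact R|]. apply (rbT_eq typ); [exact K|intros; apply f2_any|].
  - intros a Ha. unfold g'. destruct (Nat.eq_dec a w) as [->|Na].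
    + split; [|rewrite w_none; congruence]. rewrite G2. simpl.
      destruct Nat.eq_dec as [_|]; [|congruence].
      rewrite notin_remove.
      * rewrite P, g1_w. apply NoDup_Permutation.
        -- apply NoDup_app_iff. split; [|split]; try apply NoDup_filter; try apply last_gnd.
           intros n H H'. apply filter_In in H as [_ H]. apply filter_In in H' as [_ H'].
           apply memb_in in H, H'. exact (names_disj _ _ _ _ _ _ _ _ n (c_s C) H H').
        -- apply last_gnd.
        -- intro n. rewrite in_app_iff, !filter_In, !memb_in. split; [tauto|]. intro H.
           pose proof H as H'. apply last_g in H' as (e & He & <- & _).
           apply in_app_iff in He as [He|He]; apply in_names in He; tauto.
      * intro H. apply filter_In in H as [_ H]. apply memb_in in H.
        apply in_map_iff in H as (pe & E & Hpe).
        apply (y_fresh C (unm pe)); auto. now apply in_comp_r.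
    + rewrite g2_other by auto. auto.
Qed.

(** The annotation of the unit consists of the receivers of [w] on the first side. So the groups
    distinguished by the rule are the terminated receivers and the waiting ones, and the remaining
    entries do not involve [w] and are already unmasked. *)
Lemma last_sound K Γ :
  subst_last_rule K Γ ->
  side_eq ep_eq (fst K) (uside f g x T (names L1) C1) ->
  side_eq ep_eq (snd K) (uside f g y (wdual T) (names L2) C2) ->
  ctx_eq Γ (map (rb f g) (comp L1 L2)).
Proof.
  intros R (H1 & _ & Hx & Ht) (H2 & _ & Hy & Ht2).
  destruct R as [Γ1 Γ2 x0 y0 a|Γ1 Γ2 x0 y0 c ps Δ Δ' Ψc E E' us HΔ HE].
  { exfalso. simpl in Ht. inversion Ht. }
  simpl in H1, H2, Hx, Hy. subst x0 y0.
  change (aty_eq (AOne us) (AOne (g1 w))) in Ht. change (aty_eq (ABot c) (ABot (f2 w))) in Ht2.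
  assert (Permutation us (g1 w)) as Pu by (inversion Ht; auto).
  assert (c = f w) as -> by (rewrite <- f2_any; inversion Ht2; auto).
  clear Ht Ht2. fold f1 g1 in H1. fold f2 g2 in H2. change (map unm L1) with C1 in H1.
  apply mset_map_app in H1 as (Ca & C' & P1 & Fa & F').
  apply Forall2_app_inv_l in F' as (k1 & k2 & Fb & Fd & Ek).
  apply map_eq_app in Ek as (Cb & Cd & -> & <- & <-).
  destruct (cons_c C HT EO) as (ec & Hc & Wc & Fc & _).
  assert (map snd ps = map wn Cb) as Nb.
  { clear -Fb. revert ps Fb. induction Cb as [|e Cb IH]; intros [|p ps] F; inversion F as [|? ? ? ? Hp F']; subst; auto.
    simpl. f_equal; auto. apply Hp. }
  assert (map ep_name Δ = map wn Cd) as Nd.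
  { clear -Fd. revert Δ Fd. induction Cd as [|e Cb IH]; intros [|p ps] F; inversion F as [|? ? ? ? Hp F']; subst; auto.
    simpl. f_equal; auto. apply Hp. }
  assert (us = map wn (Cb ++ Cd)) as Eus by (unfold us; rewrite map_app; congruence).
  assert (NoDup (map wn C1)) as ND.
  { pose proof (NoDup_wn _ (v_decl VC)) as ND. unfold comp in ND. rewrite map_app in ND.
    apply NoDup_app_iff in ND. tauto. }
  assert (NoDup (map wn (Ca ++ Cb ++ Cd))) as ND' by now rewrite <- P1.
  rewrite map_app in ND'. apply NoDup_app_iff in ND' as (_ & _ & ND').
  assert (forall e, In e (Ca ++ Cb ++ Cd) -> In e C1) as I1
    by (intros e He; eapply Permutation_in; [symmetry; exact P1|auto]).
  assert (Forall2 ep_eq Γ1 (map (rb f g) Ca)) as Ra.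
  { erewrite map_ext_in; [exact Fa|]. intros e He. symmetry.
    assert (In e C1) as He' by (apply I1, in_app_iff; auto). apply last_rb1; auto.
    intro Hw. apply (last_names e us He' Pu) in Hw. apply (ND' (wn e)); [now apply in_map|].
    now rewrite <- Eus. }
  assert (forall e, In e (Cb ++ Cd) -> In e C1 /\ In w (iw e)) as Ib.
  { intros e He. assert (In e C1) as He' by (apply I1, in_app_iff; auto). split; auto.
    apply (last_names e us He' Pu). rewrite Eus. now apply in_map. }
  assert (Forall2 ep_eq (map (term_ep (f w)) ps) (map (rb f g) Cb)) as Rb.
  { apply (Forall2_map_impl _ _ _ _ _ _ _ Fb). intros p e He. apply star_end; apply Ib, in_app_iff; auto. }
  assert (Forall2 ep_eq Δ' (map (rb f g) Cd)) as Rd.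
  { apply (Forall2_map_step _ _ _ _ _ _ _ Fd HΔ). intros p p' e He.
    apply bot_end; apply Ib, in_app_iff; auto. }
  assert (mset_eq ep_eq (Γ2 ++ [Ep Ψc (f w) (Some E')]) (map (rb f g) C2)) as R2.
  { apply (mset_perm_l _ _ _ _ (Permutation_sym (Permutation_cons_append _ _))).
    apply (mset_perm_l ep_eq _ _ _ (Permutation_cons_append _ _)) in H2.
    apply mset_map_inv in H2 as (e & C0 & P2 & He & Hm). apply ep_align in He as (Hq & Hn & Hte).
    assert (In e C2) as He by (eapply Permutation_in; [symmetry; exact P2|simpl; auto]).
    assert (In w (ow e)) as We.
    { destruct (cons_c C HT EO) as (ec' & Hc' & Wc' & Fc' & _).
      replace e with ec'; auto. apply (wn_inj (comp L1 L2)); auto using inc2; [apply (v_decl VC)|].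
      congruence. }
    assert (NoDup (map wn C2)) as ND2.
    { pose proof (NoDup_wn _ (v_decl VC)) as ND2. unfold comp in ND2. rewrite map_app in ND2.
      apply NoDup_app_iff in ND2. tauto. }
    apply mset_sym; [apply ep_equiv|].
    apply (mset_perm_l _ _ (map (rb f g) (e :: C0))); [now apply Permutation_map|].
    apply mset_sym; [apply ep_equiv|]. apply mset_cons.
    - split; [exact Hq|split; [exact Hn|]]. simpl.
      unfold ow in We. destruct (wt e) as [Tc|] eqn:Et; [|destruct We]. simpl in Hte |- *.
        destruct (reone_cong _ _ _ _ _ Hte HE) as (B & HB & Hq2).
        destruct (reone_step e Tc us He Et We Pu) as (B' & HB' & Hq3).
        pose proof (eq_trans (eq_sym HB) HB') as EB. injection EB as ->. eauto using aty_eq_trans.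
    - change (mset_eq ep_eq Γ2 (map (rb f g) C0)).
      erewrite map_ext_in; [exact Hm|]. intros e' He'. apply rb_ext; intros a Ha.
      + symmetry. apply f2_any.
      + symmetry. apply g2_other. intros ->. rewrite P2 in ND2. simpl in ND2.
        inversion ND2 as [|? ? Nn _]. apply Nn. replace e with e'; [now apply in_map|].
        eapply ow_uniq; [exact VC| | | |]; eauto; apply inc2; auto.
        eapply Permutation_in; [symmetry; exact P2|simpl; auto]. }
  apply (mset_perm_l _ _ ((Γ1 ++ map (term_ep (f w)) ps ++ Δ') ++ Γ2 ++ [Ep Ψc (f w) (Some E')]));
    [now rewrite <- !app_assoc|].
  unfold comp. rewrite map_app. apply mset_app; auto.
  apply mset_sym; [apply ep_equiv|].
  apply (mset_perm_l _ _ (map (rb f g) (Ca ++ Cb ++ Cd))); [now apply Permutation_map|].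
  apply mset_sym; [apply ep_equiv|]. rewrite !map_app. apply mset_Forall2.
  apply Forall2_app; auto. now apply Forall2_app.
Qed.

Lemma partition3 (l : list wep) : (forall e, In e l -> In e C1) ->
  exists la lb lc, Permutation l (la ++ lb ++ lc) /\
    (forall e, In e la -> ~ In w (iw e)) /\ (forall e, In e lb -> In w (iw e) /\ wt e = None) /\
    (forall e, In e lc -> In w (iw e) /\ wt e <> None).
Proof.
  induction l as [|e l IH]; intro I.
  - exists [], [], []. simpl. split; [constructor|]. split; [|split]; intros ? [].
  - destruct IH as (la & lb & lc & P & Ha & Hb & Hc); [intros; apply I; simpl; auto|].
    destruct (in_dec Nat.eq_dec w (iw e)) as [Hw|Hw]; [destruct (wt e) as [T0|] eqn:Et|].
    + exists la, lb, (e :: lc). split; [|split; [|split]]; auto.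
      * rewrite P, !app_assoc. apply Permutation_middle.
      * intros a [<-|Ha']; auto. split; congruence || auto.
    + exists la, (e :: lb), lc. split; [|split; [|split]]; auto.
      * rewrite P. apply Permutation_middle.
      * intros a [<-|Ha']; auto.
    + exists (e :: la), lb, lc. split; [|split; [|split]]; auto.
      * rewrite P. reflexivity.
      * intros a [<-|Ha']; auto.
Qed.

Lemma Forall2_choice {A B : Type} (R : B -> A -> Prop) (l : list A) :
  (forall a, In a l -> exists b, R b a) -> exists k, Forall2 R k l.
Proof.
  induction l as [|a l IH]; intro H; [exists []; auto|].
  destruct (H a) as [b Hb]; [simpl; auto|]. destruct IH as [k Hk]; [intros; apply H; simpl; auto|].
  exists (b :: k). auto.
Qed.

Lemma last_progress :
  exists K Γ, subst_last_rule K Γ /\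
    side_eq ep_eq (fst K) (uside f g x T (names L1) C1) /\
    side_eq ep_eq (snd K) (uside f g y (wdual T) (names L2) C2).
Proof.
  destruct (partition3 C1) as (Ca & Cb & Cd & P & Ha & Hb & Hd); auto.
  destruct (cons_c C HT EO) as (ec & Hc & Wc & Fc & _).
  destruct (in_perm_cons _ _ Hc) as (C0 & PC).
  assert (forall e, In e (Ca ++ Cb ++ Cd) -> In e C1) as I1
    by (intros e He; eapply Permutation_in; [symmetry; exact P|auto]).
  (* In a terminated receiver no box behind the star is labelled [x], so the star can be swapped to
     the end of the queue, where [term_ep] expects it. *)
  destruct (Forall2_choice (fun p e => ep_eq (term_ep x p) (rb f1 g1 e)) Cb) as [ps Hps].
  { intros e He. destruct (Hb e He) as [Hw Et].
    destruct (star_queue e) as (p1 & p2 & Ep & Q1 & Q2 & _); auto.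
    { apply I1. rewrite !in_app_iff. auto. }
    exists (map (rbI f1) (p1 ++ p2), wn e). split; [|split]; simpl; auto.
    - rewrite Ep, !map_app, map_cons. change (rbI f1 (w, None)) with (Star (f1 w)). rewrite f1_w.
      apply queue_eq_lab. intro l. rewrite !lab_app, lab_cons. simpl.
      destruct (Nat.eqb_spec x l) as [El|Nl]; [|now rewrite !app_nil_r].
      rewrite <- El, (lab_nil x (map (rbI f1) p2)) by auto. now rewrite app_nil_r.
    - now rewrite Et. }
  destruct (Forall2_choice (fun e' e => rebot_ep x (f w) (rb f1 g1 e) e') Cd) as [Δ' HΔ].
  { intros e He. destruct (Hd e He) as [Hw Et]. destruct (wt e) as [T0|] eqn:Et'; [|congruence].
    eexists. unfold rebot_ep. do 4 eexists. split; [|split; [|reflexivity]].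
    - apply (rebot_step e T0 g1); auto. apply I1. rewrite !in_app_iff. auto.
    - unfold rb. rewrite Et'. reflexivity. }
  set (Δ := map (rb f1 g1) Cd). set (us := map snd ps ++ map ep_name Δ).
  assert (Forall2 (rebot_ep x (f w)) Δ Δ') as HΔ'.
  { unfold Δ. clear -HΔ. induction HΔ; simpl; constructor; auto. }
  assert (us = map wn (Cb ++ Cd)) as Eus.
  { unfold us, Δ. rewrite map_app, map_map. f_equal. clear -Hps. induction Hps as [|p e l k Hp F IH]; simpl; auto.
    f_equal; auto. apply Hp. }
  assert (NoDup (map wn C1)) as ND.
  { pose proof (NoDup_wn _ (v_decl VC)) as ND. unfold comp in ND. rewrite map_app in ND.
    apply NoDup_app_iff in ND. tauto. }
  assert (Permutation us (g1 w)) as Pu.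
  { rewrite g1_w. apply NoDup_Permutation.
    - rewrite P, map_app in ND. apply NoDup_app_iff in ND as (_ & ND & _). now rewrite Eus.
    - apply NoDup_filter, last_gnd.
    - intro n. rewrite Eus, filter_In, memb_in, last_g, in_map_iff. split.
      + intros (e & <- & He). assert (In e C1) as He' by (apply I1, in_app_iff; auto).
        split; [|now apply in_names]. exists e. split; [now apply inc1|]. split; auto.
        apply in_app_iff in He as [He|He]; [apply Hb|apply Hd]; auto.
      + intros [(e & He & En & Hw) Hn]. apply in_app_iff in He as [He|He].
        * exists e. split; auto. apply (Permutation_in _ P) in He.
          apply in_app_iff in He as [He|He]; auto. exfalso. apply (Ha e); auto.
        * exfalso. apply in_names in He. rewrite En in He.
          exact (names_disj _ _ _ _ _ _ _ _ n (c_s C) Hn He). }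
  unfold ow in Wc. destruct (wt ec) as [Tc|] eqn:Ec; [|destruct Wc].
  destruct (reone_step ec Tc us Hc Ec Wc Pu) as (B & HB & _).
  eexists (_, _), _. split; [|split].
  - apply (subst_unit (map (rb f1 g1) Ca) (map (rb f2 g2) C0) x y (f w) ps Δ Δ'
      (map (rbI f2) (wp ec)) (rbT f2 g2 Tc) B); auto.
  - split; [|split; [constructor|split; [reflexivity|]]].
    + simpl. apply mset_sym; [apply ep_equiv|].
      apply (mset_perm_l _ _ (map (rb f1 g1) (Ca ++ Cb ++ Cd))); [now apply Permutation_map|].
      apply mset_sym; [apply ep_equiv|]. rewrite !map_app. apply mset_Forall2.
      apply Forall2_app; [apply Forall2_ep_refl|]. apply Forall2_app; [|apply Forall2_ep_refl].
      clear -Hps. induction Hps; simpl; constructor; auto.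
    + simpl. constructor. exact Pu.
  - split; [|split; [constructor|split; [reflexivity|]]].
    + simpl. apply mset_sym; [apply ep_equiv|].
      apply (mset_perm_l _ _ (map (rb f2 g2) (C0 ++ [ec]))).
      { apply Permutation_map. rewrite <- Permutation_cons_append. exact PC. }
      rewrite map_app.
      apply mset_Forall2, Forall2_app; [apply Forall2_ep_refl|]. constructor; [|constructor].
      unfold rb. rewrite Ec, <- Fc. apply ep_eq_refl.
    + change (aty_eq (ABot (f w)) (ABot (f2 w))). apply aty_eq_bot.
Qed.
End Last.

Lemma lin_none x T f a : outs T = [] -> lin x T f a = f a.
Proof. intro E. apply lin_out. rewrite E. auto. Qed.

Lemma lout_none x T N g a : outs T = [] -> ins T = [] -> lout x [] T N g a = g a.
Proof. intros E E'. apply lout_out; rewrite ?E, ?E'; auto. Qed.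

Lemma last_atom f g x y a N1 N2 L1 L2 K Γ :
  subst_last_rule K Γ ->
  side_eq ep_eq (fst K) (uside f g x (WAtom a) N1 (map unm L1)) ->
  side_eq ep_eq (snd K) (uside f g y (WNAtom a) N2 (map unm L2)) ->
  ctx_eq Γ (map (rb f g) (comp L1 L2)).
Proof.
  intros R (H1 & _ & _ & Ht) (H2 & _).
  inversion R; subst; simpl in Ht; [|inversion Ht]. simpl in H1, H2.
  unfold comp. rewrite map_app. apply mset_app.
  - erewrite map_ext; [exact H1|]. intro e. apply rb_ext; intros; symmetry;
      [apply lin_none|apply lout_none]; auto.
  - erewrite map_ext; [exact H2|]. intro e. apply rb_ext; intros; symmetry;
      [apply lin_none|apply lout_none]; auto.
Qed.

(** * Canonical labels of a wiring *)

(** The default 0 is reached only for a wire that no entry of [W] sends, on which a labelling is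
    unconstrained. *)
Definition linW (W : list wep) (w : wire) : name :=
  hd 0 (map wn (filter (fun e => memb w (ow e)) W)).

Definition loutW (W : list wep) (w : wire) : list name :=
  map wn (filter (fun e => memb w (iw e)) W).

Lemma NoDup_map_filter {A B : Type} (F : A -> B) p l : NoDup (map F l) -> NoDup (map F (filter p l)).
Proof.
  induction l as [|a l IH]; simpl; auto. intro H. inversion H as [|? ? N D]; subst.
  destruct (p a); simpl; auto. constructor; auto. intro I. apply N.
  apply in_map_iff in I as (b & <- & I). apply filter_In in I as [I _]. now apply in_map.
Qed.

Lemma linW_spec W e w : NoDup (flat_map ow W) -> In e W -> In w (ow e) -> linW W w = wn e.
Proof.
  intros D He Hw. unfold linW.
  assert (forall e', In e' (filter (fun e => memb w (ow e)) W) -> e' = e) as U.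
  { intros e' H. apply filter_In in H as [H Hw']. apply memb_in in Hw'.
    eapply NoDup_flat_inj; eauto. }
  assert (In e (filter (fun e => memb w (ow e)) W)) as I by (apply filter_In; rewrite memb_in; auto).
  destruct (filter _ W) as [|e' l]; [destruct I|]. simpl. f_equal. apply U. simpl; auto.
Qed.

Lemma loutW_spec W n w : In n (loutW W w) <-> exists e, In e W /\ wn e = n /\ In w (iw e).
Proof.
  unfold loutW. rewrite in_map_iff. split.
  - intros (e & <- & H). apply filter_In in H as [H Hw]. apply memb_in in Hw. eauto.
  - intros (e & H & <- & Hw). exists e. split; auto. apply filter_In. rewrite memb_in. auto.
Qed.

Lemma loutW_nd W w : NoDup (map wn W) -> NoDup (loutW W w).
Proof. apply NoDup_map_filter. Qed.

Lemma Labelling_W typ W : Valid typ W -> Labelling (linW W) (loutW W) W.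
Proof.
  intro V. split.
  - intros e w He Hw. apply linW_spec; auto. apply (v_ow V).
  - intros. apply loutW_nd, NoDup_wn, (v_decl V).
  - intros. apply loutW_spec.
Qed.

(** * Distribution *)

Definition mk (f1 : wire -> name) (g1 : wire -> list name) (pe : list item * wep) : marked :=
  (map (rbI f1) (fst pe), rb f1 g1 (snd pe)).

(** One line during distribution, with [r] what is left of its queue. A wire of [r] is masked, so a
    destination that [g] assigns to it on the other side is not visible yet. *)
Definition mside f g x (r : list item) (T : wty) (Lm : list (list item * wep)) : side marked :=
  Side (map (mk (lin x T f) (lout x r T (names Lm) g)) Lm) (map (rbI (lin x T f)) r) x
    (rbT (lin x T f) (lout x r T (names Lm) g) T).

Lemma unmark_mside f g x T Lm :
  map_side unmark (mside f g x [] T Lm) = uside f g x T (names Lm) (map unm Lm).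
Proof.
  unfold mside, uside, map_side. simpl. f_equal. rewrite !map_map. apply map_ext.
  intros [p e]. unfold unmark, mk, rb, unm. simpl. now rewrite map_app.
Qed.

Definition Fspec (f : wire -> name) (L : list wep) : Prop :=
  forall e w, In e L -> In w (ow e) -> f w = wn e.

(** A distribution step takes a top box only up to queue equality, so the remaining queue may first
    have to be reordered. FIFO survives because wires with one sender keep their order. *)
Lemma CutWiring_reord typ x mx rx rx' T L1 y q' L2 f :
  CutWiring typ x (mx ++ rx) T L1 y q' L2 -> Fspec f L1 -> Permutation rx rx' ->
  (forall a b, before (map fst rx') a b -> before (map fst rx) a b \/ f a <> f b) ->
  CutWiring typ x (mx ++ rx') T L1 y q' L2.
Proof.
  intros S F P B. set (X := WEp (mx ++ rx) x (Some T)). set (X' := WEp (mx ++ rx') x (Some T)).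
  pose proof (s_v1 S) as V. fold X in V.
  pose proof (Labelling_W _ _ V) as LW. set (f' := linW (X :: L1)) in *.
  assert (forall a, In a (map fst rx) -> f' a = f a) as E.
  { intros a Ha. assert (In a (iw X)) as Ia.
    { unfold iw. simpl. rewrite map_app, !in_app_iff. auto. }
    destruct (v_io V X a) as (e & [<-|He] & Hw); simpl; auto.
    - destruct (v_irr V X a); simpl; auto.
    - rewrite (F e), (l_f LW e); simpl; auto. }
  assert (Forall2 (reord f') (X :: L1) (X' :: L1)) as R.
  { constructor.
    - split; [|split; [|split]]; auto; simpl.
      + now apply Permutation_app_head.
      + intros a b. rewrite !map_app, !before_app. intros [H|[H|[H H']]]; auto.
        * destruct (before_in _ _ _ H) as [Ha Hb]. apply B in H as [H|H]; auto. right.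
          rewrite !E; auto; eapply Permutation_in; try apply Permutation_map;
            try (symmetry; exact P); auto.
        * left. right; right. split; auto.
          eapply Permutation_in; [apply Permutation_map; symmetry; exact P|auto].
    - clearbody f'. clear. induction L1; constructor; auto.
      split; [reflexivity|split; [reflexivity|split; [reflexivity|auto]]]. }
  destruct (Valid_reord _ _ _ _ _ V LW R) as [V' _].
  destruct S as [_ S2 S3 S4]. fold X in S3, S4. split; auto; fold X'.
  - intros w (e & He & Hw). apply S3. destruct He as [<-|He]; [|exists e; simpl; auto].
    exists X. split; [simpl; auto|]. destruct Hw as [Hw|Hw]; auto. left.
    unfold iw in *. simpl in *. rewrite map_app, !in_app_iff in *.
    destruct Hw as [[|Hw]|]; auto. left; right.
    eapply Permutation_in; [apply Permutation_map; symmetry; exact P|auto].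
  - intros n Hn. apply S4. simpl in *. rewrite imsgs_app, !in_app_iff in *.
    destruct Hn as [|[[|Hn]|]]; auto. right; left; right.
    eapply Permutation_in; [apply imsgs_perm; symmetry; exact P|auto].
Qed.

(** * Moving one box *)

Section Move.
Context {typ : wire -> option ty} {x y : name} {mx rx q' : list item} {w : wire} {z : name}
  {B : ty} {T : wty} {L1 L2 : list (list item * wep)} {f : wire -> name} {g : wire -> list name}.
Let i : item := (w, Some (z, B)).
Context (S : CutWiring typ x (mx ++ i :: rx) T (map snd L1) y q' (map snd L2)).
Context (F1 : Fspec f (map snd L1)).
Context (G1 : forall e a, In e (map snd L1) -> In a (ow e) -> ~ In a (map fst (i :: rx)) ->
  ~ In a (ins T) -> typ a <> None -> hd 0 (g a) <> x).
Let X := WEp (mx ++ i :: rx) x (Some T).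
Let V1 := s_v1 S.

Lemma move_iwX : In w (iw X).
Proof. unfold iw. simpl. rewrite map_app, !in_app_iff. simpl; auto. Qed.

Lemma move_notouts : ~ In w (outs T).
Proof. intro H. apply (v_irr V1 X w); simpl; auto using move_iwX. Qed.

Lemma move_notins : ~ In w (ins T).
Proof.
  pose proof (v_iw V1 X (or_introl eq_refl)) as D. unfold iw in D. simpl in D.
  rewrite map_app in D. simpl in D. rewrite <- app_assoc in D. apply NoDup_mid in D as [_ D].
  intro H. apply D. rewrite !in_app_iff. auto.
Qed.

Lemma move_notrx : ~ In w (map fst rx).
Proof.
  pose proof (v_iw V1 X (or_introl eq_refl)) as D. unfold iw in D. simpl in D.
  rewrite map_app in D. simpl in D. rewrite <- app_assoc in D. apply NoDup_mid in D as [_ D].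
  intro H. apply D. rewrite !in_app_iff. auto.
Qed.

Lemma move_typ : typ w <> None.
Proof.
  destruct (v_tok V1 X) as [K _]; [simpl; auto|]. simpl in K. rewrite Forall_app in K.
  destruct K as [_ K]. apply Forall_inv in K. unfold itemok in K. simpl in K. congruence.
Qed.

Lemma move_cons : exists pd, In pd L1 /\ In w (ow (snd pd)) /\ f w = wn (snd pd).
Proof.
  destruct (v_io V1 X w) as (e & [<-|He] & Hw); simpl; auto using move_iwX.
  - destruct (v_irr V1 X w); simpl; auto using move_iwX.
  - apply in_map_iff in He as (pd & <- & H). exists pd. repeat split; auto.
    apply F1; auto. now apply in_map_snd.
Qed.

Lemma lout_move N c a : a <> w ->
  lout x (i :: rx) T N g a = lout x rx T N (upd g w [c]) a.
Proof.
  intro Na. unfold lout. simpl. rewrite memb_cons_other by auto. now rewrite upd_other.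
Qed.

(** By FIFO between [x] and the sender of [w], the outputs of that sender before [w] are neither in
    the rest of the queue nor among the inputs of [T]. By [G1] they are not annotated with [x], so
    the leftmost tensor annotated with [x] is that of [w]. *)
Lemma retensor_move N c pd Td :
  In pd L1 -> In w (ow (snd pd)) -> wt (snd pd) = Some Td ->
  retensor x c (rbT (lin x T f) (lout x (i :: rx) T N g) Td) =
  Some (rbT (lin x T f) (lout x rx T N (upd g w [c])) Td).
Proof.
  intros Hd Hw Et. apply in_map_snd in Hd.
  assert (ow (snd pd) = outs Td) as Eo by (unfold ow; now rewrite Et).
  destruct (v_tok V1 (snd pd)) as [_ K]; [simpl; auto|]. rewrite Et in K. destruct K as [K _].
  apply (retensor_rb typ) with (w := w); auto using move_typ.
  - rewrite <- Eo. apply (NoDup_flat_in ow _ _ (v_ow V1)). simpl; auto.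
  - now rewrite <- Eo.
  - rewrite lout_in; simpl; auto.
  - rewrite lout_out, upd_same; auto using move_notouts, move_notins, move_notrx.
  - intros a Ba. pose proof (before_outs_msg _ _ _ _ K Ba) as Na. rewrite <- Eo in Ba.
    destruct (before_in _ _ _ Ba) as [Ia _].
    assert (a <> w) as Naw.
    { intros ->. eapply before_irrefl; [|exact Ba].
      apply (NoDup_flat_in ow _ _ (v_ow V1)). simpl; auto. }
    assert (~ In a (map fst rx) /\ ~ In a (ins T)) as [N1 N2].
    { assert (In a (map fst rx ++ ins T) -> False) as Q; [|rewrite in_app_iff in Q; tauto].
      intro Q. apply (v_fifo V1 X (snd pd) w a); simpl; auto.
      unfold iw. simpl. rewrite map_app, <- app_assoc. apply before_app. right; left.
      simpl. auto. }
    rewrite lout_out; auto.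
    + apply (G1 (snd pd)); auto. simpl. intuition.
    + simpl. intuition.
    + intro Ho. apply (head_ow _ X _ (snd pd) a V1); auto.
  - intros a _ Na. symmetry. now apply lout_move.
Qed.

Lemma mk_other N c pd : In pd L1 -> ~ In w (ow (snd pd)) ->
  mk (lin x T f) (lout x (i :: rx) T N g) pd = mk (lin x T f) (lout x rx T N (upd g w [c])) pd.
Proof.
  intros H Hw. unfold mk. f_equal. apply rb_ext; auto.
  intros a Ha. apply lout_move. intros ->. auto.
Qed.

Lemma type_move N c : rbT (lin x T f) (lout x (i :: rx) T N g) T =
  rbT (lin x T f) (lout x rx T N (upd g w [c])) T.
Proof.
  apply rbT_ext; auto. intros a Ha. apply lout_move. intros ->. now apply move_notouts.
Qed.

Lemma lout_far ry N c a : a <> w -> lout y ry (wdual T) N g a = lout y ry (wdual T) N (upd g w [c]) a.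
Proof. intro Na. unfold lout. now rewrite upd_other. Qed.

Lemma far_ow pe : In pe L2 -> ~ In w (ow (snd pe)).
Proof.
  intros H Hw. destruct move_cons as (pd & Hd & Hwd & _).
  apply (ow_cross _ _ _ _ _ _ _ _ S (snd pd) (snd pe) w); auto using in_map_snd.
Qed.

Lemma mk_far ry N c pe : In pe L2 ->
  mk (lin y (wdual T) f) (lout y ry (wdual T) N g) pe =
  mk (lin y (wdual T) f) (lout y ry (wdual T) N (upd g w [c])) pe.
Proof.
  intros H. unfold mk. f_equal. apply rb_ext; auto.
  intros a Ha. apply lout_far. intros ->. apply (far_ow pe); auto.
Qed.

Lemma type_far ry N c : rbT (lin y (wdual T) f) (lout y ry (wdual T) N g) (wdual T) =
  rbT (lin y (wdual T) f) (lout y ry (wdual T) N (upd g w [c])) (wdual T).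
Proof.
  apply rbT_ext; auto. intros a Ha. apply lout_far. intros ->. apply move_notins.
  now rewrite <- outs_wdual.
Qed.

Lemma lin_move : lin x T f w = f w.
Proof. apply lin_out, move_notouts. Qed.

Lemma lin_far : lin y (wdual T) f w = f w.
Proof. apply lin_out. rewrite outs_wdual. apply move_notins. Qed.

Lemma uniq_cons pd pd' : In pd L1 -> In pd' L1 -> In w (ow (snd pd)) -> wn (snd pd) = wn (snd pd') ->
  In w (ow (snd pd')).
Proof.
  intros H H' Hw E. replace (snd pd') with (snd pd); auto.
  apply (wn_inj (X :: map snd L1)); auto; try (right; now apply in_map_snd). apply (v_decl V1).
Qed.

Lemma others_ow pd L0 pe : Permutation L1 (pd :: L0) -> In w (ow (snd pd)) -> In pe L0 ->
  ~ In w (ow (snd pe)).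
Proof.
  intros P Hw He Hw'. pose proof (v_ow V1) as O. simpl in O.
  apply NoDup_app_iff in O as (_ & O & _).
  assert (NoDup (flat_map ow (map snd (pd :: L0)))) as O'.
  { eapply Permutation_NoDup; [|exact O]. now apply flat_map_perm, Permutation_map. }
  simpl in O'. apply NoDup_app_iff in O' as (_ & _ & O'). apply (O' w); auto.
  apply in_flat_map. exists (snd pe). split; auto. now apply in_map_snd.
Qed.

Lemma map_mk_far ry N c L : incl L L2 ->
  map (mk (lin y (wdual T) f) (lout y ry (wdual T) N g)) L =
  map (mk (lin y (wdual T) f) (lout y ry (wdual T) N (upd g w [c]))) L.
Proof. intro I. apply map_ext_in. intros. apply mk_far. auto. Qed.

(** The target [ec] is an arbitrary endpoint of the other side. Setting [g w] to its name and
    dropping [w] from the queue unmasks the wire. *)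
Lemma distr_step ry La p ec Lb : L2 = La ++ (p, ec) :: Lb ->
  distr (mside f g x (i :: rx) T L1, mside f g y ry (wdual T) L2)
    (mside f (upd g w [wn ec]) x rx T L1,
     mside f (upd g w [wn ec]) y ry (wdual T) (La ++ (p ++ [i], ec) :: Lb)).
Proof.
  intro E2. destruct move_cons as (pd & Hd & Hw & Fw).
  destruct (in_perm_cons _ _ Hd) as (L0 & P0).
  pose proof Hw as Hw'. unfold ow in Hw'. destruct (wt (snd pd)) as [Td|] eqn:Et; [|destruct Hw'].
  assert (names (La ++ (p ++ [i], ec) :: Lb) = names L2) as EN.
  { rewrite E2. unfold names. rewrite !map_app. reflexivity. }
  set (f1 := lin x T f). set (f2 := lin y (wdual T) f).
  set (g1 := lout x (i :: rx) T (names L1) g). set (g1' := lout x rx T (names L1) (upd g w [wn ec])).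
  set (g2 := lout y ry (wdual T) (names L2) g).
  assert (incl (La ++ Lb) L2) as IL.
  { intros a Ha. rewrite E2. rewrite in_app_iff in *. simpl. tauto. }
  exists (Side ((map (rbI f1) (fst pd), Ep (map (rbI f1) (wp (snd pd))) (f w) (Some (rbT f1 g1 Td)))
             :: map (mk f1 g1) L0) (Msg (f w) z B :: map (rbI f1) rx) x (rbT f1 g1 T),
          Side ((map (rbI f2) p, Ep (map (rbI f2) (wp ec)) (wn ec) (option_map (rbT f2 g2) (wt ec)))
             :: map (mk f2 g2) (La ++ Lb)) (map (rbI f2) ry) y (rbT f2 g2 (wdual T))),
    (Side ((map (rbI f1) (fst pd), Ep (map (rbI f1) (wp (snd pd))) (f w) (Some (rbT f1 g1' Td)))
             :: map (mk f1 g1) L0) (map (rbI f1) rx) x (rbT f1 g1 T),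
          Side ((map (rbI f2) p ++ [Msg (f w) z B], Ep (map (rbI f2) (wp ec)) (wn ec) (option_map (rbT f2 g2) (wt ec)))
             :: map (mk f2 g2) (La ++ Lb)) (map (rbI f2) ry) y (rbT f2 g2 (wdual T))).
  split; [|split].
  - left. split; (split; [|split; [|split; [reflexivity|apply aty_eq_refl]]]); simpl.
    + apply (mset_perm_l _ _ (map (mk f1 g1) (pd :: L0))); [now apply Permutation_map|].
      simpl. unfold mk at 1, rb. rewrite Et, <- Fw. apply mset_refl, marked_equiv.
    + fold f1. unfold f1 at 1. rewrite lin_move. constructor.
    + apply (mset_perm_l _ _ (map (mk f2 g2) ((p, ec) :: La ++ Lb))).
      * rewrite E2 at 2. apply Permutation_map. symmetry. apply Permutation_middle.
      * apply mset_refl, marked_equiv.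
    + constructor.
  - apply distr_move. eapply retensor_move; eauto.
  - left. split; (split; [|split; [constructor|split; [reflexivity|]]]); simpl.
    + apply mset_sym; [apply marked_equiv|].
      apply (mset_perm_l _ _ (map (mk f1 g1') (pd :: L0))); [now apply Permutation_map|].
      simpl. unfold mk at 1, rb. rewrite Et, <- Fw.
      rewrite (map_ext_in (mk f1 g1') (mk f1 g1)); [apply mset_refl, marked_equiv|].
      intros a Ha. symmetry. apply mk_other.
      * eapply Permutation_in; [symmetry; exact P0|simpl; auto].
      * eapply others_ow; eauto.
    + unfold g1, f1. rewrite (type_move _ (wn ec)). apply aty_eq_refl.
    + apply mset_sym; [apply marked_equiv|]. rewrite EN.
      apply (mset_perm_l _ _ (map (mk f2 (lout y ry (wdual T) (names L2) (upd g w [wn ec])))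
        ((p ++ [i], ec) :: La ++ Lb))).
      * apply Permutation_map. symmetry. apply Permutation_middle.
      * simpl. unfold f2, g2. rewrite (map_mk_far ry (names L2) (wn ec) (La ++ Lb)) by auto.
        pose proof (mk_far ry (names L2) (wn ec) (p, ec)) as M. unfold mk in M at 1 2.
        unfold mk at 1. simpl in *. rewrite map_app. simpl. rewrite lin_far.
        assert (In (p, ec) L2) as Ip by (rewrite E2, in_app_iff; simpl; auto).
        specialize (M Ip). injection M as M1.
        unfold rb. rewrite M1. apply mset_refl, marked_equiv.
    + rewrite EN. unfold g2, f2. rewrite (type_far ry (names L2) (wn ec)). apply aty_eq_refl.
Qed.

(** The sender in the rule is forced by the label of the box, whereas the target is free: it is read
    off from the rule and recorded in [g]. *)
Lemma distr_sound1 K K' Ψ1 ry :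
  distr_rule K K' -> s_queue (fst K) = Msg (lin x T f w) z B :: Ψ1 ->
  queue_eq Ψ1 (map (rbI (lin x T f)) rx) ->
  side_eq marked_eq (fst K) (mside f g x (i :: rx) T L1) ->
  side_eq marked_eq (snd K) (mside f g y ry (wdual T) L2) ->
  exists La p ec Lb, L2 = La ++ (p, ec) :: Lb /\
    side_eq marked_eq (fst K') (mside f (upd g w [wn ec]) x rx T L1) /\
    side_eq marked_eq (snd K') (mside f (upd g w [wn ec]) y ry (wdual T) (La ++ (p ++ [i], ec) :: Lb)).
Proof.
  intros R EQ HQ (A1 & _ & A2 & A3) (A4 & A5 & A6 & A7).
  destruct R as [Γ1 Γ2 Ψ2d Ψd d D D' b B0 Ψ0 x0 A Ψ1c Ψc c Cc Ψ2 y0 A' HD].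
  simpl in *. rewrite lin_move in EQ. injection EQ as -> -> -> ->. subst x0 y0.
  destruct move_cons as (pd' & Hd' & Hw' & Fw').
  apply mset_map_inv in A1 as (pd & L0 & P0 & [M1 M2] & A1).
  destruct M2 as (M2 & M3 & M4). simpl in M1, M2, M3, M4.
  assert (In pd L1) as Hd by (eapply Permutation_in; [symmetry; exact P0|simpl; auto]).
  assert (In w (ow (snd pd))) as Hw by (apply (uniq_cons pd' pd); auto; congruence).
  pose proof Hw as Hw2. unfold ow in Hw2. destruct (wt (snd pd)) as [Td|] eqn:Et; [|destruct Hw2].
  simpl in M4.
  apply mset_map_inv in A4 as ([p ec] & L0' & P0' & [M1' M2'] & A4).
  destruct M2' as (M2' & M3' & M4'). simpl in M1', M2', M3', M4'. subst c.
  assert (In (p, ec) L2) as Hc by (eapply Permutation_in; [symmetry; exact P0'|simpl; auto]).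
  destruct (in_split _ _ Hc) as (La & Lb & E2).
  assert (Permutation L0' (La ++ Lb)) as P2.
  { apply (Permutation_cons_inv (a := (p, ec))). rewrite <- P0', E2. symmetry. apply Permutation_middle. }
  exists La, p, ec, Lb. split; auto.
  assert (names (La ++ (p ++ [i], ec) :: Lb) = names L2) as EN.
  { rewrite E2. unfold names. rewrite !map_app. reflexivity. }
  assert (incl L0' L2) as IL.
  { intros a Ha. eapply Permutation_in; [symmetry; exact P0'|simpl; auto]. }
  split; (split; [|split; [auto|split; [reflexivity|]]]); simpl.
  - apply mset_sym; [apply marked_equiv|].
    apply (mset_perm_l _ _ (map (mk (lin x T f) (lout x rx T (names L1) (upd g w [wn ec]))) (pd :: L0)));
      [now apply Permutation_map|].
    apply mset_sym; [apply marked_equiv|]. apply mset_cons.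
    + split; [exact M1|split; [exact M2|split; [exact M3|]]]. simpl. rewrite Et. simpl.
      destruct (retensor_cong _ _ _ _ _ M4 HD) as (E & HE & Hq).
      pose proof (eq_trans (eq_sym HE) (retensor_move (names L1) (wn ec) pd Td Hd Hw Et)) as EE.
      injection EE as ->. exact Hq.
    + change (mset_eq marked_eq Γ1 (map (mk (lin x T f) (lout x rx T (names L1) (upd g w [wn ec]))) L0)).
      erewrite map_ext_in; [exact A1|]. intros a Ha. symmetry. apply mk_other.
      * eapply Permutation_in; [symmetry; exact P0|simpl; auto].
      * eapply others_ow; eauto.
  - rewrite <- type_move. exact A3.
  - rewrite EN. apply mset_sym; [apply marked_equiv|].
    apply (mset_perm_l _ _ (map (mk (lin y (wdual T) f) (lout y ry (wdual T) (names L2) (upd g w [wn ec])))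
        ((p ++ [i], ec) :: L0'))).
    { apply Permutation_map. rewrite P2. symmetry. apply Permutation_middle. }
    apply mset_sym; [apply marked_equiv|]. apply mset_cons.
    + pose proof (mk_far ry (names L2) (wn ec) (p, ec) Hc) as M. unfold mk in M.
      simpl in M. injection M as M.
      split; [|split; [exact M2'|split; [reflexivity|]]]; simpl.
      * rewrite map_app. apply queue_eq_app; auto. simpl. rewrite lin_far. constructor.
      * rewrite <- M. exact M4'.
    + change (mset_eq marked_eq Γ2 (map (mk (lin y (wdual T) f) (lout y ry (wdual T) (names L2) (upd g w [wn ec]))) L0')).
      rewrite <- map_mk_far by auto. exact A4.
  - rewrite EN, <- type_far. exact A7.
Qed.
End Move.

Lemma lout_perm x r r' T N g a : Permutation r r' -> lout x r T N g a = lout x r' T N g a.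
Proof.
  intro P. unfold lout. replace (memb a (map fst r ++ ins T)) with (memb a (map fst r' ++ ins T)); auto.
  assert (forall r r' : list item, Permutation r r' -> In a (map fst r ++ ins T) -> In a (map fst r' ++ ins T)) as K.
  { clear. intros r r' P. apply Permutation_in. now apply Permutation_app_tail, Permutation_map. }
  destruct (memb a (map fst r ++ ins T)) eqn:E.
  - apply memb_in. apply memb_in in E. eauto.
  - apply memb_notin. apply memb_notin in E. intro H. apply E. symmetry in P. eauto.
Qed.

Lemma mside_perm f g x r r' T L : Permutation r r' ->
  queue_eq (map (rbI (lin x T f)) r) (map (rbI (lin x T f)) r') ->
  side_eq marked_eq (mside f g x r T L) (mside f g x r' T L).
Proof.
  intros P Q. split; [|split; [exact Q|split; [reflexivity|]]]; simpl.
  - rewrite (map_ext _ (mk (lin x T f) (lout x r' T (names L) g))); [apply mset_refl, marked_equiv|].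
    intro pe. unfold mk. f_equal. apply rb_ext; auto. intros. now apply lout_perm.
  - erewrite rbT_ext; [apply aty_eq_refl|auto|]. intros. now apply lout_perm.
Qed.

Lemma distr_sound typ x y mx rx q' T L1 L2 f g ry K K' :
  CutWiring typ x (mx ++ rx) T (map snd L1) y q' (map snd L2) -> Fspec f (map snd L1) ->
  (forall e a, In e (map snd L1) -> In a (ow e) -> ~ In a (map fst rx) ->
     ~ In a (ins T) -> typ a <> None -> hd 0 (g a) <> x) ->
  distr_rule K K' ->
  side_eq marked_eq (fst K) (mside f g x rx T L1) ->
  side_eq marked_eq (snd K) (mside f g y ry (wdual T) L2) ->
  exists w m rx' La p ec Lb, L2 = La ++ (p, ec) :: Lb /\ Permutation rx ((w, Some m) :: rx') /\
    CutWiring typ x (mx ++ (w, Some m) :: rx') T (map snd L1) y q' (map snd L2) /\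
    side_eq marked_eq (fst K') (mside f (upd g w [wn ec]) x rx' T L1) /\
    side_eq marked_eq (snd K')
      (mside f (upd g w [wn ec]) y ry (wdual T) (La ++ (p ++ [(w, Some m)], ec) :: Lb)).
Proof.
  intros S F G R H1 H2. pose proof H1 as (_ & HQ & _ & _).
  assert (exists d b B Ψ1, s_queue (fst K) = Msg d b B :: Ψ1) as (d & b & B & Ψ1 & EQ)
    by (destruct R; simpl; eauto).
  rewrite EQ in HQ. simpl in HQ. apply queue_eq_sym in HQ.
  pose proof HQ as HQ'.
  apply (queue_eq_lift (rbI (lin x T f)) fst) in HQ as (r & Er & P & Bf).
  destruct r as [|[w [[z B']|]] rx']; simpl in Er; try discriminate.
  injection Er as -> -> -> ->.
  assert (CutWiring typ x (mx ++ (w, Some (z, B')) :: rx') T (map snd L1) y q' (map snd L2)) as S'.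
  { eapply CutWiring_reord; eauto. intros a c Hb. apply Bf in Hb as [|(i & j & Hi & Hj & <- & <- & N)]; auto.
    right. rewrite !label_rbI in N.
    assert (forall i, In i rx -> ~ In (fst i) (outs T)) as NO.
    { clear -S. intros i Hi Ho. eapply (v_irr (s_v1 S)); [left; reflexivity| |exact Ho].
      unfold iw. simpl. rewrite map_app, !in_app_iff. left; right. now apply in_map. }
    rewrite !lin_out in N by auto. exact N. }
  assert (side_eq marked_eq (fst K) (mside f g x ((w, Some (z, B')) :: rx') T L1)) as H1'.
  { eapply side_trans; [apply marked_equiv|exact H1|]. apply mside_perm; auto. }
  destruct (distr_sound1 (g := g) S' F) with (K := K) (K' := K')
    (Ψ1 := map (rbI (lin x T f)) rx') (ry := ry) as (La & p & ec & Lb & E2 & HA & HB); auto.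
  - intros e a He Ha Hn Hi Hty. apply (G e a); auto. intro Hr. apply Hn.
    eapply Permutation_in; [apply Permutation_map; exact P|exact Hr].
  - constructor.
  - exists w, (z, B'), rx', La, p, ec, Lb. auto.
Qed.

(** * Realizing a given spread by a run *)

Definition init (L : list wep) : list (list item * wep) := map (fun e => ([], e)) L.

Lemma snd_init L : map snd (init L) = L.
Proof. unfold init. rewrite map_map. apply map_id. Qed.

Lemma names_init L : names (init (map snd L)) = names L.
Proof. unfold names, init. rewrite !map_map. reflexivity. Qed.

Lemma Distr_nil L : Distr [] L -> L = init (map snd L).
Proof.
  intros [_ P]. symmetry in P. apply Permutation_nil in P.
  induction L as [|[p e] L IH]; simpl in *; auto. apply app_eq_nil in P as [-> P].
  f_equal. auto.
Qed.

Lemma Distr_init L : Distr [] (init L).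
Proof.
  split.
  - intros pe a b H. apply in_map_iff in H as (e & <- & _). simpl. tauto.
  - induction L; simpl; auto.
Qed.

Lemma Distr_perm m L L' : Permutation L L' -> Distr m L -> Distr m L'.
Proof.
  intros P [H1 H2]. split.
  - intros pe a b H. apply H1. eapply Permutation_in; [symmetry; exact P|auto].
  - rewrite <- H2. apply flat_map_perm. now symmetry.
Qed.

Lemma Distr_snoc m i La p e Lb :
  Distr m (La ++ (p, e) :: Lb) -> Distr (m ++ [i]) (La ++ (p ++ [i], e) :: Lb).
Proof.
  intros [H1 H2]. assert (incl (map fst p) (map fst m)) as I.
  { intros a Ha. apply in_map_iff in Ha as (j & <- & Hj). apply in_map.
    eapply Permutation_in; [exact H2|]. apply in_flat_map. exists (p, e). split; auto.
    apply in_app_iff. simpl; auto. }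
  split.
  - intros pe a b H B. rewrite map_app, before_app. apply in_app_iff in H as [H|[<-|H]].
    + left. apply (H1 pe); auto. apply in_app_iff; auto.
    + simpl in B. rewrite map_app, before_app in B. destruct B as [B|[B|[Ha Hb]]]; auto.
      * left. apply (H1 (p, e)); auto. apply in_app_iff; simpl; auto.
    + left. apply (H1 pe); auto. apply in_app_iff; simpl; auto.
  - rewrite flat_map_app in *. simpl in *. rewrite <- H2.
    rewrite <- !app_assoc. apply Permutation_app_head. simpl.
    rewrite <- Permutation_middle. rewrite app_assoc.
    rewrite <- Permutation_cons_append. reflexivity.
Qed.

(** The last box of [m] ends its share, since a box behind it in the share would also be behind it
    in [m]. *)
Lemma Distr_unsnoc m i L : NoDup (map fst (m ++ [i])) -> Distr (m ++ [i]) L ->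
  exists La p e Lb, L = La ++ (p ++ [i], e) :: Lb /\ Distr m (La ++ (p, e) :: Lb).
Proof.
  intros D [H1 H2].
  assert (In i (flat_map fst L)) as Hi.
  { eapply Permutation_in; [symmetry; exact H2|]. apply in_app_iff. simpl; auto. }
  apply in_flat_map in Hi as ([p0 e] & Hp & Hi). simpl in Hi.
  apply in_split in Hp as (La & Lb & ->).
  apply in_split in Hi as (p & p2 & ->).
  rewrite map_app in D. simpl in D. apply NoDup_mid in D as [_ D]. rewrite app_nil_r in D.
  assert (forall a, before (map fst (m ++ [i])) (fst i) a -> False) as NB.
  { intros a B. rewrite map_app, before_app in B. simpl in B. destruct B as [B|[B|[B _]]]; try tauto.
    apply before_in in B as [B _]. auto. }
  assert (p2 = []) as ->.
  { destruct p2 as [|j p2]; auto. exfalso. apply (NB (fst j)).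
    apply (H1 (p ++ i :: j :: p2, e)); [apply in_app_iff; simpl; auto|].
    simpl. rewrite map_app, before_app. right; left. simpl. auto. }
  exists La, p, e, Lb. split; auto.
  assert (Permutation (flat_map fst (La ++ (p, e) :: Lb)) m) as P.
  { rewrite flat_map_app in *. simpl in *.
    apply (Permutation_cons_inv (a := i)). rewrite (Permutation_cons_append m i), <- H2.
    rewrite <- !app_assoc. simpl. rewrite Permutation_middle.
    apply Permutation_app_head. apply Permutation_middle. }
  split; auto.
  intros pe a b H B. assert (before (map fst (m ++ [i])) a b) as B'.
  { apply in_app_iff in H as [H|[<-|H]].
    - apply (H1 pe); auto. apply in_app_iff; auto.
    - apply (H1 (p ++ [i], e)); [apply in_app_iff; simpl; auto|]. simpl in *.
      rewrite map_app, before_app. auto.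
    - apply (H1 pe); auto. apply in_app_iff; simpl; auto. }
  rewrite map_app, before_app in B'. simpl in B'.
  destruct B' as [B'|[B'|[Ha [<-|[]]]]]; auto; try tauto. exfalso. apply D.
  apply before_in in B as [_ B]. apply in_map_iff in B as (j & Ej & Hj).
  rewrite <- Ej. apply in_map. eapply Permutation_in; [exact P|].
  apply in_flat_map; eauto.
Qed.

Definition swapc {E} (K : config E) : config E := (snd K, fst K).

Lemma swapc_eq {E} (R : E -> E -> Prop) K L : config_eq R K L -> config_eq R (swapc K) L.
Proof. intros [[]|[]]; [right|left]; auto. Qed.

Lemma swapc_eq_r {E} (R : E -> E -> Prop) K L : config_eq R K L -> config_eq R K (swapc L).
Proof. intros [[]|[]]; [right|left]; auto. Qed.

Lemma distr_swapc K K' : distr K K' -> distr (swapc K) (swapc K').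
Proof.
  intros (K0 & K0' & H1 & H2 & H3). exists K0, K0'. auto using swapc_eq, swapc_eq_r.
Qed.

Lemma subst_swapc K K' : subst K K' -> subst (swapc K) (swapc K').
Proof.
  intros (K0 & K0' & H1 & H2 & H3). exists K0, K0'. auto using swapc_eq, swapc_eq_r.
Qed.

Lemma rt_swapc K K' : clos_refl_trans _ distr K K' -> clos_refl_trans _ distr (swapc K) (swapc K').
Proof.
  induction 1; [apply rt_step; now apply distr_swapc|apply rt_refl|eapply rt_trans; eauto].
Qed.

Lemma mside_ext f g g' x r T L : (forall a, g a = g' a) -> mside f g x r T L = mside f g' x r T L.
Proof.
  intro H. assert (forall N a, lout x r T N g a = lout x r T N g' a) as E
    by (intros; unfold lout; now rewrite H).
  unfold mside. f_equal; [|apply rbT_ext; auto].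
  apply map_ext. intro pe. unfold mk. f_equal. apply rb_ext; auto.
Qed.

(** The destinations are recorded in [g] from the start but remain hidden while a wire is queued, so
    one [g] describes all states and the update made by a step changes nothing. The last box of [mx]
    moves last, hence the induction from the right. *)
Lemma distr_run typ x y T L1 ry q' f g (mx : list item) :
  forall (L2 : list (list item * wep)) (rx : list item),
  CutWiring typ x (mx ++ rx) T (map snd L1) y q' (map snd L2) -> Fspec f (map snd L1) ->
  (forall e a, In e (map snd L1) -> In a (ow e) -> typ a <> None -> hd 0 (g a) <> x) ->
  (forall pe i, In pe L2 -> In i (fst pe) -> g (fst i) = [wn (snd pe)]) ->
  Distr mx L2 ->
  clos_refl_trans _ distr
    (mside f g x (mx ++ rx) T L1, mside f g y ry (wdual T) (init (map snd L2)))
    (mside f g x rx T L1, mside f g y ry (wdual T) L2).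
Proof.
  induction mx as [|i mx IH] using rev_ind; intros L2 rx S F G GS D.
  - rewrite <- (Distr_nil _ D). apply rt_refl.
  - rewrite <- app_assoc in *. simpl in *.
    pose proof (v_iw (s_v1 S) _ (or_introl eq_refl)) as ND.
    assert (NoDup (map fst (mx ++ [i]))) as ND'.
    { unfold iw in ND. simpl in ND. apply NoDup_app_iff in ND as [ND _].
      rewrite map_app in *. simpl in *. apply NoDup_app_iff in ND as (N1 & N2 & N3).
      apply NoDup_app_iff. split; auto. split; [repeat constructor; simpl; tauto|].
      intros a Ha [<-|[]]. apply (N3 (fst i)); simpl; auto. }
    destruct (Distr_unsnoc _ _ _ ND' D) as (La & p & e & Lb & -> & D').
    assert (map snd (La ++ (p ++ [i], e) :: Lb) = map snd (La ++ (p, e) :: Lb)) as Es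
      by (rewrite !map_app; reflexivity).
    rewrite Es in *.
    eapply rt_trans; [apply (IH (La ++ (p, e) :: Lb) (i :: rx))|]; auto.
    + intros pe j Hpe Hj. apply in_app_iff in Hpe as [Hpe|[<-|Hpe]].
      * apply GS; auto. apply in_app_iff; auto.
      * apply (GS (p ++ [i], e)); [apply in_app_iff; simpl; auto|]. simpl in *.
        apply in_app_iff; auto.
      * apply GS; auto. apply in_app_iff; simpl; auto.
    + apply rt_step.
      assert (exists w z B, i = (w, Some (z, B))) as (w & z & B & ->).
      { destruct i as [w [[z B]|]]; eauto. exfalso.
        destruct (v_tok (s_v1 S) _ (or_introl eq_refl)) as [_ [_ K]].
        simpl in K. apply (msg_only_in _ (w, None) K); auto. apply in_app_iff. simpl; auto. }
      assert (g w = [wn e]) as Gw.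
      { apply (GS (p ++ [(w, Some (z, B))], e) (w, Some (z, B))); [apply in_app_iff; simpl; auto|].
        simpl. apply in_app_iff. simpl; auto. }
      pose proof (distr_step (g := g) S F) as K.
      specialize (K (fun e a He Ha _ _ N => G e a He Ha N) ry La p e Lb eq_refl).
      assert (forall a, upd g w [wn e] a = g a) as Eg.
      { intro a. unfold upd. destruct Nat.eq_dec; congruence. }
      rewrite !(mside_ext f (upd g w [wn e]) g) in K by auto. exact K.
Qed.

Lemma subst_step {typ x q U L1 y q' L2 f g} (C : Composite typ x q U L1 y q' L2 f g) {A w D}
  (HT : Suf typ (WTensor A w D) U) :
  subst (uside f g x (WTensor A w D) (names L1) (map unm L1),
         uside f g y (wdual (WTensor A w D)) (names L2) (map unm L2))
        (uside f g x D (names L1) (map unm L1), uside f g y (wdual D) (names L2) (map unm L2)).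
Proof.
  destruct (subst_progress C HT) as (K & K' & R & H1 & H2). exists K, K'.
  destruct (subst_sound C HT K K' R H1 H2) as (A' & w' & D' & E & H3 & H4).
  injection E as -> -> ->. split; [|split; auto].
  - left. split; simpl; apply side_sym; auto using ep_equiv.
  - left. auto.
Qed.

(** A tensor of [T] is consumed by a step, and a par by the same step with the two lines exchanged,
    because its dual is a tensor. What is left is an atom or a unit. *)
Lemma subst_run typ x q U L1 y q' L2 f g Γ (C : Composite typ x q U L1 y q' L2 f g) T :
  Suf typ T U -> ctx_eq (map (rb f g) (comp L1 L2)) Γ ->
  exists K, clos_refl_trans _ subst
      (uside f g x T (names L1) (map unm L1), uside f g y (wdual T) (names L2) (map unm L2)) K /\
    subst_last K Γ.
Proof.
  intros HT HΓ. pose proof (Composite_sym C) as C'.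
  assert (ctx_eq (map (rb f g) (comp L2 L1)) Γ) as HΓ'.
  { eapply ctx_eq_trans; [|exact HΓ]. apply ctx_rb_perm, comp_perm. }
  induction T as [a|a|w|w|A w T IH|A w T IH].
  - eexists. split; [apply rt_refl|]. eexists _, _.
    assert (subst_last_rule (uside f g x (WAtom a) (names L1) (map unm L1),
      uside f g y (wdual (WAtom a)) (names L2) (map unm L2)) _) as R by apply subst_atom.
    split; [apply config_refl, ep_equiv|]. split; [exact R|].
    eapply ctx_eq_trans; [|exact HΓ].
    apply (last_atom f g x y a (names L1) (names L2) L1 L2 _ _ R); apply side_refl, ep_equiv.
  - eexists. split; [apply rt_refl|]. eexists _, _.
    assert (subst_last_rule (uside f g y (WAtom a) (names L2) (map unm L2),
      uside f g x (WNAtom a) (names L1) (map unm L1)) _) as R by apply subst_atom.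
    split; [apply config_swap, ep_equiv|]. split; [exact R|].
    eapply ctx_eq_trans; [|exact HΓ'].
    apply (last_atom f g y x a (names L2) (names L1) L2 L1 _ _ R); apply side_refl, ep_equiv.
  - destruct (last_progress C HT) as (K & Γ0 & R & H1 & H2).
    eexists. split; [apply rt_refl|]. exists K, Γ0. split; [|split; [exact R|]].
    + left. split; simpl; apply side_sym; auto using ep_equiv.
    + eapply ctx_eq_trans; [|exact HΓ]. eapply (last_sound C HT); eauto.
  - apply Suf_sym in HT. simpl in HT. destruct (last_progress C' HT) as (K & Γ0 & R & H1 & H2).
    eexists. split; [apply rt_refl|]. exists K, Γ0. split; [|split; [exact R|]].
    + right. split; simpl; apply side_sym; auto using ep_equiv.
    + eapply ctx_eq_trans; [|exact HΓ']. eapply (last_sound C' HT); eauto.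
  - destruct IH as (K & HK & HL); [eapply Suf_tensor; eauto|]. exists K. split; auto.
    eapply rt_trans; [|exact HK]. apply rt_step. apply (subst_step C HT).
  - destruct IH as (K & HK & HL); [eapply Suf_par; eauto|]. exists K. split; auto.
    eapply rt_trans; [|exact HK]. apply rt_step. apply Suf_sym in HT. simpl in HT.
    pose proof (subst_swapc _ _ (subst_step C' HT)) as K'. unfold swapc in K'. simpl fst in K'.
    simpl snd in K'. change (wdual (WTensor (dual A) w (wdual T))) with
      (WPar (dual (dual A)) w (wdual (wdual T))) in K'.
    rewrite dual_dual, !wdual_wdual in K'. exact K'.
Qed.

Lemma mark_mside f g x q T L :
  map_side mark (Side (map (rb (lin x T f) (lout x q T (names L) g)) (map snd L))
    (map (rbI (lin x T f)) q) x (rbT (lin x T f) (lout x q T (names L) g) T)) =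
  mside f g x q T (init (map snd L)).
Proof.
  unfold mside, map_side. simpl. rewrite names_init. f_equal.
  unfold init. rewrite !map_map. reflexivity.
Qed.

Lemma pref_g typ x q T L1 y q' L2 f g pe i : Composite typ x q T L1 y q' L2 f g ->
  In pe L2 -> In i (fst pe) -> g (fst i) = [wn (snd pe)].
Proof.
  intros C Hpe Hi. pose proof (Composite_Valid C) as VC.
  assert (In i q) as Hq.
  { eapply Permutation_in; [apply (d_perm (c_d2 C))|].
    apply in_flat_map; eauto. }
  destruct (pool_msg _ _ _ _ _ _ _ _ (CutWiring_sym (c_s C)) i Hq) as [_ N].
  assert (In (unm pe) (comp L1 L2)) as Hc by now apply in_comp_r.
  assert (In (fst i) (iw (unm pe))) as Hw.
  { rewrite iw_unm. apply in_app_iff. left. now apply in_map. }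
  destruct (v_io VC _ _ Hc Hw) as (e & He & Hwe).
  exact (g_msg typ (comp L1 L2) f g (unm pe) e (fst i) VC (c_l C) Hc Hw He Hwe N).
Qed.

Lemma hd_not_x typ x q T L1 y q' L2 f g e a : Composite typ x q T L1 y q' L2 f g ->
  In e (map snd L1) -> In a (ow e) -> typ a <> None -> hd 0 (g a) <> x.
Proof.
  intros C He Ha N. pose proof (Composite_Valid C) as VC.
  apply in_map_iff in He as (pe & <- & He).
  assert (In (unm pe) (comp L1 L2)) as Hc by now apply in_comp_l.
  destruct (v_oi VC _ a Hc Ha) as (e & He' & Hw).
  rewrite (g_msg typ (comp L1 L2) f g e (unm pe) a VC (c_l C)); auto.
  simpl. now apply (x_fresh C).
Qed.

Lemma Fspec_comp typ x q T L1 y q' L2 f g : Composite typ x q T L1 y q' L2 f g -> Fspec f (map snd L1).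
Proof.
  intros C e w He Hw. apply in_map_iff in He as (pe & <- & He).
  apply (l_f (c_l C) (unm pe)); auto. now apply in_comp_l.
Qed.

(** Among the runs with the given shares, the one that empties the queue of [x] before that of [y]
    is exhibited. *)
Lemma Composite_composes typ x q T L1 y q' L2 f g Γ :
  Composite typ x q T L1 y q' L2 f g -> ctx_eq (map (rb f g) (comp L1 L2)) Γ ->
  let f1 := lin x T f in let g1 := lout x q T (names L1) g in
  let f2 := lin y (wdual T) f in let g2 := lout y q' (wdual T) (names L2) g in
  composes (Side (map (rb f1 g1) (map snd L1)) (map (rbI f1) q) x (rbT f1 g1 T),
            Side (map (rb f2 g2) (map snd L2)) (map (rbI f2) q') y (rbT f2 g2 (wdual T))) Γ.
Proof.
  intros C HΓ f1 g1 f2 g2. pose proof (Composite_sym C) as C'.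
  pose proof (c_s C) as S. pose proof (c_s C') as S'.
  assert (tyok typ T) as KT.
  { destruct (v_tok (s_v1 S) _ (or_introl eq_refl)) as [_ [K _]]. exact K. }
  destruct (subst_run typ x q T L1 y q' L2 f g Γ C T (Suf_refl _ _ KT) HΓ) as (K & HK & HL).
  exists (mside f g x [] T L1), (mside f g y [] (wdual T) L2), K.
  split; [|split; [reflexivity|split; [reflexivity|split; [|exact HL]]]].
  - unfold f1, g1, f2, g2. simpl fst. simpl snd. rewrite !mark_mside.
    apply rt_trans with (mside f g x [] T (init (map snd L1)), mside f g y q' (wdual T) L2).
    + pose proof (distr_run typ x y T (init (map snd L1)) q' q' f g q L2 []) as R.
      rewrite app_nil_r, snd_init in R. apply R; auto.
      * exact (Fspec_comp _ _ _ _ _ _ _ _ _ _ C).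
      * intros e a. exact (hd_not_x _ _ _ _ _ _ _ _ _ _ e a C).
      * intros pe i. exact (pref_g _ _ _ _ _ _ _ _ _ _ pe i C).
      * exact (c_d2 C).
    + pose proof (distr_run typ y x (wdual T) L2 [] q f g q' L1 []) as R.
      rewrite app_nil_r, wdual_wdual in R.
      apply rt_swapc in R; [exact R|auto| | | |]; clear R.
      * exact (Fspec_comp _ _ _ _ _ _ _ _ _ _ C').
      * intros e a. exact (hd_not_x _ _ _ _ _ _ _ _ _ _ e a C').
      * intros pe i. exact (pref_g _ _ _ _ _ _ _ _ _ _ pe i C').
      * exact (c_d1 C).
  - rewrite !unmark_mside. exact HK.
Qed.

(** * Every run comes from a spread *)

(** A stage of a distribution: [mx] and [my] have been moved, [rx] and [ry] remain. [g] is
    constrained only outside [rx] and [ry], since the destinations of their boxes are not chosen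
    yet. *)
Record Mid typ x T mx rx L1 y my ry L2 (f : wire -> name) (g : wire -> list name) : Prop := {
  m_s : CutWiring typ x (mx ++ rx) T (map snd L1) y (my ++ ry) (map snd L2);
  m_d1 : Distr my L1;
  m_d2 : Distr mx L2;
  m_f1 : Fspec f (map snd L1);
  m_f2 : Fspec f (map snd L2);
  m_g : forall e a, In e (map snd L1) \/ In e (map snd L2) -> In a (ow e) ->
    ~ In a (map fst rx) -> ~ In a (map fst ry) ->
    NoDup (g a) /\
    forall n, In n (g a) <-> exists e', In e' (comp L1 L2) /\ wn e' = n /\ In a (iw e') }.

Lemma Mid_sym typ x T mx rx L1 y my ry L2 f g :
  Mid typ x T mx rx L1 y my ry L2 f g -> Mid typ y (wdual T) my ry L2 x mx rx L1 f g.
Proof.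
  intros []. split; auto using CutWiring_sym. intros e a He Ha N1 N2.
  destruct (m_g0 e a) as [D G]; auto; [tauto|]. split; auto. intro n. rewrite G.
  split; intros (e' & H & K); exists e'; split; auto;
    (eapply Permutation_in; [apply comp_perm|exact H]).
Qed.

(** Supplies the hypothesis on [g] used by a move. Such a wire has at least one receiver in the
    composite, and no endpoint there is named [x]. *)
Lemma Mid_hd typ x T mx rx L1 y my ry L2 f g : Mid typ x T mx rx L1 y my ry L2 f g ->
  forall e a, In e (map snd L1) -> In a (ow e) -> ~ In a (map fst rx) -> ~ In a (ins T) ->
    typ a <> None -> hd 0 (g a) <> x.
Proof.
  intros [S D1 D2 F1 F2 G] e a He Ha Nr Ni Nt E.
  pose proof (s_v1 S) as V.
  set (X := WEp (mx ++ rx) x (Some T)) in V.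
  assert (~ In a (map fst ry)) as Ny.
  { intro H. apply (pool_fresh _ _ _ _ _ _ _ _ S a); [|rewrite map_app, in_app_iff; auto].
    exists e. simpl. auto. }
  destruct (G e a) as [_ G']; auto.
  assert (exists e', In e' (comp L1 L2) /\ In a (iw e')) as (e' & He' & Hw').
  { destruct (v_oi V e a) as (e' & [<-|He'] & Hw'); simpl; auto.
    - unfold iw in Hw'. simpl in Hw'. rewrite map_app, !in_app_iff in Hw'.
      destruct Hw' as [[Hw'|]|]; try tauto.
      apply in_map_iff in Hw' as (i & <- & Hi).
      apply (Permutation_in _ (Permutation_sym (d_perm D2))) in Hi.
      apply in_flat_map in Hi as (pe & Hpe & Hi). exists (unm pe). split; [now apply in_comp_r|].
      rewrite iw_unm. apply in_app_iff. left. now apply in_map.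
    - apply in_map_iff in He' as (pe & <- & Hpe). exists (unm pe). split; [now apply in_comp_l|].
      rewrite iw_unm. apply in_app_iff. auto. }
  assert (In x (g a)) as Hx.
  { destruct (g a) as [|n l] eqn:Eg.
    - exfalso. assert (In (wn e') []) as []. apply G'. eauto.
    - simpl in E. subst n. simpl; auto. }
  apply G' in Hx as (e2 & He2 & En & _). apply in_comp in He2 as (pe & -> & [H|H]); simpl in En.
  - apply (head_wn _ X _ (snd pe) V); [now apply in_map_snd|auto].
  - apply (s_nm S x); [simpl; auto|]. rewrite <- En. apply decl_wn. right.
    now apply in_map_snd.
Qed.

(** The box taken by the rule need not be the first of [rx] as listed, so the total queue is
    preserved only up to permutation. *)
Lemma Mid_step typ x T mx rx L1 y my ry L2 f g K K' :
  Mid typ x T mx rx L1 y my ry L2 f g -> distr_rule K K' ->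
  side_eq marked_eq (fst K) (mside f g x rx T L1) ->
  side_eq marked_eq (snd K) (mside f g y ry (wdual T) L2) ->
  exists mx' rx' L2' g', Mid typ x T mx' rx' L1 y my ry L2' f g' /\
    Permutation (mx ++ rx) (mx' ++ rx') /\ map snd L2' = map snd L2 /\
    side_eq marked_eq (fst K') (mside f g' x rx' T L1) /\
    side_eq marked_eq (snd K') (mside f g' y ry (wdual T) L2').
Proof.
  intros M R H1 H2. pose proof M as [S D1 D2 F1 F2 G].
  destruct (distr_sound _ _ _ _ _ _ _ _ _ _ _ _ _ _ S F1 (Mid_hd _ _ _ _ _ _ _ _ _ _ _ _ M) R H1 H2)
    as (w & m & rx' & La & p & ec & Lb & -> & P & S' & A & B).
  exists (mx ++ [(w, Some m)]), rx', (La ++ (p ++ [(w, Some m)], ec) :: Lb), (upd g w [wn ec]).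
  assert (map snd (La ++ (p ++ [(w, Some m)], ec) :: Lb) = map snd (La ++ (p, ec) :: Lb)) as Es
    by (rewrite !map_app; reflexivity).
  split; [|split; [|split; [|split]]]; auto.
  2: { rewrite P, <- app_assoc. reflexivity. }
  pose proof (CutWiring_sym S') as S2.
  set (i := (w, Some m)) in *.
  assert (In i (mx ++ i :: rx')) as Ii by (apply in_app_iff; simpl; auto).
  assert (In w (map fst (mx ++ i :: rx'))) as Iw by (apply (in_map fst) in Ii; exact Ii).
  assert (~ In w (map fst rx') /\ ~ In w (map fst mx)) as [Nw Nm].
  { pose proof (v_iw (s_v1 S') _ (or_introl eq_refl)) as D. unfold iw in D.
    simpl in D. apply NoDup_app_iff in D as [D _]. rewrite map_app in D. simpl in D.
    apply NoDup_mid in D as [_ D]. rewrite in_app_iff in D. tauto. }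
  split; rewrite ?Es; auto.
  - rewrite <- app_assoc. exact S'.
  - now apply Distr_snoc.
  - intros e a He Ha Na Na'.
    assert (forall e', In e' (comp L1 (La ++ (p, ec) :: Lb)) -> In w (iw e') -> False) as NW.
    { intros e' He' Hw'. apply in_comp in He' as (pe & -> & Hpe).
      rewrite iw_unm in Hw'. apply in_app_iff in Hw'.
      destruct (pool_msg _ _ _ _ _ _ _ _ S2 i Ii) as [_ Nt].
      destruct Hpe as [Hpe|Hpe], Hw' as [Hw'|Hw'].
      - apply (pool_fresh _ _ _ _ _ _ _ _ S' w).
        + eexists; split; [left; reflexivity|]. left. apply in_app_iff. auto.
        + rewrite map_app, in_app_iff. left. eapply pref_in_w; eauto.
      - apply (head_iw _ _ _ (snd pe) w (s_v1 S')); auto using in_map_snd.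
        apply in_app_iff. auto.
      - apply Nm. eapply pref_in_w; eauto.
      - apply (pool_fresh _ _ _ _ _ _ _ _ S2 w); auto.
        exists (snd pe). split; auto. right. now apply in_map_snd. }
    assert (forall v n, v <> w \/ n <> wn ec ->
      (exists e', In e' (comp L1 (La ++ (p ++ [i], ec) :: Lb)) /\ wn e' = n /\ In v (iw e')) <->
      (exists e', In e' (comp L1 (La ++ (p, ec) :: Lb)) /\ wn e' = n /\ In v (iw e'))) as EQ.
    { intros v n Hv. split; intros (e' & He' & En & Hw'); apply in_comp in He' as (pe & -> & [Hpe|Hpe]).
      - exists (unm pe). split; auto. now apply in_comp_l.
      - apply in_app_iff in Hpe as [Hpe|[<-|Hpe]].
        + exists (unm pe). split; auto. apply in_comp_r, in_app_iff; auto.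
        + exists (unm (p, ec)). split; [apply in_comp_r, in_app_iff; simpl; auto|]. split; auto.
          rewrite iw_unm in *. simpl in *. rewrite map_app, !in_app_iff in *. simpl in Hw'.
          subst n. destruct Hw' as [[|[E|[]]]|]; auto. subst v. tauto.
        + exists (unm pe). split; auto. apply in_comp_r, in_app_iff; simpl; auto.
      - exists (unm pe). split; auto. now apply in_comp_l.
      - apply in_app_iff in Hpe as [Hpe|[<-|Hpe]].
        + exists (unm pe). split; auto. apply in_comp_r, in_app_iff; auto.
        + exists (unm (p ++ [i], ec)). split; [apply in_comp_r, in_app_iff; simpl; auto|]. split; auto.
          rewrite iw_unm in *. simpl in *. rewrite map_app, !in_app_iff in *. tauto.
        + exists (unm pe). split; auto. apply in_comp_r, in_app_iff; simpl; auto. }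
    destruct (Nat.eq_dec a w) as [->|Naw].
    + rewrite upd_same. split; [repeat constructor; simpl; tauto|]. intro n. split.
      * intros [<-|[]]. exists (unm (p ++ [i], ec)).
        split; [apply in_comp_r, in_app_iff; simpl; auto|]. split; auto.
        rewrite iw_unm. simpl. rewrite map_app, !in_app_iff. simpl; auto.
      * intro H. destruct (Nat.eq_dec n (wn ec)) as [->|Nn]; [simpl; auto|]. exfalso.
        apply EQ in H as (e' & He' & _ & Hw'); auto. eapply NW; eauto.
    + rewrite upd_other by auto. destruct (G e a) as [G1 G2]; auto.
      * intro Hr. apply Na. apply (Permutation_in _ (Permutation_map fst P)) in Hr.
        destruct Hr as [Hr|]; auto. simpl in Hr. congruence.
      * split; auto. intro n. rewrite G2. symmetry. apply EQ. auto.
Qed.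

Lemma side_eq_unmark s t : side_eq marked_eq s t -> side_eq ep_eq (map_side unmark s) (map_side unmark t).
Proof.
  intros (H1 & H2 & H3 & H4). split; [|split; [|split]]; auto. simpl.
  destruct H1 as (l & P & F). exists (map unmark l). split; [now apply Permutation_map|].
  clear P. induction F as [|[p e] [p' e'] l l' [K1 (K2 & K3 & K4)] F IH]; simpl; constructor; auto.
  split; [|split]; simpl in *; auto. now apply queue_eq_app.
Qed.

Lemma side_eq_mark s t : side_eq ep_eq s t -> side_eq marked_eq (map_side mark s) (map_side mark t).
Proof.
  intros (H1 & H2 & H3 & H4). split; [|split; [|split]]; auto. simpl.
  destruct H1 as (l & P & F). exists (map mark l). split; [now apply Permutation_map|].
  clear P. induction F; simpl; constructor; auto. split; simpl; auto. constructor.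
Qed.

Lemma unm_init L : map unm (init L) = L.
Proof.
  unfold init. rewrite map_map. rewrite <- (map_id L) at 2. apply map_ext. intros []. reflexivity.
Qed.

Lemma names_snd L : names L = map wn (map snd L).
Proof. unfold names. now rewrite map_map. Qed.

(** Two invariants carry the proof: [Mid] along the distribution, and along the substitution the
    form [uside] for a formula that is a remainder of [T]. Configurations may be exchanged at every
    step, so each invariant is preserved with either assignment of roles. *)
Theorem composes_Composite typ x q T L1s y q' L2s f K Γ :
  CutWiring typ x q T L1s y q' L2s -> Fspec f L1s -> Fspec f L2s ->
  let g0 := loutW (L1s ++ L2s) in
  let f1 := lin x T f in let g1 := lout x q T (map wn L1s) g0 in
  let f2 := lin y (wdual T) f in let g2 := lout y q' (wdual T) (map wn L2s) g0 in
  side_eq ep_eq (fst K) (Side (map (rb f1 g1) L1s) (map (rbI f1) q) x (rbT f1 g1 T)) ->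
  side_eq ep_eq (snd K) (Side (map (rb f2 g2) L2s) (map (rbI f2) q') y (rbT f2 g2 (wdual T))) ->
  composes K Γ ->
  exists q1 q1' L1 L2 g, map snd L1 = L1s /\ map snd L2 = L2s /\
    Permutation q q1 /\ Permutation q' q1' /\
    Composite typ x q1 T L1 y q1' L2 f g /\ ctx_eq (map (rb f g) (comp L1 L2)) Γ.
Proof.
  intros S F1 F2 g0 f1 g1 f2 g2 HA HB (s1 & s2 & Kf & RD & Q1 & Q2 & RS & HL).
  set (Inv := fun (K : config marked) => exists mx rx L1 my ry L2 g,
    Mid typ x T mx rx L1 y my ry L2 f g /\ map snd L1 = L1s /\ map snd L2 = L2s /\
    Permutation q (mx ++ rx) /\ Permutation q' (my ++ ry) /\
    config_eq marked_eq K (mside f g x rx T L1, mside f g y ry (wdual T) L2)).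
  assert (forall K K', distr K K' -> Inv K -> Inv K') as Step.
  { clear. intros K K' (K0 & K0' & E1 & R & E2) (mx & rx & L1 & my & ry & L2 & g & M & M1 & M2 & P1 & P2 & E).
    assert (config_eq marked_eq K0 (mside f g x rx T L1, mside f g y ry (wdual T) L2)) as E0.
    { eapply config_trans; [apply marked_equiv|apply config_sym; [apply marked_equiv|exact E1]|exact E]. }
    destruct E0 as [[A B]|[A B]]; simpl in A, B.
    - destruct (Mid_step _ _ _ _ _ _ _ _ _ _ _ _ _ _ M R A B) as (mx' & rx' & L2' & g' & M' & P & Es & A' & B').
      exists mx', rx', L1, my, ry, L2', g'.
      split; [exact M'|split; [exact M1|split; [congruence|split; [|split; [exact P2|]]]]].
      + exact (Permutation_trans P1 P).
      + eapply config_trans; [apply marked_equiv|apply config_sym; [apply marked_equiv|exact E2]|].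
        left. auto.
    - apply Mid_sym in M. rewrite <- (wdual_wdual T) in B.
      destruct (Mid_step _ _ _ _ _ _ _ _ _ _ _ _ _ _ M R A B) as (my' & ry' & L1' & g' & M' & P & Es & A' & B').
      apply Mid_sym in M'. rewrite wdual_wdual in M', B'.
      exists mx, rx, L1', my', ry', L2, g'.
      split; [exact M'|split; [congruence|split; [exact M2|split; [exact P1|split]]]].
      + exact (Permutation_trans P2 P).
      + eapply config_trans; [apply marked_equiv|apply config_sym; [apply marked_equiv|exact E2]|].
        right. auto. }
  assert (Inv (s1, s2)) as I.
  { assert (forall K K', clos_refl_trans _ distr K K' -> Inv K -> Inv K') as Steps.
    { clear -Step. induction 1; eauto. }
    (* Nothing has moved yet, so all shares are empty and the visible receivers are those of the
       union of the two wirings. *)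
    apply (Steps _ _ RD). exists [], q, (init L1s), [], q', (init L2s), g0.
    split; [|split; [apply snd_init|split; [apply snd_init|split; [reflexivity|split; [reflexivity|]]]]].
    - split; rewrite ?snd_init; simpl; auto using Distr_init.
      intros e a He Ha _ _. unfold comp. rewrite !unm_init. split.
      + apply loutW_nd. rewrite map_app. pose proof (NoDup_wn _ (v_decl (s_v1 S))) as N1.
        pose proof (NoDup_wn _ (v_decl (s_v2 S))) as N2.
        simpl in N1, N2. inversion N1; inversion N2; subst. apply NoDup_app_iff. split; [|split]; auto.
        intros n Hn Hn'. apply in_map_iff in Hn as (e1 & <- & J1). apply in_map_iff in Hn' as (e2 & E & J2).
        apply (s_nm S (wn e1)).
        * apply decl_wn. simpl; auto.
        * rewrite <- E. apply decl_wn. simpl; auto.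
      + intro n. apply loutW_spec.
    - left. pose proof (mark_mside f g0 x q T (init L1s)) as MA. pose proof (mark_mside f g0 y q' (wdual T) (init L2s)) as MB.
      rewrite names_snd, !snd_init in MA, MB. simpl. rewrite <- MA, <- MB.
      split; apply side_eq_mark; auto. }
  destruct I as (mx & rx & L1 & my & ry & L2 & g & M & M1 & M2 & P1 & P2 & E).
  assert (rx = [] /\ ry = []) as [-> ->].
  { assert (forall s f g z r (U : wty) L, s_queue s = [] -> side_eq marked_eq s (mside f g z r U L) -> r = []) as N.
    { clear. intros s f g z r U L Q (_ & H & _). rewrite Q in H. apply queue_eq_perm in H.
      apply Permutation_nil in H. simpl in H. destruct r; [auto|discriminate]. }
    destruct E as [[A B]|[A B]]; simpl in A, B; split; eauto. }
  rewrite app_nil_r in P1, P2. pose proof M as [S' D1 D2 F1' F2' G]. rewrite !app_nil_r in S'.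
  assert (Composite typ x mx T L1 y my L2 f g) as C.
  { split; auto. split.
    - intros e w He Hw. apply in_comp in He as (pe & -> & [H|H]).
      + apply (F1' (snd pe)); auto using in_map_snd.
      + apply (F2' (snd pe)); auto using in_map_snd.
    - intros e w He Hw. apply in_comp in He as (pe & -> & H). rewrite ow_unm in Hw.
      apply (G (snd pe)); auto. destruct H; auto using in_map_snd.
    - intros e w n He Hw. apply in_comp in He as (pe & -> & H). rewrite ow_unm in Hw.
      apply (G (snd pe)); auto. destruct H; auto using in_map_snd. }
  exists mx, my, L1, L2, g.
  split; [exact M1|split; [exact M2|split; [exact P1|split; [exact P2|split; [exact C|]]]]].
  assert (tyok typ T) as KT.
  { destruct (v_tok (s_v1 S) _ (or_introl eq_refl)) as [_ [K0 _]]. exact K0. }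
  pose proof (Composite_sym C) as C'.
  set (Inv2 := fun (K : config endpoint) => exists U, Suf typ U T /\
    config_eq ep_eq K (uside f g x U (names L1) (map unm L1), uside f g y (wdual U) (names L2) (map unm L2))).
  assert (forall K K', subst K K' -> Inv2 K -> Inv2 K') as Step2.
  { intros K1 K1' (K0 & K0' & E1 & R & E2) (U & HU & E3).
    assert (config_eq ep_eq K0 (uside f g x U (names L1) (map unm L1), uside f g y (wdual U) (names L2) (map unm L2))) as E0.
    { eapply config_trans; [apply ep_equiv|apply config_sym; [apply ep_equiv|exact E1]|exact E3]. }
    destruct E0 as [[A B]|[A B]]; simpl in A, B.
    - destruct (subst_sound C HU K0 K0' R A B) as (A0 & w & D & -> & A' & B').
      exists D. split; [eapply Suf_tensor; eauto|].
      eapply config_trans; [apply ep_equiv|apply config_sym; [apply ep_equiv|exact E2]|]. left; auto.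
    - rewrite <- (wdual_wdual U) in B.
      destruct (subst_sound C' (Suf_sym _ _ _ HU) K0 K0' R A B) as (A0 & w & D & EU & A' & B').
      assert (U = WPar (dual A0) w (wdual D)) as -> by (rewrite <- (wdual_wdual U), EU; reflexivity).
      exists (wdual D). split; [eapply Suf_par; eauto|]. rewrite wdual_wdual.
      eapply config_trans; [apply ep_equiv|apply config_sym; [apply ep_equiv|exact E2]|]. right; auto. }
  assert (Inv2 Kf) as (U & HU & E3).
  { assert (forall K K', clos_refl_trans _ subst K K' -> Inv2 K -> Inv2 K') as Steps.
    { clear -Step2. induction 1; eauto. }
    apply (Steps _ _ RS). exists T. split; [now apply Suf_refl|].
    rewrite <- !unmark_mside.
    destruct E as [[A B]|[A B]]; [left|right]; split; simpl in *; now apply side_eq_unmark. }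
  destruct HL as (K0 & Γ0 & E4 & R & E5).
  assert (config_eq ep_eq K0 (uside f g x U (names L1) (map unm L1), uside f g y (wdual U) (names L2) (map unm L2))) as E0.
  { eapply config_trans; [apply ep_equiv|apply config_sym; [apply ep_equiv|exact E4]|exact E3]. }
  eapply ctx_eq_trans; [apply ctx_eq_sym|exact E5].
  destruct E0 as [[A B]|[A B]]; simpl in A, B.
  - assert ((exists a, U = WAtom a) \/ (exists w, U = WOne w)) as [[a ->]|[w ->]].
    { destruct A as (_ & _ & _ & A). destruct R; simpl in A; destruct U; simpl in A;
        inversion A; subst; eauto. }
    + eapply (last_atom f g x y); eauto.
    + eapply (last_sound C HU); eauto.
  - eapply ctx_eq_trans; [|apply ctx_rb_perm, comp_perm].
    assert ((exists a, U = WNAtom a) \/ (exists w, U = WBot w)) as [[a ->]|[w ->]].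
    { destruct A as (_ & _ & _ & A). destruct R; simpl in A; destruct U; simpl in A;
        inversion A; subst; eauto. }
    + eapply (last_atom f g y x); eauto.
    + eapply (last_sound C' (Suf_sym _ _ _ HU)); eauto.
Qed.

(** * Renaming wires *)

Fixpoint twires (T : wty) : list wire :=
  match T with
  | WOne w | WBot w => [w]
  | WTensor _ w B | WPar _ w B => w :: twires B
  | _ => []
  end.

Lemma twires_in T w : In w (twires T) <-> In w (ins T) \/ In w (outs T).
Proof. induction T; simpl; tauto. Qed.

Lemma twires_nd T : NoDup (ins T) -> NoDup (outs T) ->
  (forall w, In w (ins T) -> In w (outs T) -> False) -> NoDup (twires T).
Proof.
  induction T as [| |u|u|A u T IH|A u T IH]; simpl; intros H1 H2 H3; try constructor; simpl; auto;
    try constructor.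
  - rewrite twires_in. inversion H2; subst. intros [H|H]; eauto.
  - inversion H2; subst. apply IH; auto. eauto.
  - rewrite twires_in. inversion H1; subst. intros [H|H]; eauto.
  - inversion H1; subst. apply IH; auto. eauto.
Qed.

Fixpoint werase (T : wty) : ty :=
  match T with
  | WAtom a => Atom a
  | WNAtom a => NAtom a
  | WOne _ => One
  | WBot _ => Bot
  | WTensor A _ B => Tensor A (werase B)
  | WPar A _ B => Par A (werase B)
  end.

Lemma erase_rbT f g T : erase (rbT f g T) = werase T.
Proof. induction T; simpl; congruence. Qed.

Lemma erase_eq A B : aty_eq A B -> erase A = erase B.
Proof. induction 1; simpl; congruence. Qed.

Lemma werase_wdual T : werase (wdual T) = dual (werase T).
Proof. induction T; simpl; congruence. Qed.

Fixpoint rnT (r : wire -> wire) (T : wty) : wty :=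
  match T with
  | WOne w => WOne (r w)
  | WBot w => WBot (r w)
  | WTensor A w B => WTensor A (r w) (rnT r B)
  | WPar A w B => WPar A (r w) (rnT r B)
  | T => T
  end.

Definition rnI (r : wire -> wire) (i : item) : item := (r (fst i), snd i).

Definition rnE (r : wire -> wire) (e : wep) : wep :=
  WEp (map (rnI r) (wp e)) (wn e) (option_map (rnT r) (wt e)).

Lemma rnT_ext r r' T : (forall w, In w (twires T) -> r w = r' w) -> rnT r T = rnT r' T.
Proof. induction T; simpl; intro H; f_equal; auto. Qed.

(** Matching wires of [T'] and [T] are identified in order, starting from the shift by [N], which
    sends everything else to [N] or above. As the wires of [T] lie below [N] the two parts do not
    collide, and the left inverse [s] witnesses injectivity. *)
Lemma matching_renaming N T : forall T', werase T' = dual (werase T) ->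
  NoDup (twires T) -> NoDup (twires T') -> (forall w, In w (twires T) -> w < N) ->
  exists r s : wire -> wire, (forall w, s (r w) = w) /\ rnT r T' = wdual T /\
    forall w, In (r w) (twires T) \/ N <= r w.
Proof.
  assert (exists r s : wire -> wire, (forall w, s (r w) = w) /\ forall w, N <= r w) as (r0 & s0 & E0 & B0).
  { exists (fun w => w + N), (fun w => w - N). split; intro w; lia. }
  assert (forall w w', w' < N -> exists r s : wire -> wire, (forall v, s (r v) = v) /\ r w = w' /\
    forall v, w' = r v \/ N <= r v) as K.
  { intros w w' L. exists (upd r0 w w'), (upd s0 w' w). split; [|split].
    - intro v. destruct (Nat.eq_dec v w) as [->|n]; [now rewrite !upd_same|].
      rewrite (upd_other r0), upd_other; auto. specialize (B0 v). lia.
    - apply upd_same.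
    - intro v. unfold upd. destruct (Nat.eq_dec v w); auto. }
  induction T as [a|a|w|w|A w T IH|A w T IH]; intros [b|b|v|v|A' v T'|A' v T'] E D D' B;
    simpl in E; try discriminate; simpl.
  - exists r0, s0. repeat split; auto. congruence.
  - exists r0, s0. repeat split; auto. congruence.
  - destruct (K v w) as (r & s & E1 & <- & E2); [apply B; simpl; auto|]. exists r, s.
    repeat split; auto. intro u. destruct (E2 u); auto.
  - destruct (K v w) as (r & s & E1 & <- & E2); [apply B; simpl; auto|]. exists r, s.
    repeat split; auto. intro u. destruct (E2 u); auto.
  - injection E as -> E. simpl in D, D', B. inversion D as [|? ? D1 D2]; inversion D' as [|? ? D3 D4]; subst.
    destruct (IH T') as (r & s & E1 & E2 & E3); auto.
    exists (upd r v w), (upd s w v). split; [|split].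
    + intro u. destruct (Nat.eq_dec u v) as [->|n]; [now rewrite !upd_same|].
      rewrite (upd_other r), upd_other; auto. intro Er. destruct (E3 u) as [I|I].
      * rewrite Er in I. auto.
      * rewrite Er in I. specialize (B w (or_introl eq_refl)). lia.
    + simpl. rewrite upd_same. f_equal. rewrite <- E2. apply rnT_ext. intros u Hu.
      apply upd_other. intros ->. auto.
    + intro u. unfold upd. destruct (Nat.eq_dec u v); auto. destruct (E3 u); auto.
  - injection E as -> E. simpl in D, D', B. inversion D as [|? ? D1 D2]; inversion D' as [|? ? D3 D4]; subst.
    destruct (IH T') as (r & s & E1 & E2 & E3); auto.
    exists (upd r v w), (upd s w v). split; [|split].
    + intro u. destruct (Nat.eq_dec u v) as [->|n]; [now rewrite !upd_same|].
      rewrite (upd_other r), upd_other; auto. intro Er. destruct (E3 u) as [I|I].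
      * rewrite Er in I. auto.
      * rewrite Er in I. specialize (B w (or_introl eq_refl)). lia.
    + simpl. rewrite upd_same. f_equal. rewrite <- E2. apply rnT_ext. intros u Hu.
      apply upd_other. intros ->. auto.
    + intro u. unfold upd. destruct (Nat.eq_dec u v); auto. destruct (E3 u); auto.
Qed.

Lemma before_map (r : nat -> nat) l a b : before (map r l) a b ->
  exists a' b', a = r a' /\ b = r b' /\ before l a' b'.
Proof.
  induction l as [|c l IH]; simpl; [tauto|]. intros [[-> H]|H].
  - apply in_map_iff in H as (b' & <- & H). exists c, b'. auto.
  - destruct (IH H) as (a' & b' & -> & -> & H'). exists a', b'. auto.
Qed.

Section Rename.
Context (r s : wire -> wire) (H : forall w, s (r w) = w).

Lemma rn_inj a b : r a = r b -> a = b.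
Proof. intro E. rewrite <- (H a), <- (H b). congruence. Qed.

Lemma ins_rn T : ins (rnT r T) = map r (ins T).
Proof. induction T; simpl; congruence. Qed.

Lemma outs_rn T : outs (rnT r T) = map r (outs T).
Proof. induction T; simpl; congruence. Qed.

Lemma iw_rn e : iw (rnE r e) = map r (iw e).
Proof.
  unfold iw. simpl. rewrite map_app, !map_map. f_equal.
  destruct (wt e); simpl; auto using ins_rn.
Qed.

Lemma ow_rn e : ow (rnE r e) = map r (ow e).
Proof. unfold ow. simpl. destruct (wt e); simpl; auto using outs_rn. Qed.

Lemma imsgs_rn q : imsgs (map (rnI r) q) = imsgs q.
Proof. induction q as [|[w [[z A]|]] q IH]; simpl; congruence. Qed.

Lemma decl_rn W : decl (map (rnE r) W) = decl W.
Proof.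
  induction W as [|e W IH]; simpl; auto. rewrite imsgs_rn. f_equal. f_equal. auto.
Qed.

Lemma flat_ow_rn W : flat_map ow (map (rnE r) W) = map r (flat_map ow W).
Proof. induction W; simpl; auto. rewrite map_app, ow_rn. f_equal; auto. Qed.

Lemma tyok_rn typ T : tyok typ T -> tyok (fun w => typ (s w)) (rnT r T).
Proof. induction T; simpl; rewrite ?H; tauto. Qed.

Lemma in_rn_iw e w : In w (iw (rnE r e)) <-> exists v, w = r v /\ In v (iw e).
Proof. rewrite iw_rn, in_map_iff. split; intros (v & ? & ?); eauto. Qed.

Lemma in_rn_ow e w : In w (ow (rnE r e)) <-> exists v, w = r v /\ In v (ow e).
Proof. rewrite ow_rn, in_map_iff. split; intros (v & ? & ?); eauto. Qed.

Lemma Valid_rn typ W : Valid typ W -> Valid (fun w => typ (s w)) (map (rnE r) W).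
Proof.
  intro V.
  assert (forall e, In e (map (rnE r) W) -> exists e0, e = rnE r e0 /\ In e0 W) as I
    by (intros e He; apply in_map_iff in He as (e0 & <- & He); eauto).
  split.
  - rewrite decl_rn. apply (v_decl V).
  - intros e He. destruct (I e He) as (e0 & -> & H0). rewrite iw_rn.
    apply FinFun.Injective_map_NoDup; [exact rn_inj|]. now apply (v_iw V).
  - rewrite flat_ow_rn. apply FinFun.Injective_map_NoDup; [exact rn_inj|]. apply (v_ow V).
  - intros e w He. destruct (I e He) as (e0 & -> & H0). rewrite in_rn_iw, in_rn_ow.
    intros (v & -> & Hv) (v' & E & Hv'). apply rn_inj in E. subst v'. eapply (v_irr V); eauto.
  - intros e e' w He He'. destruct (I e He) as (e0 & -> & H0). destruct (I e' He') as (e1 & -> & H1).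
    rewrite !in_rn_iw. intros (v & -> & Hv) (v' & E & Hv'). apply rn_inj in E. subst v'.
    rewrite H. simpl. now apply (v_msg V).
  - intros e w He. destruct (I e He) as (e0 & -> & H0). rewrite in_rn_iw.
    intros (v & -> & Hv). destruct (v_io V e0 v H0 Hv) as (e' & He' & Hw).
    exists (rnE r e'). split; [now apply in_map|]. rewrite in_rn_ow. eauto.
  - intros e w He. destruct (I e He) as (e0 & -> & H0). rewrite in_rn_ow.
    intros (v & -> & Hv). destruct (v_oi V e0 v H0 Hv) as (e' & He' & Hw).
    exists (rnE r e'). split; [now apply in_map|]. rewrite in_rn_iw. eauto.
  - intros e e' a b He He'. destruct (I e He) as (e0 & -> & H0). destruct (I e' He') as (e1 & -> & H1).
    rewrite iw_rn, ow_rn. intros HI HO.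
    apply before_map in HI as (a1 & b1 & -> & -> & HI).
    apply before_map in HO as (b2 & a2 & Eb & Ea & HO).
    apply rn_inj in Ea, Eb. subst. eapply (v_fifo V e0 e1); eauto.
  - intros e He. destruct (I e He) as (e0 & -> & H0). destruct (v_tok V e0 H0) as [K1 K2].
    assert (forall q, filter isstar (map (rnI r) q) = map (rnI r) (filter isstar q)) as F.
    { clear. induction q as [|[w [m|]] q IH]; simpl; auto. f_equal. auto. }
    split; simpl.
    + apply Forall_map. revert K1. apply Forall_impl. intros [w m]. unfold itemok. simpl.
      now rewrite H.
    + rewrite F. destruct (wt e0) as [T|]; simpl.
      * destruct K2 as [K2 ->]. split; auto. now apply tyok_rn.
      * destruct K2 as [w ->]. exists (r w). reflexivity.
Qed.

Lemma Labelling_rn f g W : Labelling f g W ->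
  Labelling (fun w => f (s w)) (fun w => g (s w)) (map (rnE r) W).
Proof.
  intros L. split.
  - intros e w He Hw. apply in_map_iff in He as (e0 & <- & He). apply in_rn_ow in Hw as (v & -> & Hv).
    rewrite H. now apply (l_f L e0).
  - intros e w He Hw. apply in_map_iff in He as (e0 & <- & He). apply in_rn_ow in Hw as (v & -> & Hv).
    rewrite H. eapply (l_nd L); eauto.
  - intros e w n He Hw. apply in_map_iff in He as (e0 & <- & He). apply in_rn_ow in Hw as (v & -> & Hv).
    rewrite H, (l_g L e0) by auto. split.
    + intros (e' & He' & <- & Hw). exists (rnE r e'). split; [now apply in_map|]. split; auto.
      rewrite in_rn_iw. eauto.
    + intros (e' & He' & <- & Hw). apply in_map_iff in He' as (e1 & <- & He').
      apply in_rn_iw in Hw as (v' & E & Hv'). apply rn_inj in E. subst v'. exists e1. auto.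
Qed.

Lemma rbT_rn f g T : rbT (fun w => f (s w)) (fun w => g (s w)) (rnT r T) = rbT f g T.
Proof. induction T; simpl; rewrite ?H; congruence. Qed.

(** Labels follow the wires through [s], so a renaming of wires is invisible in the context read
    back. *)
Lemma rb_rn f g e : rb (fun w => f (s w)) (fun w => g (s w)) (rnE r e) = rb f g e.
Proof.
  unfold rb. simpl. f_equal.
  - rewrite map_map. apply map_ext. intros [w [[z A]|]]; unfold rnI; simpl; now rewrite H.
  - destruct (wt e); simpl; auto. now rewrite rbT_rn.
Qed.

Lemma fwd_rn n P M E : fwd n P M E ->
  fwd n P (map (rnI r) M) (map (fun p => (fst p, rnT r (snd p))) E).
Proof.
  induction 1; simpl in *.
  - now apply f_link.
  - apply f_close. apply Forall_map. revert H0. apply Forall_impl. intros ? <-. reflexivity.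
  - now apply f_wait.
  - apply f_recv; auto. rewrite imsgs_rn, map_map. simpl. auto.
  - now apply f_send.
  - eapply f_eq; [eassumption|apply Permutation_map; eassumption ..|exact IHfwd].
Qed.

Lemma types_rn W : types (map (rnE r) W) = map (fun p => (fst p, rnT r (snd p))) (types W).
Proof.
  induction W as [|e W IH]; simpl; auto. rewrite map_app, IH. destruct (wt e); reflexivity.
Qed.

Lemma items_rn W : flat_map wp (map (rnE r) W) = map (rnI r) (flat_map wp W).
Proof. induction W as [|e W IH]; simpl; auto. now rewrite map_app, IH. Qed.
End Rename.

Lemma Valid_ext typ typ' W : Valid typ W -> (forall w, inw W w -> typ w = typ' w) -> Valid typ' W.
Proof.
  intros V E. split; try apply V.
  - intros e e' w He He' Hw Hw' N. apply (v_msg V e e' w); auto.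
    rewrite E; auto. exists e. auto.
  - intros e He. eapply tok_ext; [|apply (v_tok V); auto]. intros w Hw. apply E. exists e. auto.
Qed.

Lemma tyok_agree typ typ' T w : tyok typ T -> tyok typ' T -> In w (twires T) -> typ w = typ' w.
Proof.
  induction T; simpl; try tauto.
  - intros ? ? [<-|[]]. congruence.
  - intros ? ? [<-|[]]. congruence.
  - intros [] [] [<-|]; [congruence|auto].
  - intros [] [] [<-|]; [congruence|auto].
Qed.

Lemma decl_ep_names Γ n : In n (declared Γ) -> In n (flat_map ep_names Γ).
Proof.
  intro H. apply in_flat_map in H as (e & He & Hn). apply in_flat_map. exists e. split; auto.
  unfold ep_names. destruct Hn as [<-|Hn]; simpl; auto. rewrite !in_app_iff. auto.
Qed.

(** * Wiring the given cut *)

(** The two premises are wired independently, then the wires of the second are renamed so that the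
    dual formulas share theirs and nothing else is shared. The given run is finally converted into
    shares and labels. *)
Lemma initial_state P Q Γ1 Γ2 Ψ1 Ψ2 x y A1 A2 Γ :
  erase A2 = dual (erase A1) ->
  typed false P (Ep Ψ1 x (Some A1) :: Γ1) ->
  typed false Q (Ep Ψ2 y (Some A2) :: Γ2) ->
  ctx_disjoint (Ep Ψ1 x (Some A1) :: Γ1) (Ep Ψ2 y (Some A2) :: Γ2) ->
  composes (Side Γ1 Ψ1 x A1, Side Γ2 Ψ2 y A2) Γ ->
  exists n1 n2 typ q T L1 q' L2 f g,
    Composite typ x q T L1 y q' L2 f g /\
    fwd n1 P (q ++ flat_map wp (map snd L1)) ((x, T) :: types (map snd L1)) /\
    fwd n2 Q (q' ++ flat_map wp (map snd L2)) ((y, wdual T) :: types (map snd L2)) /\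
    ctx_eq (map (rb f g) (comp L1 L2)) Γ.
Proof.
  intros HE HP HQ HD HC.
  destruct (typed_fwd _ _ HP) as (n1 & typ1 & fP & gP & W1 & V1 & LP & R1 & FP).
  destruct (typed_fwd _ _ HQ) as (n2 & typ2 & fQ & gQ & W2 & V2 & LQ & R2 & FQ).
  pose proof (rep_declared _ _ _ _ R1) as ED1. pose proof (rep_declared _ _ _ _ R2) as ED2.
  pose proof (rep_ep_eq _ _ _ _ R1) as RE1. pose proof (rep_ep_eq _ _ _ _ R2) as RE2.
  inversion R1 as [|? e1 ? L1s (Ra & Rb & Rc) _]; subst. destruct e1 as [q x' [T|]]; simpl in Rb, Rc; [|tauto].
  subst x'.
  inversion R2 as [|? e2 ? L2s (Rd & Re & Rf) _]; subst. destruct e2 as [q' y' [T'|]]; simpl in Re, Rf; [|tauto].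
  subst y'. simpl in Ra, Rd. subst Ψ1 Ψ2.
  set (X := WEp q x (Some T)) in *. set (Y0 := WEp q' y (Some T')) in *.
  assert (forall typ W z r U, Valid typ (WEp r z (Some U) :: W) -> NoDup (twires U)) as ND.
  { clear. intros typ W z r U V. apply twires_nd.
    - pose proof (v_iw V _ (or_introl eq_refl)) as D. apply NoDup_app_iff in D. tauto.
    - exact (NoDup_flat_in ow _ _ (v_ow V) (or_introl eq_refl)).
    - intros w H H'. apply (v_irr V _ w (or_introl eq_refl)); auto. apply in_app_iff; auto. }
  (* A strict bound on the wires of the first side: renamed wires of the second side that are not in
     [T] land at [N] or above, hence outside it. *)
  set (N := S (list_max (flat_map (fun e => iw e ++ ow e) (X :: L1s)))).
  assert (forall w, inw (X :: L1s) w -> w < N) as HN.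
  { intros w (e & He & Hw). assert (Forall (fun k => k <= list_max (flat_map (fun e => iw e ++ ow e) (X :: L1s)))
      (flat_map (fun e => iw e ++ ow e) (X :: L1s))) as M by now apply list_max_le.
    rewrite Forall_forall in M. unfold N. apply Nat.lt_succ_r, M. apply in_flat_map. exists e.
    rewrite in_app_iff. auto. }
  assert (forall w, In w (twires T) -> inw (X :: L1s) w) as HT.
  { intros w Hw. exists X. split; [simpl; auto|]. apply twires_in in Hw as [Hw|Hw]; auto.
    left. apply in_app_iff. auto. }
  destruct (matching_renaming N T T') as (r & s & Ers & ET & Er).
  { rewrite <- (erase_rbT fQ gQ T'), <- (erase_rbT fP gP T).
    apply erase_eq in Rc, Rf. simpl in Rc, Rf. congruence. }
  { eapply ND; eauto. }
  { eapply ND; eauto. }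
  { auto. }
  set (L2s' := map (rnE r) L2s). set (Y := WEp (map (rnI r) q') y (Some (wdual T))).
  assert (map (rnE r) (Y0 :: L2s) = Y :: L2s') as EW.
  { simpl. unfold rnE at 1. simpl. rewrite ET. reflexivity. }
  pose proof (Valid_rn r s Ers _ _ V2) as V2'. rewrite EW in V2'.
  pose proof (Labelling_rn r s Ers _ _ _ LQ) as LQ'. rewrite EW in LQ'.
  pose proof (fwd_rn r _ _ _ _ FQ) as FQ'. rewrite <- items_rn, <- types_rn, EW in FQ'.
  assert (forall w, inw (Y :: L2s') w -> exists v, w = r v) as HY.
  { intros w (e & He & Hw). rewrite <- EW in He. apply in_map_iff in He as (e0 & <- & _).
    rewrite in_rn_iw, in_rn_ow in Hw. destruct Hw as [(v & -> & _)|(v & -> & _)]; eauto. }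
  assert (forall w, inw (X :: L1s) w -> inw (Y :: L2s') w -> In w (twires T)) as HS.
  { intros w H1 H2. destruct (HY w H2) as (v & ->). destruct (Er v) as [|Hv]; auto.
    specialize (HN _ H1). lia. }
  (* The two assignments agree on the shared wires, since both make [T] well typed; preferring the
     first one is harmless. *)
  set (typ := fun w => if in_dec Nat.eq_dec w (flat_map (fun e => iw e ++ ow e) (X :: L1s))
    then typ1 w else typ2 (s w)).
  assert (forall w, inw (X :: L1s) w <-> In w (flat_map (fun e => iw e ++ ow e) (X :: L1s))) as HI.
  { intro w. rewrite in_flat_map. split; intros (e & He & Hw); exists e; rewrite in_app_iff in *; auto. }
  assert (CutWiring typ x q T L1s y (map (rnI r) q') L2s') as S.
  { split.
    - apply (Valid_ext typ1); auto. intros w Hw. unfold typ. apply HI in Hw.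
      destruct in_dec; [reflexivity|tauto].
    - apply (Valid_ext (fun w => typ2 (s w))); auto. intros w Hw. unfold typ.
      destruct in_dec as [I|]; auto. apply HI in I.
      symmetry. apply (tyok_agree typ1 (fun w => typ2 (s w)) T).
      + destruct (v_tok V1 X) as [_ [K _]]; simpl; auto.
      + rewrite <- (wdual_wdual T). apply tyok_wdual.
        destruct (v_tok V2' Y) as [_ [K _]]; simpl; auto.
      + now apply HS.
    - intros w H1 H2. apply twires_in. now apply HS.
    - intros n H1 H2. apply (HD n).
      + apply decl_ep_names. rewrite ED1. exact H1.
      + apply decl_ep_names. rewrite ED2.
        pose proof (decl_rn r (Y0 :: L2s)) as DR. rewrite EW in DR. rewrite <- DR. exact H2. }
  assert (forall e e' w, In e L1s -> In e' L2s' -> In w (ow e) -> In w (ow e') -> False) as OX.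
  { intros e e' w He He'. pose proof (ow_cross typ x q T (init L1s) y (map (rnI r) q') (init L2s')) as K.
    rewrite !snd_init in K. eauto. }
  (* A label names the true sender. By [OX] no wire is sent by endpoints of both sides other than
     [x] and [y], so the two label maps can be glued. *)
  set (f := fun w => if in_dec Nat.eq_dec w (flat_map ow L1s) then fP w else fQ (s w)).
  assert (Fspec f L1s) as F1.
  { intros e w He Hw. unfold f. destruct in_dec as [_|NI].
    - apply (l_f LP e); simpl; auto.
    - destruct NI. apply in_flat_map. eauto. }
  assert (Fspec f L2s') as F2.
  { intros e w He Hw. unfold f. destruct in_dec as [I|_].
    - exfalso. apply in_flat_map in I as (e' & He' & Hw'). eauto.
    - apply (l_f LQ' e); simpl; auto. }
  set (g0 := loutW (L1s ++ L2s')).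
  assert (NoDup (map wn (L1s ++ L2s'))) as NW.
  { rewrite map_app. pose proof (NoDup_wn _ (v_decl V1)) as N1.
    pose proof (NoDup_wn _ (v_decl V2')) as N2.
    simpl in N1, N2. apply NoDup_cons_iff in N1 as [_ N1]. apply NoDup_cons_iff in N2 as [_ N2].
    apply NoDup_app_iff. split; [|split]; auto.
    intros n Hn Hn'. apply in_map_iff in Hn as (e1 & <- & J1). apply in_map_iff in Hn' as (e2 & E & J2).
    apply (s_nm S (wn e1)).
    - apply decl_wn. simpl; auto.
    - rewrite <- E. apply decl_wn. simpl; auto. }
  assert (Labelling f g0 (comp (init L1s) (init L2s'))) as L0.
  { unfold comp. rewrite !unm_init. split.
    - intros e w He Hw. apply in_app_iff in He as [He|He]; auto.
    - intros. now apply loutW_nd.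
    - intros. apply loutW_spec. }
  assert (forall (m : list item) L pe, In pe (init L) -> incl (map fst (fst pe)) (map fst m)) as NP.
  { intros m L pe H. apply in_map_iff in H as (e & <- & _). simpl. intros a []. }
  assert (names (init L1s) = map wn L1s) as NM1 by now rewrite names_snd, snd_init.
  assert (names (init L2s') = map wn L2s') as NM2 by now rewrite names_snd, snd_init.
  assert (CutWiring typ x q T (map snd (init L1s)) y (map (rnI r) q') (map snd (init L2s'))) as S'
    by now rewrite !snd_init.
  pose proof (Labelling_side _ _ _ _ _ _ _ _ _ _ S' (NP _ _) (NP _ _) L0) as LA.
  pose proof (Labelling_side _ _ _ _ _ _ _ _ _ _ (CutWiring_sym S') (NP _ _) (NP _ _)
    (Labelling_perm (comp_perm _ _) L0)) as LB.
  rewrite snd_init, NM1 in LA. rewrite snd_init, NM2 in LB.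
  (* The labels obtained from the premises and the masked ones both label the same wirings, so the
     given configuration is the masked one up to equality. *)
  destruct (composes_Composite typ x q T L1s y (map (rnI r) q') L2s' f
    (Side Γ1 (map (rbI fP) q) x A1, Side Γ2 (map (rbI fQ) q') y A2) Γ S F1 F2)
    as (q1 & q1' & L1 & L2 & g & M1 & M2 & Pq & Pq' & C & HΓ); auto.
  - assert (Forall2 ep_eq (Ep (map (rbI fP) q) x (Some A1) :: Γ1)
      (map (rb (lin x T f) (lout x q T (map wn L1s) g0)) (X :: L1s))) as HA.
    { eapply Forall2_trans; [apply ep_eq_trans|exact RE1|].
      apply (rb_LSpec_ctx typ1 (X :: L1s)); auto using incl_refl. }
    inversion HA as [|? ? ? ? (Ha & _ & Hb) Hc]; subst. simpl in Ha, Hb.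
    split; [|split; [|split]]; simpl; auto. now apply mset_Forall2.
  - assert (Forall2 ep_eq (Ep (map (rbI fQ) q') y (Some A2) :: Γ2)
      (map (rb (lin y (wdual T) f) (lout y (map (rnI r) q') (wdual T) (map wn L2s') g0)) (Y :: L2s'))) as HA.
    { eapply Forall2_trans; [apply ep_eq_trans|exact RE2|].
      assert (map (rb fQ gQ) (Y0 :: L2s) = map (rb (fun w => fQ (s w)) (fun w => gQ (s w))) (Y :: L2s')) as EB.
      { rewrite <- EW, map_map. apply map_ext. intro e. now rewrite rb_rn. }
      rewrite EB. apply (rb_LSpec_ctx (fun w => typ2 (s w)) (Y :: L2s')); auto using incl_refl. }
    inversion HA as [|? ? ? ? (Ha & _ & Hb) Hc]; subst. simpl in Ha, Hb.
    split; [|split; [|split]]; simpl; auto. now apply mset_Forall2.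
  - exists n1, n2, typ, q1, T, L1, q1', L2, f, g. split; [exact C|]. rewrite M1, M2.
    split; [|split; [|exact HΓ]].
    + eapply f_eq; [constructor| |reflexivity|exact FP]. simpl. now apply Permutation_app_tail.
    + eapply f_eq; [constructor| |reflexivity|exact FQ']. simpl. now apply Permutation_app_tail.
Qed.

Lemma aty_names_rbT f g T n : In n (aty_names (rbT f g T)) ->
  (exists w, In w (ins T) /\ n = f w) \/ (exists w, In w (outs T) /\ (In n (g w) \/ n = hd 0 (g w))).
Proof.
  induction T as [| |u|u|A u T IH|A u T IH]; simpl; try tauto.
  - intro H. right. exists u. auto.
  - intros [<-|[]]. left. exists u. auto.
  - intros [<-|H]; [right; exists u; auto|].
    destruct (IH H) as [(w & ? & ?)|(w & ? & ?)]; [left|right]; exists w; auto.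
  - intros [<-|H]; [left; exists u; auto|].
    destruct (IH H) as [(w & ? & ?)|(w & ? & ?)]; [left|right]; exists w; auto.
Qed.

(** Labels and annotations are names of endpoints, so the disjointness required by the Cut rule
    reduces to that of the declared names. *)
Lemma ep_names_decl typ f g W n : Valid typ W -> Labelling f g W ->
  In n (flat_map ep_names (map (rb f g) W)) -> In n (decl W).
Proof.
  intros V L H. apply in_flat_map in H as (e' & He & Hn). apply in_map_iff in He as (e & <- & He).
  assert (forall w, In w (iw e) -> In (f w) (decl W)) as HF.
  { intros w Hw. destruct (f_ow _ _ _ _ _ _ V L He Hw) as (e' & He' & _ & ->). now apply decl_wn. }
  assert (forall w, In w (ow e) -> forall n, In n (g w) -> In n (decl W)) as HG.
  { intros w Hw m Hm. apply (l_g L e) in Hm as (e' & He' & <- & _); auto. now apply decl_wn. }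
  unfold ep_names in Hn. simpl in Hn. destruct Hn as [<-|Hn]; [now apply decl_wn|].
  rewrite msg_names_rb, !in_app_iff in Hn. destruct Hn as [Hn|[Hn|Hn]].
  - rewrite map_map in Hn. apply in_map_iff in Hn as (i & <- & Hi). rewrite label_rbI. apply HF.
    apply in_app_iff. left. now apply in_map.
  - apply in_flat_map. exists e. simpl; auto.
  - destruct e as [q x [T|]]; simpl in *; [|tauto].
    apply aty_names_rbT in Hn as [(w & Hw & ->)|(w & Hw & [Hn| ->])].
    + apply HF, in_app_iff. auto.
    + eapply HG; eauto.
    + pose proof (g_nonempty _ _ _ _ _ _ V L He Hw) as N. apply (HG w Hw).
      destruct (g w); simpl; [congruence|auto].
Qed.

(** * Typing a cut by its wirings *)

(** [n1] and [n2] bound the numbers of actions of the two processes outside spawned ones, and their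
    sum is the measure of the final induction. *)
Record CutState n1 n2 typ x q T L1 y q' L2 (f : wire -> name) (g : wire -> list name) P Q : Prop := {
  k_c : Composite typ x q T L1 y q' L2 f g;
  k_1 : fwd n1 P (q ++ flat_map wp (map snd L1)) ((x, T) :: types (map snd L1));
  k_2 : fwd n2 Q (q' ++ flat_map wp (map snd L2)) ((y, wdual T) :: types (map snd L2)) }.
Arguments k_c {n1 n2 typ x q T L1 y q' L2 f g P Q}.
Arguments k_1 {n1 n2 typ x q T L1 y q' L2 f g P Q}.
Arguments k_2 {n1 n2 typ x q T L1 y q' L2 f g P Q}.

Lemma CutState_sym n1 n2 typ x q T L1 y q' L2 f g P Q :
  CutState n1 n2 typ x q T L1 y q' L2 f g P Q -> CutState n2 n1 typ y q' (wdual T) L2 x q L1 f g Q P.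
Proof. intros []. split; auto using Composite_sym. now rewrite wdual_wdual. Qed.
Arguments CutState_sym {n1 n2 typ x q T L1 y q' L2 f g P Q}.

Lemma Composite_Labelling typ x q T L1 y q' L2 f g : Composite typ x q T L1 y q' L2 f g ->
  Labelling (lin x T f) (lout x q T (names L1) g) (WEp q x (Some T) :: map snd L1).
Proof.
  intros []. eapply Labelling_side; eauto; intros pe H a Ha; eapply pref_in_w; eauto.
Qed.
Arguments Composite_Labelling {typ x q T L1 y q' L2 f g}.

(** The premises are typed by the two masked contexts, and [Composite_composes] supplies the run to
    the composite. The context of the cut thus depends on the wirings and not on how they were
    obtained. *)
Lemma CutState_cut n1 n2 typ x q T L1 y q' L2 f g P Q :
  CutState n1 n2 typ x q T L1 y q' L2 f g P Q ->
  typed true (Cut x y P Q) (map (rb f g) (comp L1 L2)).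
Proof.
  intros [C F1 F2].
  pose proof (Composite_Labelling C) as LA.
  pose proof (Composite_Labelling (Composite_sym C)) as LB.
  pose proof (c_s C) as S.
  pose proof (s_v1 S) as V1. pose proof (s_v2 S) as V2.
  eapply t_cut; [reflexivity| | | | |eapply (Composite_composes _ _ _ _ _ _ _ _ _ _ _ C); apply ctx_eq_refl|].
  - now rewrite !erase_rbT, werase_wdual.
  - apply typed_mono. apply (fwd_typed _ _ _ _ _ _ _ _ F1 V1 LA); reflexivity.
  - apply typed_mono. apply (fwd_typed _ _ _ _ _ _ _ _ F2 V2 LB); reflexivity.
  - intros n Hn Hn'. apply (s_nm S n).
    + eapply ep_names_decl; [exact V1|exact LA|exact Hn].
    + eapply ep_names_decl; [exact V2|exact LB|exact Hn'].
  - eapply wf_rb; [eapply Composite_Valid|apply (c_l C)]; eauto.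
Qed.

Lemma rb_comp_comm f g L1 L2 :
  ctx_eq (map (rb f g) (comp L1 L2)) (map (rb f g) (comp L2 L1)).
Proof. apply ctx_rb_perm, comp_perm. Qed.

Lemma CutState_typed n1 n2 typ x q T L1 y q' L2 f g P Q m :
  CutState n1 n2 typ x q T L1 y q' L2 f g P Q ->
  typed true (par_comp m x y P Q) (map (rb f g) (comp L1 L2)).
Proof.
  intro C. destruct m; simpl; [|eapply CutState_cut; eauto].
  eapply t_ctx_eq; [eapply CutState_cut, CutState_sym; exact C|]. apply rb_comp_comm.
Qed.

(** * Typed reductions *)

(** An inductive form of the typed reduction sequence. It is easier to extend under an action, where
    the context changes at every element of the sequence. *)
Inductive reaches (Γ : ctx) : proc -> Prop :=
| reaches_done P : typed false P Γ -> reaches Γ P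
| reaches_step P P' : typed true P Γ -> beta P P' -> reaches Γ P' -> reaches Γ P.

Lemma reaches_ctx Γ Γ' P : ctx_eq Γ Γ' -> reaches Γ P -> reaches Γ' P.
Proof.
  intro E. induction 1.
  - apply reaches_done. eapply t_ctx_eq; eauto.
  - eapply reaches_step; eauto. eapply t_ctx_eq; eauto.
Qed.

Lemma reaches_under K Γ Γ' P :
  (forall c P, typed c P Γ -> typed c (K P) Γ') ->
  (forall P P', beta P P' -> beta (K P) (K P')) -> reaches Γ P -> reaches Γ' (K P).
Proof.
  intros HT HB. induction 1; [apply reaches_done; auto|]. eapply reaches_step; eauto.
Qed.

Lemma reaches_path Γ P : reaches Γ P -> exists R, typed false R Γ /\
  exists (n : nat) (Ps : nat -> proc), Ps 0 = P /\ Ps n = R /\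
    (forall i, i < n -> beta (Ps i) (Ps (i + 1))) /\ (forall i, i <= n -> typed true (Ps i) Γ).
Proof.
  induction 1 as [P H|P P' HT HB _ (R & HR & n & Ps & E0 & En & HB' & HT')].
  - exists P. split; auto. exists 0, (fun _ => P). repeat split; auto; [lia|].
    intros. now apply typed_mono.
  - exists R. split; auto. exists (S n), (fun i => match i with 0 => P | S i => Ps i end).
    repeat split; auto.
    + intros [|i] Hi; simpl.
      * now rewrite E0.
      * apply HB'. lia.
    + intros [|i] Hi; auto. apply HT'. lia.
Qed.

Lemma par_comp_eq m x y P P' Q Q' : proc_eq P P' -> proc_eq Q Q' ->
  proc_eq (par_comp m x y P Q) (par_comp m x y P' Q').
Proof. destruct m; simpl; auto using pe_ctx_cut. Qed.

Lemma beta_redex m x y P P' Q Q' R : proc_eq P P' -> proc_eq Q Q' ->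
  redex m (par_comp m x y P' Q') R -> beta (par_comp m x y P Q) R.
Proof.
  intros. eapply b_eq; [apply par_comp_eq; eauto|eapply b_redex; eauto|apply pe_refl].
Qed.

Lemma Composite_perm typ x q T L1 L1' y q' L2 L2' f g : Permutation L1 L1' -> Permutation L2 L2' ->
  Composite typ x q T L1 y q' L2 f g -> Composite typ x q T L1' y q' L2' f g.
Proof.
  intros P1 P2 [[V1 V2 Hs Hn] D1 D2 L].
  assert (Permutation (WEp q x (Some T) :: map snd L1) (WEp q x (Some T) :: map snd L1')) as Q1
    by (constructor; now apply Permutation_map).
  assert (Permutation (WEp q' y (Some (wdual T)) :: map snd L2)
    (WEp q' y (Some (wdual T)) :: map snd L2')) as Q2 by (constructor; now apply Permutation_map).
  assert (forall W W' w, Permutation W W' -> inw W' w -> inw W w) as I.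
  { intros W W' w P (e & He & Hw). exists e. split; auto. eapply Permutation_in; [symmetry|]; eauto. }
  split; eauto using Distr_perm.
  - split; eauto using Valid_perm.
    intros n H H'. apply (Hn n); eapply Permutation_in; [apply decl_perm; symmetry; exact Q1|exact H|
      apply decl_perm; symmetry; exact Q2|exact H'].
  - eapply Labelling_perm; [|exact L]. apply Permutation_app; now apply Permutation_map.
Qed.

Lemma CutState_perm n1 n2 typ x q T L1 L1' y q' L2 L2' f g P Q :
  Permutation L1 L1' -> Permutation L2 L2' ->
  CutState n1 n2 typ x q T L1 y q' L2 f g P Q -> CutState n1 n2 typ x q T L1' y q' L2' f g P Q.
Proof.
  intros P1 P2 [C K1 K2]. split.
  - eapply Composite_perm; eauto.
  - eapply f_eq; [constructor| | |exact K1].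
    + apply Permutation_app_head, items_perm. now apply Permutation_map.
    + constructor. apply types_perm. now apply Permutation_map.
  - eapply f_eq; [constructor| | |exact K2].
    + apply Permutation_app_head, items_perm. now apply Permutation_map.
    + constructor. apply types_perm. now apply Permutation_map.
Qed.
Arguments CutState_perm {n1 n2 typ x q T L1 L1' y q' L2 L2' f g P Q}.

Lemma comp_cons_r L1 pe L2 : Permutation (comp L1 (pe :: L2)) (unm pe :: comp L1 L2).
Proof. unfold comp. simpl. symmetry. apply Permutation_middle. Qed.

Lemma comp_cons_l L1 pe L2 : comp (pe :: L1) L2 = unm pe :: comp L1 L2.
Proof. reflexivity. Qed.

Lemma comp_perms L1 L1' L2 L2' : Permutation L1 L1' -> Permutation L2 L2' ->
  Permutation (comp L1 L2) (comp L1' L2').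
Proof. intros. apply Permutation_app; now apply Permutation_map. Qed.

Lemma head_split y U L u V E : ~ In y (map fst (types L)) ->
  Permutation ((y, U) :: types L) ((u, V) :: E) ->
  (u = y /\ V = U /\ Permutation (types L) E) \/
  (u <> y /\ exists q L', Permutation L (WEp q u (Some V) :: L') /\
    Permutation E ((y, U) :: types L')).
Proof.
  intros N P. destruct (Permutation_in _ P (or_introl eq_refl)) as [Hd|Hin].
  - injection Hd as -> ->. left. repeat split. now apply Permutation_cons_inv in P.
  - right. apply in_split in Hin as (E1 & E2 & ->).
    assert (Permutation (types L) ((u, V) :: E1 ++ E2)) as P'.
    { apply (Permutation_cons_inv (a := (y, U))). rewrite P, perm_swap.
      constructor. symmetry. apply Permutation_middle. }
    split.
    + intros ->. apply N. apply (in_map fst _ (y, V)). eapply Permutation_in; [symmetry; exact P'|].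
      simpl; auto.
    + destruct (find_type L u V (E1 ++ E2)) as (q & L' & HL & HE); [now symmetry|].
      exists q, L'. split; auto. rewrite <- HE. symmetry. apply Permutation_middle.
Qed.

Lemma types_fst W n : In n (map fst (types W)) -> In n (map wn W).
Proof.
  intro H. apply in_map_iff in H as ([m T] & <- & H). apply in_flat_map in H as (e & He & H).
  apply in_map_iff. exists e. destruct (wt e); simpl in H; [|tauto].
  destruct H as [[= <- <-]|[]]. auto.
Qed.

Lemma CutWiring_fresh typ x q T L1 y q' L2 : CutWiring typ x q T L1 y q' L2 -> ~ In y (map fst (types L2)).
Proof.
  intros S H. apply types_fst in H. pose proof (NoDup_wn _ (v_decl (s_v2 S))) as D.
  simpl in D. inversion D; auto.
Qed.

Lemma CutState_split n1 n2 typ x q T L1 y q' L2 f g P Q u V E :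
  CutState n1 n2 typ x q T L1 y q' L2 f g P Q ->
  Permutation ((y, wdual T) :: types (map snd L2)) ((u, V) :: E) ->
  (u = y /\ V = wdual T /\ Permutation (types (map snd L2)) E) \/
  (u <> y /\ exists p qu L2', Permutation L2 ((p, WEp qu u (Some V)) :: L2') /\
    Permutation E ((y, wdual T) :: types (map snd L2'))).
Proof.
  intros K PE. apply head_split in PE as [H|(N & qu & L' & PL & PE)]; auto.
  - right. split; auto. symmetry in PL. apply Permutation_map_inv in PL as (L3 & E3 & PL).
    destruct L3 as [|[p e] L3]; [discriminate|]. simpl in E3. injection E3 as <- ->.
    exists p, qu, L3. auto.
  - eapply CutWiring_fresh, c_s, k_c, K.
Qed.
Arguments CutState_split {n1 n2 typ x q T L1 y q' L2 f g P Q u V E}.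

(** * Actions that commute with the cut *)

(** Covers receptions by an endpoint of the second side: no wire is added, and a message name may
    enter the queue only if it is not declared on the first side. *)
Lemma Composite_upd typ x q T L1 y q' p e e' L2 f g :
  Composite typ x q T L1 y q' ((p, e) :: L2) f g ->
  wn e = wn e' -> incl (iw e') (iw e) -> incl (ow e') (ow e) ->
  Valid typ (e' :: WEp q' y (Some (wdual T)) :: map snd L2) ->
  Labelling f g (unm (p, e') :: comp L1 L2) ->
  (forall n, In n (decl (WEp q x (Some T) :: map snd L1)) -> In n (imsgs (wp e')) ->
    In n (imsgs (wp e))) ->
  Composite typ x q T L1 y q' ((p, e') :: L2) f g.
Proof.
  intros [[V1 V2 Hs Hn] D1 D2 L] En Ei Eo V2' L' N3.
  set (Y := WEp q' y (Some (wdual T))) in *.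
  split; auto.
  - split; simpl; auto.
    + eapply Valid_perm; [apply perm_swap|exact V2'].
    + intros w H1 (e1 & He1 & Hw). apply Hs; auto.
      destruct He1 as [<-|[<-|He1]].
      * exists Y. simpl; auto.
      * exists e. split; [simpl; auto|]. destruct Hw; auto.
      * exists e1. simpl; auto.
    + intros n H1 H2. simpl in H2. rewrite in_app_iff in H2. simpl in H2.
      rewrite in_app_iff in H2.
      assert (In n (decl (Y :: map snd ((p, e) :: L2))) -> False) as G by (apply Hn; exact H1).
      simpl in G. rewrite !in_app_iff in G. simpl in G. rewrite in_app_iff, En in G.
      specialize (N3 n H1). tauto.
  - destruct D2 as [O P]. split; auto. intros pe a b [<-|H]; [|apply O; simpl; auto].
    apply (O (p, e)). simpl; auto.
  - eapply Labelling_perm; [symmetry; apply comp_cons_r|exact L'].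
Qed.

Lemma decl_comp typ x q T L1 y q' L2 f g n :
  Composite typ x q T L1 y q' L2 f g -> In n (decl (comp L1 L2)) ->
  In n (decl (WEp q x (Some T) :: map snd L1)) \/
  In n (decl (WEp q' y (Some (wdual T)) :: map snd L2)).
Proof.
  intros [_ [_ D1] [_ D2] _] H. unfold comp, decl in H. rewrite flat_map_app in H.
  apply in_app_iff in H as [H|H]; (eapply Permutation_in in H; [|apply decl_unm; eassumption]);
    simpl; rewrite !in_app_iff in *; tauto.
Qed.

Lemma perm_mid {A : Type} (i : A) a b c : Permutation (i :: a ++ b ++ c) (a ++ (b ++ [i]) ++ c).
Proof.
  rewrite <- (app_assoc b [i] c), (app_assoc a b c), (app_assoc a b). apply Permutation_middle.
Qed.

Section Commute.
Context (n1 n2 : nat) (typ : wire -> option ty) (x : name) (q : list item) (T : wty) (L1 : list (list item * wep))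
  (y : name) (q' : list item) (f : wire -> name) (g : wire -> list name) (P Q : proc) (m : bool).
Context (IH : forall L1 q' L2 Q', CutState n1 n2 typ x q T L1 y q' L2 f g P Q' ->
  reaches (map (rb f g) (comp L1 L2)) (par_comp m x y P Q')).

(** The reception is performed twice on wires: in the second side, to obtain the state of the inner
    cut, and in the composite, to obtain the typing rule for the action now in front of the cut. *)
Lemma commute_wait p qu u w L2 Q' E :
  CutState n1 (S n2) typ x q T L1 y q' ((p, WEp qu u (Some (WBot w))) :: L2) f g P Q ->
  proc_eq Q (Wait u Q') -> u <> y ->
  fwd n2 Q' ((w, None) :: q' ++ qu ++ flat_map wp (map snd L2)) E ->
  Permutation E ((y, wdual T) :: types (map snd L2)) ->
  reaches (map (rb f g) (comp L1 ((p, WEp qu u (Some (WBot w))) :: L2))) (par_comp m x y P Q).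
Proof.
  intros K Pe N HQ PE. destruct (K) as [C K1 K2].
  pose proof (Composite_Labelling (Composite_sym C)) as LB.
  pose proof (s_v2 (c_s C)) as V2. simpl in V2, LB.
  pose proof (Valid_perm (perm_swap _ _ _) V2) as V2p.
  pose proof (Labelling_perm (perm_swap _ _ _) LB) as LBp.
  destruct (rb_wait _ _ _ _ _ _ _ P true V2p LBp) as (V2' & _ & _).
  pose proof (Valid_perm (comp_cons_r _ _ _) (Composite_Valid C)) as VC.
  pose proof (Labelling_perm (comp_cons_r _ _ _) (c_l C)) as LC.
  unfold unm at 1 in VC. unfold unm at 1 in LC. simpl in VC, LC.
  assert (forall c R, typed c R (map (rb f g) (comp L1 ((p, WEp (qu ++ [(w, None)]) u None) :: L2))) ->
    typed c (Wait u R) (map (rb f g) (comp L1 ((p, WEp qu u (Some (WBot w))) :: L2)))) as HT.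
  { intros c R HR. eapply typed_rb_perm; [symmetry; apply comp_cons_r|].
    destruct (rb_wait _ _ _ _ _ _ _ R c VC LC) as (_ & _ & G). apply G.
    eapply typed_rb_perm; [|exact HR]. rewrite comp_cons_r. unfold unm at 1. simpl.
    now rewrite app_assoc. }
  eapply reaches_step; [eapply CutState_typed; exact K| |].
  - eapply beta_redex; [apply pe_refl|exact Pe|apply r_wait; exact N].
  - eapply (reaches_under (Wait u)); [exact HT|apply b_wait|].
    apply (IH L1 q'). split; auto.
    + eapply Composite_upd; [exact C|reflexivity| | |exact V2'| |].
      * unfold iw. simpl. rewrite map_app, app_nil_r. apply incl_refl.
      * apply incl_refl.
      * destruct (rb_wait _ _ _ _ _ _ _ P true VC LC) as (_ & LC' & _).
        unfold unm at 1. simpl. rewrite app_assoc. exact LC'.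
      * simpl. intros n _. rewrite imsgs_app. simpl. now rewrite app_nil_r.
    + simpl. eapply f_eq; [constructor| |exact PE|exact HQ].
      apply perm_mid.
Qed.

Lemma commute_recv p qu u w z A B L2 Q' E :
  CutState n1 (S n2) typ x q T L1 y q' ((p, WEp qu u (Some (WPar A w B))) :: L2) f g P Q ->
  proc_eq Q (Recv u z Q') -> u <> y ->
  fwd n2 Q' ((w, Some (z, A)) :: q' ++ qu ++ flat_map wp (map snd L2)) ((u, B) :: E) ->
  Permutation E ((y, wdual T) :: types (map snd L2)) ->
  z <> y -> ~ In z (fn P) -> ~ In z (decl (WEp q x (Some T) :: map snd L1)) ->
  ~ In z (decl (WEp qu u (Some (WPar A w B)) :: WEp q' y (Some (wdual T)) :: map snd L2)) ->
  reaches (map (rb f g) (comp L1 ((p, WEp qu u (Some (WPar A w B))) :: L2))) (par_comp m x y P Q).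
Proof.
  intros K Pe N HQ PE Z1 Z2 Z3 Z4. destruct (K) as [C K1 K2].
  pose proof (Composite_Labelling (Composite_sym C)) as LB.
  pose proof (s_v2 (c_s C)) as V2. simpl in V2, LB.
  pose proof (Valid_perm (perm_swap _ _ _) V2) as V2p.
  pose proof (Labelling_perm (perm_swap _ _ _) LB) as LBp.
  destruct (rb_recv _ _ _ _ _ _ _ _ _ _ P true Z4 V2p LBp) as (V2' & _ & _).
  pose proof (Valid_perm (comp_cons_r _ _ _) (Composite_Valid C)) as VC.
  pose proof (Labelling_perm (comp_cons_r _ _ _) (c_l C)) as LC.
  assert (~ In z (decl (unm (p, WEp qu u (Some (WPar A w B))) :: comp L1 L2))) as Z5.
  { intro H. eapply Permutation_in in H; [|apply decl_perm; symmetry; apply comp_cons_r].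
    eapply decl_comp in H; eauto. destruct H as [H|H]; auto. apply Z4.
    eapply Permutation_in; [apply decl_perm, perm_swap|exact H]. }
  unfold unm at 1 in VC. unfold unm at 1 in LC. unfold unm at 1 in Z5. simpl in VC, LC, Z5.
  assert (forall c R, typed c R (map (rb f g) (comp L1 ((p, WEp (qu ++ [(w, Some (z, A))]) u (Some B)) :: L2))) ->
    typed c (Recv u z R) (map (rb f g) (comp L1 ((p, WEp qu u (Some (WPar A w B))) :: L2)))) as HT.
  { intros c R HR. eapply typed_rb_perm; [symmetry; apply comp_cons_r|].
    destruct (rb_recv _ _ _ _ _ _ _ _ _ _ R c Z5 VC LC) as (_ & _ & G). apply G.
    eapply typed_rb_perm; [|exact HR]. rewrite comp_cons_r. unfold unm at 1. simpl.
    now rewrite app_assoc. }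
  eapply reaches_step; [eapply CutState_typed; exact K| |].
  - eapply beta_redex; [apply pe_refl|exact Pe|apply r_recv; auto].
  - eapply (reaches_under (Recv u z)); [exact HT|apply b_recv|].
    apply (IH L1 q'). split; auto.
    + eapply Composite_upd; [exact C|reflexivity| | |exact V2'| |].
      * unfold iw. simpl. rewrite map_app, <- app_assoc. apply incl_refl.
      * apply incl_refl.
      * destruct (rb_recv _ _ _ _ _ _ _ _ _ _ P true Z5 VC LC) as (_ & LC' & _).
        unfold unm at 1. simpl. rewrite app_assoc. exact LC'.
      * simpl. intros n Hn. rewrite imsgs_app, in_app_iff. simpl. intros [H|[<-|[]]]; auto. now destruct Z3.
    + simpl. eapply f_eq; [constructor| | |exact HQ].
      * apply perm_mid.
      * rewrite PE. apply perm_swap.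
Qed.
End Commute.

Lemma Composite_sub typ x q T L1 y q' L2 f g L1' q2' L2' :
  Composite typ x q T L1 y q' L2 f g -> map snd L1' = map snd L1 ->
  Valid typ (WEp q2' y (Some (wdual T)) :: map snd L2') ->
  (forall w, inw (WEp q2' y (Some (wdual T)) :: map snd L2') w ->
    inw (WEp q' y (Some (wdual T)) :: map snd L2) w) ->
  incl (decl (WEp q2' y (Some (wdual T)) :: map snd L2'))
    (decl (WEp q' y (Some (wdual T)) :: map snd L2)) ->
  Distr q2' L1' -> Distr q L2' -> Labelling f g (comp L1' L2') -> Composite typ x q T L1' y q2' L2' f g.
Proof.
  intros [[V1 V2 Hs Hn] D1 D2 L] E V2' I J D1' D2' L'. split; auto.
  split; rewrite ?E; eauto.
Qed.

Lemma Distr_fst m L L' : map fst L = map fst L' -> Distr m L -> Distr m L'.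
Proof.
  intros E [O P]. split.
  - intros pe a b H B. apply (in_map fst) in H. rewrite <- E in H.
    apply in_map_iff in H as (pe' & E' & H). apply (O pe'); auto. congruence.
  - rewrite <- P, !flat_map_concat_map, <- E. reflexivity.
Qed.

Lemma before_mid (l1 l2 : list nat) a b c : NoDup (l1 ++ c :: l2) ->
  before (l1 ++ c :: l2) a b -> a <> c -> b <> c -> before (l1 ++ l2) a b.
Proof.
  intros D B Na Nb. rewrite before_app in *. simpl in B.
  destruct B as [B|[[[E _]|B]|[Ha [E|Hb]]]]; auto; congruence.
Qed.

Lemma Distr_remove a1 i a2 e L q1 q2 : NoDup (map fst (q1 ++ i :: q2)) ->
  Distr (q1 ++ i :: q2) ((a1 ++ i :: a2, e) :: L) -> Distr (q1 ++ q2) ((a1 ++ a2, e) :: L).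
Proof.
  intros D [O P].
  assert (Permutation (flat_map fst ((a1 ++ a2, e) :: L)) (q1 ++ q2)) as P'.
  { simpl in *. rewrite <- app_assoc in *. simpl in P. now apply Permutation_app_inv in P. }
  split; auto. intros pe a b H B.
  assert (before (map fst (q1 ++ i :: q2)) a b) as G.
  { destruct H as [<-|H]; [|apply (O pe); simpl; auto]. apply (O _ a b (or_introl eq_refl)). simpl in *.
    rewrite map_app in *. simpl. now apply before_app_split. }
  assert (forall c, In c (map fst (fst pe)) -> c <> fst i) as NI.
  { intros c Hc ->. rewrite map_app in D. simpl in D. apply NoDup_mid in D as [_ D].
    apply D. rewrite <- map_app, <- P'. apply in_map_iff in Hc as (j & Ej & Hj). rewrite <- Ej.
    apply in_map. apply in_flat_map. eauto. }
  apply before_in in B as [Ha Hb]. rewrite map_app in *. simpl in *.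
  eapply before_mid; eauto.
Qed.

Section CommuteSend.
Context (n1 n2 : nat) (typ : wire -> option ty) (x : name) (q : list item) (T : wty)
  (y : name) (f : wire -> name) (g : wire -> list name) (P Q : proc) (m : bool).
Context (IH : forall L1 q' L2 Q', CutState n1 n2 typ x q T L1 y q' L2 f g P Q' ->
  reaches (map (rb f g) (comp L1 L2)) (par_comp m x y P Q')).
Context (u v z : name) (w : wire) (A : ty) (B : wty) (S0 Q' : proc) (qx : list item).
Context (Pe : proc_eq Q (Send u v S0 Q')) (N : u <> y)
  (HS : typed false S0 [Ep [] z (Some (annot (dual A) v)); Ep [] v (Some (annot A z))]).
Let i : item := (w, Some (z, dual A)).
Let ex := WEp qx u (Some (WTensor A w B)).
Let ex' := WEp qx u (Some B).

(** The common part of two cases. In the composite the message always waits at an endpoint; before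
    composition it waits either at an endpoint of the second side or in the queue of [y]. *)
Lemma send_step L1 q' L2 L1' q2' L2' q1 q2 uu C qc W :
  CutState n1 (S n2) typ x q T L1 y q' L2 f g P Q -> z <> y ->
  Permutation (comp L1 L2) (WEp (q1 ++ i :: q2) uu C :: WEp qc u (Some (WTensor A w B)) :: W) ->
  Permutation (comp L1' L2') (WEp (q1 ++ q2) uu C :: WEp qc u (Some B) :: W) ->
  (Labelling f g (comp L1' L2') -> CutState n1 n2 typ x q T L1' y q2' L2' f g P Q') ->
  reaches (map (rb f g) (comp L1 L2)) (par_comp m x y P Q).
Proof.
  intros K Nz PC PC' K'. pose proof (k_c K) as CC.
  pose proof (Valid_perm PC (Composite_Valid CC)) as VC.
  pose proof (Labelling_perm PC (c_l CC)) as LC.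
  destruct (Valid_send _ _ _ _ _ _ _ _ _ _ _ _ _ _ VC LC) as [VC' LC'].
  eapply reaches_step; [eapply CutState_typed; exact K| |].
  - eapply beta_redex; [apply pe_refl|exact Pe|apply r_send; auto].
    rewrite in_remove_iff. intros [H H']. apply (spawn_fn _ _ _ _ HS) in H as [->| ->]; auto.
  - eapply (reaches_under (Send u v S0) (map (rb f g) (comp L1' L2'))); [|apply b_send_r|].
    + intros c R HR. eapply typed_rb_perm; [symmetry; exact PC|].
      eapply (rb_send _ _ _ _ _ _ _ _ _ _ _ _ _ _ _ _ _ c VC LC); eauto.
      eapply typed_rb_perm; [exact PC'|exact HR].
    + eapply IH. apply K'. eapply Labelling_perm; [symmetry; exact PC'|exact LC'].
Qed.

Lemma commute_send_own L1 q' pu px q1 q2 uu C L2 M E :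
  let eu := WEp (q1 ++ i :: q2) uu C in
  CutState n1 (S n2) typ x q T L1 y q' ((pu, eu) :: (px, ex) :: L2) f g P Q ->
  fwd n2 Q' M ((u, B) :: E) ->
  Permutation M (q' ++ (q1 ++ q2) ++ qx ++ flat_map wp (map snd L2)) ->
  Permutation E ((y, wdual T) :: types (WEp (q1 ++ q2) uu C :: map snd L2)) ->
  reaches (map (rb f g) (comp L1 ((pu, eu) :: (px, ex) :: L2))) (par_comp m x y P Q).
Proof.
  intros eu K HQ PM PE. destruct (K) as [CC K1 K2].
  pose proof (Composite_Labelling (Composite_sym CC)) as LB.
  pose proof (s_v2 (c_s CC)) as V2. simpl in V2, LB.
  set (Y := WEp q' y (Some (wdual T))) in *.
  assert (forall a b W, Permutation (Y :: a :: b :: W) (a :: b :: Y :: W)) as PS.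
  { intros. rewrite perm_swap. constructor. apply perm_swap. }
  destruct (Valid_send _ _ _ _ _ _ _ _ _ _ _ _ _ _ (Valid_perm (PS _ _ _) V2)
    (Labelling_perm (PS _ _ _) LB)) as [V2' _].
  assert (In z (imsgs (wp eu))) as Iz.
  { simpl. rewrite imsgs_app, in_app_iff. simpl. auto. }
  apply (send_step L1 q' ((pu, eu) :: (px, ex) :: L2) L1 q'
    ((pu, WEp (q1 ++ q2) uu C) :: (px, ex') :: L2) (pu ++ q1) q2 uu C (px ++ qx) (comp L1 L2)); auto.
  - pose proof (v_decl V2) as D. simpl in D. inversion D as [|? ? D1 _]; subst.
    intros ->. apply D1. simpl in Iz. rewrite !in_app_iff. simpl. rewrite in_app_iff. auto.
  - rewrite !comp_cons_r. unfold unm at 1 2. simpl. now rewrite <- app_assoc.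
  - rewrite !comp_cons_r. unfold unm at 1 2. simpl. now rewrite <- app_assoc.
  - intro L'. split; auto.
    + eapply Composite_sub; [exact CC|reflexivity| | | |apply (c_d1 CC)| |exact L'].
      * eapply Valid_perm; [symmetry; apply PS|exact V2'].
      * simpl. intros c (e & [<-|[<-|[<-|He]]] & Hc).
        -- exists Y. simpl; auto.
        -- exists eu. split; [simpl; auto|]. destruct Hc as [Hc|Hc]; [left|right; exact Hc].
           unfold iw in *. simpl in *. rewrite !map_app in *. simpl. rewrite !in_app_iff in *. simpl. tauto.
        -- exists ex. split; [simpl; auto|]. destruct Hc as [Hc|Hc]; [left; exact Hc|right].
           unfold ow in *. simpl in *. auto.
        -- exists e. simpl. auto.
      * intros c. simpl. rewrite !imsgs_app, !in_app_iff. simpl. rewrite !in_app_iff. simpl.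
        rewrite !in_app_iff. tauto.
      * eapply Distr_fst; [|apply (c_d2 CC)]. reflexivity.
    + simpl. eapply f_eq; [constructor| | |exact HQ].
      * exact PM.
      * rewrite PE. simpl. rewrite perm_swap. constructor. destruct C; simpl; [apply perm_swap|reflexivity].
Qed.

(** The message is queued at [y] and was given to an endpoint of the first side by the distribution.
    It is removed from the queue and from that share alike, so the rest is still a distribution. *)
Lemma commute_send_pool a1 a2 e1 L1 q1 q2 px L2 M E :
  CutState n1 (S n2) typ x q T ((a1 ++ i :: a2, e1) :: L1) y (q1 ++ i :: q2) ((px, ex) :: L2) f g P Q ->
  fwd n2 Q' M ((u, B) :: E) ->
  Permutation M ((q1 ++ q2) ++ qx ++ flat_map wp (map snd L2)) ->
  Permutation E ((y, wdual T) :: types (map snd L2)) ->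
  reaches (map (rb f g) (comp ((a1 ++ i :: a2, e1) :: L1) ((px, ex) :: L2))) (par_comp m x y P Q).
Proof.
  intros K HQ PM PE. destruct (K) as [CC K1 K2].
  pose proof (Composite_Labelling (Composite_sym CC)) as LB.
  pose proof (s_v2 (c_s CC)) as V2. simpl in V2, LB.
  destruct (Valid_send _ _ _ _ _ _ _ _ _ _ _ _ _ _ V2 LB) as [V2' _].
  apply (send_step ((a1 ++ i :: a2, e1) :: L1) (q1 ++ i :: q2) ((px, ex) :: L2) ((a1 ++ a2, e1) :: L1) (q1 ++ q2)
    ((px, ex') :: L2) a1 (a2 ++ wp e1) (wn e1) (wt e1) (px ++ qx) (comp L1 L2)); auto.
  - pose proof (v_decl V2) as D. simpl in D. inversion D as [|? ? D1 _]; subst.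
    intros ->. apply D1. rewrite imsgs_app, !in_app_iff. simpl. auto.
  - rewrite !comp_cons_r, comp_cons_l. unfold unm at 1 2. simpl. rewrite <- app_assoc. apply perm_swap.
  - rewrite !comp_cons_r, comp_cons_l. unfold unm at 1 2. simpl. rewrite <- app_assoc. apply perm_swap.
  - intro L'. split; auto.
    + eapply Composite_sub; [exact CC|reflexivity|exact V2'| | | | |exact L'].
      * simpl. intros c (e & [<-|[<-|He]] & Hc).
        -- eexists. split; [left; reflexivity|]. destruct Hc as [Hc|Hc]; [left|right; exact Hc].
           unfold iw in *. simpl in *. rewrite !map_app in *. simpl. rewrite !in_app_iff in *. simpl. tauto.
        -- exists ex. split; [simpl; auto|]. destruct Hc as [Hc|Hc]; [left; exact Hc|right].
           unfold ow in *. simpl in *. auto.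
        -- exists e. simpl. auto.
      * intros c. simpl. rewrite !imsgs_app, !in_app_iff. simpl. rewrite !in_app_iff. simpl. tauto.
      * eapply Distr_remove; [|apply (c_d1 CC)].
        pose proof (v_iw V2 _ (or_introl eq_refl)) as D. apply NoDup_app_iff in D. tauto.
      * eapply Distr_fst; [|apply (c_d2 CC)]. reflexivity.
    + simpl. eapply f_eq; [constructor|exact PM| |exact HQ].
      rewrite PE. apply perm_swap.
Qed.
End CommuteSend.

(** * Actions on the cut endpoint *)

Inductive principal (F : list name) (n : nat) (Q : proc) (y : name) (V : wty)
    (M : list item) (E : list (name * wty)) : Prop :=
| p_link z : proc_eq Q (Link z y) -> z <> y -> M = [] -> E = [(z, wdual V)] ->
    principal F n Q y V M E
| p_close w : proc_eq Q (Close y) -> V = WOne w -> E = [] -> Forall (eq (w, None)) M ->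
    principal F n Q y V M E
| p_wait n' w Q' : n = S n' -> proc_eq Q (Wait y Q') -> V = WBot w ->
    fwd n' Q' ((w, None) :: M) E -> principal F n Q y V M E
| p_recv n' w z A B Q' : n = S n' -> proc_eq Q (Recv y z Q') -> V = WPar A w B ->
    ~ In z F -> ~ In z (imsgs M ++ y :: map fst E) ->
    fwd n' Q' ((w, Some (z, A)) :: M) ((y, B) :: E) -> principal F n Q y V M E
| p_send n' v z w A B S0 Q' M' : n = S n' -> proc_eq Q (Send y v S0 Q') ->
    V = WTensor A w B ->
    typed false S0 [Ep [] z (Some (annot (dual A) v)); Ep [] v (Some (annot A z))] ->
    Permutation M ((w, Some (z, dual A)) :: M') ->
    fwd n' Q' M' ((y, B) :: E) -> principal F n Q y V M E.

Lemma perm_two {A : Type} (a b c : A) E : Permutation (a :: E) [b; c] ->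
  (a = b /\ E = [c]) \/ (a = c /\ E = [b]).
Proof.
  intro P. apply Permutation_sym, Permutation_length_2_inv in P as [[= -> ->]|[= -> ->]]; auto.
Qed.

(** A process acts either on [y] or on another endpoint of its context, and in the latter case the
    action commutes with the cut. [F'] keeps the bound name of a commuted input away from [P] and
    both contexts; [F] adds the names to be avoided in a principal input. *)
Lemma head_cases F n1 n2 typ x q T L1 y q' L2 f g P Q m :
  (forall n L1 q' L2 Q', n < n2 -> CutState n1 n typ x q T L1 y q' L2 f g P Q' ->
    reaches (map (rb f g) (comp L1 L2)) (par_comp m x y P Q')) ->
  CutState n1 n2 typ x q T L1 y q' L2 f g P Q ->
  reaches (map (rb f g) (comp L1 L2)) (par_comp m x y P Q) \/
  principal F n2 Q y (wdual T) (q' ++ flat_map wp (map snd L2)) (types (map snd L2)).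
Proof.
  intros IH K. destruct (K) as [CC K1 K2].
  set (F' := F ++ y :: fn P ++ decl (WEp q x (Some T) :: map snd L1) ++
    decl (WEp q' y (Some (wdual T)) :: map snd L2)).
  assert (incl F F') as IF by (intros a Ha; apply in_app_iff; auto).
  pose proof (fwd_inv F' _ _ _ _ K2) as HI.
  remember (q' ++ flat_map wp (map snd L2)) as M eqn:EM.
  remember ((y, wdual T) :: types (map snd L2)) as E eqn:EE.
  destruct HI as
    [n u z a P' E Pe N PE|n u w P' M Pe FM|n u w P0 Q' M E E' Pe HQ PE|
     n u z w A B P0 Q' M E E' Pe NF NN HQ PE|n u v z w A B S0 P0 Q' M M' E E' Pe HS HQ PM PE]; try subst E.
  - right. subst. apply perm_two in PE as [[[= -> ->] ->]|[[= -> ->] ->]].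
    + apply (p_link _ _ _ _ _ _ _ z); auto. eapply pe_trans; [exact Pe|apply pe_link].
    + apply (p_link _ _ _ _ _ _ _ u); auto.
  - right. injection EE as <- <- <-. eapply p_close; eauto.
  - destruct (CutState_split K PE) as [(-> & <- & PE')|(N & p & qu & L2' & PL & PE')].
    + right. eapply p_wait; [reflexivity|exact Pe|reflexivity|]. eapply f_eq; [constructor|reflexivity| |exact HQ].
      now symmetry.
    + left. pose proof (CutState_perm (Permutation_refl _) PL K) as K'.
      eapply reaches_ctx; [apply ctx_rb_perm, comp_perms; [reflexivity|symmetry; exact PL]|].
      eapply commute_wait; [|exact K'|exact Pe|exact N| |exact PE'].
      * intros. eapply IH; [|eassumption]. lia.
      * eapply f_eq; [constructor| |reflexivity|exact HQ]. constructor. rewrite EM.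
        apply Permutation_app_head. change (qu ++ flat_map wp (map snd L2')) with
          (flat_map wp (map snd ((p, WEp qu u (Some (WBot w))) :: L2'))).
        apply items_perm. now apply Permutation_map.
  - destruct (CutState_split K PE) as [(-> & <- & PE')|(N & p & qu & L2' & PL & PE')].
    + right. eapply p_recv; [reflexivity|exact Pe|reflexivity| | |].
      * intro H. apply NF, IF, H.
      * intro H. apply NN. rewrite <- PE'. exact H.
      * eapply f_eq; [constructor|reflexivity| |exact HQ]. constructor. now symmetry.
    + left. pose proof (CutState_perm (Permutation_refl _) PL K) as K'.
      eapply reaches_ctx; [apply ctx_rb_perm, comp_perms; [reflexivity|symmetry; exact PL]|].
      assert (z <> y /\ ~ In z (fn P) /\ ~ In z (decl (WEp q x (Some T) :: map snd L1)) /\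
        ~ In z (decl (WEp q' y (Some (wdual T)) :: map snd L2))) as (Z1 & Z2 & Z3 & Z4).
      { repeat split; intro H; apply NF; unfold F'; apply in_app_iff; right;
          [left; auto|right; apply in_app_iff; auto|right..]; apply in_app_iff; right;
          apply in_app_iff; auto. }
      eapply commute_recv; [|exact K'|exact Pe|exact N| |exact PE'| | | |].
      * intros. eapply IH; [|eassumption]. lia.
      * eapply f_eq; [constructor| |reflexivity|exact HQ]. constructor. rewrite EM.
        apply Permutation_app_head. change (qu ++ flat_map wp (map snd L2')) with
          (flat_map wp (map snd ((p, WEp qu u (Some (WPar A w B))) :: L2'))).
        apply items_perm. now apply Permutation_map.
      * exact Z1.
      * exact Z2.
      * exact Z3.
      * intro H. apply Z4.
        eapply Permutation_in; [|exact H]. apply decl_perm. rewrite perm_swap. constructor.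
        symmetry. apply (Permutation_map snd PL).
  - destruct (CutState_split K PE) as [(-> & <- & PE')|(N & p & qu & L2' & PL & PE')].
    + right. eapply p_send; [reflexivity|exact Pe|reflexivity|exact HS|exact PM|].
      eapply f_eq; [constructor|reflexivity| |exact HQ]. constructor. now symmetry.
    + left. pose proof (CutState_perm (Permutation_refl _) PL K) as K'.
      eapply reaches_ctx; [apply ctx_rb_perm, comp_perms; [reflexivity|symmetry; exact PL]|].
      set (i := (w, Some (z, dual A))) in *.
      assert (Permutation (i :: M') (q' ++ qu ++ flat_map wp (map snd L2'))) as PM'.
      { rewrite <- PM, EM. apply Permutation_app_head.
        change (qu ++ flat_map wp (map snd L2')) with
          (flat_map wp (map snd ((p, WEp qu u (Some (WTensor A w B))) :: L2'))).
        apply items_perm. now apply Permutation_map. }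
      assert (In i (q' ++ qu ++ flat_map wp (map snd L2'))) as Hi
        by (eapply Permutation_in; [exact PM'|simpl; auto]).
      rewrite !in_app_iff in Hi. destruct Hi as [Hi|[Hi|Hi]].
      * apply in_split in Hi as (q1 & q2 & ->).
        pose proof (d_perm (c_d1 CC)) as DP.
        assert (In i (flat_map fst L1)) as Hi.
        { eapply Permutation_in; [symmetry; exact DP|]. apply in_app_iff. simpl; auto. }
        apply in_flat_map in Hi as ([a e1] & He & Hi). simpl in Hi.
        apply in_split in Hi as (a1 & a2 & ->).
        apply in_split in He as (La & Lb & ->).
        pose proof (Permutation_sym (Permutation_middle La Lb (a1 ++ i :: a2, e1))) as PL1.
        pose proof (CutState_perm PL1 (Permutation_refl _) K') as K3.
        eapply reaches_ctx; [apply ctx_rb_perm, comp_perms; [symmetry; exact PL1|reflexivity]|].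
        eapply commute_send_pool; [|exact Pe|exact N|exact HS|exact K3|exact HQ| |exact PE'].
        -- intros. eapply IH; [|eassumption]. lia.
        -- rewrite <- app_assoc in PM'. simpl in PM'. rewrite <- Permutation_middle in PM'.
           apply Permutation_cons_inv in PM'. now rewrite <- app_assoc.
      (* The message cannot wait at [u], which sends its wire. *)
      * exfalso. pose proof (k_c K') as C'.
        pose proof (s_v2 (c_s C')) as V2. simpl in V2.
        apply (v_irr V2 (WEp qu u (Some (WTensor A w B))) w); simpl; auto.
        apply in_app_iff. left. apply (in_map fst _ i Hi).
      * apply in_flat_map in Hi as (eu & He & Hi). apply in_map_iff in He as ([pu eu'] & E0 & He).
        simpl in E0. subst eu'. destruct eu as [qe uu C]. simpl in Hi.
        apply in_split in Hi as (q1 & q2 & ->).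
        apply in_split in He as (La & Lb & ->).
        set (eu := WEp (q1 ++ i :: q2) uu C) in *.
        assert (Permutation ((p, WEp qu u (Some (WTensor A w B))) :: La ++ (pu, eu) :: Lb)
          ((pu, eu) :: (p, WEp qu u (Some (WTensor A w B))) :: La ++ Lb)) as PL2.
        { rewrite perm_swap. constructor. symmetry. apply Permutation_middle. }
        pose proof (CutState_perm (Permutation_refl _) PL2 K') as K3.
        eapply reaches_ctx; [apply ctx_rb_perm, comp_perms; [reflexivity|symmetry; exact PL2]|].
        assert (Permutation (map snd (La ++ (pu, eu) :: Lb)) (eu :: map snd (La ++ Lb))) as PL3.
        { rewrite !map_app. simpl. symmetry. apply Permutation_middle. }
        eapply commute_send_own; [|exact Pe|exact N|exact HS|exact K3|exact HQ| |].
        -- intros. eapply IH; [|eassumption]. lia.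
        -- apply (Permutation_cons_inv (a := i)). rewrite PM', PL3. simpl.
           rewrite <- !app_assoc. simpl.
           rewrite (Permutation_app_comm qu). rewrite <- !app_assoc. simpl.
           rewrite !app_assoc. rewrite <- (app_assoc (q' ++ q1)). rewrite <- !Permutation_middle.
           constructor. rewrite <- !app_assoc. repeat apply Permutation_app_head.
           apply Permutation_app_comm.
        -- rewrite PE'. constructor. exact (types_perm _ _ PL3).
Qed.

(** * Cuts on links and on units *)

Lemma bn_swap a b P : bn (swap a b P) = map (transp a b) (bn P).
Proof. induction P; simpl; rewrite ?map_app; congruence. Qed.

(** The substitution performed by a link reduction avoids capture only if its new name is not bound,
    so bound names have to be changed beforehand. *)
Lemma bn_fresh z P : exists P', proc_eq P P' /\ ~ In z (bn P').
Proof.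
  assert (forall v P0, ~ In z (bn P0) -> exists v', (v' = v \/ ~ In v' (fn P0)) /\ v' <> z /\
    ~ In z (bn (swap v v' P0))) as R.
  { intros v P0 H. destruct (Nat.eq_dec v z) as [->|N].
    - destruct (fresh_name (z :: fn P0 ++ bn P0)) as [v' F]. simpl in F. rewrite in_app_iff in F.
      exists v'. split; [tauto|]. split; [intros ->; tauto|]. rewrite bn_swap. intro I.
      apply in_map_iff in I as (c & Ec & Hc). assert (c = v') as -> by (apply (transp_inj z v'); now rewrite Ec, transp_r). tauto.
    - exists v. split; auto. split; auto. rewrite bn_swap. intro I.
      apply in_map_iff in I as (c & Ec & Hc). unfold transp in Ec.
      destruct (Nat.eq_dec c v); [congruence|]. subst c. tauto. }
  assert (forall v P0, swap v v P0 = P0) as I.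
  { assert (forall v n, transp v v n = n) as T
      by (intros; unfold transp; repeat destruct Nat.eq_dec; congruence).
    intros v P0. induction P0; simpl; rewrite ?T; congruence. }
  induction P as [u v|u v P1 (P1' & E1 & H1) P2 (P2' & E2 & H2)|u P1 (P1' & E1 & H1)|u|
    u v P1 (P1' & E1 & H1)|u v P1 (P1' & E1 & H1) P2 (P2' & E2 & H2)].
  - exists (Link u v). split; [constructor|simpl; auto].
  - destruct (R u P1' H1) as (u' & Hu & Nu & Bu). destruct (R v P2' H2) as (v' & Hv & Nv & Bv).
    exists (Cut u' v' (swap u u' P1') (swap v v' P2')). split.
    + eapply pe_trans; [apply pe_ctx_cut; eassumption|]. eapply pe_trans.
      * instantiate (1 := Cut u' v (swap u u' P1') P2'). destruct Hu as [->|Hu]; [|now apply pe_cut_l].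
        rewrite I. constructor.
      * destruct Hv as [->|Hv]; [|now apply pe_cut_r]. rewrite I. constructor.
    + simpl. rewrite in_app_iff. intuition.
  - exists (Wait u P1'). split; [now constructor|auto].
  - exists (Close u). split; [constructor|simpl; auto].
  - destruct (R v P1' H1) as (v' & Hv & Nv & Bv). exists (Recv u v' (swap v v' P1')). split.
    + eapply pe_trans; [apply pe_ctx_recv; eassumption|].
      destruct Hv as [->|Hv]; [|now apply pe_recv]. rewrite I. constructor.
    + simpl. intuition.
  - destruct (R v P1' H1) as (v' & Hv & Nv & Bv). exists (Send u v' (swap v v' P1') P2'). split.
    + eapply pe_trans; [apply pe_ctx_send; eassumption|].
      destruct Hv as [->|Hv]; [|now apply pe_send]. rewrite I. constructor.
    + simpl. rewrite in_app_iff. intuition.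
Qed.

Lemma swap_sym a b P : swap a b P = swap b a P.
Proof.
  assert (forall n, transp a b n = transp b a n) as T
    by (intros; unfold transp; repeat destruct Nat.eq_dec; congruence).
  induction P; simpl; rewrite ?T; congruence.
Qed.

(** For [z] neither free nor bound, the two differ only under a binder of [y]: there the
    substitution stops while the swap renames the binder to [z], which is an equality of
    processes. *)
Lemma subst_swap z y P : z <> y -> ~ In z (fn P) -> ~ In z (bn P) ->
  proc_eq (subst_name z y P) (swap z y P).
Proof.
  intros N.
  assert (forall n, n <> z -> (if Nat.eq_dec n y then z else n) = transp z y n) as T.
  { intros n H. unfold transp. destruct (Nat.eq_dec n z); [congruence|reflexivity]. }
  induction P as [u v|u v P1 IH1 P2 IH2|u P1 IH1|u|u v P1 IH1|u v P1 IH1 P2 IH2]; simpl;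
    rewrite ?in_app_iff, ?in_remove_iff; intros HF HB; rewrite ?T by (intros ->; tauto).
  - constructor.
  - eapply pe_trans; [|eapply pe_trans].
    + instantiate (1 := Cut (transp z y u) v (swap z y P1) (if Nat.eq_dec v y then P2 else subst_name z y P2)).
      destruct (Nat.eq_dec u y) as [->|Nu].
      * rewrite transp_r, (swap_sym z). apply pe_cut_l. intro H. apply HF. auto.
      * rewrite transp_other by (auto; intros ->; tauto). apply pe_ctx_cut; [|constructor].
        apply IH1; [|tauto]. intro H. apply HF. left. split; [auto|intros ->; tauto].
    + instantiate (1 := Cut (transp z y u) (transp z y v) (swap z y P1) (swap z y P2)).
      destruct (Nat.eq_dec v y) as [->|Nv].
      * rewrite transp_r, (swap_sym z y P2). apply pe_cut_r. intro H. apply HF. auto.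
      * rewrite (transp_other z y v) by (auto; intros ->; tauto). apply pe_ctx_cut; [constructor|].
        apply IH2; [|tauto]. intro H. apply HF. right. split; [auto|intros ->; tauto].
    + constructor.
  - apply pe_ctx_wait, IH1; tauto.
  - constructor.
  - destruct (Nat.eq_dec v y) as [->|Nv].
    + rewrite transp_r, (swap_sym z). apply pe_recv. intro H. apply HF. auto.
    + rewrite (transp_other z y v) by (auto; intros ->; tauto). apply pe_ctx_recv, IH1; [|tauto].
      intro H. apply HF. right. split; [auto|intros ->; tauto].
  - eapply pe_trans.
    + apply pe_ctx_send; [constructor|]. apply IH2; tauto.
    + destruct (Nat.eq_dec v y) as [->|Nv].
      * rewrite transp_r, (swap_sym z y P1). apply pe_send. intro H. apply HF. auto.
      * rewrite (transp_other z y v) by (auto; intros ->; tauto). apply pe_ctx_send; [|constructor].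
        apply IH1; [|tauto]. intro H. apply HF. right; left. split; [auto|intros ->; tauto].
Qed.

Lemma items_unm L q : Permutation (flat_map fst L) q ->
  Permutation (flat_map wp (map unm L)) (q ++ flat_map wp (map snd L)).
Proof.
  intros <-. induction L as [|[p e] L IH]; simpl; [constructor|].
  rewrite IH, <- !app_assoc. apply Permutation_app_head. rewrite !app_assoc.
  apply Permutation_app_tail, Permutation_app_comm.
Qed.

Lemma items_comp typ x q T L1 y q' L2 f g : Composite typ x q T L1 y q' L2 f g ->
  Permutation (flat_map wp (comp L1 L2))
    ((q' ++ flat_map wp (map snd L1)) ++ q ++ flat_map wp (map snd L2)).
Proof.
  intros C. unfold comp. rewrite flat_map_app.
  apply Permutation_app; apply items_unm; apply d_perm;
    [apply (c_d1 C)|apply (c_d2 C)].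
Qed.
Arguments items_comp {typ x q T L1 y q' L2 f g}.

Lemma types_comp L1 L2 : types (comp L1 L2) = types (map snd L1) ++ types (map snd L2).
Proof.
  unfold comp, types. rewrite flat_map_app. f_equal; rewrite !flat_map_concat_map, !map_map; reflexivity.
Qed.

Lemma fwd_stars w n P M M0 E : Forall (eq (w, None)) M0 -> M0 <> [] ->
  fwd n P ((w, None) :: M) E -> fwd n P (M0 ++ M) E.
Proof.
  intros H N F. induction H as [|i M0 <- H IH]; [congruence|]. destruct M0 as [|j M0]; auto.
  simpl. assert (j = (w, None)) as -> by (inversion H; auto).
  apply fwd_star; [|simpl; auto]. apply IH. congruence.
Qed.

Lemma par_comp_flip m x y P Q : par_comp m x y P Q = par_comp (negb m) y x Q P.
Proof. destruct m; reflexivity. Qed.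

Lemma side_fresh typ W e n m : Valid typ (e :: W) -> In n (wn e :: imsgs (wp e)) ->
  In m (decl W) -> n <> m.
Proof.
  intros V H H' ->. pose proof (v_decl V) as D. simpl in D.
  change (NoDup ((wn e :: imsgs (wp e)) ++ decl W)) in D. apply NoDup_app_iff in D as (_ & _ & D). eauto.
Qed.

Lemma imsgs_items W n : In n (imsgs (flat_map wp W)) -> In n (decl W).
Proof.
  intro H. unfold imsgs in H. apply in_flat_map in H as (i & Hi & Hn).
  apply in_flat_map in Hi as (e & He & Hi). apply in_flat_map. exists e. split; auto.
  right. apply in_flat_map. eauto.
Qed.

Lemma types_decl W n : In n (map fst (types W)) -> In n (decl W).
Proof.
  intro H. apply types_fst in H. apply in_map_iff in H as (e & <- & He). now apply decl_wn.
Qed.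

(** One reduction removes the cut. The star received by [y] is traded for the stars that wait on the
    first side, of which there is at least one because [w] has a receiver there; copies are allowed
    by [fwd_star]. *)
Lemma unit_step n1 n2 typ x q T L1 y q' L2 f g P Q m w Q' :
  CutState n1 (S n2) typ x q T L1 y q' L2 f g P Q ->
  proc_eq P (Close x) -> T = WOne w -> types (map snd L1) = [] ->
  Forall (eq (w, None)) (q ++ flat_map wp (map snd L1)) ->
  proc_eq Q (Wait y Q') -> fwd n2 Q' ((w, None) :: q' ++ flat_map wp (map snd L2)) (types (map snd L2)) ->
  reaches (map (rb f g) (comp L1 L2)) (par_comp m x y P Q).
Proof.
  intros K PE -> ET HM QE HQ. destruct (K) as [C K1 K2].
  pose proof (c_s C) as S.
  (* All items of the first side are stars, but the active endpoint [x] has received none. *)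
  assert (q = []) as ->.
  { destruct (v_tok (s_v1 S) _ (or_introl eq_refl)) as [_ [_ M]].
    destruct q as [|i q]; auto. inversion HM; subst. discriminate. }
  simpl in HM. eapply reaches_step; [eapply CutState_typed; exact K| |apply reaches_done].
  - eapply beta_redex; [exact PE|exact QE|]. apply r_unit. intro H. apply (fwd_fn _ _ _ _ HQ) in H.
    simpl in H. rewrite imsgs_app, !in_app_iff in H.
    pose proof (s_v2 S) as V2. destruct H as [[H|H]|H].
    + pose proof (v_decl V2) as D. simpl in D. inversion D as [|? ? D1 _]. apply D1, in_app_iff. auto.
    + apply (side_fresh _ _ _ y y V2); simpl; auto using imsgs_items.
    + apply (side_fresh _ _ _ y y V2); simpl; auto using types_decl.
  - eapply fwd_typed; [|eapply Composite_Valid; exact C|apply (c_l C)| |].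
    + apply (fwd_stars w _ _ _ (flat_map wp (map snd L1))) in HQ; [exact HQ|exact HM|].
      destruct (outs_supp _ _ _ _ _ _ _ _ S w) as (e & He & Hw); [simpl; auto|].
      pose proof (types_nil _ ET e He) as Te.
      unfold iw in Hw. rewrite Te, app_nil_r in Hw. apply in_map_iff in Hw as (i & _ & Hi).
      intro E0. assert (In i []) as []. rewrite <- E0. apply in_flat_map. eauto.
    + rewrite (items_comp C). simpl. rewrite !app_assoc.
      apply Permutation_app_tail, Permutation_app_comm.
    + rewrite types_comp, ET. reflexivity.
Qed.

(** The side of the link has no message and, apart from [y], only the endpoint [z], which has type
    [T]. The composite is thus the first side with [x] renamed to [z]. *)
Lemma link_step n1 n2 typ x q T L1 y q' L2 f g P Q m z :
  CutState n1 n2 typ x q T L1 y q' L2 f g P Q ->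
  proc_eq Q (Link z y) -> z <> y -> q' ++ flat_map wp (map snd L2) = [] ->
  types (map snd L2) = [(z, T)] ->
  reaches (map (rb f g) (comp L1 L2)) (par_comp m x y P Q).
Proof.
  intros K QE N EM ET. destruct (K) as [C K1 K2].
  pose proof (c_s C) as S.
  pose proof (s_v1 S) as V1.
  apply app_eq_nil in EM as [-> EM].
  assert (In z (decl (map snd L2))) as Hz by (apply types_decl; rewrite ET; simpl; auto).
  assert (In z (decl (WEp q x (Some T) :: map snd L1)) -> False) as NZ.
  { intro H. apply (s_nm S z H). simpl. auto. }
  assert (z <> x) as Nx by (intros ->; apply NZ; simpl; auto).
  assert (forall n, In n (imsgs (q ++ flat_map wp (map snd L1))) -> In n (imsgs q ++ decl (map snd L1))) as IM.
  { intro n. rewrite imsgs_app, !in_app_iff. intros [H|H]; auto using imsgs_items. }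
  assert (~ In x (imsgs q ++ decl (map snd L1))) as HX.
  { pose proof (v_decl V1) as D. simpl in D. now inversion D. }
  assert (~ In z (fn P)) as FZ.
  { intro H. apply (fwd_fn _ _ _ _ K1) in H. apply in_app_iff in H as [H|[H|H]]; auto.
    - apply NZ. simpl. auto.
    - apply NZ. simpl. right. apply in_app_iff. auto using types_decl. }
  destruct (bn_fresh z P) as (P' & PE & BZ).
  assert (~ In z (fn P')) as FZ' by (intro H; apply FZ; eapply (proc_eq_fn _ _ PE); exact H).
  eapply (reaches_step _ _ (swap z x P)); [eapply CutState_typed; exact K| |apply reaches_done].
  - rewrite par_comp_flip. eapply b_eq; [apply par_comp_eq; [exact QE|exact PE]|
      eapply b_redex, r_link; [exact N|exact BZ]|].
    eapply pe_trans; [apply subst_swap; auto|]. apply proc_eq_swap. now apply pe_sym.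
  - eapply fwd_typed; [apply (fwd_swap z x); exact K1|eapply Composite_Valid; exact C|
      apply (c_l C)| |].
    + rewrite swI_fresh.
      * rewrite (items_comp C), EM, app_nil_r. simpl. apply Permutation_app_comm.
      * intro H. apply NZ. simpl. auto.
      * intro H. auto.
    + rewrite types_comp, ET. simpl. unfold swE at 1. simpl. rewrite transp_r, swE_fresh.
      * apply Permutation_cons_append.
      * intro H. apply NZ. simpl. right. apply in_app_iff. auto using types_decl.
      * intro H. apply HX. apply in_app_iff. auto using types_decl.
Qed.

(** * Cuts between a tensor and a par *)

Lemma perm_cons_cases {A : Type} (i j : A) M N : Permutation (i :: M) (j :: N) ->
  (i = j /\ Permutation M N) \/ exists N', Permutation N (i :: N') /\ Permutation M (j :: N').
Proof.
  intro P. destruct (Permutation_in _ P (or_introl eq_refl)) as [->|H].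
  - left. split; auto. now apply Permutation_cons_inv in P.
  - right. apply in_split in H as (N1 & N2 & ->). exists (N1 ++ N2). split.
    + symmetry. apply Permutation_middle.
    + apply (Permutation_cons_inv (a := i)). rewrite P, perm_swap. constructor.
      symmetry. apply Permutation_middle.
Qed.

(* The message on a wire is forwarded by some output, because a process that
   ends in a link or a close has no message left. *)
Lemma fwd_graft a S0 c z w A n :
  typed false S0 [Ep [] z (Some (annot (dual A) a)); Ep [] a (Some (annot A z))] ->
  forall R M E M0, fwd n R M E -> Permutation M ((w, Some (c, dual A)) :: M0) ->
  exists R0 R', proc_eq R R0 /\ graft a S0 c R0 R' /\ fwd n R' ((w, Some (z, dual A)) :: M0) E.
Proof.
  intro HS. induction n as [n IH] using lt_wf_ind. intros R M E M0 H PM.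
  destruct (fwd_inv [c; z] _ _ _ _ H) as
    [n u u' a' P' E Pe N PE|n u w' P' M Pe FM|n u w' P0 Q' M E E' Pe HQ PE|
     n u z' w' A' B P0 Q' M E E' Pe NF NN HQ PE|n u v z' w' A' B S1 P0 Q' M M' E E' Pe HS1 HQ PM1 PE].
  - apply Permutation_nil in PM. discriminate.
  - rewrite PM in FM. inversion FM. congruence.
  - destruct (IH n (Nat.lt_succ_diag_r n) Q' ((w', None) :: M) E' ((w', None) :: M0))
      as (R0 & R' & E1 & G & HR); auto.
    { rewrite PM. apply perm_swap. }
    exists (Wait u R0), (Wait u R'). split; [|split].
    + eapply pe_trans; [exact Pe|now apply pe_ctx_wait].
    + now apply graft_wait.
    + eapply f_eq; [constructor|reflexivity|symmetry; exact PE|]. apply f_wait.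
      eapply f_eq; [constructor|apply perm_swap|reflexivity|exact HR].
  - destruct (IH n (Nat.lt_succ_diag_r n) Q' ((w', Some (z', A')) :: M) ((u, B) :: E')
      ((w', Some (z', A')) :: M0)) as (R0 & R' & E1 & G & HR); auto.
    { rewrite PM. apply perm_swap. }
    simpl in NF. exists (Recv u z' R0), (Recv u z' R'). split; [|split].
    + eapply pe_trans; [exact Pe|now apply pe_ctx_recv].
    + apply graft_recv; auto. split; [intros ->; auto|]. rewrite in_remove_iff. intros [I N].
      apply (spawn_fn _ _ _ _ HS) in I as [->| ->]; tauto.
    + eapply f_eq; [constructor|reflexivity|symmetry; exact PE|]. apply f_recv.
      * eapply f_eq; [constructor|apply perm_swap|reflexivity|exact HR].
      * intro I. apply NN. apply in_app_iff in I as [I|I]; apply in_app_iff; auto. left.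
        simpl in I. destruct I as [->|I]; [tauto|].
        eapply Permutation_in; [apply imsgs_perm; symmetry; exact PM|]. simpl. auto.
  (* Either this output forwards [c], which by [spawn_fn] is then free in its spawned process, or
     the graft takes place in the continuation. *)
  - rewrite PM in PM1. apply perm_cons_cases in PM1 as [[[= -> -> EA] PM1]|(N' & PN & PM1)].
    + assert (A = A') as -> by (rewrite <- (dual_dual A), EA; apply dual_dual).
      exists (Send u v S1 Q'), (Send u a S0 Q'). split; [exact Pe|split].
      * destruct (spawn_fn _ _ _ _ HS1) as [N F]. apply graft_here; [congruence|]. apply F. auto.
      * eapply f_eq; [constructor| |symmetry; exact PE|apply f_send; [exact HS|exact HQ]].
        constructor. now symmetry.
    + destruct (IH n (Nat.lt_succ_diag_r n) Q' M' ((u, B) :: E') N') as (R0 & R' & E1 & G & HR); auto.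
      exists (Send u v S1 R0), (Send u v S1 R'). split; [|split].
      * eapply pe_trans; [exact Pe|apply pe_ctx_send; [constructor|exact E1]].
      * now apply graft_send.
      * eapply f_eq; [constructor| |symmetry; exact PE|apply f_send; [exact HS1|exact HR]].
        rewrite perm_swap. constructor. now symmetry.
Qed.

Lemma Labelling_same f g e e' W : Labelling f g (e :: W) -> wn e = wn e' ->
  (forall w, In w (iw e') <-> In w (iw e)) -> ow e = ow e' -> Labelling f g (e' :: W).
Proof.
  intros L En Ei Eo. split.
  - intros d w [<-|H] Hw; [rewrite <- En; rewrite <- Eo in Hw; apply (l_f L e)|apply (l_f L d)];
      simpl; auto.
  - intros d w [<-|H] Hw; [rewrite <- Eo in Hw; apply (l_nd L e w)|apply (l_nd L d w)];
      simpl; auto.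
  - assert (forall w n, (exists d, In d (e :: W) /\ wn d = n /\ In w (iw d)) <->
      (exists d, In d (e' :: W) /\ wn d = n /\ In w (iw d))) as X.
    { intros w n. split; intros (d & [<-|H] & E & Hw).
      - exists e'. rewrite Ei, <- En. simpl; auto.
      - exists d. simpl; auto.
      - exists e. rewrite <- Ei, En. simpl; auto.
      - exists d. simpl; auto. }
    intros d w n [<-|H] Hw; rewrite <- X.
    + rewrite <- Eo in Hw. apply (l_g L e); simpl; auto.
    + apply (l_g L d); simpl; auto.
Qed.

(** The transmitted wire leaves its side altogether, so the smaller cut formula again contains every
    shared wire. *)
Lemma Valid_send_gone typ q1 w z q2 u C q x A B W :
  let eu := WEp (q1 ++ (w, Some (z, dual A)) :: q2) u C in
  let ex := WEp q x (Some (WTensor A w B)) in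
  Valid typ (eu :: ex :: W) -> ~ inw (WEp (q1 ++ q2) u C :: WEp q x (Some B) :: W) w.
Proof.
  intros eu ex V (e & He & Hw).
  assert (In w (iw eu)) as Iu by (unfold iw; simpl; rewrite map_app, !in_app_iff; simpl; auto).
  assert (In w (ow ex)) as Ox by (simpl; auto).
  assert (typ w <> None) as Tw.
  { destruct (v_tok V ex) as [_ [[K _] _]]; simpl; auto. congruence. }
  pose proof (NoDup_wn _ (v_decl V)) as D. simpl in D.
  inversion D as [|? ? D1 D2]; subst. inversion D2 as [|? ? D3 _]; subst.
  pose proof (v_ow V) as O. simpl in O.
  change (NoDup (ow eu ++ w :: (outs B ++ flat_map ow W))) in O.
  apply NoDup_mid in O as [_ O]. rewrite !in_app_iff in O.
  destruct He as [<-|[<-|He]], Hw as [Hw|Hw].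
  - pose proof (v_iw V eu (or_introl eq_refl)) as ND. unfold iw in *. simpl in *.
    rewrite map_app in *. simpl in *. rewrite <- !app_assoc in *. simpl in *.
    apply NoDup_mid in ND as [_ ND]. auto.
  - apply O. auto.
  - apply D1. left. symmetry. apply (v_msg V eu ex w); simpl; auto.
  - apply O. auto.
  - apply D1. right. assert (wn eu = wn e) as E by (apply (v_msg V eu e w); simpl; auto).
    simpl in E. rewrite E. now apply in_map.
  - apply O. right; right. apply in_flat_map. eauto.
Qed.

Lemma perm_pick {A : Type} (i : A) a b b' c :
  Permutation (i :: a ++ (b ++ b') ++ c) (a ++ (b ++ i :: b') ++ c).
Proof.
  rewrite <- !app_assoc. simpl. rewrite !(app_assoc a b). apply Permutation_middle.
Qed.

(** Before the step the message [z] waits at [b] on the wire [w], sent by [x]; after it, [z] is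
    queued at [y] and its box in the share of [b] answers the grafted output. In the composite this
    box overtakes those of [a1], none of which has its label, so the queue of [b] is unchanged up to
    equality. *)
Lemma comm_step n1 n2 typ x q A w D L1 y q' L2 f g P Q m a z S0 P' M1 c Q' :
  (forall q T L1 q' L2 P' Q', CutState n1 n2 typ x q T L1 y q' L2 f g P' Q' ->
    reaches (map (rb f g) (comp L1 L2)) (par_comp m x y P' Q')) ->
  CutState (S n1) (S n2) typ x q (WTensor A w D) L1 y q' L2 f g P Q ->
  proc_eq P (Send x a S0 P') ->
  typed false S0 [Ep [] z (Some (annot (dual A) a)); Ep [] a (Some (annot A z))] ->
  Permutation (q ++ flat_map wp (map snd L1)) ((w, Some (z, dual A)) :: M1) ->
  fwd n1 P' M1 ((x, D) :: types (map snd L1)) ->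
  proc_eq Q (Recv y c Q') -> ~ In c (decl (map snd L1)) ->
  ~ In c (imsgs (q' ++ flat_map wp (map snd L2)) ++ y :: map fst (types (map snd L2))) ->
  fwd n2 Q' ((w, Some (c, dual A)) :: q' ++ flat_map wp (map snd L2))
    ((y, wdual D) :: types (map snd L2)) ->
  reaches (map (rb f g) (comp L1 L2)) (par_comp m x y P Q).
Proof.
  intros IH K PE HS PM HP QE C1 C2 HQ. set (i := (w, Some (z, dual A))) in *.
  (* The message cannot wait at [x], which sends [w]. *)
  assert (exists p1 a1 a2 b Cb L1', Permutation L1 ((p1, WEp (a1 ++ i :: a2) b Cb) :: L1'))
    as (p1 & a1 & a2 & b & Cb & L1' & PL).
  { assert (In i (q ++ flat_map wp (map snd L1))) as Hi
      by (eapply Permutation_in; [symmetry; exact PM|simpl; auto]).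
    apply in_app_iff in Hi as [Hi|Hi].
    - exfalso. pose proof (s_v1 (c_s (k_c K))) as V1.
      apply (v_irr V1 _ w (or_introl eq_refl)); simpl; auto.
      apply in_app_iff. left. apply (in_map fst _ i Hi).
    - apply in_flat_map in Hi as (e & He & Hi). apply in_map_iff in He as ([p e'] & E0 & He).
      simpl in E0. subst e'. destruct e as [qe b C]. simpl in Hi.
      apply in_split in Hi as (a1 & a2 & ->). apply in_split in He as (La & Lb & ->).
      exists p, a1, a2, b, C, (La ++ Lb). symmetry. apply Permutation_middle. }
  set (e1 := WEp (a1 ++ i :: a2) b Cb) in *.
  pose proof (CutState_perm PL (Permutation_refl _) K) as K'.
  eapply reaches_ctx; [apply ctx_rb_perm, comp_perms; [symmetry; exact PL|reflexivity]|].
  assert (~ In c (decl (map snd ((p1, e1) :: L1')))) as C1'.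
  { intro H. apply C1. eapply Permutation_in; [|exact H].
    apply decl_perm. symmetry. apply (Permutation_map snd PL). }
  rewrite (Permutation_map snd PL) in PM.
  assert (Permutation (types (map snd L1)) (types (map snd ((p1, e1) :: L1')))) as PT
    by apply types_perm, (Permutation_map snd PL).
  assert (fwd n1 P' M1 ((x, D) :: types (map snd ((p1, WEp (a1 ++ a2) b Cb) :: L1')))) as HP'
    by (eapply f_eq; [constructor|reflexivity|constructor; exact PT|exact HP]).
  clear HP. rename HP' into HP. clear PT K PL C1 L1.
  destruct (K') as [CC _ _]. pose proof (c_s CC) as S.
  pose proof (s_v1 S) as V1. pose proof (s_v2 S) as V2.
  pose proof (Composite_Labelling CC) as LA.
  pose proof (Composite_Labelling (Composite_sym CC)) as LB.
  simpl in V1, V2, LA, LB.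
  set (X := WEp q x (Some (WTensor A w D))) in *.
  set (Y := WEp q' y (Some (WPar (dual A) w (wdual D)))) in *.
  pose proof (Valid_perm (perm_swap _ _ _) V1) as V1p.
  pose proof (Labelling_perm (perm_swap _ _ _) LA) as LAp.
  destruct (Valid_send _ _ _ _ _ _ _ _ _ _ _ _ _ _ V1p LAp) as [V1' _].
  assert (In z (imsgs (wp e1))) as Iz by (simpl; rewrite imsgs_app, in_app_iff; simpl; auto).
  assert (In z (decl (X :: e1 :: map snd L1'))) as Dz.
  { simpl. rewrite !in_app_iff. right; right; right. apply in_app_iff. auto. }
  assert (~ In z (decl (Y :: map snd L2))) as NZ by (intro H; exact (s_nm S z Dz H)).
  assert (z <> y) as Nzy by (intros ->; apply NZ; simpl; auto).
  assert (z <> x) as Nzx.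
  { intros ->. apply (side_fresh _ _ _ x x V1); simpl; auto. right. apply in_app_iff. auto. }
  assert (c <> z) as Ncz.
  { intros ->. apply C1'. simpl. right. apply in_app_iff. auto. }
  assert (x <> y) as Nxy by (intros ->; apply (s_nm S y); simpl; auto).
  destruct (rb_recv _ _ _ _ _ _ _ _ _ _ P true NZ V2 LB) as (V2' & _ & _). fold i in V2'.
  destruct (fwd_graft a S0 c z w A n2 HS _ _ _ _ HQ (Permutation_refl _)) as (R0 & R' & QE' & G & HR).
  fold i in HR.
  set (e1' := WEp (a1 ++ a2) b Cb) in *.
  (* The message takes the last place both in the queue of [y] and in the share of its receiver, so
     the shares are still a distribution. *)
  assert (CutState n1 n2 typ x q D ((p1 ++ [i], e1') :: L1') y (q' ++ [i]) L2 f g P' R') as KN.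
  { split.
    - split.
      + split.
        * simpl. eapply Valid_perm; [apply perm_swap|exact V1'].
        * exact V2'.
        * intros w' H1 H2.
          assert (w' <> w) as NW.
          { intros ->. apply (Valid_send_gone _ _ _ _ _ _ _ _ _ _ _ _ V1p).
            destruct H1 as (d & Hd & Hw). exists d. split; auto. simpl in *. tauto. }
          assert (In w' (ins (WTensor A w D)) \/ In w' (outs (WTensor A w D))) as J.
          { apply (s_sh S).
            - destruct H1 as (d & [<-|[<-|Hd]] & Hw).
              + exists X. split; [simpl; auto|]. destruct Hw as [Hw|Hw]; [left; exact Hw|right; simpl; auto].
              + exists e1. split; [simpl; auto|]. destruct Hw as [Hw|Hw]; [left|right; exact Hw].
                unfold iw in *. simpl in *. rewrite !map_app in *. simpl. rewrite !in_app_iff in *. simpl. tauto.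
              + exists d. split; [simpl; auto|auto].
            - destruct H2 as (d & [<-|Hd] & Hw).
              + exists Y. split; [simpl; auto|]. destruct Hw as [Hw|Hw]; [left|right; exact Hw].
                unfold iw in *. simpl in *. rewrite map_app in *. simpl in *. rewrite !in_app_iff in *.
                simpl in *. tauto.
              + exists d. split; [simpl; auto|auto]. }
          simpl in J. destruct J as [J|[J|J]]; auto. congruence.
        * intros n H1 H2.
          assert (In n (decl (Y :: map snd L2)) \/ n = z) as [J|J].
          { simpl in H2. rewrite imsgs_app, !in_app_iff in H2. simpl in H2. simpl.
            rewrite in_app_iff. destruct H2 as [H2|[[H2|[H2|[]]]|H2]]; auto. }
          -- apply (s_nm S n); auto. clear - H1. simpl in *.
             rewrite !imsgs_app, !in_app_iff in *. simpl in *. rewrite !in_app_iff in *. simpl. tauto.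
          -- subst n. pose proof (v_decl V1p) as DD. simpl in DD. rewrite imsgs_app, <- app_assoc in DD.
             simpl in DD. change (NoDup ((b :: imsgs a1) ++ z :: (imsgs a2 ++ x :: imsgs q ++ decl (map snd L1')))) in DD.
             apply NoDup_mid in DD as [_ DD]. apply DD.
             eapply Permutation_in in H1; [|apply decl_perm, perm_swap].
             simpl in H1. rewrite imsgs_app, <- app_assoc in H1. exact H1.
      + apply (Distr_fst _ ((p1 ++ [i], e1) :: L1')); [reflexivity|].
        apply (Distr_snoc q' i []). apply (c_d1 CC).
      + apply (c_d2 CC).
      + pose proof (c_l CC) as L. rewrite comp_cons_l in *.
        eapply Labelling_same; [exact L|reflexivity| |reflexivity].
        intro w'. rewrite !iw_unm. unfold iw. simpl. rewrite !map_app. simpl. rewrite !in_app_iff. simpl. tauto.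
    - eapply f_eq; [constructor| |reflexivity|exact HP].
      apply (Permutation_cons_inv (a := i)). rewrite <- PM. symmetry. apply perm_pick.
    - eapply f_eq; [constructor| |reflexivity|exact HR]. rewrite <- app_assoc. apply Permutation_middle. }
  assert (~ In c (fn R')) as CR.
  { intro H. apply (fwd_fn _ _ _ _ HR) in H. apply C2. simpl in H.
    destruct H as [H|H]; [congruence|exact H]. }
  apply (reaches_step _ _ (par_comp m x y P' R')); [eapply CutState_typed; exact K'| |].
  - eapply beta_redex; [exact PE|eapply pe_trans; [exact QE|apply pe_ctx_recv; exact QE']|].
    apply r_comm; auto.
    + intros ->. apply C2. apply in_app_iff. simpl. auto.
    + rewrite in_remove_iff. intros [H H']. apply (spawn_fn _ _ _ _ HS) in H as [H|H]; congruence.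
    + rewrite in_remove_iff. intros [H H']. apply (spawn_fn _ _ _ _ HS) in H as [H|H]; congruence.
  - eapply reaches_ctx; [|eapply IH; exact KN].
    rewrite !comp_cons_l. simpl. apply mset_Forall2. constructor; [|apply Forall2_ep_refl].
    split; [|split]; simpl; auto.
    + rewrite <- app_assoc. simpl. rewrite !map_app. simpl. rewrite !map_app. simpl.
      apply queue_eq_app; [constructor|]. apply queue_eq_sym. apply (queue_eq_front (rbI f i)).
      (* A box of [a1] with the label of [w] would have the same sender on the second side, hence be
         on an output of the cut formula received before its first output [w]; this contradicts
         [first_x]. *)
      apply Forall_map, Forall_forall. intros j Hj. rewrite !label_rbI. intro E.
      set (pe := (p1, e1)) in *. assert (In pe (pe :: L1')) as Hpe by (simpl; auto).
      assert (In w (iw (snd pe)) /\ In (fst j) (iw (snd pe))) as [Iw Ij].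
      { unfold iw. simpl. rewrite map_app, !in_app_iff. simpl. split; auto.
        left; left. now apply in_map. }
      assert (In w (iw (unm pe)) /\ In (fst j) (iw (unm pe))) as [Iw' Ij']
        by (rewrite iw_unm, !in_app_iff; auto).
      pose proof (Composite_Valid CC) as VC.
      pose proof (c_l CC) as LC.
      assert (In (unm pe) (comp (pe :: L1') L2)) as Hin by (apply in_comp_l; auto).
      destruct (f_ow _ _ _ _ _ _ VC LC Hin Iw') as (d & Hd & Ow & Ed).
      change (fst i) with w in E. assert (In (fst j) (ow d)) as Oj by (apply (f_wn_ow _ _ _ _ _ _ _ VC LC Hin Ij' Hd); now rewrite E).
      apply in_comp in Hd as (pd & -> & [Hd|Hd]).
      * apply (head_ow typ X (e1 :: map snd L1') (snd pd) w V1); [|simpl; auto|exact Ow].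
        apply (in_map_snd _ _ Hd).
      * assert (In (fst j) (outs (WTensor A w D))) as Oj'.
        { apply (cross_io _ _ _ _ _ _ _ _ S (snd pe) (snd pd)); auto.
          - simpl; auto.
          - now apply in_map_snd. }
        apply (first_x CC (Suf_refl typ _ (proj1 (proj2 (v_tok V1 X (or_introl eq_refl)))))
          (w := w) (O := outs D) eq_refl (unm pe) (fst j)); auto.
        { apply in_map. exact Hpe. }
        rewrite iw_unm, before_app. right; left. unfold iw. simpl. rewrite map_app, <- app_assoc, before_app.
        right; right. split; [now apply in_map|]. simpl. auto.
    + destruct Cb; simpl; auto. apply aty_eq_refl.
Qed.

(** * Elimination of a cut *)

(** If neither process starts with an action that commutes, both act on the cut endpoints or one is
    a link. Duality of the formulas then leaves only matching pairs of actions, and [par_comp_flip]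
    reduces each pair to one orientation. *)
Lemma cut_reaches n1 n2 typ x q T L1 y q' L2 f g P Q m :
  CutState n1 n2 typ x q T L1 y q' L2 f g P Q ->
  reaches (map (rb f g) (comp L1 L2)) (par_comp m x y P Q).
Proof.
  remember (n1 + n2) as N eqn:EN. revert n1 n2 q T L1 q' L2 P Q EN.
  induction N as [N IH0] using lt_wf_ind. intros n1 n2 q T L1 q' L2 P Q ->.
  assert (forall n1' n2' q T L1 q' L2 P Q, n1' + n2' < n1 + n2 ->
    CutState n1' n2' typ x q T L1 y q' L2 f g P Q ->
    reaches (map (rb f g) (comp L1 L2)) (par_comp m x y P Q)) as IH by (intros; eapply IH0; eauto).
  clear IH0. intro K.
  assert (forall n1' n2' q T L1 q' L2 P Q, n1' + n2' < n1 + n2 ->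
    CutState n1' n2' typ y q T L1 x q' L2 f g P Q ->
    reaches (map (rb f g) (comp L1 L2)) (par_comp (negb m) y x P Q)) as IH'.
  { intros ? ? ? ? ? ? ? ? ? H K0. rewrite <- par_comp_flip.
    eapply reaches_ctx; [apply rb_comp_comm|]. eapply IH; [|exact (CutState_sym K0)]. lia. }
  pose proof (CutState_sym K) as K'.
  assert (reaches (map (rb f g) (comp L2 L1)) (par_comp (negb m) y x Q P) ->
    reaches (map (rb f g) (comp L1 L2)) (par_comp m x y P Q)) as flip.
  { intro H. rewrite par_comp_flip. eapply reaches_ctx; [apply rb_comp_comm|exact H]. }
  destruct (head_cases (decl (map snd L1)) _ _ _ _ _ _ _ _ _ _ _ _ _ _ m
    (fun n L1 q' L2 Q' Hn => IH n1 n q T L1 q' L2 P Q' (proj1 (Nat.add_lt_mono_l _ _ _) Hn)) K)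
    as [H|HQ]; auto.
  destruct (head_cases (decl (map snd L2)) n2 n1 typ y q' (wdual T) L2 x q L1 f g Q P (negb m))
    as [H|HP]; auto.
  { intros n La qa Lb P' Hn K0. eapply IH'; [|exact K0]. lia. }
  rewrite wdual_wdual in HP.
  destruct HQ as [z QE N EM ET|w QE EV ET HM|n' w Q' -> QE EV HQ|n' c w A B Q' -> QE EV C1 C2 HQ|
    n' v z w A B S0 Q' M' -> QE EV HS PM HQ].
  - rewrite wdual_wdual in ET. eapply link_step; eauto.
  - destruct HP as [z PE N EM ET'|w' PE EV' ET' HM'|n'' w' P' -> PE EV' HP|n'' c w' A B P' -> PE EV' C1 C2 HP|
      n'' v z w' A B S0 P' M' -> PE EV' HS PM HP]; try (subst T; discriminate).
    + apply flip. eapply link_step; eauto.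
    + apply flip. subst T. injection EV as <-. eapply unit_step; eauto. reflexivity.
  - destruct HP as [z PE N EM ET'|w' PE EV' ET' HM'|n'' w' P' -> PE EV' HP|n'' c w' A B P' -> PE EV' C1 C2 HP|
      n'' v z w' A B S0 P' M' -> PE EV' HS PM HP]; try (subst T; discriminate).
    + apply flip. eapply link_step; eauto.
    + subst T. injection EV as <-. eapply unit_step; eauto.
  - destruct HP as [z PE N EM ET'|w' PE EV' ET' HM'|n'' w' P' -> PE EV' HP|n'' c' w' A' B' P' -> PE EV' C1' C2' HP|
      n'' v z w' A' B' S0 P' M' -> PE EV' HS PM HP]; try (subst T; discriminate).
    + apply flip. eapply link_step; eauto.
    + subst T. injection EV as <- <- <-. eapply comm_step; eauto.
      intros. eapply IH; [|eassumption]. lia.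
  - destruct HP as [z' PE N EM ET'|w' PE EV' ET' HM'|n'' w' P' -> PE EV' HP|n'' c' w' A' B' P' -> PE EV' C1' C2' HP|
      n'' v' z' w' A' B' S0' P' M'' -> PE EV' HS' PM' HP]; try (subst T; discriminate).
    + apply flip. eapply link_step; eauto.
    + apply flip. subst T. injection EV as <- <- <-. eapply comm_step; eauto.
      * intros. eapply IH'; [|eassumption]. lia.
      * rewrite dual_dual, wdual_wdual. exact HP.
Qed.

Theorem theorem1
  (P Q : proc) (Γ1 Γ2 : ctx) (Ψ1 Ψ2 : queue) (x y : name) (A1 A2 : aty)
  (hdual : erase A2 = dual (erase A1))
  (hP : typed false P (Ep Ψ1 x (Some A1) :: Γ1))
  (hQ : typed false Q (Ep Ψ2 y (Some A2) :: Γ2))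
  (hdisj : ctx_disjoint (Ep Ψ1 x (Some A1) :: Γ1) (Ep Ψ2 y (Some A2) :: Γ2))
  (Γ : ctx)
  (hΓ : composes (Side Γ1 Ψ1 x A1, Side Γ2 Ψ2 y A2) Γ) :
  exists R : proc,
    typed false R Γ /\
    exists (n : nat) (Ps : nat -> proc),
      Ps 0 = Cut x y P Q /\ Ps n = R /\
      (forall i, i < n -> beta (Ps i) (Ps (i + 1))) /\
      (forall i, i <= n -> typed true (Ps i) Γ).
Proof.
  destruct (initial_state _ _ _ _ _ _ _ _ _ _ _ hdual hP hQ hdisj hΓ)
    as (n1 & n2 & typ & q & T & L1 & q' & L2 & f & g & C & K1 & K2 & HΓ).
  apply reaches_path. eapply reaches_ctx; [exact HΓ|].
  apply (cut_reaches n1 n2 typ x q T L1 y q' L2 f g P Q false). split; auto.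
Qed.
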